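(* Let $K$ be an algebraically closed field (of arbitrary characteristic), let $B$ be a smooth projective curve over $K$, and let $k=\overline{K(B)}$ be an algebraic closure of the function field of $B$. For every admissible triple $(X,f,x_0)$ over $k$, we have $$\overline{\alpha}_f(x_0)\leq\lambda_1(f).$$
   Context: A variety is an irreducible, reduced, separated scheme of finite type over a field. An admissible triple is $(X,f,x)$ where $X$ is a quasi-projective variety over $k$, $f:X\dashrightarrow X$ is a dominant rational self-map and $x\in X(k)$ is a point whose $f$-orbit is well defined (i.e. $f^n(x)$ is not in the indeterminacy locus of $f$ for all $n\ge 0$). Two admissible triples $(X,f,x)$, $(Y,g,y)$ are birational if there is a birational map $\pi:X\dashrightarrow Y$ with $\pi\circ f=g\circ\pi$ and a Zariski dense open subset $V\subseteq Y$ containing $O_g(y)=\{g^n(y)\mid n\ge0\}$ such that $\pi|_U:U:=\pi^{-1}(V)\to V$ is a well-defined isomorphism and $\pi(x)=y$. Every admissible triple is birational to one with projective underlying variety (e.g. any projective compactification of $X$). Heights: for a projective variety $X$ over $k$ and a line bundle (or divisor class) $L$, $h_L:X(k)\to\mathbb{R}$ is a Weil height associated to $L$ and the function field $K(B)$, well defined up to bounded functions. For instance if $X$ is normal and is the geometric generic fiber of a projective morphism $X_B\to B$ with $X_B$ normal and projective, and $L$ is the restriction of a line bundle $L_B$ on $X_B$, one may take $h_L(x)=[K(B)(x):K(B)]^{-1}(\overline{x}\cdot L_B)$, with $\overline{x}$ the Zariski closure of $x$ in $X_B$. Upper arithmetic degree: if $X$ is projective and $L$ is an ample divisor on $X$,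 $A_f(x)\subseteq[1,\infty]$ is the set of limit points of the sequence $(h_L^+(f^n(x)))^{1/n}$, where $h_L^+:=\max\{h_L,1\}$; it does not depend on the choice of $L$. For a general admissible triple, $A_f(x):=A_{f'}(x')$ for any birational admissible triple $(X',f',x')$ with $X'$ projective (independent of the choice). Then $\overline{\alpha}_f(x):=\sup A_f(x)$. First dynamical degree: choose a normal projective variety $X'$ birational to $X$, let $f'$ be the rational self-map of $X'$ induced by $f$, and let $L$ be an ample divisor on $X'$. For $n\ge 0$ choose a normal projective variety $\Gamma$ with a birational morphism $\pi_1:\Gamma\to X'$ and a morphism $\pi_2:\Gamma\to X'$ such that $f'^n=\pi_2\circ\pi_1^{-1}$, and set $(f'^n)^*(L)=(\pi_1)_*\pi_2^*(L)$. Then $\lambda_1(f)=\lim_{n\to\infty}((f'^n)^*(L)\cdot L^{\dim X-1})^{1/n}$; the limit exists and is independent of all choices. *)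

(* Defs.v *)
From mathcomp Require Import all_boot all_order all_algebra fieldext.
From mathcomp Require Import all_classical all_reals all_analysis.
From mathcomp Require mpoly.
(* The notations of mpoly clash with those of mathcomp-analysis. *)
Import (canonicals, coercions) mpoly.

Set Implicit Arguments.
Unset Strict Implicit.
Unset Printing Implicit Defensive.

Import Order.TTheory GRing.Theory Num.Theory.
Import numFieldNormedType.Exports.

Local Open Scope classical_set_scope.
Local Open Scope ring_scope.

(** Quasi-projective varieties over an algebraically closed field [k] are
    treated classically, as irreducible locally closed subsets of [P^n(k)].
    A point of [P^n] is represented by any of its nonzero vectors of homogeneous
    coordinates and a subset of [P^n] by the set of all representatives of its
    points, i.e. by a punctured cone. *)

Section ProjectiveSets.
Variable k : fieldType.

Definition hpoly (n : nat) := mpoly.mpoly n.+1 k.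

Definition ev (n : nat) (p : hpoly n) (v : 'rV[k]_n.+1) : k :=
  mpoly.meval (v ord0) p.

Definition homog (n d : nat) (p : hpoly n) : Prop :=
  p \is @mpoly.ishomog1 n.+1 k d mpoly.mdeg.

Definition ishom (n : nat) (p : hpoly n) : Prop := exists d, homog d p.

Definition zclosed (n : nat) (Z : set 'rV[k]_n.+1) : Prop :=
  exists S : set (hpoly n), (forall p, S p -> ishom p) /\
    Z = [set v | v != 0 /\ forall p, S p -> ev p v = 0].

Definition zlocally_closed (n : nat) (X : set 'rV[k]_n.+1) : Prop :=
  exists Z1 Z2, [/\ zclosed Z1, zclosed Z2 & X = Z1 `\` Z2].

Definition zirreducible (n : nat) (X : set 'rV[k]_n.+1) : Prop :=
  X !=set0 /\ forall Z1 Z2, zclosed Z1 -> zclosed Z2 ->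
    X `<=` Z1 `|` Z2 -> X `<=` Z1 \/ X `<=` Z2.

Definition quasi_projective (n : nat) (X : set 'rV[k]_n.+1) : Prop :=
  zlocally_closed X /\ zirreducible X.

Definition projective (n : nat) (X : set 'rV[k]_n.+1) : Prop :=
  zclosed X /\ zirreducible X.

Definition open_in (n : nat) (Y V : set 'rV[k]_n.+1) : Prop :=
  exists2 Z, zclosed Z & V = Y `\` Z.

Definition dense_in (n : nat) (Y V : set 'rV[k]_n.+1) : Prop :=
  V `<=` Y /\ forall Z, zclosed Z -> V `<=` Z -> Y `<=` Z.

Definition proj_eq (n : nat) (v w : 'rV[k]_n.+1) : Prop :=
  exists2 c : k, c != 0 & w = c *: v.

Definition is_point (n : nat) (X : set 'rV[k]_n.+1) : Prop :=
  exists2 v, v != 0 & X = [set w | proj_eq v w].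

Definition eq_on (n : nat) (X : set 'rV[k]_n.+1) (p q : hpoly n) : Prop :=
  forall v, X v -> ev p v = ev q v.

Definition nonzero_on (n : nat) (X : set 'rV[k]_n.+1) (p : hpoly n) : Prop :=
  exists2 v, X v & ev p v != 0.

(** Elements of the function field of [X] are the fractions [P / Q] with [P], [Q]
    homogeneous of the same degree and [Q] not identically zero on [X]; such a
    fraction belongs to the local ring at [x] if [Q] can be chosen with
    [Q(x) <> 0].  Below, [S * P^r + \sum_(i < r) A_i * P^i * Q^(r-i) = 0] is an
    equation of integral dependence of [P / Q] over the local ring at [x], with
    coefficients [A_i / S] written over a common denominator. *)
Definition normal (n : nat) (X : set 'rV[k]_n.+1) : Prop :=
  forall x, X x -> forall (d : nat) (P Q : hpoly n),
    homog d P -> homog d Q -> nonzero_on X Q ->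
    (exists (r e : nat) (S : hpoly n) (A : 'I_r -> hpoly n),
       [/\ homog e S, ev S x != 0, forall i, homog e (A i)
         & eq_on X (S * P ^+ r + \sum_(i < r) A i * P ^+ i * Q ^+ (r - i)) 0]) ->
    exists (e : nat) (P' Q' : hpoly n),
      [/\ homog e P', homog e Q', ev Q' x != 0 & eq_on X (P * Q') (P' * Q)].

(** The projective Jacobian criterion: a curve is smooth at [b] when the tangent
    space at [b] of its affine cone has dimension [1 + 1]. *)
Definition smooth_projective_curve (n : nat) (B : set 'rV[k]_n.+1) : Prop :=
  [/\ projective B,
      ~ is_point B /\
        (forall E, projective E -> E `<=` B -> E = B \/ is_point E)
    & forall b, B b -> exists M : 'M[k]_(2, n.+1), forall v : 'rV[k]_n.+1,
        (forall p, ishom p -> eq_on B p 0 ->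
           \sum_(i < n.+1) v ord0 i * ev (mpoly.mderiv i p) b = 0) ->
        (v <= M)%MS].

(** [F] is the function field [k(B)]: [xi] is the generic point of [B]. *)
Definition is_function_field (n : nat) (B : set 'rV[k]_n.+1)
    (F : fieldType) (iota : {rmorphism k -> F}) : Prop :=
  exists xi : 'rV[F]_n.+1,
    (forall p : hpoly n, ishom p ->
       (mpoly.mmap iota (xi ord0) p = 0 <-> eq_on B p 0)) /\
    (forall a : F, exists (d : nat) (P Q : hpoly n),
       [/\ homog d P, homog d Q, mpoly.mmap iota (xi ord0) Q != 0
         & a = mpoly.mmap iota (xi ord0) P / mpoly.mmap iota (xi ord0) Q]).

(** A rational map to [P^m] is given by [m + 1] homogeneous polynomials of the
    same degree that do not all vanish identically on the source; two such tuples
    are the same map when they are proportional on the source.  The map is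
    regular at [x] when some representative does not vanish at [x]. *)
Definition tuplemap (n m : nat) := 'I_m.+1 -> hpoly n.

Definition tm_hom (n m : nat) (F : tuplemap n m) : Prop :=
  exists d, forall i, homog d (F i).

Definition tm_val (n m : nat) (F : tuplemap n m) (v : 'rV[k]_n.+1) :
  'rV[k]_m.+1 := \row_i ev (F i) v.

Definition tm_nonzero_on (n m : nat) (X : set 'rV[k]_n.+1) (F : tuplemap n m) :=
  exists2 v, X v & tm_val F v != 0.

Definition tm_eqv (n m : nat) (X : set 'rV[k]_n.+1) (F G : tuplemap n m) :=
  [/\ tm_nonzero_on X F, tm_nonzero_on X G
    & forall i j, eq_on X (F i * G j) (F j * G i)].

Definition tm_id (n : nat) : tuplemap n n :=
  fun i => mpoly.mpolyX k (mpoly.mnm1 i).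

Definition tm_comp (n m l : nat) (G : tuplemap m l) (F : tuplemap n m) :
  tuplemap n l :=
  fun i => mpoly.comp_mpoly [tuple F j | j < m.+1] (G i).

Definition tm_iter (n : nat) (f : tuplemap n n) (r : nat) : tuplemap n n :=
  iter r (tm_comp f) (@tm_id n).

Definition rational_map (n m : nat) (X : set 'rV[k]_n.+1)
    (Y : set 'rV[k]_m.+1) (F : tuplemap n m) : Prop :=
  tm_hom F /\ exists U, [/\ open_in X U, U !=set0
    & forall x, U x -> tm_val F x != 0 /\ Y (tm_val F x)].

Definition evaluates (n m : nat) (X : set 'rV[k]_n.+1) (Y : set 'rV[k]_m.+1)
    (F : tuplemap n m) (x : 'rV[k]_n.+1) (y : 'rV[k]_m.+1) : Prop :=
  [/\ X x, Y y & exists G : tuplemap n m,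
    [/\ tm_hom G, tm_eqv X F G, tm_val G x != 0 & y = tm_val G x]].

Definition defined_at (n m : nat) (X : set 'rV[k]_n.+1) (Y : set 'rV[k]_m.+1)
    (F : tuplemap n m) (x : 'rV[k]_n.+1) : Prop :=
  exists y, evaluates X Y F x y.

(** Some homogeneous coordinates of the image of [x]. *)
Definition rm_app (n m : nat) (X : set 'rV[k]_n.+1) (Y : set 'rV[k]_m.+1)
    (F : tuplemap n m) (x : 'rV[k]_n.+1) : 'rV[k]_m.+1 :=
  xget 0 [set y | evaluates X Y F x y].

Definition rm_image (n m : nat) (X : set 'rV[k]_n.+1) (Y : set 'rV[k]_m.+1)
    (F : tuplemap n m) (E : set 'rV[k]_n.+1) : set 'rV[k]_m.+1 :=
  [set y | exists2 x, E x & evaluates X Y F x y].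

Definition dominant (n m : nat) (X : set 'rV[k]_n.+1) (Y : set 'rV[k]_m.+1)
    (F : tuplemap n m) : Prop :=
  rational_map X Y F /\ dense_in Y (rm_image X Y F X).

Definition is_morphism (n m : nat) (X : set 'rV[k]_n.+1) (Y : set 'rV[k]_m.+1)
    (F : tuplemap n m) : Prop :=
  rational_map X Y F /\ forall x, X x -> defined_at X Y F x.

Definition birational_inverse (n m : nat) (X : set 'rV[k]_n.+1)
    (Y : set 'rV[k]_m.+1) (p : tuplemap n m) (q : tuplemap m n) : Prop :=
  [/\ dominant X Y p, dominant Y X q,
      tm_eqv X (tm_comp q p) (@tm_id n) & tm_eqv Y (tm_comp p q) (@tm_id m)].

Definition rm_orbit (n : nat) (X : set 'rV[k]_n.+1) (f : tuplemap n n)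
    (x : 'rV[k]_n.+1) (r : nat) : 'rV[k]_n.+1 :=
  iter r (rm_app X X f) x.

(** In a variety, codimension one means maximal among the proper irreducible
    closed subsets. *)
Definition prime_divisor (n : nat) (X E : set 'rV[k]_n.+1) : Prop :=
  [/\ projective E, E `<` X
    & forall E', projective E' -> E `<=` E' -> E' `<=` X -> E' = E \/ E' = X].

(** [T] generates the maximal ideal of the discrete valuation ring of [X] at the
    generic point of [E]; homogeneous polynomials not vanishing identically on
    [E] are units there. *)
Definition local_equation (n : nat) (X E : set 'rV[k]_n.+1) (T : hpoly n) :=
  [/\ ishom T, eq_on E T 0
    & forall G, ishom G -> eq_on E G 0 -> exists A C : hpoly n,
        [/\ ishom A, ishom C, nonzero_on E C & eq_on X (G * C) (A * T)]].

Definition is_order_along (n : nat) (X E : set 'rV[k]_n.+1) (P : hpoly n)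
    (r : nat) : Prop :=
  exists T A C : hpoly n,
    [/\ local_equation X E T, ishom A /\ ishom C,
        nonzero_on E A /\ nonzero_on E C & eq_on X (P * C) (A * T ^+ r)].

(** The multiplicity along [E] of the pullback by [p] of the hyperplane [h = 0]:
    near the generic point of [E], a local equation of the pullback is [h(G)] for
    a representative [G] of [p] that is regular there. *)
Definition pullback_mult (n m : nat) (X : set 'rV[k]_n.+1) (p : tuplemap n m)
    (h : hpoly m) (E : set 'rV[k]_n.+1) : nat :=
  xget 0%N [set r | exists G : tuplemap n m,
    [/\ tm_hom G, tm_eqv X p G, tm_nonzero_on E G
      & is_order_along X E (mpoly.comp_mpoly [tuple G j | j < m.+1] h) r]].

(** The degree of the extension of function fields [k(E) / k(D)] induced by the
    map [G : E -> D].  Families in [k(E)] and in [k(D)] are written with common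
    denominators, which drop out of the linear relations. *)
Definition indep_over (n m : nat) (E : set 'rV[k]_n.+1) (D : set 'rV[k]_m.+1)
    (G : tuplemap n m) (r : nat) : Prop :=
  exists P : 'I_r -> hpoly n, (exists d, forall i, homog d (P i)) /\
    forall A : 'I_r -> hpoly m, (exists d, forall i, homog d (A i)) ->
      eq_on E (\sum_(i < r)
        mpoly.comp_mpoly [tuple G j | j < m.+1] (A i) * P i) 0 ->
      forall i, eq_on D (A i) 0.

Definition field_degree (n m : nat) (X : set 'rV[k]_n.+1) (p : tuplemap n m)
    (E : set 'rV[k]_n.+1) (D : set 'rV[k]_m.+1) : nat :=
  xget 0%N [set r | exists G : tuplemap n m,
    [/\ tm_hom G, tm_eqv X p G, tm_nonzero_on E G, indep_over E D G r
      & forall s, indep_over E D G s -> (s <= r)%N]].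

(** The dimension of the degree [e] part of the homogeneous coordinate ring. *)
Definition indep_forms (n : nat) (D : set 'rV[k]_n.+1) (e r : nat) : Prop :=
  exists P : 'I_r -> hpoly n, (forall i, homog e (P i)) /\
    forall c : 'I_r -> k,
      (forall v, D v -> \sum_(i < r) c i * ev (P i) v = 0) -> forall i, c i = 0.

Definition hilbert_function (n : nat) (D : set 'rV[k]_n.+1) (e : nat) : nat :=
  xget 0%N [set r | indep_forms D e r /\
    forall s, indep_forms D e s -> (s <= r)%N].

(** [(\dim D)!] times the leading coefficient of the Hilbert polynomial of [D];
    it is the intersection number of [D] with [\dim D] copies of [O(1)]. *)
Definition proj_degree (n : nat) (D : set 'rV[k]_n.+1) : nat :=
  xget 0%N [set d | exists p : {poly rat},
    (exists e0 : nat, forall e : nat, (e0 <= e)%N ->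
       p.[e%:R] = (hilbert_function D e)%:R) /\
    d%:R = ((size p).-1)`!%:R * lead_coef p].

(** [(p_* [E] . L^(\dim X' - 1))] for a prime divisor [E] of [X], a birational
    morphism [p : X -> X'] and [L = O(1)]; the pushforward is zero when the
    dimension of [E] drops. *)
Definition pushforward_degree (n m : nat) (X : set 'rV[k]_n.+1)
    (X' : set 'rV[k]_m.+1) (p : tuplemap n m) (E : set 'rV[k]_n.+1) : nat :=
  let D := rm_image X X' p E in
  if `[< prime_divisor X' D >] then (field_degree X p E D * proj_degree D)%N
  else 0%N.

(** [r = (g^* L . L^(\dim X - 1))] with [L = O(1)] and [g^* L = p1_* p2^* L], for a
    rational self-map [g] of a normal projective variety [X].  The expression has
    no meaning when [X] is a point; it is then given the value [1]. *)
Definition is_pullback_degree (n : nat) (X : set 'rV[k]_n.+1) (g : tuplemap n n)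
    (r : nat) : Prop :=
  (is_point X /\ r = 1%N) \/
  (~ is_point X /\
   exists (m : nat) (Gam : set 'rV[k]_m.+1) (p1 p2 : tuplemap m n)
          (q1 : tuplemap n m) (h : hpoly n),
     [/\ projective Gam /\ normal Gam,
         is_morphism Gam X p1 /\ birational_inverse Gam X p1 q1,
         is_morphism Gam X p2 /\ tm_eqv X g (tm_comp p2 q1),
         homog 1 h /\ nonzero_on X h
       & r = \sum_(E \in [set E | prime_divisor Gam E])
               (pullback_mult Gam p2 h E * pushforward_degree Gam X p1 E)%N]).

Unset Implicit Arguments.
Record admissible_triple := AdmissibleTriple {
  at_dim : nat;
  at_X : set 'rV[k]_at_dim.+1;
  at_f : tuplemap at_dim at_dim;
  at_x : 'rV[k]_at_dim.+1;
  at_quasi_projective : quasi_projective at_X;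
  at_dominant : dominant at_X at_X at_f;
  at_point : at_X at_x;
  at_orbit_defined : forall r,
    defined_at at_X at_X at_f (rm_orbit at_X at_f at_x r)
}.
Set Implicit Arguments.

Definition birational_triples (S T : admissible_triple) : Prop :=
  exists (p : tuplemap (at_dim S) (at_dim T))
         (q : tuplemap (at_dim T) (at_dim S)) (V : set 'rV[k]_(at_dim T).+1),
    let X := at_X S in let Y := at_X T in
    let U := [set u | defined_at X Y p u /\ V (rm_app X Y p u)] in
    [/\ birational_inverse X Y p q,
        tm_eqv X (tm_comp p (at_f S)) (tm_comp (at_f T) p),
        [/\ open_in Y V, dense_in Y V
          & forall r, V (rm_orbit Y (at_f T) (at_x T) r)],
        (* q restricts to a morphism V -> U inverse to p *)
        (forall u, U u -> defined_at Y X q (rm_app X Y p u) /\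
           proj_eq u (rm_app Y X q (rm_app X Y p u))) /\
        (forall v, V v -> [/\ defined_at Y X q v, U (rm_app Y X q v)
           & proj_eq v (rm_app X Y p (rm_app Y X q v))])
      & evaluates X Y p (at_x S) (at_x T)].

End ProjectiveSets.

Arguments at_dim {k} a.
Arguments at_X {k} a _.
Arguments at_f {k} a _.
Arguments at_x {k} a.

Section Heights.
Variables (R : realType) (K F k : fieldType).
Variables (iota : {rmorphism K -> F}) (j : {rmorphism F -> k}).

(** The normalized discrete valuations of [L] that are trivial on [K].  The value
    at [0] is irrelevant; it is fixed so that a place is a unique function. *)
Definition is_place (L : fieldExtType F) (v : L -> int) : Prop :=
  [/\ v 0 = 0,
      forall a b, a != 0 -> b != 0 -> v (a * b) = v a + v b,
      forall a b, a != 0 -> b != 0 -> a + b != 0 ->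
        Num.min (v a) (v b) <= v (a + b),
      forall c : K, v ((iota c)%:A) = 0
    & exists2 a, a != 0 & v a = 1].

(** The absolute logarithmic Weil height on [P^n(k)], for the line bundle [O(1)]:
    [L] is any finite extension of [F] inside [k] over which the point has its
    coordinates.  All residue fields are equal to the algebraically closed field
    [K], so that no residue degrees appear. *)
Definition weil_height (n : nat) (x : 'rV[k]_n.+1) : R :=
  xget 0 [set h : R |
    exists (L : fieldExtType F) (e : {rmorphism L -> k}) (z : 'rV[L]_n.+1),
      [/\ forall a : F, e a%:A = j a,
          forall i, e (z ord0 i) = x ord0 i
        & h = (\dim {:L})%:R^-1 *
              \sum_(v \in [set v | @is_place L v])
                sup [set ((- v (z ord0 i))%:~R : R)
                    | i in [set i | z ord0 i != 0]]]].

(** [(h_L^+ (f^r x))^(1/r)] for [L = O(1)]. *)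
Definition height_growth (T : admissible_triple k) (r : nat) : R :=
  (Num.max (weil_height (rm_orbit (at_X T) (at_f T) (at_x T) r)) 1)
    `^ (r%:R^-1).

Local Open Scope ereal_scope.

Definition arith_degree_set (T : admissible_triple k) : set (\bar R) :=
  [set a | exists T' : admissible_triple k,
    [/\ projective (at_X T'), birational_triples T T'
      & cluster ((fun r => (height_growth T' r)%:E) @ \oo) a]].

Definition upper_arith_degree (T : admissible_triple k) : \bar R :=
  ereal_sup (arith_degree_set T).

End Heights.

Definition is_first_dynamical_degree (R : realType) (k : fieldType) (n : nat)
    (X : set 'rV[k]_n.+1) (f : tuplemap k n n) (l : R) : Prop :=
  exists (m : nat) (X' : set 'rV[k]_m.+1) (p : tuplemap k n m)
         (q : tuplemap k m n) (f' : tuplemap k m m) (u : nat -> nat),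
    [/\ projective X' /\ normal X',
        birational_inverse X X' p q,
        rational_map X' X' f' /\ tm_eqv X (tm_comp p f) (tm_comp f' p),
        forall r, is_pullback_degree X' (tm_iter f' r) (u r)
      & ((u r)%:R : R) `^ (r%:R^-1) @[r --> \oo] --> l].

(* Main.v *)
(** A height over the function field counts poles: up to constants, [h x] is the sum over
    all pairs of coordinates of the number of poles of [x_i / x_l], divided by the degree of
    the field of definition. Let [u m] be the degree of the pullback of a hyperplane under
    the [m]-th iterate. Project [X'] finitely onto a projective space by linear forms. If the
    iterate is given by forms [Q], each [Q_i / l(Q)] is a root of a polynomial over the
    coordinate ring of that projective space, and every prime factor of the leading
    coefficient comes from a pole divisor of [Q_i / l(Q)] on a resolution; comparing Hilbert
    functions bounds the degree of the leading coefficient by [C * u m], with [C] independent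
    of [m]. Evaluating the equation at the orbit and bounding the roots at each place by the
    coefficients gives [h (f^(n+m) x) <= C * u m * h (f^n x) + O_m(1)]. For [m] large the
    factor [C] disappears in the [m]-th root, whence the bound by [lim (u m)^(1/m)]. *)
Require Import Defs.
From HB Require Import structures.
From mathcomp Require mpoly.
Import -(notations) mpoly.
From mathcomp Require Import all_boot all_order all_algebra falgebra fieldext.
From mathcomp Require Import all_classical all_reals all_analysis.
From mathcomp Require Import zify ring lra.

Set Implicit Arguments.
Unset Strict Implicit.
Unset Printing Implicit Defensive.

Import Order.TTheory GRing.Theory Num.Theory.
Import numFieldNormedType.Exports.

Local Open Scope classical_set_scope.
Local Open Scope ring_scope.

(** * Valuation rings *)

(** No intersection theory is used: divisors enter only through valuation rings of a field [Om]
    containing the generic points. A prime factor of a leading coefficient gives, by Chevalley's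
    theorem, a valuation ring at which a coordinate has a pole. The finite projection makes it
    discrete on the function field and normality identifies it with the local ring at its center; so
    the centers on the resolution and on [X'] are prime divisors and really occur in the sum
    defining [u m]. Two uniformity problems shape the rest. [C] may only involve numbers of module
    generators, numbers of coordinates and degrees of fixed birational maps. And a leading
    coefficient may vanish at an orbit point: so each orbit point gets its own projection, whose
    fibre avoids the bad locus and whose number of generators is bounded in advance; by
    Noetherianity finitely many of the resulting relations serve the whole orbit, which makes the
    additive error uniform in [n]. The normal model carrying [u m] and the projective model carrying
    the orbit differ, so denominators are cleared on the first and carried to the second as integral
    fractions. *)

Section ValuationRings.
Variable Om : fieldType.
Implicit Types (R V W I : set Om) (x y : Om).

Definition subring R :=
  [/\ R 1, forall x y, R x -> R y -> R (x - y) & forall x y, R x -> R y -> R (x * y)].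

Definition valring V := subring V /\ forall x, V x \/ V x^-1.

(** The nonunits of a valuation ring [V]. *)
Definition maxi V x := x = 0 \/ ~ V x^-1.

Section Subring.
Variables (R : set Om) (sR : subring R).

Lemma subring1 : R 1. Proof. by case: sR. Qed.
Lemma subringB x y : R x -> R y -> R (x - y). Proof. by case: sR => _ h _; apply: h. Qed.
Lemma subringM x y : R x -> R y -> R (x * y). Proof. by case: sR => _ _; apply. Qed.
Lemma subring0 : R 0. Proof. by rewrite -(subrr 1); apply: subringB; exact: subring1. Qed.
Lemma subringN x : R x -> R (- x). Proof. by rewrite -sub0r; apply: subringB; exact: subring0. Qed.
Lemma subringD x y : R x -> R y -> R (x + y).
Proof. by move=> Rx Ry; rewrite -[y]opprK; apply: subringB => //; exact: subringN. Qed.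
Lemma subringX x n : R x -> R (x ^+ n).
Proof. by move=> Rx; elim: n => [|n IH]; rewrite ?expr0 ?exprS; [exact: subring1|exact: subringM]. Qed.
Lemma subring_sum (T : Type) (s : seq T) (P : pred T) (f : T -> Om) :
  (forall i, P i -> R (f i)) -> R (\sum_(i <- s | P i) f i).
Proof. by move=> h; apply: (big_ind R) => //; [exact: subring0|exact: subringD]. Qed.
End Subring.

Section Extension.
Variables (R I : set Om).
Hypotheses (sR : subring R) (IR : I `<=` R) (I1 : ~ exists (n : nat) (a b : 'I_n -> Om),
  [/\ forall i, I (a i), forall i, R (b i) & 1 = \sum_i a i * b i]).

Let J V x := exists s : seq (Om * Om),
  (forall u, u \in s -> I u.1 /\ V u.2) /\ x = \sum_(u <- s) u.1 * u.2.

Let ok V := [/\ subring V, R `<=` V & ~ J V 1].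

Let J0 V : J V 0.
Proof. by exists [::]; split=> //; rewrite big_nil. Qed.

Let JD V x y : J V x -> J V y -> J V (x + y).
Proof.
case=> s [hs ->] [t [ht ->]]; exists (s ++ t); split; last by rewrite big_cat.
by move=> u; rewrite mem_cat => /orP[/hs|/ht].
Qed.

Let JM V x y : subring V -> J V x -> V y -> J V (x * y).
Proof.
move=> sV [s [hs ->]] Vy; exists [seq (u.1, u.2 * y) | u <- s]; split.
  by move=> u /mapP[w ws ->] /=; have [? ?] := hs _ ws; split=> //; apply: subringM.
by rewrite big_map mulr_suml; apply: eq_bigr => u _; rewrite mulrA.
Qed.

Let JV V x : subring V -> R `<=` V -> J V x -> V x.
Proof.
move=> sV RV [s [hs ->]]; rewrite big_seq; apply: subring_sum => // u us.
by have [Iu Vu] := hs _ us; apply: subringM => //; apply: RV; apply: IR.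
Qed.

Let J_sum V n (f : 'I_n -> Om) : (forall i, J V (f i)) -> J V (\sum_i f i).
Proof. by move=> h; apply: (big_ind (J V)) => // *; exact: JD. Qed.

Let exists_max : exists V, ok V /\ forall W, subring W -> V `<=` W -> ~ J W 1 -> W `<=` V.
Proof.
have okR : ok R.
  split=> // -[s [hs e]]; apply: I1; exists (size s).
  exists (fun i => (nth (0, 0) s i).1), (fun i => (nth (0, 0) s i).2).
  split=> [i|i|]; last by rewrite e (big_nth (0, 0)) big_mkord.
  - by case: (hs (nth (0, 0) s i)) => //; apply: mem_nth.
  - by case: (hs (nth (0, 0) s i)) => //; apply: mem_nth.
(* Maximizing over sets [A] whose union with [R] is admissible, rather than over rings, gives the
   empty chain a bound: the empty set stands for [R]. *)
have [A [okA maxA]] : exists A, ok (A `|` R) /\ forall B, A `<` B -> ~ ok (B `|` R).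
  apply: Zorn_bigcup => F okF tF.
  have common : forall s : seq Om,
      (forall x, x \in s -> (\bigcup_(X in F) X `|` R) x) ->
      (forall x, x \in s -> R x) \/
      exists2 X, F X & forall x, x \in s -> (X `|` R) x.
    elim=> [|x s IH] hs; first by left.
    have [|hR|[X FX hX]] := IH; first by move=> y ys; apply: hs; rewrite inE ys orbT.
      case: (hs x (mem_head _ _)) => [[X FX Xx]|Rx]; last first.
        by left=> y; rewrite inE => /orP[/eqP->|/hR].
      by right; exists X => // y; rewrite inE => /orP[/eqP->|/hR]; [left|right].
    case: (hs x (mem_head _ _)) => [[Y FY Yx]|Rx]; last first.
      by right; exists X => // y; rewrite inE => /orP[/eqP->|/hX //]; right.
    case: (tF X Y FX FY) => XY; right.
      exists Y => // y; rewrite inE => /orP[/eqP->|/hX[]]; first by left.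
        by move=> /XY; left.
      by right.
    by exists X => // y; rewrite inE => /orP[/eqP->|/hX //]; left; apply: XY.
  have sub X : F X -> X `|` R `<=` \bigcup_(X in F) X `|` R.
    by move=> FX y [Xy|Ry]; [left; exists X|right].
  split.
  - split=> [|x y hx hy|x y hx hy]; first by right; exact: subring1.
    + case: (common [:: x; y]) => [z|hR|[X FX hX]].
      * by rewrite !inE => /orP[]/eqP->.
      * by right; apply: subringB => //; apply: hR; rewrite !inE eqxx ?orbT.
      * case: (okF _ FX) => sX _ _; apply: (sub _ FX).
        by apply: subringB => //; apply: hX; rewrite !inE eqxx ?orbT.
    + case: (common [:: x; y]) => [z|hR|[X FX hX]].
      * by rewrite !inE => /orP[]/eqP->.
      * by right; apply: subringM => //; apply: hR; rewrite !inE eqxx ?orbT.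
      * case: (okF _ FX) => sX _ _; apply: (sub _ FX).
        by apply: subringM => //; apply: hX; rewrite !inE eqxx ?orbT.
  - by move=> x Rx; right.
  - case=> s [hs e].
    case: (common (unzip2 s)) => [z /mapP[u us ->]|hR|[X FX hX]].
    + by case: (hs _ us).
    + case: okR => _ _; apply; exists s; split=> // u us; split; first by case: (hs _ us).
      by apply: hR; apply: map_f.
    + case: (okF _ FX) => _ _; apply; exists s; split=> // u us; split; first by case: (hs _ us).
      by apply: hX; apply: map_f.
exists (A `|` R); split=> // W sW AW J1 x Wx.
apply: contrapT => nx.
have RW : W `|` R = W.
  by apply/seteqP; split=> [y [//|Ry]|y ?]; [apply: AW; right|left].
apply: (maxA W); last by rewrite RW; split=> // y Ry; apply: AW; right.
split; first by move=> y Ay; apply: AW; left.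
by move=> WA; apply: nx; left; apply: WA.
Qed.

(** Chevalley's extension theorem. A subring maximal among those in which [I] generates a proper
    ideal is a valuation ring: if it contained neither [x] nor its inverse, adjoining either one
    would put 1 in the extended ideal, and the two resulting equations reduce each other in degree
    until one becomes constant. *)
Lemma valring_extension :
  exists V, [/\ valring V, R `<=` V & forall x, I x -> maxi V x].
Proof.
have [V [[sV RV J1] maxV]] := exists_max.
have Jpow a n : J V a -> J V (1 - (1 - a) ^+ n).
  move=> Ja; elim: n => [|n IH]; first by rewrite expr0 subrr; exact: J0.
  have -> : 1 - (1 - a) ^+ n.+1 = a + (1 - (1 - a) ^+ n) * (1 - a).
    by rewrite exprS; ring.
  apply: JD => //; apply: JM => //; apply: subringB => //; first exact: subring1.
  exact: JV.
(* Maximality is tested against [V[1/u]] with [u = 1 - a]: an equation putting 1 in its ideal puts a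
   power [u ^+ n] in the ideal of [V], which already contains [1 - u ^+ n]. *)
have unit1 a : J V a -> V (1 - a)^-1.
  move=> Ja; set u := 1 - a.
  have Vu : V u by apply: subringB => //; [exact: subring1|exact: JV].
  have u0 : u != 0.
    by apply/eqP => /eqP; rewrite subr_eq0 => /eqP e; apply: J1; rewrite e.
  pose W := [set w | exists n, V (w * u ^+ n)].
  apply: (maxV W).
  - split=> [|x y [n hn] [m hm]|x y [n hn] [m hm]].
    + by exists 0%N; rewrite expr0 mulr1; exact: subring1.
    + exists (n + m)%N; rewrite exprD.
      have -> : (x - y) * (u ^+ n * u ^+ m) = x * u ^+ n * u ^+ m - y * u ^+ m * u ^+ n.
        by ring.
      by apply: subringB => //; apply: subringM => //; apply: subringX.
    + exists (n + m)%N; rewrite exprD.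
      have -> : x * y * (u ^+ n * u ^+ m) = (x * u ^+ n) * (y * u ^+ m) by ring.
      exact: subringM.
  - by move=> x Vx; exists 0%N; rewrite expr0 mulr1.
  - case=> s [hs e].
    have [n hn] : exists n, forall w, w \in s -> V (w.2 * u ^+ n).
      elim: s {e} hs => [|w s IH] hs; first by exists 0%N.
      have [|n hn] := IH; first by move=> z zs; apply: hs; rewrite inE zs orbT.
      have [_ [m hm]] := hs w (mem_head _ _).
      exists (n + m)%N => z; rewrite inE => /orP[/eqP->|/hn hz].
        by rewrite addnC exprD mulrA; apply: subringM => //; apply: subringX.
      by rewrite exprD mulrA; apply: subringM => //; apply: subringX.
    apply: J1.
    have -> : 1 = u ^+ n + (1 - u ^+ n) by ring.
    apply: JD; last exact: Jpow.
    exists [seq (w.1, w.2 * u ^+ n) | w <- s]; split.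
      by move=> w /mapP[z zs ->] /=; split; [case: (hs _ zs)|exact: hn].
    rewrite big_map -[LHS]mul1r e mulr_suml; apply: eq_bigr => w _ /=.
    by rewrite mulrA.
  - by exists 1%N; rewrite expr1 mulVf //; exact: subring1.
have adj x : ~ V x -> exists2 p : {poly Om}, (forall i, J V p`_i) & p.[x] = 1.
  move=> nx.
  pose W := [set w | exists2 p : {poly Om}, (forall i, V p`_i) & w = p.[x]].
  have sW : subring W.
    split=> [|y z [p hp ->] [q hq ->]|y z [p hp ->] [q hq ->]].
    - exists 1; rewrite ?hornerC // => i; rewrite coef1; case: (i == 0%N) => /=.
        exact: subring1.
      exact: subring0.
    - exists (p - q); last by rewrite hornerD hornerN.
      by move=> i; rewrite coefB; apply: subringB.
    - exists (p * q); last by rewrite hornerM.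
      by move=> i; rewrite coefM; apply: subring_sum => // k _; apply: subringM.
  have VW : V `<=` W.
    move=> y Vy; exists y%:P; last by rewrite hornerC.
    by move=> i; rewrite coefC; case: (i == 0%N) => //; apply: subring0.
  have [s [hs e]] : J W 1.
    apply: contrapT => nJ; apply: nx; apply: (maxV W) => //.
    exists 'X; rewrite ?hornerX // => i; rewrite coefX; case: (i == 1%N) => /=.
      exact: subring1.
    exact: subring0.
  rewrite e; elim: s {e} hs => [|w s IH] hs.
    exists 0; last by rewrite horner0 big_nil.
    by move=> i; rewrite coef0; exact: J0.
  have [|p hp ep] := IH; first by move=> z zs; apply: hs; rewrite inE zs orbT.
  have [Iw [q hq eq]] := hs w (mem_head _ _).
  exists (w.1 *: q + p); last by rewrite big_cons hornerD hornerZ ep eq.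
  move=> i; rewrite coefD coefZ; apply: JD => //.
  exists [:: (w.1, q`_i)]; split; last by rewrite big_seq1.
  by move=> z; rewrite inE => /eqP -> /=; split.
(* Descent on the sum of the degrees. As 1 minus the constant term of [q] is a unit, [q.[y] = 1]
   writes 1 as a combination of positive powers of [y]; multiplying the top term of [p] by it lowers
   the degree of [p], because [x * y = 1]. *)
have noboth : forall n (p q : {poly Om}) x y, (size p + size q < n)%N -> x * y = 1 ->
    (forall i, J V p`_i) -> (forall i, J V q`_i) -> p.[x] = 1 -> q.[y] = 1 -> False.
  elim=> // n IH.
  have key (p q : {poly Om}) x y : (size q <= size p)%N -> (size p + size q < n.+1)%N -> x * y = 1 ->
    (forall i, J V p`_i) -> (forall i, J V q`_i) -> p.[x] = 1 -> q.[y] = 1 -> False.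
    move=> sqp sn xy hp hq px qy.
    case sq : (size q) => [|[|m]].
    - move/eqP: sq; rewrite size_poly_eq0 => /eqP q0.
      by move/eqP: qy; rewrite q0 horner0 eq_sym oner_eq0.
    - have q0 : q = (q`_0)%:P by apply: size1_polyC; rewrite sq.
      by apply: J1; move: (hq 0%N); rewrite -qy [in X in _ -> J V X]q0 hornerC.
    have [N sp] : exists N, size p = N.+1 by case: (size p) sqp; rewrite sq // => N _; exists N.
    have mN : (m.+1 <= N)%N by move: sqp; rewrite sq sp.
    have u1 := unit1 _ (hq 0%N).
    set c := (1 - q`_0)^-1 in u1.
    have c0 : 1 - q`_0 != 0.
      by apply/eqP => /eqP; rewrite subr_eq0 => /eqP e; apply: J1; rewrite e.
    have qE : 1 - q`_0 = \sum_(i < m.+1) q`_i.+1 * y ^+ i.+1.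
      rewrite -qy horner_coef sq big_ord_recl /= expr0 mulr1 addrC addKr.
      by apply: eq_bigr => i _.
    pose p' := \poly_(i < N) p`_i + \sum_(i < m.+1) (p`_N * (c * q`_i.+1)) *: 'X^(N - i.+1).
    have sp' : (size p' <= N)%N.
      rewrite (leq_trans (size_polyD _ _)) // geq_max size_poly /=.
      rewrite (leq_trans (size_sum _ _ _)) //; apply/bigmax_leqP => i _.
      rewrite (leq_trans (size_scale_leq _ _)) // size_polyXn.
      have := ltn_ord i; lia.
    apply: (IH p' q x y) => //.
    - rewrite sp in sn; lia.
    - move=> i; rewrite coefD coef_sum; apply: JD.
        by rewrite coef_poly; case: ifP => _ //; exact: J0.
      apply: J_sum => k; rewrite coefZ; apply: JM => //; last first.
        rewrite coefXn; case: (_ == _) => /=; [exact: subring1|exact: subring0].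
      by apply: JM => //; apply: subringM => //; apply: JV.
    - move: (px); rewrite horner_coef sp big_ord_recr /= => <-.
      rewrite hornerD horner_poly horner_sum; congr (_ + _).
      have -> : p`_N * x ^+ N = p`_N * x ^+ N * (c * (1 - q`_0)).
        by rewrite mulVf // mulr1.
      rewrite qE !mulr_sumr; apply: eq_bigr => i _; rewrite hornerZ hornerXn.
      have iN : (i.+1 <= N)%N by have := ltn_ord i; lia.
      have -> : x ^+ N = x ^+ (N - i.+1) * x ^+ i.+1 by rewrite -exprD subnK.
      have e1 : x ^+ i.+1 * y ^+ i.+1 = 1 by rewrite -exprMn xy expr1n.
      transitivity (p`_N * (c * q`_i.+1) * x ^+ (N - i.+1) * (x ^+ i.+1 * y ^+ i.+1)).
        by rewrite e1 mulr1.
      by ring.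
  move=> p q x y sn xy hp hq px qy.
  case: (leqP (size q) (size p)) => s; first exact: (key p q x y).
  by apply: (key q p y x) => //; [exact: ltnW|rewrite addnC|rewrite mulrC].
exists V; split=> //.
- split=> // x; case: (eqVneq x 0) => [->|x0]; first by left; exact: subring0.
  case: (pselect (V x)) => [|nx]; first by left.
  case: (pselect (V x^-1)) => [|nx']; first by right.
  have [p hp px] := adj _ nx; have [q hq qx] := adj _ nx'.
  by exfalso; apply: (noboth _ p q x x^-1 (ltnSn _)) => //; rewrite divff.
- move=> x Ix; case: (eqVneq x 0) => [|x0]; first by left.
  right=> Vx; apply: J1; exists [:: (x, x^-1)]; split; last by rewrite big_seq1 divff.
  by move=> u; rewrite inE => /eqP ->.
Qed.

End Extension.

Section Valring.
Variables (V : set Om) (vV : valring V).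
Let sV : subring V. Proof. by case: vV. Qed.

Lemma maxi_sub x : maxi V x -> V x.
Proof.
by case=> [->|nx]; [exact: subring0|case: vV => _ /(_ x)[]].
Qed.

Lemma maxi1 : ~ maxi V 1.
Proof.
by case=> [/eqP|]; [rewrite oner_eq0|rewrite invr1 => h; apply: h; exact: subring1].
Qed.

Lemma maxiM x y : V x -> maxi V y -> maxi V (x * y).
Proof.
move=> Vx [->|ny]; first by rewrite mulr0; left.
case: (eqVneq x 0) => [->|x0]; first by rewrite mul0r; left.
right; rewrite invfM => h; apply: ny.
by have := subringM sV Vx h; rewrite mulrA divff // mul1r.
Qed.

Lemma maxiMl x y : maxi V x -> V y -> maxi V (x * y).
Proof. by move=> ? ?; rewrite mulrC; apply: maxiM. Qed.

Lemma maxiD x y : maxi V x -> maxi V y -> maxi V (x + y).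
Proof.
wlog : x y / V (y / x) => [wl mx my|Vyx mx my].
  case: vV => _ /(_ (y / x))[h|]; first exact: wl.
  by rewrite invf_div addrC => h; apply: wl.
case: (eqVneq x 0) => [->|x0]; first by rewrite add0r.
have -> : x + y = (1 + y / x) * x by rewrite mulrDl mul1r divfK.
by apply: maxiM => //; apply: subringD => //; exact: subring1.
Qed.

Lemma maxiN x : maxi V x -> maxi V (- x).
Proof. by rewrite -mulN1r => mx; apply: maxiM => //; apply: subringN => //; exact: subring1. Qed.

Lemma maxiB x y : maxi V x -> maxi V y -> maxi V (x - y).
Proof. by move=> mx my; apply: maxiD => //; exact: maxiN. Qed.

Lemma maxi_sum (T : Type) (s : seq T) (P : pred T) (f : T -> Om) :
  (forall i, P i -> maxi V (f i)) -> maxi V (\sum_(i <- s | P i) f i).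
Proof. by move=> h; apply: (big_ind (maxi V)) => //; [left|exact: maxiD]. Qed.

Lemma maxi_prime x y : V x -> V y -> maxi V (x * y) -> maxi V x \/ maxi V y.
Proof.
move=> Vx Vy [/eqP|nxy].
  by rewrite mulf_eq0 => /orP[]/eqP ->; [left|right]; left.
case: (pselect (V x^-1)) => [Vx'|]; last by left; right.
by right; right=> Vy'; apply: nxy; rewrite invfM; apply: subringM.
Qed.

Lemma maxiXn x n : V x -> maxi V (x ^+ n) -> maxi V x.
Proof.
move=> Vx; elim: n => [|n IH]; first by rewrite expr0 => /maxi1.
by rewrite exprS => /maxi_prime[] //; apply: subringX.
Qed.

Lemma nmaxi_unit x : V x -> ~ maxi V x -> V x^-1.
Proof. by move=> Vx h; apply: contrapT => h2; apply: h; right. Qed.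

Lemma unit_nmaxi x : x != 0 -> V x^-1 -> ~ maxi V x.
Proof. by move=> /eqP x0 Vx []. Qed.

Lemma nmaxi_neq0 x : ~ maxi V x -> x != 0.
Proof. by move=> h; apply/eqP => x0; apply: h; left. Qed.

Lemma nmem_maxi_inv x : ~ V x -> maxi V x^-1.
Proof. by move=> nx; right; rewrite invrK. Qed.

Lemma maxi_scaleX c d a : c != 0 -> V c -> V c^-1 -> maxi V (c ^+ d * a) <-> maxi V a.
Proof.
move=> c0 Vc Vc'; split=> h; last by apply: maxiM => //; exact: subringX.
by rewrite -[a](mulKf (expf_neq0 d c0)) -exprVn; apply: maxiM => //; exact: subringX.
Qed.

Lemma valring_integral (p : {poly Om}) x :
  p \is monic -> (forall i, V p`_i) -> p.[x] = 0 -> V x.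
Proof.
move=> mp hp px; apply: contrapT => nx.
have x0 : x != 0 by apply/eqP => x0; apply: nx; rewrite x0; exact: subring0.
have mx := nmem_maxi_inv nx.
case sp : (size p) => [|n].
  move/eqP: sp; rewrite size_poly_eq0 => /eqP p0.
  by move: mp; rewrite p0 monicE lead_coef0 eq_sym oner_eq0.
have lp : p`_n = 1 by move/monicP: mp; rewrite lead_coefE sp.
apply: maxi1.
have -> : 1 = - \sum_(i < n) p`_i * (x^-1) ^+ (n - i).
  apply/eqP; rewrite -subr_eq0 opprK; apply/eqP.
  apply: (mulIf (x := x ^+ n)); first by rewrite expf_neq0.
  move: px; rewrite horner_coef sp big_ord_recr /= lp mul1r addrC => px.
  rewrite mul0r -[RHS]px mulrDl mul1r mulr_suml; congr (_ + _).
  apply: eq_bigr => i _; rewrite -mulrA; congr (_ * _).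
  have -> : x ^+ n = x ^+ (n - i) * x ^+ i by rewrite -exprD subnK // ltnW.
  by rewrite mulrA -exprMn mulVf // expr1n mul1r.
apply/maxiN/maxi_sum => i _; apply: maxiM => //.
have [k ->] : exists k, (n - i = k.+1)%N by exists (n - i).-1; have := ltn_ord i; lia.
by rewrite exprS; apply: maxiMl => //; apply: subringX => //; apply: maxi_sub.
Qed.

End Valring.
End ValuationRings.

(** * Factorial rings and minimal equations *)

Lemma horner_map_wide (A S : nzRingType) (f : {rmorphism A -> S}) n (p : {poly A}) x :
  (size p <= n)%N -> (map_poly f p).[x] = \sum_(i < n) f p`_i * x ^+ i.
Proof.
move=> le; rewrite (horner_coef_wide _ (n := n)) ?map_polyE ?(leq_trans (size_Poly _)) ?size_map //.
by apply: eq_bigr => i _; rewrite -map_polyE coef_map.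
Qed.

Section FactorialRings.

Definition dvd (R : idomainType) (a b : R) := exists c, b = c * a.

Definition primel (R : idomainType) (p : R) :=
  [/\ p != 0, p \isn't a GRing.unit & forall a b, dvd p (a * b) -> dvd p a \/ dvd p b].

Definition factored (R : idomainType) (x : R) := exists (s : seq R) (u : R),
  [/\ u \is a GRing.unit, forall p, p \in s -> primel p & x = u * \prod_(p <- s) p].

Definition factorial_ring (R : idomainType) := forall x : R, x != 0 -> factored x.

Lemma dvd_mulr (R : idomainType) (a b c : R) : dvd a b -> dvd a (c * b).
Proof. by move=> [d ->]; exists (c * d); rewrite mulrA. Qed.

Lemma dvd_prod (R : idomainType) (p : R) (s : seq R) : primel p ->
  dvd p (\prod_(q <- s) q) -> exists2 q, q \in s & dvd p q.
Proof.
case=> p0 pu pp; elim: s => [|q s IH].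
  by rewrite big_nil => -[c e]; case/negP: pu; apply/unitrPr; exists c; rewrite mulrC.
rewrite big_cons => /pp[h|/IH[r rs h]]; first by exists q; rewrite ?mem_head.
by exists r => //; rewrite inE rs orbT.
Qed.

Section Poly.
Variables (R : idomainType) (fR : factorial_ring R).
Implicit Types (f g h t : {poly R}).

Lemma dvd_polyC (p : R) f : (forall i, dvd p f`_i) -> dvd p%:P f.
Proof.
move=> /choice[c hc]; exists (\poly_(i < size f) c i); apply/polyP => i.
rewrite coefMC coef_poly; case: ltnP => h; first exact: hc.
by rewrite mul0r nth_default.
Qed.

Lemma dvd_polyC_coef (p : R) f i : dvd p%:P f -> dvd p f`_i.
Proof. by case=> g ->; exists g`_i; rewrite coefMC. Qed.

(** Gauss: take the lowest coefficient not divisible by [p] in each factor; in the matching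
    coefficient of the product every other term is divisible by [p]. *)
Lemma primel_polyC (p : R) : primel p -> primel p%:P.
Proof.
case=> p0 pu pp; split; first by rewrite polyC_eq0.
  by rewrite poly_unitE coefC eqxx (negbTE pu) andbF.
move=> f g dfg; apply: contrapT => /not_orP[nf ng].
have ex h : ~ dvd p%:P h -> exists i, `[< ~ dvd p h`_i >].
  move=> nh; apply: contrapT => e; apply: nh; apply: dvd_polyC => i.
  by apply: contrapT => ni; apply: e; exists i; apply/asboolP.
have [i /asboolP ni mi] := ex_minnP (ex _ nf).
have [j /asboolP nj mj] := ex_minnP (ex _ ng).
have di l : (l < i)%N -> dvd p f`_l.
  by move=> li; apply: contrapT => /asboolP/mi; rewrite leqNgt li.
have dj l : (l < j)%N -> dvd p g`_l.
  by move=> li; apply: contrapT => /asboolP/mj; rewrite leqNgt li.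
suff : dvd p f`_i \/ dvd p g`_j by case.
  apply: pp; have [c hc] := dvd_polyC_coef (i + j) dfg.
  have ile : (i < (i + j).+1)%N by lia.
  rewrite coefM (bigD1 (Ordinal ile)) //= addKn in hc.
  have [d hd] : dvd p (\sum_(l < (i + j).+1 | l != Ordinal ile) f`_l * g`_(i + j - l)).
    apply: (big_ind (dvd p)); first by exists 0; rewrite mul0r.
      by move=> x y [a ->] [b ->]; exists (a + b); rewrite mulrDl.
    move=> l nl; have [li|il] := ltnP l i; first by rewrite mulrC; apply: dvd_mulr; exact: di.
    apply: dvd_mulr; apply: dj; have := ltn_ord l; move: nl.
    rewrite -(inj_eq val_inj) /=; lia.
  by exists (c - d); rewrite mulrBl -hc hd addrK.
Qed.

Definition primitive f := forall p : R, primel p -> ~ dvd p%:P f.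

Lemma primitive_cancel f g t (c : R) :
  primitive f -> c != 0 -> c%:P * g = f * t -> dvd f g.
Proof.
move=> pf /fR[s [u [uu ps ->]]]; elim: s g t ps => [|p s IH] g t ps.
  rewrite big_nil mulr1 => e; exists (u^-1%:P * t).
  rewrite -mulrA [t * f]mulrC -e mulrA -polyCM mulVr // mul1r.
  by [].
rewrite big_cons => e.
have pp : primel p by apply: ps; rewrite mem_head.
have [//|[t' et]] : dvd p%:P f \/ dvd p%:P t.
- have [_ _] := primel_polyC pp; apply; rewrite -e.
  by exists ((u * \prod_(q <- s) q)%:P * g); rewrite -!mulrA [g * _]mulrC !mulrA -!polyCM; congr (_%:P * _); ring.
- by move/(pf _ pp).
- apply: (IH g t'); first by move=> q qs; apply: ps; rewrite inE qs orbT.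
  have p0 : p%:P != 0 by case: pp; rewrite polyC_eq0.
  apply: (mulfI p0); rewrite mulrA -polyCM.
  have -> : p * (u * \prod_(q <- s) q) = u * (p * \prod_(q <- s) q) by ring.
  by rewrite e et; ring.
Qed.

(** Each prime factor of [c] divides [g] or [h] by Gauss and is cancelled there without changing the
    degree. *)
Lemma content_cancel f g h (c : R) : c != 0 -> c%:P * f = g * h ->
  exists g' h', [/\ f = g' * h', size g' = size g & size h' = size h].
Proof.
move=> /fR[s [u [uu ps ->]]]; elim: s g h ps => [|p s IH] g h ps.
  rewrite big_nil mulr1 => e; exists (u^-1%:P * g), h; split=> //.
    by rewrite -mulrA -e mulrA -polyCM mulVr // mul1r.
  have u0 : u^-1 != 0 by apply: contraTneq uu => u0; rewrite -unitrV u0 unitr0.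
  by rewrite mul_polyC size_scale.
rewrite big_cons => e.
have pp : primel p by apply: ps; rewrite mem_head.
have p0 : p != 0 by case: pp.
have p0' : p%:P != 0 by rewrite polyC_eq0.
have ps' q : q \in s -> primel q by move=> qs; apply: ps; rewrite inE qs orbT.
have [] : dvd p%:P g \/ dvd p%:P h.
- have [_ _] := primel_polyC pp; apply; rewrite -e.
  by exists ((u * \prod_(q <- s) q)%:P * f); rewrite -!mulrA [f * _]mulrC !mulrA -!polyCM; congr (_%:P * _); ring.
- case=> g' eg; have [|g2 [h2 [e1 e2 e3]]] := IH g' h ps'.
    apply: (mulfI p0'); rewrite mulrA -polyCM.
    have -> : p * (u * \prod_(q <- s) q) = u * (p * \prod_(q <- s) q) by ring.
    by rewrite e eg; ring.
  by exists g2, h2; split=> //; rewrite e2 eg mulrC mul_polyC size_scale.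
- case=> h' eh; have [|g2 [h2 [e1 e2 e3]]] := IH g h' ps'.
    apply: (mulfI p0'); rewrite mulrA -polyCM.
    have -> : p * (u * \prod_(q <- s) q) = u * (p * \prod_(q <- s) q) by ring.
    by rewrite e eh; ring.
  by exists g2, h2; split=> //; rewrite e3 eh mulrC mul_polyC size_scale.
Qed.

(** In the ideal generated by [f] and [g], a nonzero element of minimal degree
    divides both up to constants. *)
Lemma pseudo_gcd f g : f != 0 -> exists d a b : {poly R},
  [/\ d != 0, d = a * f + b * g,
      exists c q, c != 0 /\ c%:P * f = q * d &
      exists c q, c != 0 /\ c%:P * g = q * d].
Proof.
move=> f0.
pose P n := `[< exists d a b : {poly R}, [/\ d != 0, d = a * f + b * g & size d = n] >].
have exP : exists n, P n.
  by exists (size f); apply/asboolP; exists f, 1, 0; split=> //; rewrite mul1r mul0r addr0.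
have [n /asboolP[d [a [b [d0 ed sd]]]] mn] := ex_minnP exP.
have lc0 m : lead_coef d ^+ m != 0 by rewrite expf_neq0 // lead_coef_eq0.
have div x y : exists c q, c != 0 /\ c%:P * (x * f + y * g) = q * d.
  set w := x * f + y * g.
  exists (lead_coef d ^+ scalp w d), (w %/ d); split=> //.
  have := Pdiv.Idomain.divp_eq w d; rewrite mul_polyC => ->.
  suff -> : w %% d = 0 by rewrite addr0.
  apply: contrapT => /eqP r0.
  have := mn (size (w %% d)); rewrite leqNgt -sd Pdiv.Idomain.ltn_modp d0 => h.
  suff : false by []; apply: h; apply/asboolP.
  pose c := lead_coef d ^+ scalp w d.
  exists (w %% d), (c%:P * x - w %/ d * a), (c%:P * y - w %/ d * b).
  split=> //.
  have := Pdiv.Idomain.divp_eq w d; rewrite -/c -mul_polyC => e.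
  have -> : w %% d = c%:P * w - w %/ d * d by rewrite e; ring.
  by rewrite /w [in X in _ - _ * X]ed; ring.
exists d, a, b; split=> //.
- by have [c [q]] := div 1 0; rewrite mul1r mul0r addr0; exists c, q.
- by have [c [q]] := div 0 1; rewrite mul1r mul0r add0r; exists c, q.
Qed.

(** A pseudo-gcd [d] of [f] and [g] divides [f] up to a constant, so irreducibility leaves two
    cases: [d] has the degree of [f], and [f] divides [g]; or [d] is constant, and the Bezout
    identity multiplied by [h] makes [f] divide [h]. *)
Lemma primitive_irreducible_primel f : (1 < size f)%N -> primitive f ->
  (forall g h, f = g * h -> size g = 1%N \/ size h = 1%N) -> primel f.
Proof.
move=> sf pf irr.
have f0 : f != 0 by rewrite -size_poly_gt0; lia.
split=> //; first by rewrite poly_unitE; case: eqP => // e; move: sf; rewrite e.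
move=> g h [t et].
have [d [a [b [d0 ed [c [q [c0 ecq]]] [c' [q' [c'0 ecq']]]]]]] := pseudo_gcd g f0.
have [g1 [h1 [e1 sg1 sh1]]] := content_cancel c0 ecq.
have [s1|s1] := irr _ _ e1.
- left; have q0 : q = (q`_0)%:P by apply: size1_polyC; rewrite -sg1 s1.
  have q00 : q`_0 != 0 by rewrite -polyC_eq0 -q0 -size_poly_eq0 -sg1 s1.
  apply: (@primitive_cancel f g (q' * c%:P) (q`_0 * c')) => //.
    by rewrite mulf_neq0.
  by rewrite polyCM -q0 -mulrA ecq' mulrCA -ecq; ring.
- right; have d1 : d = (d`_0)%:P by apply: size1_polyC; rewrite -sh1 s1.
  have d00 : d`_0 != 0 by rewrite -polyC_eq0 -d1.
  apply: (@primitive_cancel f h (a * h + b * t) d`_0) => //.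
  by rewrite -d1 ed mulrDl -[b * g * h]mulrA et; ring.
Qed.

Lemma factorial_poly : factorial_ring {poly R}.
Proof.
have cat_fact (g h : {poly R}) : factored g -> factored h -> factored (g * h).
  case=> s [u [uu ps ->]] [t [v [vv pt ->]]]; exists (s ++ t), (u * v); split.
  - by rewrite unitrM uu.
  - by move=> p; rewrite mem_cat => /orP[/ps|/pt].
  - by rewrite big_cat /=; ring.
move=> f; have [n] := ubnP (size f); elim: n f => // n IHn f sfn f0.
have [sf1|sf1] := leqP (size f) 1.
  have ef : f = (f`_0)%:P by exact: size1_polyC.
  have [|s [u [uu ps e]]] := @fR f`_0; first by rewrite -polyC_eq0 -ef.
  exists (map polyC s), u%:P; split; first by rewrite rmorph_unit.
    by move=> p /mapP[q qs ->]; apply: primel_polyC; apply: ps.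
  by rewrite ef e polyCM rmorph_prod /= big_map.
have [|s [u [uu ps e]]] := @fR (lead_coef f); first by rewrite lead_coef_eq0.
(* Inner induction on the number of primes in the leading coefficient: a prime constant dividing [f]
   divides it too, so splitting that constant off removes one of them. A primitive reducible [f]
   splits into factors of smaller degree and falls under the outer induction. *)
have [m] := ubnP (size s); elim: m s u f uu ps e f0 sfn sf1 => // m IHm s u f uu ps e f0 sfn sf1 sm.
have [pf|/existsNP[p /not_implyP[pp /contrapT [f1 ef1]]]] := pselect (primitive f); last first.
  have p0 : p != 0 by case: pp.
  have p0' : p%:P != 0 by rewrite polyC_eq0.
  have f10 : f1 != 0 by apply: contraNneq f0 => z; rewrite ef1 z mul0r.
  have sf1f : size f = size f1 by rewrite ef1 mulrC mul_polyC size_scale.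
  have elc : lead_coef f = lead_coef f1 * p by rewrite ef1 lead_coefM lead_coefC.
  have [q qs [c eq]] : exists2 q, q \in s & dvd p q.
    apply: dvd_prod => //; exists (u^-1 * lead_coef f1); rewrite -mulrA -elc e mulrA mulVr // mul1r.
    by [].
  have [q0 qu qq] := ps _ qs.
  have cu : c \is a GRing.unit.
    have [] : dvd q c \/ dvd q p by apply: qq; exists 1; rewrite mul1r.
    - case=> d ec; case/negP: (let: And3 _ h _ := pp in h).
      apply/unitrPr; exists d; rewrite mulrC.
      by apply: (mulIf q0); rewrite mul1r -mulrA [p * q]mulrC mulrA -ec -eq.
    - case=> d ep; apply/unitrPr; exists d.
      by apply: (mulIf p0); rewrite mul1r [RHS]ep eq; ring.
  have := perm_to_rem qs => prm.
  have hf1 : factored f1.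
    apply: (IHm (rem q s) (u * c) f1); rewrite -?sf1f ?unitrM ?uu //.
    - by move=> r rs; apply: ps; apply: mem_rem rs.
    - apply: (mulIf p0); rewrite -elc e (perm_big _ prm) big_cons /=.
      by move: (\prod_(_ <- rem q s) _) => X; rewrite eq; ring.
    - by move: sm; rewrite size_rem //; case: (s) qs.
  rewrite ef1; apply: cat_fact => //; exists [:: p%:P], 1; split; first exact: unitr1.
    by move=> r; rewrite inE => /eqP ->; exact: primel_polyC.
  by rewrite big_seq1 mul1r.
have [/existsNP[g /existsNP[h /not_implyP[efgh /not_orP[g1 h1]]]]|nred] :=
    pselect (~ forall g h, f = g * h -> size g = 1%N \/ size h = 1%N); last first.
  exists [:: f], 1; split; first exact: unitr1.
    move=> p; rewrite inE => /eqP ->; apply: primitive_irreducible_primel => //.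
    exact: contrapT.
  by rewrite big_seq1 mul1r.
have gh0 : g * h != 0 by rewrite -efgh.
have [g0 h0] : g != 0 /\ h != 0 by move: gh0; rewrite mulf_eq0 negb_or => /andP.
have sgh : size f = (size g + size h).-1 by rewrite efgh size_mul.
have gp : (0 < size g)%N by rewrite size_poly_gt0.
have hp : (0 < size h)%N by rewrite size_poly_gt0.
by rewrite efgh; apply: cat_fact; apply: IHn => //; lia.
Qed.

End Poly.

Lemma factorial_can (R S : idomainType) (f : {rmorphism R -> S}) (g : {rmorphism S -> R}) :
  cancel f g -> cancel g f -> factorial_ring R -> factorial_ring S.
Proof.
move=> fK gK fR x x0.
have gx0 : g x != 0 by apply: contraNneq x0 => e; rewrite -(gK x) e rmorph0.
have [s [u [uu ps e]]] := fR _ gx0.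
exists (map f s), (f u); split; first exact: rmorph_unit.
- move=> _ /mapP[p pin ->]; have [p0 pu pp] := ps _ pin; split.
  + by apply: contraNneq p0 => z; rewrite -(fK p) z rmorph0.
  + by apply: contraNN pu => h; rewrite -(fK p) rmorph_unit.
  + move=> a b [c ec].
    have [] : dvd p (g a) \/ dvd p (g b).
      by apply: pp; exists (g c); rewrite -rmorphM ec rmorphM fK.
    * by case=> d ed; left; exists (f d); rewrite -rmorphM -ed gK.
    * by case=> d ed; right; exists (f d); rewrite -rmorphM -ed gK.
- by rewrite big_map -(gK x) e rmorphM rmorph_prod.
Qed.

Definition divides_relations (A : idomainType) (S : nzRingType) (th : {rmorphism A -> S}) x mu :=
  forall F : {poly A}, (map_poly th F).[x] = 0 -> dvd mu F.

(** The kernel of [A[s] -> Om] is principal. *)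
Lemma primitive_minpoly (A : idomainType) (Om : fieldType) (th : {rmorphism A -> Om}) (x : Om) :
  factorial_ring A -> injective th ->
  (exists2 F : {poly A}, F != 0 & (map_poly th F).[x] = 0) ->
  exists mu : {poly A}, [/\ mu != 0, (map_poly th mu).[x] = 0, (1 < size mu)%N
    & divides_relations th x mu].
Proof.
move=> fA ith exF.
pose P n := `[< exists F : {poly A}, [/\ F != 0, (map_poly th F).[x] = 0 & size F = n] >].
have exP : exists n, P n.
  by case: exF => F F0 rF; exists (size F); apply/asboolP; exists F.
have [n /asboolP[F [F0 rF sF]] mn] := ex_minnP exP.
have [s [u [uu ps e]]] := factorial_poly fA F0.
have sz1 (G : {poly A}) : G != 0 -> (map_poly th G).[x] = 0 -> (1 < size G)%N.
  move=> G0 rG; rewrite ltnNge; apply/negP => sG.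
  have eG : G = (G`_0)%:P by exact: size1_polyC.
  move: rG; rewrite eG map_polyC hornerC => z.
  have z0 : G`_0 = 0 by apply: ith; rewrite rmorph0.
  by move: G0; rewrite eG z0 polyC0 eqxx.
have [mu mus rmu] : exists2 mu, mu \in s & (map_poly th mu).[x] = 0.
  have : (map_poly th u).[x] * \prod_(p <- s) (map_poly th p).[x] = 0.
    by rewrite -rF e rmorphM hornerM rmorph_prod horner_prod.
  move/eqP; rewrite mulf_eq0 => /orP[/eqP ru|].
    have u0 : u != 0 by apply: contraTneq uu => ->; rewrite unitr0.
    by have := sz1 _ u0 ru; move: uu; rewrite poly_unitE => /andP[/eqP ->].
  by rewrite prodf_seq_eq0 => /hasP[p pin /= /eqP rp]; exists p.
have pmu := ps _ mus; have [mu0 muu mup] := pmu.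
have smu : size mu = n.
  apply/eqP; rewrite eqn_leq mn; last by apply/asboolP; exists mu.
  rewrite andbT -sF; move: F0; rewrite e (perm_big _ (perm_to_rem mus)) big_cons mulrCA mulf_eq0 negb_or.
  case/andP=> _ G0; rewrite size_mul //; move: G0; rewrite -size_poly_gt0.
  by move: (size _) (size _) => a b; lia.
exists mu; split=> //; first exact: sz1.
move=> G rG.
have lc0 : lead_coef mu != 0 by rewrite lead_coef_eq0.
pose c := lead_coef mu ^+ scalp G mu.
have := Pdiv.Idomain.divp_eq G mu; rewrite -/c -mul_polyC => eG.
have r0 : G %% mu = 0.
  apply: contrapT => /eqP r0.
  have := mn (size (G %% mu)); rewrite leqNgt -smu Pdiv.Idomain.ltn_modp mu0 => h.
  suff : false by []; apply: h; apply/asboolP; exists (G %% mu); split=> //.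
  have -> : G %% mu = c%:P * G - G %/ mu * mu by rewrite eG; ring.
  by rewrite rmorphB !rmorphM hornerD hornerN !hornerM rG rmu !mulr0 subrr.
rewrite r0 addr0 in eG.
have [] : dvd mu c%:P \/ dvd mu G by apply: mup; exists (G %/ mu).
- case=> d ed; have c0 : c%:P != 0 by rewrite polyC_eq0 expf_neq0.
  have d0 : d != 0 by apply: contraNneq c0 => z; rewrite ed z mul0r.
  have := sz1 _ mu0 rmu; have := f_equal (fun p : {poly A} => size p) ed.
  rewrite size_polyC -polyC_eq0 c0 size_mul //.
  have : (0 < size d)%N by rewrite size_poly_gt0.
  by rewrite /=; lia.
- by [].
Qed.

End FactorialRings.

(** * Valuation rings above a prime ideal, and integrality over a local ring *)

Section Specialization.
Variables (Om : fieldType) (A : comNzRingType) (th : {rmorphism A -> Om}) (P : set A).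
Hypotheses (P1 : ~ P 1) (PD : forall a b, P a -> P b -> P (a + b))
  (PM : forall a b, P a -> P (b * a)) (Pp : forall a b, P (a * b) -> P a \/ P b)
  (Pk : forall a, th a = 0 -> P a).

Let PB a b : P a -> P b -> P (a - b).
Proof. by move=> pa pb; apply: PD => //; rewrite -mulN1r; apply: PM. Qed.

Let P0 : P 0. Proof. by apply: Pk; rewrite rmorph0. Qed.

(** The image of [P] generates a proper ideal in the image of [A] because [P] contains the kernel,
    so Chevalley's theorem applies. Points are lifted along finite projections and along morphisms
    in this way. *)
Lemma valring_specialization :
  exists V, [/\ valring V, forall a, V (th a) & forall a, P a -> maxi V (th a)].
Proof.
pose I := [set y | exists2 a, P a & y = th a].
have sR : subring (range th).
  split=> [|_ _ [a _ <-] [b _ <-]|_ _ [a _ <-] [b _ <-]].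
  - by exists 1; rewrite ?rmorph1.
  - by exists (a - b); rewrite ?rmorphB.
  - by exists (a * b); rewrite ?rmorphM.
have [||V [vV RV IV]] := @valring_extension _ (range th) I sR.
- by move=> _ [a _ ->]; exists a.
- case=> m [a [b [ha hb e1]]].
  have [c pc ec] : I 1.
    rewrite e1; apply: (big_ind I) => [|_ _ [a' pa ->] [b' pb ->]|i _].
    - by exists 0; rewrite ?rmorph0.
    - by exists (a' + b'); rewrite ?rmorphD //; exact: PD.
    - have [[a' pa ->] [b' _ <-]] := (ha i, hb i).
      by exists (b' * a'); [exact: PM|rewrite rmorphM mulrC].
  have /Pk/PD/(_ pc) : th (1 - c) = 0 by rewrite rmorphB rmorph1 -ec subrr.
  by rewrite subrK.
by exists V; split=> // a => [|pa]; [apply: RV; exists a|apply: IV; exists a].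
Qed.

(** If [x] were not integral over the local ring at [P], then [P] and [x^-1] would generate a proper
    ideal after adjoining [x^-1], and a valuation ring above that ideal would exclude [x].
    Denominators are cleared in the conclusion: integrality over the local ring becomes a leading
    coefficient outside [P]. *)
Lemma integral_local (x : Om) :
  (forall V, valring V -> (forall a, V (th a)) -> (forall a, P a <-> maxi V (th a)) -> V x) ->
  exists F : {poly A}, ~ P (lead_coef F) /\ (map_poly th F).[x] = 0.
Proof.
move=> hV; have [x0|x0] := eqVneq x 0.
  by exists 'X; rewrite lead_coefX map_polyX hornerX.
apply: contrapT => nF.
pose ev (Q : {poly A}) := (map_poly th Q).[x^-1].
have evM Q1 Q2 : ev (Q1 * Q2) = ev Q1 * ev Q2 by rewrite /ev rmorphM hornerM.
have evD Q1 Q2 : ev (Q1 + Q2) = ev Q1 + ev Q2 by rewrite /ev rmorphD hornerD.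
have evB Q1 Q2 : ev (Q1 - Q2) = ev Q1 - ev Q2 by rewrite /ev rmorphB hornerD hornerN.
have evC a : ev a%:P = th a by rewrite /ev map_polyC hornerC.
have nPM a b : ~ P a -> ~ P b -> ~ P (a * b) by move=> na nb /Pp[].
have nP0 a : ~ P a -> th a != 0 by move=> na; apply/eqP => /Pk.
pose R := [set y | exists Q b, ~ P b /\ y * th b = ev Q].
pose I := [set y | exists (Q : {poly A}) b, [/\ ~ P b, P Q`_0 & y * th b = ev Q]].
have sR : subring R.
  split.
  - by exists 1, 1; rewrite rmorph1 mulr1 -polyC1 evC rmorph1.
  - move=> y z [Q [b [nb e]]] [Q' [b' [nb' e']]].
    exists (b'%:P * Q - b%:P * Q'), (b * b'); split; first exact: nPM.
    by rewrite rmorphM evB !evM !evC -e -e'; ring.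
  - move=> y z [Q [b [nb e]]] [Q' [b' [nb' e']]].
    exists (Q * Q'), (b * b'); split; first exact: nPM.
    by rewrite rmorphM evM -e -e'; ring.
have II (n : nat) (a b : 'I_n -> Om) : (forall i, I (a i)) -> (forall i, R (b i)) ->
    I (\sum_i a i * b i).
  move=> ha hb; apply: (big_ind I).
  - by exists 0, 1; rewrite coef0 mul0r -polyC0 evC rmorph0.
  - move=> y z [Q [c [nc pc e]]] [Q' [c' [nc' pc' e']]].
    exists (c'%:P * Q + c%:P * Q'), (c * c'); split; first exact: nPM.
      by rewrite coefD !coefCM; apply: PD; apply: PM.
    by rewrite rmorphM evD !evM !evC -e -e'; ring.
  - move=> i _; have [Q [c [nc pc e]]] := ha i; have [Q' [c' [nc' e']]] := hb i.
    exists (Q * Q'), (c * c'); split; first exact: nPM.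
      by rewrite coefM big_ord1 subnn mulrC; apply: PM.
    by rewrite rmorphM evM -e -e'; ring.
have IR : I `<=` R by move=> y [Q [b [nb _ e]]]; exists Q, b.
have I1 : ~ I 1.
  (* If 1 lay in the ideal, [G] would vanish at [x^-1] with a constant coefficient outside [P];
     reversing the coefficients of [G] gives the forbidden equation of [x]. *)
  case=> Q [b [nb pQ]]; rewrite mul1r => e; apply: nF.
  pose G := b%:P - Q; pose n := size G.
  have eG : ev G = 0 by rewrite evB evC e subrr.
  have G0 : ~ P G`_0.
    rewrite coefB coefC eqxx => h; apply: nb.
    by have := PD h pQ; rewrite subrK.
  pose F := \poly_(i < n.+1) G`_(n - i).
  have G00 : G`_0 != 0 by apply/eqP => z; apply: G0; rewrite z.
  exists F; split; first by rewrite lead_coef_poly // ?subnn.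
  have -> : (map_poly th F).[x] = x ^+ n * ev G; last by rewrite eG mulr0.
  rewrite (horner_map_wide _ _ (size_poly _ _)) /ev (horner_map_wide _ _ (leqnSn _)) -/n mulr_sumr.
  rewrite (reindex_inj rev_ord_inj) /=; apply: eq_bigr => i _; rewrite coef_poly.
  have ilt := ltn_ord i; rewrite subSS ltnS leq_subr subKn // mulrCA; congr (_ * _).
  have -> : x ^+ n = x ^+ (n - i) * x ^+ i by rewrite -exprD (subnK (ltnSE ilt)).
  by rewrite exprVn mulfK // expf_neq0.
have [V [vV RV IV]] : exists V, [/\ valring V, R `<=` V & forall x, I x -> maxi V x].
  apply: valring_extension => // -[n [a [b [ha hb e]]]]; apply: I1.
  by rewrite e; apply: II.
have Ix : I x^-1.
  by exists 'X, 1; split=> //; rewrite ?coefX // rmorph1 mulr1 /ev map_polyX hornerX.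
have Vx : ~ V x by case: (IV _ Ix) => [/eqP|]; rewrite ?invr_eq0 ?(negbTE x0) // invrK.
have Vth a : V (th a).
  by apply: RV; exists a%:P, 1; rewrite rmorph1 mulr1 evC.
apply: Vx; apply: hV => // a; split=> [pa|ma].
  by apply: IV; exists a%:P, 1; split=> //; rewrite ?coefC ?rmorph1 ?mulr1 ?evC.
apply: contrapT => na; apply: (unit_nmaxi (nP0 _ na) _ ma).
by apply: RV; exists 1, a; rewrite mulVf ?nP0 // -polyC1 evC rmorph1.
Qed.

End Specialization.

(** Gaussian elimination without fractions: the pivot column is cleared by cross-multiplication, so
    the coefficients stay in [R]. *)
Lemma linear_dependence (R : idomainType) (m n : nat) (C : 'I_n -> 'I_m -> R) :
  (m < n)%N -> exists c : 'I_n -> R, (exists i, c i != 0) /\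
    forall j, \sum_i c i * C i j = 0.
Proof.
elim: m n C => [|m IH] n C mn.
  exists (fun _ => 1); split; last by case.
  by exists (Ordinal mn); exact: oner_neq0.
have [z|/existsNP[i0 /eqP ne]] := pselect (forall i, C i ord0 = 0).
  have [|c [c0 hc]] := IH n (fun i j => C i (lift ord0 j)); first exact: ltnW.
  exists c; split=> // j; case: (unliftP ord0 j) => [j' ->|->]; first exact: hc.
  by apply: big1 => i _; rewrite z mulr0.
case: n C mn i0 ne => // n C mn i0 a0.
have [|c [[i ci] hc]] := IH n (fun i j => C i0 ord0 * C (lift i0 i) (lift ord0 j)
    - C (lift i0 i) ord0 * C i0 (lift ord0 j)); first by [].
pose d i := oapp (fun i' => C i0 ord0 * c i') (- \sum_i' c i' * C (lift i0 i') ord0) (unlift i0 i).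
have dl i' : d (lift i0 i') = C i0 ord0 * c i' by rewrite /d liftK.
have d0 : d i0 = - \sum_i' c i' * C (lift i0 i') ord0 by rewrite /d unlift_none.
have sumd (f : 'I_n.+1 -> R) : \sum_i d i * f i =
    \sum_i' c i' * (C i0 ord0 * f (lift i0 i') - C (lift i0 i') ord0 * f i0).
  rewrite (bigD1_ord i0) //= d0 mulNr mulr_suml.
  rewrite -sumrN -big_split /=; apply: eq_bigr => i' _; rewrite dl; ring.
exists d; split; first by exists (lift i0 i); rewrite dl mulf_neq0.
move=> j; rewrite sumd; case: (unliftP ord0 j) => [j' ->|->].
  by rewrite -[RHS](hc j'); apply: eq_bigr => i' _; ring.
by apply: big1 => i' _; ring.
Qed.

(** * Homogeneous polynomials *)

Import generic_quotient ring_quotient.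

Section PrimeQuotient.
Variables (R : comNzRingType) (I : set R).
Hypotheses (I1 : ~ I 1) (ID : forall a b, I a -> I b -> I (a + b))
  (IM : forall a b, I a -> I (b * a)) (I0 : I 0)
  (Ip : forall a b, I (a * b) -> I a \/ I b).

Let S : {pred R} := fun a => `[< I a >].

Let S_closed : idealr_closed S.
Proof.
split; [exact/asboolP|exact/asboolPn|].
move=> a u v /asboolW Iu /asboolW Iv; apply: asboolT.
by apply: ID => //; apply: IM.
Qed.

Let S_prime : prime_idealr_closed S.
Proof.
by move=> u v /asboolW /Ip[] h; apply/orP; [left|right]; apply: asboolT.
Qed.

(** The field is the fraction field of the quotient. The partial inverse that the hierarchy asks of
    an integral domain is chosen classically. *)
Lemma prime_quotient_field : exists (F : fieldType) (f : {rmorphism R -> F}),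
  forall a, f a = 0 <-> I a.
Proof.
pose mI := isIdealr.Build R S S_closed.
pose pI := isPrimeIdealrClosed.Build R S S_prime.
pose PI : PrimeIdealr.type R := HB.pack S mI pI.
pose D := {ideal_quot PI}.
pose inv (x : D) : D := xget x [set y : D | y * x = 1].
pose un : pred D := fun x => `[< exists y : D, y * x = 1 >].
have VP : {in un, left_inverse 1 inv *%R}.
  move=> x /asboolW[y hy]; rewrite /inv.
  by case: xgetP => [z _ hz|/(_ y) h] //; case: h.
have IP (x y : D) : y * x = 1 -> un x by move=> e; apply/asboolP; exists y.
have OP : {in [predC un], inv =1 id}.
  move=> x; rewrite !inE => /asboolPn nx; rewrite /inv; case: xgetP => // y _ hy.
  by case: nx; exists y.
pose mU := GRing.ComNzRing_hasMulInverse.Build D VP IP OP.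
pose U : comUnitRingType := HB.pack D mU.
pose mD := GRing.ComUnitRing_isIntegral.Build U (@Quotient.rquot_IdomainAxiom R PI).
pose E : idomainType := HB.pack U mD.
pose f : {rmorphism R -> E} := ((\pi_D)%qT : {rmorphism R -> D}).
exists {fraction E}, (@FracField.tofrac E \o f : {rmorphism _ -> _}) => a.
have h := Quotient.idealrBE PI a 0; rewrite subr0 in h.
have f0 : f 0 = 0 by exact: rmorph0.
have hf : (a \in PI) = (f a == f 0) by rewrite h.
split => /= [/eqP|Ia].
  rewrite tofrac_eq0 => e; apply: asboolW.
  by have : a \in PI by rewrite hf f0.
apply/eqP; rewrite tofrac_eq0; rewrite -[X in _ == X]f0 -hf.
exact: asboolT.
Qed.

End PrimeQuotient.

Notation mp n k := (mpoly n k).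
Notation mpX k i := (mpolyX k (mnm1 i)).
Notation hc d P := (pihomog mdeg d P).
Notation hom d P := (P \is @ishomog1 _ _ d mdeg).
Notation wid := (widen_ord (leqnSn _)).
Notation tcomp F P := (comp_mpoly [tuple F i | i < _] P).

Section MpolyBasics.

Lemma mp_rmorph_ext n (k S : comNzRingType) (f g : {rmorphism mp n k -> S}) :
  (forall c, f (mpolyC n c) = g (mpolyC n c)) ->
  (forall i, f (mpX k i) = g (mpX k i)) -> f =1 g.
Proof.
move=> hC hX P; rewrite (mpolyE P) !rmorph_sum; apply: eq_bigr => m _.
rewrite -mul_mpolyC !rmorphM hC; congr (_ * _).
rewrite mpolyXE_id !rmorph_prod; apply: eq_bigr => i _.
by rewrite !rmorphXn hX.
Qed.

Lemma mmap_var n (k S : comNzRingType) (io : {rmorphism k -> S}) (x : 'I_n -> S) i :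
  mmap io x (mpX k i) = x i.
Proof. by rewrite mmapX mmap1U. Qed.

Lemma mmap_ext n (k S : comNzRingType) (io : {rmorphism k -> S}) (x y : 'I_n -> S) :
  x =1 y -> mmap io x =1 mmap io y.
Proof.
move=> e; apply: (mp_rmorph_ext (f := mmap io x) (g := mmap io y)) => [c|i] /=.
  by rewrite !mmapC.
by rewrite !mmap_var.
Qed.

Lemma mmap_rmorph n (k S S' : comNzRingType) (io : {rmorphism k -> S}) (f : {rmorphism S -> S'})
    (x : 'I_n -> S) P :
  f (mmap io x P) = mmap (f \o io) (f \o x) P.
Proof.
apply: (mp_rmorph_ext (f := f \o mmap io x) (g := mmap (f \o io) (f \o x))).
  by move=> c; rewrite /= !mmapC.
by move=> i /=; rewrite !mmap_var.
Qed.

Lemma mmap_comp n m (k S : comNzRingType) (io : {rmorphism k -> S}) (x : 'I_n -> S)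
    (lq : m.-tuple (mp n k)) P :
  mmap io x (comp_mpoly lq P) =
  mmap io (fun i => mmap io x (tnth lq i)) P.
Proof.
rewrite /comp_mpoly mmap_rmorph; apply: (mp_rmorph_ext
  (f := mmap (mmap io x \o @mpolyC n k) (mmap io x \o tnth lq))
  (g := mmap io (fun i => mmap io x (tnth lq i)))).
  by move=> c /=; rewrite !mmapC /= mmapC.
by move=> i /=; rewrite !mmap_var.
Qed.

Lemma ord_lift_max c (j : 'I_c) : lift ord_max j = wid j.
Proof. by apply: val_inj; rewrite /= /bump leqNgt ltn_ord add0n. Qed.

Lemma muni_var n (k : comNzRingType) (i : 'I_n.+1) : muni (mpX k i) =
  if unlift ord_max i is Some j then (mpX k j)%:P else 'X.
Proof.
rewrite muniE msuppX big_seq1 mcoeffX eqxx scale1r.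
case: unliftP => [j ->|->].
  rewrite ord_lift_max mnm1E -(inj_eq val_inj) /= eqn_leq [(n <= j)%N]leqNgt ltn_ord andbF expr0.
  rewrite -mul_polyC mulr1; congr (mpolyX _ _)%:P; apply/mnmP => l.
  by rewrite mnmE !mnm1E -!(inj_eq val_inj).
rewrite mnm1E eqxx expr1.
suff -> : Multinom [tuple (mnm1 (@ord_max n)) (wid i) | i < n] = mnm0 by rewrite mpolyX0 scale1r.
by apply/mnmP => l; rewrite mnmE mnm1E mnm0E -(inj_eq val_inj) /= eq_sym (ltn_eqF (ltn_ord l)).
Qed.

Lemma mmap_muni n (k S : comNzRingType) (io : {rmorphism k -> S}) (x : 'I_n.+1 -> S) P :
  mmap io x P =
  (map_poly (mmap io (x \o wid)) (muni P)).[x ord_max].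
Proof.
apply: (mp_rmorph_ext (f := mmap io x)
  (g := horner_eval (x ord_max) \o (map_poly (mmap io (x \o wid)) \o @muni n k))).
  by move=> c /=; rewrite muniC map_polyC /horner_eval hornerC /= !mmapC.
move=> i /=; rewrite muni_var mmap_var /horner_eval; case: unliftP => [j ->|->].
  by rewrite map_polyC hornerC /= mmap_var /= ord_lift_max.
by rewrite map_polyX hornerX.
Qed.

Lemma mwiden_var n (k : comNzRingType) (i : 'I_n) : mwiden (mpX k i) = mpX k (wid i).
Proof. by rewrite mwidenX mnmwiden1. Qed.

Lemma muniK (k : comNzRingType) n :
  cancel (@muni n k) (horner_eval (mpX k ord_max) \o map_poly (@mwiden n k)).
Proof.
move=> P; apply: (mp_rmorph_ext
  (f := horner_eval (mpX k ord_max) \o map_poly (@mwiden n k) \o @muni n k) (g := idfun)).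
  by move=> c; rewrite /= muniC /horner_eval map_polyC hornerC /= mwidenC.
move=> i; rewrite /= muni_var /horner_eval; case: unliftP => [j ->|->].
  by rewrite map_polyC hornerC /= mwiden_var ord_lift_max.
by rewrite map_polyX hornerX.
Qed.

Lemma muni_eq0 (k : comNzRingType) n (P : mp n.+1 k) : (muni P == 0) = (P == 0).
Proof.
apply/eqP/eqP => [e|->]; last by rewrite rmorph0.
by rewrite -(muniK P) e /= rmorph0 /horner_eval horner0.
Qed.

Lemma factorial_mpoly (k : fieldType) n : factorial_ring (mp n k).
Proof.
elim: n => [|n IH].
  move=> x x0; exists [::], x; split=> //; last by rewrite big_nil mulr1.
  have e := nvar0_mpolyC x; rewrite e rmorph_unit // unitfE.
  by apply: contraNneq x0 => z; rewrite e z mpolyC0.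
pose g : {rmorphism mp n.+1 k -> {poly mp n k}} := @muni n k.
pose f : {rmorphism {poly mp n k} -> mp n.+1 k} :=
  horner_eval (mpX k ord_max) \o map_poly (@mwiden n k).
apply: (factorial_can (f := f) (g := g)); last exact: factorial_poly.
  move=> p; rewrite /g /f /= /horner_eval.
  elim/poly_ind: p => [|p c IHp]; first by rewrite !(rmorph0, horner0).
  rewrite rmorphD rmorphM /= map_polyX map_polyC hornerD hornerM hornerX hornerC.
  rewrite rmorphD rmorphM /= IHp muni_var unlift_none; congr (_ + _).
  apply: (mp_rmorph_ext (f := @muni n k \o @mwiden n k) (g := polyC)).
    by move=> a /=; rewrite mwidenC muniC.
  by move=> i /=; rewrite mwiden_var muni_var -ord_lift_max liftK.
exact: muniK.
Qed.

Lemma closed_nonroot (k : closedFieldType) (p : {poly k}) : p != 0 -> exists x, p.[x] != 0.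
Proof. by move/closed_nonrootP. Qed.

Lemma mpoly_nonroot (k : closedFieldType) n (P : mp n k) : P != 0 ->
  exists v : 'I_n -> k, meval v P != 0.
Proof.
elim: n P => [|n IH] P P0.
  exists (fun _ => 0); rewrite (nvar0_mpolyC P) mevalC.
  by apply: contraNneq P0 => z; rewrite (nvar0_mpolyC P) z mpolyC0.
have lP : lead_coef (muni P) != 0 by rewrite lead_coef_eq0 muni_eq0.
have [v hv] := IH _ lP.
pose Q := map_poly (meval v) (muni P).
have [|c hc] := @closed_nonroot k Q.
  apply: contraNneq hv => /polyP/(_ (size (muni P)).-1).
  by rewrite coef_map coef0 lead_coefE => ->.
exists (fun i => if unlift ord_max i is Some j then v j else c).
rewrite /meval mmap_muni unlift_none; congr (_.[_] != 0): hc.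
by rewrite /Q; apply: eq_map_poly => R; apply: mmap_ext => i /=; rewrite -ord_lift_max liftK.
Qed.

Lemma dhomog_scale n (k S : comNzRingType) (io : {rmorphism k -> S}) (x : 'I_n -> S) (c : S) d
    (P : mp n k) : hom d P ->
  mmap io (fun i => c * x i) P = c ^+ d * mmap io x P.
Proof.
move=> hP; rewrite /mmap mulr_sumr big_seq [RHS]big_seq; apply: eq_bigr => m mP.
rewrite mulrCA; congr (_ * _); rewrite /mmap1.
have <- := dhomog_mf hP mP.
set e := (X in c ^+ X); have -> : e = (\sum_i m i)%N by exact: mdegE.
rewrite expr_sum -big_split /=; apply: eq_bigr => i _.
by rewrite exprMn.
Qed.

Lemma hom_decomp n (k : comNzRingType) (P : mp n k) :
  P = \sum_(d < mmeasure mdeg P) hc d P.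
Proof. by rewrite {1}(pihomog_partitionE (leqnn (mmeasure mdeg P))). Qed.

Lemma hc_hom n (k : comNzRingType) d (P : mp n k) : hom d (hc d P).
Proof. exact: pihomogP. Qed.

Lemma hom_hc n (k : comNzRingType) d e (P : mp n k) : hom d P ->
  hc e P = if e == d then P else 0.
Proof.
move=> hP; case: eqVneq => [->|ne]; first exact: pihomog_dE.
rewrite pihomogE big_seq_cond big_pred0 // => m; apply/negP => /andP[mP /eqP e1].
by move: ne; rewrite -e1 (dhomog_mf hP mP) eqxx.
Qed.

Lemma hc_big n (k : comNzRingType) d (P : mp n k) : (mmeasure mdeg P <= d)%N -> hc d P = 0.
Proof.
move=> le; rewrite pihomogE big_seq_cond big_pred0 // => m; apply/negP => /andP[mQ /eqP e1].
by have := mmeasure_mnm_lt mdeg mQ; rewrite e1 ltnNge le.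
Qed.

Lemma hc_neq0 n (k : comNzRingType) (P : mp n k) : P != 0 -> exists d, hc d P != 0.
Proof.
move=> P0; apply: contrapT => /forallNP h; case/eqP: P0; rewrite (hom_decomp P) big1 // => d _.
by apply: contrapT => /eqP; exact: h.
Qed.

Lemma hom1X n (k : comNzRingType) d (P : mp n k) : hom 1%N P -> hom d (P ^+ d).
Proof. by rewrite -[X in hom X (_ ^+ _)]mul1n; exact: dhomogMn. Qed.

Lemma hcM n (k : comNzRingType) d e (P Q : mp n k) : hom d P ->
  hc (d + e) (P * Q) = P * hc e Q.
Proof.
move=> hP; rewrite {1}(hom_decomp Q) mulr_sumr raddf_sum /=.
have step i : hc (d + e) (P * hc i Q) = if i == e then P * hc e Q else 0.
  rewrite (hom_hc _ (dhomogM hP (hc_hom i Q))) eqn_add2l eq_sym.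
  by case: eqP => [->|].
under eq_bigr do rewrite step.
have [el|el] := ltnP e (mmeasure mdeg Q).
  rewrite (bigD1 (Ordinal el)) //= eqxx big1 ?addr0 // => i; rewrite -(inj_eq val_inj) /=.
  by move/negbTE ->.
rewrite big1 => [|i _]; last by case: eqP => // ei; have := ltn_ord i; rewrite ei ltnNge el.
by rewrite hc_big ?mulr0.
Qed.

End MpolyBasics.

(** * Finite linear projections *)

Section Residues.
Variables (k : closedFieldType) (Om : fieldType) (io : {rmorphism k -> Om}).
Implicit Types V : set Om.

Definition overk V := forall c, V (io c).

Definition resk V y := exists c, maxi V (y - io c).

Variables (V : set Om) (vV : valring V) (kV : overk V).
Let sV : subring V. Proof. by case: vV. Qed.

Lemma maxi_const c : maxi V (io c) -> c = 0.
Proof.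
case=> [/eqP|nc]; first by rewrite fmorph_eq0 => /eqP.
by case: nc; rewrite -fmorphV; apply: kV.
Qed.

Lemma resk_sub y : resk V y -> V y.
Proof.
by case=> c m; rewrite -(subrK (io c) y); apply: subringD => //; apply: (maxi_sub vV).
Qed.

Lemma resk_const c : resk V (io c).
Proof. by exists c; rewrite subrr; left. Qed.

Lemma reskD y z : resk V y -> resk V z -> resk V (y + z).
Proof.
case=> c hc [d hd]; exists (c + d); rewrite rmorphD.
have -> : y + z - (io c + io d) = (y - io c) + (z - io d) by ring.
exact: (maxiD vV).
Qed.

Lemma reskM y z : resk V y -> resk V z -> resk V (y * z).
Proof.
move=> ry rz; have Vy := resk_sub ry; case: ry rz => c hc [d hd]; exists (c * d); rewrite rmorphM.
have -> : y * z - io c * io d = y * (z - io d) + (y - io c) * io d by ring.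
by apply: (maxiD vV); [apply: (maxiM vV)|apply: (maxiMl vV)].
Qed.

Lemma mmap_maxi n (t : 'I_n -> Om) (c : 'I_n -> k) P : (forall j, maxi V (t j - io (c j))) ->
  maxi V (mmap io t P - io (meval c P)).
Proof.
move=> ht.
have Vt j : V (t j) by apply: resk_sub; exists (c j).
suff [] : V (mmap io t P) /\ maxi V (mmap io t P - io (meval c P)) by [].
have K1 : V 1 /\ maxi V (1 - io 1) by rewrite rmorph1 subrr; split; [exact: subring1|left].
have KM y d z f : V y /\ maxi V (y - io d) -> V z /\ maxi V (z - io f) ->
    V (y * z) /\ maxi V (y * z - io (d * f)).
  case=> Vy m [Vz m']; split; first exact: subringM.
  have -> : y * z - io (d * f) = y * (z - io f) + (y - io d) * io f by rewrite rmorphM; ring.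
  by apply: (maxiD vV); [apply: (maxiM vV)|apply: (maxiMl vV)].
rewrite /meval /mmap.
apply: (big_ind2 (fun y d => V y /\ maxi V (y - io d))) => [||m _].
- by rewrite rmorph0 subrr; split; [exact: subring0|left].
- move=> y d z f [Vy m] [Vz m']; split; first exact: subringD.
  have -> : y + z - io (d + f) = (y - io d) + (z - io f) by rewrite rmorphD; ring.
  exact: (maxiD vV).
apply: (KM); first by rewrite subrr; split; [exact: kV|left].
rewrite /mmap1; apply: (big_ind2 (fun y d => V y /\ maxi V (y - io d))) => [||i _].
- exact: K1.
- by move=> ? ? ? ?; exact: (KM).
by elim: (m i) => [|e IH]; rewrite ?expr0 // !exprS; apply: (KM).
Qed.

Lemma resk_mmap n (t : 'I_n -> Om) P : (forall j, resk V (t j)) -> resk V (mmap io t P).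
Proof. by move=> /choice[c hc]; exists (meval c P); exact: mmap_maxi. Qed.

Lemma V_mmap n (t : 'I_n -> Om) P : (forall j, V (t j)) -> V (mmap io t P).
Proof.
move=> ht; rewrite /mmap; apply: subring_sum => // m _; apply: subringM => //.
rewrite /mmap1; apply: (big_ind V) => [||i _]; first exact: subring1.
  by move=> ? ?; exact: subringM.
exact: subringX.
Qed.

(** Modulo the maximal ideal the equation has coefficients in the algebraically closed [k], hence
    splits; one of its linear factors at [y] must be a nonunit. *)
Lemma resk_integral (p : {poly Om}) y :
  p \is monic -> (forall i, resk V p`_i) -> p.[y] = 0 -> resk V y.
Proof.
move=> mp hp py.
have Vy : V y by apply: (valring_integral vV mp) => // i; exact: resk_sub.
have /choice[c hc] := hp.
case sp : (size p) => [|n].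
  move/eqP: sp; rewrite size_poly_eq0 => /eqP p0.
  by move: mp; rewrite p0 monicE lead_coef0 eq_sym oner_eq0.
have lp : p`_n = 1 by move/monicP: mp; rewrite lead_coefE sp.
have cn : c n = 1.
  have := hc n; rewrite lp => h; apply/eqP; rewrite eq_sym -subr_eq0; apply/eqP.
  by apply: maxi_const; rewrite rmorphB rmorph1.
pose C := \poly_(i < n.+1) c i.
have sC : size C = n.+1 by rewrite size_poly_eq // cn oner_neq0.
have C0 : C != 0 by rewrite -size_poly_eq0 sC.
have mC : maxi V (map_poly io C).[y].
  rewrite -[X in maxi V X]subr0 -py (horner_coef_wide _ (n := n.+1)); last by rewrite size_map_poly sC.
  rewrite horner_coef sp -sumrB; apply: (maxi_sum vV) => i _.
  rewrite -mulrBl coef_map coef_poly ltn_ord; apply: (maxiMl vV); last exact: subringX.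
  by rewrite -opprB; apply: (maxiN vV).
have [r er] := closed_field_poly_normal C.
have lC : lead_coef C = 1 by rewrite lead_coef_poly // cn // oner_neq0.
move: mC; rewrite er lC scale1r rmorph_prod horner_prod /=.
elim: r {er} => [|z r IH]; first by rewrite big_nil => /maxi1; case.
rewrite big_cons /= rmorphB /= map_polyX map_polyC /= hornerXsubC => /(maxi_prime vV)[||h|].
- by apply: subringB.
- apply: (big_ind V) => [||w _]; first exact: subring1.
    by move=> ? ?; exact: subringM.
  by rewrite rmorphB /= map_polyX map_polyC /= hornerXsubC; apply: subringB.
- by exists z.
- exact: IH.
Qed.

End Residues.

Section LinearForms.

Definition lin (k : closedFieldType) (S : comNzRingType) (io : {rmorphism k -> S}) n c
  (M : 'I_n -> 'I_c -> k) (x : 'I_n -> S) : 'I_c -> S := fun j => \sum_i io (M i j) * x i.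

Definition linf (k : closedFieldType) n c (M : 'I_n -> 'I_c -> k) (j : 'I_c) : mp n k :=
  \sum_i M i j *: mpX k i.

Definition lincomp (k : closedFieldType) n c (M : 'I_n -> 'I_c -> k) (P : mp c k) : mp n k :=
  comp_mpoly [tuple linf M j | j < c] P.

Variables (k : closedFieldType) (S : comNzRingType) (io : {rmorphism k -> S}).

Lemma mmap_linf n c (M : 'I_n -> 'I_c -> k) (x : 'I_n -> S) j :
  mmap io x (linf M j) = lin io M x j.
Proof.
rewrite /linf raddf_sum; apply: eq_bigr => i _ /=.
by rewrite mmapZ mmap_var.
Qed.

Lemma mmap_lincomp n c (M : 'I_n -> 'I_c -> k) (x : 'I_n -> S) P :
  mmap io x (lincomp M P) = mmap io (lin io M x) P.
Proof. by rewrite /lincomp mmap_comp; apply: mmap_ext => j; rewrite tnth_mktuple mmap_linf. Qed.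

Lemma comp_hom n c e d (L : c.-tuple (mp n k)) (P : mp c k) :
  (forall j, hom e (tnth L j)) -> hom d P -> hom (e * d) (comp_mpoly L P).
Proof.
move=> hL hP; rewrite comp_mpolyEX big_seq rpred_sum // => m mP.
apply: dhomogZ; rewrite comp_mpolyX.
have := dhomog_mf hP mP; set D := (X in X = d); have -> : D = (\sum_i m i)%N by exact: mdegE.
move=> <-; rewrite big_distrr /=.
apply: (big_ind2 (fun p e' => hom e' p)).
- exact: dhomog1.
- by move=> ? ? ? ?; exact: dhomogM.
- by move=> j _; apply: dhomogMn.
Qed.

Lemma linf_hom n c (M : 'I_n -> 'I_c -> k) j : hom 1%N (linf M j).
Proof.
rewrite /linf rpred_sum // => i _; apply: dhomogZ.
by rewrite dhomogX; apply/eqP; exact: mdeg1.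
Qed.

Lemma lincomp_hom n c d (M : 'I_n -> 'I_c -> k) (P : mp c k) : hom d P -> hom d (lincomp M P).
Proof.
by move=> hP; rewrite -[d]mul1n; apply: comp_hom => // j; rewrite tnth_mktuple linf_hom.
Qed.

Lemma hc_comp n c e d (L : c.-tuple (mp n k)) (P : mp c k) : (0 < e)%N ->
  (forall j, hom e (tnth L j)) ->
  hc (e * d) (comp_mpoly L P) = comp_mpoly L (hc d P).
Proof.
move=> e0 hL; rewrite {1}(hom_decomp P) (raddf_sum (comp_mpoly L)) raddf_sum /=.
under eq_bigr => i _ do rewrite (hom_hc _ (comp_hom hL (hc_hom i P))) eqn_pmul2l //.
have [el|el] := ltnP d (mmeasure mdeg P).
  rewrite (bigD1 (Ordinal el)) //= eqxx big1 ?addr0 // => i; rewrite -(inj_eq val_inj) /= eq_sym.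
  by move/negbTE ->.
rewrite big1 => [|i _]; last by case: eqP => // ei; have := ltn_ord i; rewrite -ei ltnNge el.
by rewrite hc_big ?rmorph0.
Qed.

End LinearForms.

Section Graded.
Variables (k : closedFieldType) (Om : fieldType) (io : {rmorphism k -> Om}).

(** A point whose ideal is homogeneous, i.e. a generic point of a cone. *)
Definition graded n (x : 'I_n -> Om) := forall P, mmap io x P = 0 ->
  forall d, mmap io x (hc d P) = 0.

Lemma graded_comp n c e (L : c.-tuple (mp n k)) (x : 'I_n -> Om) : (0 < e)%N ->
  (forall j, hom e (tnth L j)) -> graded x ->
  graded (fun j => mmap io x (tnth L j)).
Proof.
move=> e0 hL gx P; rewrite -mmap_comp => h d; rewrite -mmap_comp -(hc_comp d P e0 hL).
exact: gx.
Qed.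

Lemma graded_ext n (x y : 'I_n -> Om) : x =1 y -> graded x -> graded y.
Proof. by move=> e gx P; rewrite -!(mmap_ext io e) => h d; rewrite -(mmap_ext io e); apply: gx. Qed.

Lemma graded_lin n c (M : 'I_n -> 'I_c -> k) (x : 'I_n -> Om) : graded x -> graded (lin io M x).
Proof.
move=> gx; apply: (@graded_ext _ (fun j => mmap io x (tnth [tuple linf M j | j < c] j))).
  by move=> j; rewrite tnth_mktuple mmap_linf.
by apply: (@graded_comp _ _ 1%N) => // j; rewrite tnth_mktuple linf_hom.
Qed.

End Graded.

(** The guard is needed because subtraction truncates: for [l > D] the only form of negative degree
    is zero, whereas [D - l] would allow constants. *)
Definition homm (k : nzRingType) n (D l : nat) (a : mp n k) :=
  if (l <= D)%N then is_true (hom (D - l)%N a) else a = 0.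

Section Homm.
Variables (k : comNzRingType) (n : nat).
Implicit Types a b : mp n k.

Lemma homm0 D l : homm D l (0 : mp n k).
Proof. by rewrite /homm; case: ifP => // _; exact: dhomog0. Qed.

Lemma hommD D l a b : homm D l a -> homm D l b -> homm D l (a + b).
Proof. by rewrite /homm; case: ifP => _; [exact: rpredD|move=> -> ->; rewrite addr0]. Qed.

Lemma hommM D D' l l' a b : homm D l a -> homm D' l' b -> homm (D + D') (l + l') (a * b).
Proof.
rewrite {1 2}/homm; case: ifP => h; last by move=> -> _; rewrite mul0r; exact: homm0.
case: ifP => h'; last by move=> _ ->; rewrite mulr0; exact: homm0.
move=> ha hb; rewrite /homm; have -> : (l + l' <= D + D')%N by lia.
have -> : (D + D' - (l + l') = (D - l) + (D' - l'))%N by lia.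
exact: dhomogM.
Qed.

Lemma homm_sum D l (T : Type) (s : seq T) (P : pred T) (f : T -> mp n k) :
  (forall i, P i -> homm D l (f i)) -> homm D l (\sum_(i <- s | P i) f i).
Proof. by move=> h; apply: (big_ind (homm D l)) => //; [exact: homm0|exact: hommD]. Qed.

(** Homogeneity of total degree [D], the outer variable having weight 1. *)
Definition bihom D (Q : {poly mp n k}) := forall l, homm D l Q`_l.

Lemma bihomD D Q R : bihom D Q -> bihom D R -> bihom D (Q + R).
Proof. by move=> hQ hR l; rewrite coefD; apply: hommD. Qed.

Lemma bihomM D E Q R : bihom D Q -> bihom E R -> bihom (D + E) (Q * R).
Proof.
move=> hQ hR l; rewrite coefM; apply: homm_sum => i _.
by have := hommM (hQ i) (hR (l - i)%N); rewrite subnKC // -ltnS.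
Qed.

Lemma bihom0 D : bihom D 0.
Proof. by move=> l; rewrite coef0; exact: homm0. Qed.

Lemma bihomC D a : hom D a -> bihom D a%:P.
Proof. by move=> h [|l]; rewrite coefC /=; [rewrite /homm leq0n subn0|exact: homm0]. Qed.

Lemma bihomX : bihom 1 'X.
Proof.
move=> l; rewrite coefX; case: eqP => [->|_]; last exact: homm0.
by rewrite /homm leqnn subnn; exact: dhomog1.
Qed.

Lemma bihomXn D e Q : bihom D Q -> bihom (e * D) (Q ^+ e).
Proof.
move=> h; elim: e => [|e IH]; last by rewrite exprS mulSn; apply: bihomM.
by rewrite expr0 mul0n -polyC1; apply: bihomC; exact: dhomog1.
Qed.

Lemma bihom_size D Q : bihom D Q -> (size Q <= D.+1)%N.
Proof.
move=> h; apply/leq_sizeP => l hl; have := h l.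
by rewrite /homm leqNgt hl.
Qed.

End Homm.

Section Projection.
Variables (k : closedFieldType) (Om : fieldType) (io : {rmorphism k -> Om}) (c : nat).
Variable o : 'I_c.+1 -> k.
Hypothesis o1 : o ord_max = 1.

(** Projection from the point [o]: the old coordinates in terms of the new ones
    and of the last old one. *)
Let sv (j : 'I_c.+1) : {poly mp c k} :=
  if unlift ord_max j is Some j' then (mpX k j')%:P + (mpolyC c (o j))%:P * 'X else 'X.

Definition psubst (P : mp c.+1 k) : {poly mp c k} :=
  mmap (polyC \o @mpolyC c k) sv P.

Let sv_bihom j : bihom 1 (sv j).
Proof.
rewrite /sv; case: unliftP => [j' _|_]; last exact: bihomX.
apply: bihomD; first by apply: bihomC; rewrite dhomogX; apply/eqP; exact: mdeg1.
rewrite -[1%N]add0n; apply: bihomM; last exact: bihomX.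
by apply: bihomC; rewrite -[mpolyC _ _]mulr1 mul_mpolyC; apply: dhomogZ; exact: dhomog1.
Qed.

Lemma psubst_bihom D P : hom D P -> bihom D (psubst P).
Proof.
move=> hP; rewrite /psubst /mmap big_seq.
apply: (big_ind (bihom D)); first exact: bihom0; first exact: bihomD.
move=> m mP; rewrite -[D]add0n; apply: bihomM.
  by apply: bihomC => /=; rewrite -[mpolyC _ _]mulr1 mul_mpolyC; apply: dhomogZ; exact: dhomog1.
have := dhomog_mf hP mP; set d := (X in X = D); have -> : d = (\sum_i m i)%N by exact: mdegE.
move=> <-; rewrite /mmap1.
apply: (big_ind2 (fun p e' => bihom e' p)).
- by rewrite -polyC1; apply: bihomC; exact: dhomog1.
- by move=> ? ? ? ?; exact: bihomM.
- by move=> j _; rewrite -[X in bihom X]muln1; apply: bihomXn.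
Qed.

Lemma psubst_eval (t : 'I_c.+1 -> Om) (t' : 'I_c -> Om) P :
  (forall j, t' j = t (wid j) - io (o (wid j)) * t ord_max) ->
  (map_poly (mmap io t') (psubst P)).[t ord_max] = mmap io t P.
Proof.
move=> ht; apply: (mp_rmorph_ext (f := horner_eval (t ord_max) \o map_poly (mmap io t') \o
   mmap (polyC \o @mpolyC c k) sv) (g := mmap io t)).
  by move=> a /=; rewrite /horner_eval !mmapC /= map_polyC hornerC /= mmapC.
move=> j /=; rewrite /horner_eval !mmap_var /sv; case: unliftP => [j' ->|->].
  rewrite rmorphD rmorphM /= !map_polyC map_polyX hornerD hornerM !hornerC hornerX /=.
  rewrite mmap_var mmapC ht.
  by rewrite ord_lift_max subrK.
by rewrite map_polyX hornerX.
Qed.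

(** Setting the new coordinates to 0 leaves the restriction of [P] to the line through the center,
    which is [P(o)] times the [e]-th power of the variable. A center off the hypersurface thus makes
    the equation monic in the last coordinate. *)
Lemma psubst_lead e P : hom e P -> (psubst P)`_e = mpolyC c (meval o P).
Proof.
move=> hP; have := psubst_bihom hP e; rewrite /homm leqnn subnn.
set a := (psubst P)`_e => ha.
have ea : a = mpolyC c (meval (fun=> 0) a).
  apply/mpolyP => m; rewrite mcoeffC.
  have [->|m0] := eqVneq m (mnm0); last first.
    rewrite mulr0; apply: (dhomog_nemf_coeff ha).
    by apply: contraNneq m0 => h; rewrite -mdeg_eq0; apply/eqP.
  rewrite mulr1 {1}[a]mpolyE.
  have hm m' : m' \in msupp a -> m' = mnm0.
    by move=> h; apply/eqP; rewrite -mdeg_eq0; apply/eqP; exact: (dhomog_mf ha h).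
  rewrite /meval /mmap raddf_sum /= big_seq [RHS]big_seq.
  apply: eq_bigr => m' /hm ->; rewrite mcoeffZ mcoeffX eqxx.
  by rewrite /mmap1 big1 // => i _; rewrite mnm0E expr0.
rewrite ea; congr (mpolyC _ _).
pose h := map_poly (meval (fun=> 0 : k)) (psubst P).
have eh : h = meval o P *: 'X^e.
  transitivity (mmap polyC (fun j => 'X * (o j)%:P) P).
    apply: (mp_rmorph_ext (f := map_poly (meval (fun=> 0 : k)) \o
      mmap (polyC \o @mpolyC c k) sv)
      (g := mmap polyC (fun j => 'X * (o j)%:P))).
      by move=> b /=; rewrite !mmapC /= map_polyC /= mevalC.
    move=> j /=; rewrite !mmap_var /sv; case: unliftP => [j' ->|->].
      by rewrite rmorphD rmorphM /= !map_polyC map_polyX /= mevalXU mevalC add0r mulrC.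
    by rewrite map_polyX o1 mulr1.
  rewrite (dhomog_scale _ _ _ hP) mulrC -mul_polyC; congr (_ * _).
  rewrite [RHS](mmap_rmorph _ polyC); apply: (mp_rmorph_ext
    (f := mmap polyC (fun j => (o j)%:P)) (g := mmap (polyC \o idfun) (polyC \o o))).
    by move=> b /=; rewrite !mmapC.
  by move=> j /=; rewrite !mmap_var.
by have := f_equal (fun p : {poly k} => p`_e) eh; rewrite coef_map coefZ coefXn eqxx mulr1.
Qed.

End Projection.

Section FiniteProjection.
Variables (k : closedFieldType) (Om : fieldType) (io : {rmorphism k -> Om}) (n : nat).
Variable x : 'I_n -> Om.
Notation ev := (mmap io x).

Definition zeros (z : 'I_n -> k) := forall P, ev P = 0 -> meval z P = 0.

(** The linear projection [M] is finite on the locus of [x]; the forms [g] span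
    the coordinate ring of the source over that of the target. *)
Record finlin c (M : 'I_n -> 'I_c -> k) (I : finType) (dg : I -> nat) (g : I -> mp n k) := Finlin {
  finlin_val : forall V, valring V -> overk io V -> (forall j, V (lin io M x j)) ->
    forall i, V (x i);
  finlin_res : forall V, valring V -> overk io V -> (forall j, resk io V (lin io M x j)) ->
    forall i, resk io V (x i);
  finlin_fib : forall w : 'I_c -> k, exists s : seq ('I_n -> k), forall z, zeros z ->
    lin idfun M z =1 w -> exists2 z' , List.In z' s & z =1 z';
  finlin_hom : forall i, hom (dg i) (g i);
  finlin_span : forall D P, hom D P -> exists a : I -> mp c k,
    (forall i, homm D (dg i) (a i)) /\
    ev P = \sum_i mmap io (lin io M x) (a i) * ev (g i) }.

Definition projM c (M : 'I_n -> 'I_c.+1 -> k) (o : 'I_c.+1 -> k) (i : 'I_n) (j : 'I_c) :=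
  M i (wid j) - o (wid j) * M i ord_max.

Lemma lin_projM (S : comNzRingType) (h : {rmorphism k -> S}) (y : 'I_n -> S) c
    (M : 'I_n -> 'I_c.+1 -> k) o j :
  lin h (projM M o) y j = lin h M y (wid j) - h (o (wid j)) * lin h M y ord_max.
Proof.
rewrite /lin mulr_sumr -sumrB; apply: eq_bigr => i _.
by rewrite /projM rmorphB rmorphM mulrBl mulrA.
Qed.

(** Euclidean division by a monic polynomial; every subtracted term has the weight of [Q], so the
    remainder keeps total degree [D]. *)
Lemma bihom_reduce c e (Ft : {poly mp c k}) D : bihom e Ft -> Ft`_e = 1 ->
  forall Q, bihom D Q -> exists R A : {poly mp c k}, [/\ (size R <= e)%N, bihom D R & Q = R + A * Ft].
Proof.
move=> bF F1 Q; have [m] := ubnP (size Q); elim: m Q => // m IH Q sQ bQ.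
have [se|es] := leqP (size Q) e; first by exists Q, 0; rewrite mul0r addr0.
pose s := (size Q).-1.
have sQ' : size Q = s.+1 by rewrite /s prednK //; lia.
have es' : (e <= s)%N by rewrite -ltnS -sQ'.
pose B := (Q`_s)%:P * 'X^(s - e).
have sD : (s <= D)%N by rewrite -ltnS -sQ'; exact: bihom_size.
have bB : bihom (D - e) B.
  have -> : (D - e = (D - s) + (s - e))%N by lia.
  apply: bihomM; first by apply: bihomC; have := bQ s; rewrite /homm sD.
  by rewrite -[X in bihom X]muln1; apply: bihomXn; exact: bihomX.
have bBF : bihom D (B * Ft).
  by rewrite -[D](subnK (leq_trans es' sD)); apply: bihomM.
have sF := bihom_size bF.
have bN : bihom D (Q - B * Ft).
  apply: bihomD => // l; rewrite coefN.
  have := bBF l; rewrite /homm; case: ifP => _; last by move=> ->; rewrite oppr0.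
  by move=> h; rewrite dhomogN.
have sN : (size (Q - B * Ft)%R <= s)%N.
  apply/leq_sizeP => l; rewrite leq_eqVlt => /orP[/eqP <-|sl].
    rewrite coefB /B -mulrA coefCM coefXnM ltnNge leq_subr /= subKn // F1 mulr1 subrr.
    by [].
  rewrite coefB /B -mulrA coefCM coefXnM (nth_default _ (s := Q)) ?sQ' // sub0r.
  rewrite ltnNge (leq_trans _ (ltnW sl)) ?leq_subr //= (nth_default _ (s := Ft)) ?mulr0 ?oppr0 //.
  apply: leq_trans sF _; lia.
have [|R [A [sR bR e1]]] := IH (Q - B * Ft) _ bN.
  by rewrite (leq_ltn_trans sN) // -ltnS -sQ'.
exists R, (A + B); split=> //.
by rewrite mulrDl addrA -e1 subrK.
Qed.

(** Since [F] is 1 at the center, it becomes a monic equation of degree [e] for the last coordinate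
    over the new ones. Integrality, constant residues and finite fibres follow, and the powers below
    [e] of the last coordinate multiply the old generators. *)
Lemma finlin_step c (M : 'I_n -> 'I_c.+1 -> k) (I : finType) dg g e (F : mp c.+1 k) (o : 'I_c.+1 -> k) :
  @finlin c.+1 M I dg g -> hom e F -> mmap io (lin io M x) F = 0 ->
  o ord_max = 1 -> meval o F = 1 ->
  @finlin c (projM M o) (I * 'I_e)%type (fun il => (dg il.1 + il.2)%N)
    (fun il => g il.1 * linf M ord_max ^+ il.2).
Proof.
case=> hval hres hfib hhom hspan hF rF o1 oF.
set t := lin io M x in rF hval hres hspan *.
pose t' := lin io (projM M o) x.
have ht j : t' j = t (wid j) - io (o (wid j)) * t ord_max by exact: lin_projM.
pose Ft := psubst o F.
have bF : bihom e Ft by exact: psubst_bihom.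
have F1 : Ft`_e = 1 by rewrite /Ft psubst_lead // oF mpolyC1.
have sF : size Ft = e.+1.
  apply/eqP; rewrite eqn_leq bihom_size //= ltnNge; apply/negP => /leq_sizeP/(_ e (leqnn _)).
  by rewrite F1 => /eqP; rewrite oner_eq0.
have mF (S : comNzRingType) (f : {rmorphism mp c k -> S}) : map_poly f Ft \is monic.
  by apply: monic_map; rewrite monicE lead_coefE sF F1.
have rFt : (map_poly (mmap io t') Ft).[t ord_max] = 0.
  by rewrite (psubst_eval (t := t)).
have split_t (C : Om -> Prop) : (forall y z, C y -> C z -> C (y + z)) ->
    (forall y z, C y -> C z -> C (y * z)) -> (forall a, C (io a)) ->
    (forall j, C (t' j)) -> C (t ord_max) -> forall j, C (t j).
  move=> CD CM Ck Ct Cm j; case: (unliftP ord_max j) => [j' ->|-> //].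
  rewrite ord_lift_max -(subrK (io (o (wid j')) * t ord_max) (t (wid j'))) -ht.
  by apply: CD => //; apply: CM.
split.
- move=> V vV kV Vt'; apply: hval => //.
  have sV : subring V by case: vV.
  apply: (split_t V) => //; [by move=> ? ?; exact: subringD|by move=> ? ?; exact: subringM|].
  apply: (valring_integral vV (mF _ (mmap io t'))) rFt => i.
  by rewrite coef_map; apply: (V_mmap vV kV).
- move=> V vV kV Vt'; apply: hres => //.
  apply: (split_t (resk io V)) => //.
  + by move=> ? ?; exact: reskD.
  + by move=> ? ?; exact: reskM.
  + by move=> a; exact: resk_const.
  apply: (resk_integral vV kV (mF _ (mmap io t'))) rFt => i.
  by rewrite coef_map; apply: (resk_mmap vV kV).
- move=> w.
  have [r er] := closed_field_poly_normal (map_poly (meval w) Ft).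
  have lF : lead_coef (map_poly (meval w) Ft) = 1 by apply/monicP; exact: mF.
  pose tv z (j : 'I_c.+1) : k := if unlift ord_max j is Some j' then w j' + o j * z else z.
  have [s hs] : exists s : seq ('I_n -> k), forall b, b \in r -> forall z, zeros z ->
      lin idfun M z =1 tv b -> exists2 z', List.In z' s & z =1 z'.
    elim: r {er} => [|b r [s hs]]; first by exists [::].
    have [s' hs'] := hfib (tv b); exists (s' ++ s) => b'; rewrite inE => /orP[/eqP ->|br] z hz e1.
      by have [z' h1 h2] := hs' z hz e1; exists z' => //; apply/List.in_or_app; left.
    by have [z' h1 h2] := hs _ br z hz e1; exists z' => //; apply/List.in_or_app; right.
  exists s => z hz ez; apply: (hs (lin idfun M z ord_max)) => //; last first.
    move=> j; rewrite /tv; case: (unliftP ord_max j) => [j' ->|-> //].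
    by rewrite ord_lift_max -ez lin_projM subrK.
  have : (map_poly (meval w) Ft).[lin idfun M z ord_max] = 0.
    have -> : map_poly (meval w) Ft = map_poly (mmap idfun (lin idfun (projM M o) z)) Ft.
      by apply: eq_map_poly => a; apply: mmap_ext => j; rewrite ez.
    have h (j : 'I_c) : lin idfun (projM M o) z j =
      lin idfun M z (wid j) - idfun (o (wid j)) * lin idfun M z ord_max by exact: lin_projM.
    rewrite (psubst_eval (io := idfun) (t := lin idfun M z)) //.
    rewrite -(mmap_lincomp (idfun : {rmorphism k -> k})); apply: hz.
    by rewrite mmap_lincomp.
  rewrite er lF scale1r horner_prod => /eqP; rewrite prodf_seq_eq0 => /hasP[b br /=].
  by rewrite hornerXsubC subr_eq0 => /eqP ->.
- by move=> [i l] /=; apply: dhomogM => //; apply: hom1X; exact: linf_hom.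
move=> D P hP; have [a [ha ea]] := hspan D P hP.
have /choice[R hR] : forall i, exists R : {poly mp c k}, [/\ (size R <= e)%N,
    forall l, homm D (dg i + l) R`_l &
    mmap io t (a i) = (map_poly (mmap io t') R).[t ord_max]].
  move=> i; have := ha i; rewrite /homm; case: ifP => [le hai|nle ->]; last first.
    exists 0; rewrite size_poly0 rmorph0 rmorph0 horner0; split=> // l.
    by rewrite coef0; exact: homm0.
  have [R [A [sR bR eR]]] := bihom_reduce bF F1 (psubst_bihom o hai).
  exists R; split=> // [l|].
    by have := bR l; rewrite /homm leq_subRL // -subnDA.
  by rewrite -(psubst_eval _ ht) eR rmorphD rmorphM hornerD hornerM rFt mulr0 addr0.
exists (fun il : I * 'I_e => (R il.1)`_il.2); split.
  by move=> [i l] /=; have [_ h _] := hR i; exact: h.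
rewrite ea (eq_bigr (fun i => \sum_(l < e) (mmap io t' (R i)`_l * ev (g i * linf M ord_max ^+ l)))).
  by rewrite pair_bigA; apply: eq_bigr => -[i l] _.
move=> i _; have [sR _ ->] := hR i.
rewrite (horner_map_wide _ _ (n := e)) // mulr_suml; apply: eq_bigr => l _.
by rewrite rmorphM rmorphXn /= mmap_linf -/t -!mulrA [_ * ev _]mulrC.
Qed.

Lemma exists_center c e (F : mp c.+1 k) : hom e F -> F != 0 ->
  exists (a : k) (o : 'I_c.+1 -> k), o ord_max = 1 /\ meval o (a *: F) = 1.
Proof.
move=> hF F0.
have [|o ho] := @mpoly_nonroot k c.+1 (F * mpX k ord_max).
  rewrite mulf_neq0 //; apply/eqP => h.
  have := f_equal (mcoeff (mnm1 ord_max)) h.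
  by rewrite mcoeffX eqxx mcoeff0 => /eqP; rewrite oner_eq0.
rewrite rmorphM /= mevalXU in ho.
have [oF om] : meval o F != 0 /\ o ord_max != 0.
  by move: ho; rewrite mulf_eq0 negb_or => /andP.
have hn0 : meval (fun i => (o ord_max)^-1 * o i) F != 0.
  by rewrite /meval (dhomog_scale _ _ _ hF) mulf_neq0 // expf_neq0 // invr_eq0.
exists (meval (fun i => (o ord_max)^-1 * o i) F)^-1, (fun i => (o ord_max)^-1 * o i).
by split; [rewrite mulVf|rewrite mevalZ mulVf].
Qed.

Definition algindep c (t : 'I_c -> Om) := forall P : mp c k, mmap io t P = 0 -> P = 0.

Definition idM (i j : 'I_n) : k := (i == j)%:R.

Lemma lin_idM (S : comNzRingType) (h : {rmorphism k -> S}) (y : 'I_n -> S) : lin h idM y =1 y.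
Proof.
move=> j; rewrite /lin (bigD1 j) //= /idM eqxx rmorph1 mul1r big1 ?addr0 // => i ne.
by rewrite (negbTE ne) rmorph0 mul0r.
Qed.

Lemma finlin_id : @finlin n idM 'I_1 (fun=> 0%N) (fun=> 1).
Proof.
split.
- by move=> V vV kV h i; rewrite -[x i](lin_idM io).
- by move=> V vV kV h i; rewrite -[x i](lin_idM io).
- move=> w; exists [:: w] => z _ h; exists w; first by left.
  by move=> i; rewrite -h lin_idM.
- by move=> _; exact: dhomog1.
- move=> D P hP; exists (fun=> P); split; first by move=> _; rewrite /homm subn0.
  by rewrite big_ord1 rmorph1 mulr1; apply: mmap_ext => i; rewrite lin_idM.
Qed.

(** Noether normalization by successive projections from points: as long as the coordinates satisfy
    a relation, [graded] turns it into a homogeneous one, and projecting from a point off that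
    hypersurface drops one coordinate. *)
Lemma noether : graded io x -> exists d (M : 'I_n -> 'I_d -> k) (I : finType) dg g,
  @finlin d M I dg g /\ algindep (lin io M x).
Proof.
move=> gx.
suff gen c : forall (M : 'I_n -> 'I_c -> k) (I : finType) dg g, @finlin c M I dg g ->
    exists d (M : 'I_n -> 'I_d -> k) (I : finType) dg g, @finlin d M I dg g /\ algindep (lin io M x).
  exact: (gen _ _ _ _ _ finlin_id).
elim: c => [|c IH] M I dg g fM.
  exists 0%N, M, I, dg, g; split=> // P; rewrite (nvar0_mpolyC P) mmapC => /eqP.
  by rewrite fmorph_eq0 => /eqP ->; rewrite mpolyC0.
have [ai|/existsNP[F /not_implyP[rF /eqP F0]]] := pselect (algindep (lin io M x)).
  by exists c.+1, M, I, dg, g.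
have [e eF0] := hc_neq0 F0.
have rF' : mmap io (lin io M x) (hc e F) = 0 by apply: graded_lin.
have [a [ce [ce1 ceF]]] := exists_center (hc_hom e F) eF0.
apply: (IH (projM M ce)); apply: (finlin_step fM _ _ ce1 ceF).
  by apply: dhomogZ; exact: hc_hom.
by rewrite mmapZ rF' mulr0.
Qed.

Lemma place_zeros V (v : 'I_n -> k) : valring V -> overk io V ->
  (forall i, maxi V (x i - io (v i))) -> zeros v.
Proof.
move=> vV kV hv Q rQ; have := mmap_maxi vV kV Q hv; rewrite rQ sub0r => h.
by have := maxi_const kV (let h' := maxiN vV h in eq_ind _ (maxi V) h' _ (opprK _)).
Qed.

Section Spanning.
Variables (c : nat) (M : 'I_n -> 'I_c -> k) (I : finType) (dg : I -> nat) (g : I -> mp n k).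
Hypothesis fM : @finlin c M I dg g.

Lemma finlin_span_any P : exists a : I -> mp c k,
  ev P = \sum_i mmap io (lin io M x) (a i) * ev (g i).
Proof.
have /choice[a ha] : forall d, exists a : I -> mp c k,
    ev (hc d P) = \sum_i mmap io (lin io M x) (a i) * ev (g i).
  by move=> d; have [a [_ ea]] := finlin_span fM (hc_hom d P); exists a.
exists (fun i => \sum_(d < mmeasure mdeg P) a d i).
rewrite {1}(hom_decomp P) raddf_sum /=.
under [RHS]eq_bigr do rewrite raddf_sum mulr_suml.
by rewrite exchange_big; apply: eq_bigr => d _; exact: ha.
Qed.

Lemma finlin_dependent m (P : 'I_m -> mp n k) : (#|I| < m)%N ->
  exists a : 'I_m -> mp c k, (exists l, a l != 0) /\
    \sum_l mmap io (lin io M x) (a l) * ev (P l) = 0.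
Proof.
move=> Im; have /choice[C hC] := fun l => finlin_span_any (P l).
have [a [a0 ha]] := linear_dependence (fun l (j : 'I_#|I|) => C l (enum_val j)) Im.
exists a; split=> //.
under eq_bigr do rewrite hC mulr_sumr.
rewrite exchange_big big1 // => i _ /=.
under eq_bigr do rewrite mulrA -rmorphM.
rewrite -mulr_suml -rmorph_sum /=.
by have := ha (enum_rank i); rewrite enum_rankK => ->; rewrite rmorph0 mul0r.
Qed.

(** The powers of [P] are dependent over the coordinate ring of the target. Dividing a relation by
    its lowest power of [P] exhibits the lowest nonzero coefficient [b] as a multiple of [P]; it
    replaces the norm. *)
Lemma finlin_norm P : algindep (lin io M x) -> ev P != 0 ->
  exists (b : mp c k) (W : mp n k), b != 0 /\ mmap io (lin io M x) b = ev P * ev W.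
Proof.
move=> ai P0.
have [a [[l al] ha]] := finlin_dependent (fun l : 'I_#|I|.+1 => P ^+ l) (ltnSn _).
have exl : exists l, (l < #|I|.+1)%N && (if insub l is Some l' then a l' != 0 else false).
  by exists l; rewrite ltn_ord valK.
have [l0 /andP[l0I]] := ex_minnP exl; rewrite insubT => al0 minl.
pose W := - \sum_(i < #|I|.+1 | (l0 < i)%N) lincomp M (a i) * P ^+ (i - l0.+1).
exists (a (Sub l0 l0I)), W; split=> //.
have Pl0 : ev P ^+ l0 != 0 by rewrite expf_neq0.
apply: (mulIf Pl0); rewrite /W rmorphN mulrN mulNr; apply/eqP; rewrite -addr_eq0; apply/eqP.
rewrite -[RHS]ha [RHS](bigD1 (Sub l0 l0I)) //=; congr (_ + _); first by rewrite -rmorphXn.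
rewrite rmorph_sum /= mulr_sumr mulr_suml [RHS](bigID (fun i : 'I_#|I|.+1 => (l0 < i)%N)) /=.
rewrite [X in _ = _ + X]big1 ?addr0 => [|i /andP[ne nl]]; last first.
  have il : (i < l0)%N by rewrite ltn_neqAle -(inj_eq val_inj) /= in ne *; rewrite ne leqNgt.
  have [->|ai0] := eqVneq (a i) 0; first by rewrite rmorph0 mul0r.
  have := minl i; rewrite ltn_ord valK ai0 => /(_ isT); rewrite leqNgt il; by [].
apply: eq_big => [i|i li].
  by rewrite -(inj_eq val_inj) /=; case: ltngtP.
rewrite rmorphM !rmorphXn /= mmap_lincomp.
have -> : ev P ^+ i = ev P * (ev P ^+ (i - l0.+1) * ev P ^+ l0).
  by rewrite -exprD -exprS; congr (_ ^+ _); lia.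
by ring.
Qed.

Lemma finlin_point V (w : 'I_c -> k) : valring V -> overk io V ->
  (forall j, maxi V (lin io M x j - io (w j))) ->
  exists v, [/\ forall i, maxi V (x i - io (v i)), zeros v & lin idfun M v =1 w].
Proof.
move=> vV kV tw.
have [v hv] := choice (finlin_res fM vV kV (fun j => ex_intro (fun c => maxi V (lin io M x j - io c)) (w j) (tw j))).
exists v; split=> //; first exact: place_zeros hv.
move=> j; apply/eqP; rewrite -subr_eq0; apply/eqP; apply: (maxi_const kV).
have := maxiB vV (tw j) (mmap_maxi vV kV (linf M j) hv).
by rewrite /meval !mmap_linf opprB addrC addrA subrK rmorphB.
Qed.

(** Surjectivity of the finite projection: independence makes evaluation at [w] a specialization of
    the target coordinates, a valuation ring realizes it, and the residues of [x] there are a point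
    above [w]. *)
Lemma finlin_place (w : 'I_c -> k) : algindep (lin io M x) ->
  exists V, [/\ valring V, overk io V, forall j, maxi V (lin io M x j - io (w j))
    & exists v, [/\ forall i, maxi V (x i - io (v i)), zeros v & lin idfun M v =1 w]].
Proof.
move=> ai.
have [||||V [vV Vt IV]] := @valring_specialization _ _ (mmap io (lin io M x)) [set a | meval w a = 0].
- by rewrite /= meval1 => /eqP; rewrite oner_eq0.
- by move=> a b /= ha hb; rewrite mevalD ha hb addr0.
- by move=> a b /= ha; rewrite mevalM ha mulr0.
- by move=> a /ai ->; rewrite /= meval0.
have kV : overk io V by move=> a; have := Vt (mpolyC c a); rewrite /= mmapC.
have tw j : maxi V (lin io M x j - io (w j)).
  have -> : lin io M x j - io (w j) = mmap io (lin io M x) (mpX k j - mpolyC c (w j)).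
    by rewrite rmorphB /= mmap_var mmapC.
  by apply: IV; rewrite /= mevalB mevalXU mevalC subrr.
by exists V; split=> //; exact: finlin_point.
Qed.

End Spanning.

(** Choose [w] off the zeros of the norm of [P] and lift it; as [P] divides its norm at the place,
    [P] cannot vanish at the lift. *)
Lemma nullstellensatz P : graded io x -> ev P != 0 ->
  exists v, meval v P != 0 /\ zeros v.
Proof.
move=> gx P0; have [d [M [I [dg [g [fM ai]]]]]] := noether gx.
have [b [W [b0 eb]]] := finlin_norm fM ai P0.
have [w hw] := mpoly_nonroot b0.
have [V [vV kV Vt [v [hv zv _]]]] := finlin_place fM w ai.
exists v; split=> //.
apply: contraNneq hw => Pv; apply/eqP; apply: (maxi_const kV).
have sV : subring V by case: vV.
have mP : maxi V (ev P) by have := mmap_maxi vV kV P hv; rewrite Pv rmorph0 subr0.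
have VW : V (ev W).
  by apply: (V_mmap vV kV) => i; apply: (resk_sub vV kV); exists (v i).
have mb := mmap_maxi vV kV b Vt.
have -> : io (meval w b) = ev P * ev W - (mmap io (lin io M x) b - io (meval w b)).
  by rewrite eb; ring.
by apply: (maxiB vV) => //; apply: (maxiMl vV).
Qed.

End FiniteProjection.

(** * Generic points of homogeneous prime ideals *)

Section HomogeneousPrimes.
Variables (k : closedFieldType) (n : nat) (I : set (mp n k)).
Hypotheses (I1 : ~ I 1) (ID : forall a b, I a -> I b -> I (a + b))
  (IM : forall a b, I a -> I (b * a)) (I0 : I 0) (Ih : forall P d, I P -> I (hc d P))
  (Ip : forall a b d e, hom d a -> hom e b -> I (a * b) -> I a \/ I b).

(** Primality is only assumed for forms. In general one removes from each factor the top components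
    that lie in [I]; the product of the remaining top components is then a component of an element
    of [I]. *)
Lemma hprime_generic : exists (Om : fieldType) (io : {rmorphism k -> Om}) (x : 'I_n -> Om),
  graded io x /\ forall P, mmap io x P = 0 <-> I P.
Proof.
have IB a b : I a -> I b -> I (a - b).
  by move=> ha hb; apply: ID => //; rewrite -mulN1r; apply: IM.
have Isum (T : Type) (s : seq T) (p : pred T) (f : T -> mp n k) :
    (forall i, p i -> I (f i)) -> I (\sum_(i <- s | p i) f i).
  by move=> h; apply: (big_ind I).
have top (P : mp n k) : ~ I P -> exists d Q, [/\ I (P - Q), ~ I (hc d Q) &
    forall e, (d < e)%N -> hc e Q = 0].
  move=> nP.
  pose good m := `[< forall e, (m <= e)%N -> I (hc e P) >].
  have exg : exists m, good m.
    by exists (mmeasure mdeg P); apply: asboolT => e le; rewrite hc_big.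
  have [m /asboolW hm minm] := ex_minnP exg.
  case: m hm minm => [|m] hm minm.
    by case: nP; rewrite (hom_decomp P); apply: Isum => i _; apply: hm.
  exists m, (\sum_(e < m.+1) hc e P).
  have hcQ e : hc e (\sum_(e < m.+1) hc e P) = if (e <= m)%N then hc e P else 0.
    rewrite raddf_sum /=; under eq_bigr => i _ do rewrite (hom_hc _ (hc_hom i P)).
    case: leqP => em.
      rewrite (bigD1 (Ordinal (em : (e < m.+1)%N))) //= eqxx big1 ?addr0 // => i.
      by rewrite -(inj_eq val_inj) /= eq_sym => /negbTE ->.
    by rewrite big1 // => i _; case: eqP => // ei; have := ltn_ord i; rewrite -ei ltnS leqNgt em.
  split.
  - set Q := \sum_(e < _) _ in hcQ *.
    rewrite (hom_decomp (P - Q)); apply: Isum => i _; rewrite raddfB /= hcQ.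
    by case: leqP => im; [rewrite subrr|rewrite subr0; apply: hm].
  - rewrite hcQ leqnn => h; suff : good m by move/minm; rewrite ltnn.
    by apply: asboolT => e; rewrite leq_eqVlt => /orP[/eqP <- //|]; exact: hm.
  - by move=> e me; rewrite hcQ leqNgt me.
have prime a b : I (a * b) -> I a \/ I b.
  move=> hab; apply: contrapT => /not_orP[na nb].
  have [d [A [hA nA tA]]] := top _ na; have [e [B [hB nB tB]]] := top _ nb.
  have hAB : I (A * B).
    have -> : A * B = a * b - B * (a - A) - a * (b - B) by ring.
    by apply: (IB); [apply: (IB) => //|]; apply: IM.
  have decomp (C : mp n k) f : (forall e, (f < e)%N -> hc e C = 0) -> C = \sum_(i < f.+1) hc i C.
    move=> h; rewrite {1}(hom_decomp C); set s := mmeasure _ _.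
    have [sf|fs] := leqP s f.+1.
      rewrite (big_ord_widen _ (fun i => hc i C) sf) [RHS](bigID (fun i : 'I_f.+1 => (i < s)%N)) /=.
      by rewrite [X in _ = _ + X]big1 ?addr0 // => i; rewrite -leqNgt; exact: hc_big.
    rewrite (big_ord_widen _ (fun i => hc i C) (ltnW fs)) [LHS](bigID (fun i : 'I_s => (i < f.+1)%N)) /=.
    by rewrite [X in _ + X = _]big1 ?addr0 // => i; rewrite -leqNgt => si; apply: h.
  have := Ih (d + e) hAB.
  rewrite {1}(decomp A d tA) mulr_suml raddf_sum /= big_ord_recr /= => h.
  have hde : hc (d + e) (hc d A * B) = hc d A * hc e B by exact: hcM (hc_hom d A).
  have small (i : 'I_d) : hc (d + e) (hc i A * B) = 0.
    have -> : (d + e = i + (d + e - i))%N by have := ltn_ord i; lia.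
    rewrite (hcM _ _ (hc_hom i A)) tB ?mulr0 //; have := ltn_ord i; lia.
  rewrite big1 ?add0r // hde in h.
  by case: (Ip (hc_hom d A) (hc_hom e B) h).
have [F [f hf]] := prime_quotient_field I1 ID IM I0 prime.
exists F, (f \o @mpolyC n k : {rmorphism k -> F}), (fun i => f (mpX k i)).
have ef : mmap (f \o @mpolyC n k) (fun i => f (mpX k i)) =1 f.
  apply: (mp_rmorph_ext (f := mmap (f \o @mpolyC n k) (fun i => f (mpX k i))) (g := f)).
    by move=> c; rewrite /= mmapC.
  by move=> i; rewrite /= mmap_var.
split=> P; rewrite ef hf //.
by move=> IP d; rewrite ef hf; apply: Ih.
Qed.
End HomogeneousPrimes.

(** * Weighted homogeneity of minimal equations *)

Section HomogeneousFactors.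
Variables (k : fieldType) (n : nat).
Implicit Types P Q : mp n k.

Lemma hcM_gen D P Q :
  hc D (P * Q) = \sum_(i < mmeasure mdeg P) (if (i <= D)%N then hc i P * hc (D - i) Q else 0).
Proof.
rewrite {1}(hom_decomp P) mulr_suml raddf_sum /=; apply: eq_bigr => i _.
case: leqP => iD; first by rewrite -{1}(subnKC iD) (hcM _ _ (hc_hom i P)).
rewrite {1}(hom_decomp Q) mulr_sumr raddf_sum big1 //= => j _.
by rewrite (hom_hc _ (dhomogM (hc_hom i P) (hc_hom j Q))); case: eqP => // e; move: iD; rewrite e ltnNge leq_addr.
Qed.

Lemma hom_unique d e P : P != 0 -> hom d P -> hom e P -> d = e.
Proof. exact: dhomog_uniq. Qed.

(** In a domain the lowest components of [P] and [Q] multiply to a nonzero component of the product,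
    and so do the highest ones; both have degree [D], so lowest and highest coincide. *)
Lemma hom_factor D P Q : P * Q != 0 -> hom D (P * Q) ->
  exists d e, [/\ (d + e = D)%N, hom d P & hom e Q].
Proof.
move=> PQ0 hPQ; have [P0 Q0] : P != 0 /\ Q != 0 by move: PQ0; rewrite mulf_eq0 negb_or => /andP.
have low (R : mp n k) : R != 0 -> exists2 r, hc r R != 0 & forall i, (i < r)%N -> hc i R = 0.
  move=> R0; have [r hr mr] := ex_minnP (hc_neq0 R0); exists r => // i ir.
  by apply/eqP; apply: contrapT => /negP /mr; rewrite leqNgt ir.
have hi (R : mp n k) : R != 0 -> exists2 r, hc r R != 0 & forall i, (r < i)%N -> hc i R = 0.
  move=> R0; have [r0 hr0 _] := low R R0.
  have bd r : hc r R != 0 -> (r <= mmeasure mdeg R)%N.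
    by apply: contraNleq => h; apply/eqP; apply: hc_big; exact: ltnW.
  have [r hr mr] := ex_maxnP (ex_intro (fun r => hc r R != 0) r0 hr0) bd.
  exists r => // i ri; apply/eqP; apply: contrapT => /negP /mr; by rewrite leqNgt ri.
have [p0 hp0 lp] := low _ P0; have [q0 hq0 lq] := low _ Q0.
have [p1 hp1 up] := hi _ P0; have [q1 hq1 uq] := hi _ Q0.
have pi r : hc r P != 0 -> (r < mmeasure mdeg P)%N.
  by apply: contraNltn => h; apply/eqP; exact: hc_big.
have e0 : hc (p0 + q0) (P * Q) = hc p0 P * hc q0 Q.
  rewrite hcM_gen (bigD1 (Ordinal (pi _ hp0))) //= leq_addr addKn big1 ?addr0 // => i.
  rewrite -(inj_eq val_inj) /= neq_ltn => /orP[ip|pi']; first by rewrite lp // mul0r if_same.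
  by case: leqP => // h; rewrite lq ?mulr0 //; lia.
have e1 : hc (p1 + q1) (P * Q) = hc p1 P * hc q1 Q.
  rewrite hcM_gen (bigD1 (Ordinal (pi _ hp1))) //= leq_addr addKn big1 ?addr0 // => i.
  rewrite -(inj_eq val_inj) /= neq_ltn => /orP[ip|pi']; last by rewrite up // mul0r if_same.
  by case: leqP => // h; rewrite uq ?mulr0 //; lia.
have p01 : (p0 <= p1)%N by rewrite leqNgt; apply: contra hp0 => /up ->.
have q01 : (q0 <= q1)%N by rewrite leqNgt; apply: contra hq0 => /uq ->.
have D0 : (p0 + q0 = D)%N.
  apply/eqP; apply: contraT => ne; move: (e0); rewrite (hom_hc _ hPQ) (negbTE ne) => /esym/eqP.
  by rewrite mulf_eq0 (negbTE hp0) (negbTE hq0).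
have D1 : (p1 + q1 = D)%N.
  apply/eqP; apply: contraT => ne; move: (e1); rewrite (hom_hc _ hPQ) (negbTE ne) => /esym/eqP.
  by rewrite mulf_eq0 (negbTE hp1) (negbTE hq1).
have pe : p0 = p1 by lia.
have qe : q0 = q1 by lia.
have one (R : mp n k) r : (forall i, (i < r)%N -> hc i R = 0) -> (forall i, (r < i)%N -> hc i R = 0) -> hom r R.
  move=> l u; rewrite (hom_decomp R) rpred_sum // => i _.
  by case: (ltngtP i r) => [/l ->|/u ->|<-]; rewrite ?dhomog0 // hc_hom.
by exists p0, q0; split=> //; apply: one => //; rewrite ?pe ?qe.
Qed.

(** The part of [F] of weight [e] when the last variable has weight [dl]. *)
Definition wpart dl e (F : {poly mp n k}) : {poly mp n k} :=
  \poly_(j < size F) (if (dl * j <= e)%N then hc (e - dl * j) F`_j else 0).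

Lemma wpart_root0 dl F : F != 0 -> exists e, wpart dl e F != 0.
Proof.
move=> F0; have lF : lead_coef F != 0 by rewrite lead_coef_eq0.
have [d hd] := hc_neq0 lF.
exists (d + dl * (size F).-1)%N; apply/eqP => /polyP/(_ (size F).-1).
rewrite coef_poly coef0 prednK ?size_poly_gt0 // leqnn leq_addl addnK.
by move/eqP; rewrite -lead_coefE (negbTE hd).
Qed.

(** A nonzero weighted part of [mu] is again a relation, hence a multiple of [mu], and by degree a
    constant [q] times [mu]. The factors of the homogeneous products of [q] with the coefficients
    are homogeneous. *)
Lemma weighted_minpoly (Om : fieldType) (io : {rmorphism k -> Om}) (t : 'I_n -> Om) (x : Om) dl
    (mu : {poly mp n k}) :
  mu != 0 -> (map_poly (mmap io t) mu).[x] = 0 ->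
  divides_relations (mmap io t) x mu ->
  (forall F : {poly mp n k}, (map_poly (mmap io t) F).[x] = 0 ->
    forall e, (map_poly (mmap io t) (wpart dl e F)).[x] = 0) ->
  exists e, forall j, homm e (dl * j) mu`_j.
Proof.
move=> mu0 rmu gen hw; have [e he] := wpart_root0 dl mu0.
have [Q eQ] := gen _ (hw _ rmu e).
have Q0 : Q != 0 by apply: contraNneq he => z; rewrite eQ z mul0r.
have sQ : size Q = 1%N.
  have := f_equal (fun p : {poly mp n k} => size p) eQ; rewrite /= size_mul //.
  have : (size (wpart dl e mu) <= size mu)%N by exact: size_poly.
  have : (0 < size Q)%N by rewrite size_poly_gt0.
  have : (0 < size mu)%N by rewrite size_poly_gt0.
  have gen3 (a b c : nat) : (0 < a -> 0 < b -> c <= a -> c = (b + a).-1 -> b = 1)%N by lia.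
  exact: gen3.
have {Q Q0 sQ eQ}[q q0 eq] : exists2 q, q != 0 & wpart dl e mu = q%:P * mu.
  exists Q`_0; last by rewrite -size1_polyC // sQ.
  by rewrite -polyC_eq0 -size1_polyC // sQ.
have hj j : homm e (dl * j) (q * mu`_j).
  have <- : (wpart dl e mu)`_j = q * mu`_j by rewrite eq coefCM.
  rewrite coef_poly; case: ifP => _; last exact: homm0.
  by rewrite /homm; case: (dl * j <= e)%N => //; exact: hc_hom.
have lmu : lead_coef mu != 0 by rewrite lead_coef_eq0.
have := hj (size mu).-1; rewrite -lead_coefE /homm; case: ifP => [le h|_ /eqP]; last first.
  by rewrite mulf_eq0 (negbTE q0) (negbTE lmu).
have [dq [_ [_ hq _]]] := hom_factor (mulf_neq0 q0 lmu) h.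
exists (e - dq)%N => j; have [->|m0] := eqVneq mu`_j 0; first exact: homm0.
have := hj j; rewrite /homm; case: ifP => [le' h'|_ /eqP]; last first.
  by rewrite mulf_eq0 (negbTE q0) (negbTE m0).
have [d' [e' [es hq' hm]]] := hom_factor (mulf_neq0 q0 m0) h'.
have ed : dq = d' by exact: hom_unique hq hq'.
have -> : (dl * j <= e - dq)%N by clear -le' es ed; lia.
by have -> : (e - dq - dl * j = e')%N by clear -le' es ed; lia.
Qed.

End HomogeneousFactors.

Lemma hc_lincomp (k : closedFieldType) n c d (M : 'I_n -> 'I_c -> k) (P : mp c k) :
  hc d (lincomp M P) = lincomp M (hc d P).
Proof.
rewrite -{1}[d]mul1n /lincomp hc_comp // => l; rewrite tnth_mktuple; exact: linf_hom.
Qed.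

Section HomogeneousFraction.
Variables (k : closedFieldType) (Om : fieldType) (io : {rmorphism k -> Om}) (n c : nat).
Variables (x : 'I_n -> Om) (M : 'I_n -> 'I_c -> k).
Hypothesis gx : graded io x.
Notation ev := (mmap io x).
Notation evt := (mmap io (lin io M x)).

(** After multiplication by a power of [Q] the relation becomes the vanishing of a polynomial at
    [x]; its homogeneous components, which also vanish, are the weighted parts. *)
Lemma fraction_weighted (P Q : mp n k) a b dl (F : {poly mp c k}) :
  hom a P -> hom b Q -> (a = b + dl)%N -> ev Q != 0 ->
  (map_poly evt F).[ev P / ev Q] = 0 ->
  forall e, (map_poly evt (wpart dl e F)).[ev P / ev Q] = 0.
Proof.
move=> hP hQ ab Q0 rF e; pose r := (size F).-1.
have [F0|F0] := eqVneq F 0.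
  by rewrite /wpart F0 size_poly0 poly_def big_ord0 rmorph0 horner0.
have sF : size F = r.+1 by rewrite /r prednK // size_poly_gt0.
pose H (G : {poly mp c k}) := \sum_(j < r.+1) lincomp M G`_j * P ^+ j * Q ^+ (r - j).
have eH (G : {poly mp c k}) : (size G <= r.+1)%N ->
    ev (H G) = ev Q ^+ r * (map_poly evt G).[ev P / ev Q].
  move=> sG; rewrite (horner_map_wide _ _ sG) raddf_sum mulr_sumr; apply: eq_bigr => j _ /=.
  rewrite !rmorphM !rmorphXn /= mmap_lincomp exprMn exprVn /=.
  have -> : ev Q ^+ r = ev Q ^+ (r - j) * ev Q ^+ j by rewrite -exprD subnK // -ltnS.
  have Qj : ev Q ^+ j != 0 by rewrite expf_neq0.
  by field.
have sw : (size (wpart dl e F) <= r.+1)%N by rewrite -sF; exact: size_poly.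
have Qr : ev Q ^+ r != 0 by rewrite expf_neq0.
apply: (mulfI Qr); rewrite mulr0 -eH //.
suff -> : H (wpart dl e F) = hc (e + b * r) (H F).
  by apply: gx; rewrite eH ?sF // rF mulr0.
rewrite raddf_sum /=; apply: eq_bigr => j _.
have hPQ : hom (a * j + b * (r - j)) (P ^+ j * Q ^+ (r - j)).
  by apply: dhomogM; apply: dhomogMn.
rewrite coef_poly sF ltn_ord -!mulrA.
have e1 : (a * j + b * (r - j) = dl * j + b * r)%N.
  have := ltn_ord j; rewrite ltnS => jr; have er : (b * r = b * (r - j) + b * j)%N by rewrite -mulnDr subnK.
  by rewrite ab er mulnDl; lia.
case: leqP => le.
  rewrite [in RHS]mulrC; have -> : (e + b * r = (a * j + b * (r - j)) + (e - dl * j))%N by lia.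
  rewrite (hcM _ _ hPQ) mulrC; congr (_ * _).
  exact: esym (hc_lincomp _ _ _).
have z : lincomp M (0 : mp c k) = 0 by rewrite /lincomp rmorph0.
rewrite z mul0r [lincomp M F`_j * _]mulrC hcM_gen big1 // => i _.
case: leqP => // ie; rewrite (hom_hc _ hPQ).
by case: eqP => [ei|_]; rewrite ?mul0r //; move: ie; rewrite ei e1 leq_add2r leqNgt le.
Qed.

End HomogeneousFraction.

(** * Discreteness of a valuation on a field of finite degree *)

Section Discreteness.
Variables (Om : fieldType) (V W C : set Om) (p0 : Om) (N : nat).
Hypotheses (vV : valring V) (mp0 : maxi V p0) (p00 : p0 != 0)
  (hC : forall a, C a -> a != 0 -> exists (j : nat) u, [/\ a = p0 ^+ j * u, V u & V u^-1])
  (W1 : W 1) (Wp0 : W p0) (WM : forall a b, W a -> W b -> W (a * b)) (WV : forall a, W a -> W a^-1)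
  (hdep : forall y : 'I_N.+1 -> Om, (forall l, W (y l)) -> exists a : 'I_N.+1 -> Om,
     [/\ forall l, C (a l), exists l, a l != 0 & \sum_l a l * y l = 0]).
Let sV : subring V. Proof. by case: vV. Qed.

Lemma dominant_term n (f : 'I_n -> Om) :
  (forall l m, l != m -> f l != 0 -> f m != 0 -> maxi V (f l / f m) \/ maxi V (f m / f l)) ->
  (exists l, f l != 0) -> \sum_l f l != 0.
Proof.
move=> hf [l0 hl0].
have [l [fl hl]] : exists l, f l != 0 /\ forall m, m \in enum 'I_n -> m != l -> maxi V (f m / f l).
  elim: (enum 'I_n) => [|m s [l [fl hl]]]; first by exists l0.
  have [ml|ml] := eqVneq m l.
    by exists l; split=> // m'; rewrite inE => /orP[/eqP ->|/hl //]; rewrite ml eqxx.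
  have [fm|fm] := eqVneq (f m) 0.
    exists l; split=> // m'; rewrite inE => /orP[/eqP -> _|/hl //].
    by rewrite fm mul0r; left.
  have [h|h] := hf _ _ ml fm fl.
    by exists l; split=> // m'; rewrite inE => /orP[/eqP -> _|/hl].
  exists m; split=> // m'; rewrite inE => /orP[/eqP ->|ms ne]; first by rewrite eqxx.
  have [->|nl] := eqVneq m' l; first exact: h.
  have -> : f m' / f m = (f m' / f l) * (f l / f m) by rewrite mulrA divfK.
  by apply: (maxiMl vV); [apply: hl|apply: (maxi_sub vV)].
rewrite (bigD1 l) //=; apply/eqP => e.
apply: (maxi1 vV).
have -> : 1 = - \sum_(i < n | i != l) f i / f l.
  by rewrite -mulr_suml; apply: (mulIf fl); rewrite mul1r mulNr divfK //; apply/eqP; rewrite -addr_eq0 e.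
by apply: (maxiN vV); apply: (maxi_sum vV) => m ml; apply: hl; rewrite ?mem_enum.
Qed.

Let WX a n : W a -> W (a ^+ n).
Proof. by move=> Wa; elim: n => [|n IH]; rewrite ?expr0 // exprS; apply: WM. Qed.

(** A bound on ramification. Values of elements of [C] are multiples of that of [p0], so if [s ^+ n]
    divides [p0] with [n > N], the terms of a relation among 1, ..., [s ^+ N] have pairwise distinct
    values and cannot cancel. *)
Let bounded s n : maxi V s -> s != 0 -> W s -> V (p0 / s ^+ n) -> (n <= N)%N.
Proof.
move=> ms s0 Ws hn; rewrite leqNgt; apply/negP => nN.
have [a [Ca [l al] e]] := hdep (fun l : 'I_N.+1 => WX l Ws).
have sl j : s ^+ j != 0 by rewrite expf_neq0.
have /negP : \sum_l a l * s ^+ l != 0; last by rewrite e eqxx.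
apply: dominant_term; last by exists l; rewrite mulf_neq0.
have Vs : V s by apply: (maxi_sub vV).
have msX j : (0 < j)%N -> maxi V (s ^+ j).
  by case: j => // j _; rewrite exprS; apply: (maxiMl vV) => //; apply: subringX.
have key (l1 l2 : 'I_N.+1) : (l1 < l2)%N -> a l1 != 0 -> a l2 != 0 ->
    maxi V (a l2 * s ^+ l2 / (a l1 * s ^+ l1)) \/ maxi V (a l1 * s ^+ l1 / (a l2 * s ^+ l2)).
  move=> l12 a1 a2; have [j1 [u1 [e1 Vu1 Vu1']]] := hC (Ca l1) a1.
  have [j2 [u2 [e2 Vu2 Vu2']]] := hC (Ca l2) a2.
  have u10 : u1 != 0 by apply: contraNneq a1 => z; rewrite e1 z mulr0.
  have u20 : u2 != 0 by apply: contraNneq a2 => z; rewrite e2 z mulr0.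
  have pj j : p0 ^+ j != 0 by rewrite expf_neq0.
  have l2n : (l2 - l1 < n)%N by have := ltn_ord l2; lia.
  have [j12|j21] := leqP j1 j2; [left|right].
    have -> : a l2 * s ^+ l2 / (a l1 * s ^+ l1) = (p0 ^+ (j2 - j1) * (u2 / u1)) * s ^+ (l2 - l1).
      rewrite e1 e2 -{1}(subnK j12) -{1}(subnK (ltnW l12)) !exprD.
      have h1 := pj j1; have h2 := sl (l1 : nat); by field; rewrite u10 h1 h2.
    apply: (maxiM vV); last by apply: msX; lia.
    apply: subringM => //; first by apply: subringX => //; apply: (maxi_sub vV).
    exact: subringM.
  have -> : a l1 * s ^+ l1 / (a l2 * s ^+ l2) =
      (p0 / s ^+ n) * (s ^+ (n - (l2 - l1))) * (p0 ^+ (j1 - j2).-1 * (u1 / u2)).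
    rewrite e1 e2 -{1}(subnK (ltnW j21)) -{1}(subnK (ltnW l12)) !exprD.
    have -> : p0 ^+ (j1 - j2) = p0 * p0 ^+ (j1 - j2).-1 by rewrite -exprS prednK // subn_gt0.
    have -> : s ^+ n = s ^+ (n - (l2 - l1)) * s ^+ (l2 - l1) by rewrite -exprD subnK // ltnW.
    have h1 := pj j2; have h2 := sl (l1 : nat); have h3 := sl (l2 - l1)%N; have h4 := sl (n - (l2 - l1))%N.
    by field; rewrite u20 h1 h2 h3 h4.
  apply: (maxiMl vV).
    by apply: (maxiM vV) => //; apply: msX; rewrite subn_gt0.
  apply: subringM => //; first by apply: subringX => //; apply: (maxi_sub vV).
  exact: subringM.
move=> l1 l2; rewrite -(inj_eq val_inj) /= neq_ltn !mulf_eq0 !negb_or => l12 /andP[a1 _] /andP[a2 _].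
by case/orP: l12 => h; [have [] := key _ _ h a1 a2; [right|left]|apply: key].
Qed.

(** The uniformizer is an [s] whose [n]-th power divides [p0] with [n] maximal; [bounded] makes this
    maximum exist. *)
Lemma uniformizer : exists s, [/\ W s, maxi V s, s != 0
  & forall w, W w -> V w -> w != 0 -> exists j : nat, V (w / s ^+ j) /\ V (s ^+ j / w)].
Proof.
pose P n := `[< exists s, [/\ W s, maxi V s, s != 0 & V (p0 / s ^+ n)] >].
have exP : exists n, P n.
  by exists 1%N; apply: asboolT; exists p0; split=> //; rewrite expr1 divff //; exact: subring1.
have bP n : P n -> (n <= N)%N by move=> /asboolW[s [Ws ms s0 h]]; exact: (bounded ms s0 Ws h).
have [n /asboolW[s [Ws ms s0 hn]] maxn] := ex_maxnP exP bP.
have n0 : (0 < n)%N.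
  by apply: maxn; apply: asboolT; exists p0; split=> //; rewrite expr1 divff //; exact: subring1.
have sl j : s ^+ j != 0 by rewrite expf_neq0.
(* If [s] did not divide the nonunit [w], then [w] and [s / w] would both be nonunits and the square
   of one of them would divide [s], which would allow the exponent [2 * n]. *)
have gen w : W w -> maxi V w -> V (w / s).
  move=> Ww mw; have [->|w0] := eqVneq w 0; first by rewrite mul0r; exact: subring0.
  apply: contrapT => nws.
  have msw : maxi V (s / w) by rewrite -[s / w]invrK invf_div; apply: nmem_maxi_inv.
  have double z : W z -> maxi V z -> z != 0 -> V (s / z ^+ 2) -> False.
    move=> Wz mz z0 h; have : P (2 * n)%N.
      apply: asboolT; exists z; split=> //.
      have -> : p0 / z ^+ (2 * n) = (p0 / s ^+ n) * (s / z ^+ 2) ^+ n.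
        rewrite exprMn exprVn -exprM; have := sl n => h1.
        have h2 : z ^+ (2 * n) != 0 by rewrite expf_neq0.
        by field; rewrite h1 h2.
      by apply: subringM => //; apply: subringX.
    by move/maxn; lia.
  have [h|h] : V (s / w ^+ 2) \/ V (s / w ^+ 2)^-1 by case: vV.
    exact: (double w).
  apply: (double (s / w)) => //; first by apply: WM => //; apply: WV.
    by rewrite mulf_neq0 // invr_eq0.
  have -> // : s / (s / w) ^+ 2 = (s / w ^+ 2)^-1.
  by field; rewrite s0 w0.
have [u up Vu'] : exists2 u, p0 = s ^+ n * u & V u /\ V u^-1.
  exists (p0 / s ^+ n); first by rewrite mulrC divfK.
  split=> //; apply: (nmaxi_unit hn) => mu.
  have Wu : W (p0 / s ^+ n) by apply: WM => //; apply: WV; apply: WX.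
  have := gen _ Wu mu => h.
  have : P n.+1.
    by apply: asboolT; exists s; split=> //; rewrite exprSr invfM mulrA.
  by move/maxn; rewrite ltnn.
exists s; split=> // w Ww Vw w0.
pose Q j := `[< V (w / s ^+ j) >].
(* The lowest nonzero coefficient of a relation among the powers of [w] is a multiple of [w] and a
   power of [p0] times a unit, so [w] has finite order. *)
have [j nQ] : exists j, ~ V (w / s ^+ j).
  have [a [Ca [l0 al0] e]] := hdep (fun l : 'I_N.+1 => WX l Ww).
  have exl : exists l, (l < N.+1)%N && (if insub l is Some l' then a l' != 0 else false).
    by exists l0; rewrite ltn_ord valK.
  have [l /andP[lN]] := ex_minnP exl; rewrite insubT => al minl.
  have [j [v [ea Vv Vv']]] := hC (Ca (Sub l lN)) al.
  exists (n * j).+1 => h.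
  have v0 : v != 0 by apply: contraNneq al => z; rewrite ea z mulr0.
  have [W' [VW' eW]] : exists W', V W' /\ a (Sub l lN) = w * W'.
    exists (- \sum_(i < N.+1 | (l < i)%N) a i * w ^+ (i - l.+1)); split.
      apply: subringN => //; apply: subring_sum => // i _; apply: subringM => //; last exact: subringX.
      have [->|ai] := eqVneq (a i) 0; first exact: subring0.
      have [ji [ui [-> Vui _]]] := hC (Ca i) ai; apply: subringM => //.
      by apply: subringX => //; apply: (maxi_sub vV).
    have wl : w ^+ l != 0 by rewrite expf_neq0.
    apply: (mulIf wl); rewrite mulrN mulNr; apply/eqP; rewrite -addr_eq0; apply/eqP.
    rewrite -[RHS]e [RHS](bigD1 (Sub l lN)) //=; congr (_ + _).
    rewrite mulr_sumr mulr_suml [RHS](bigID (fun i : 'I_N.+1 => (l < i)%N)) /=.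
    rewrite [X in _ = _ + X]big1 ?addr0 => [|i /andP[ne nl]]; last first.
      have il : (i < l)%N by rewrite ltn_neqAle -(inj_eq val_inj) /= in ne *; rewrite ne leqNgt.
      have [->|ai0] := eqVneq (a i) 0; first by rewrite mul0r.
      by have := minl i; rewrite ltn_ord valK ai0 => /(_ isT); rewrite leqNgt il.
    apply: eq_big => [i|i li]; first by rewrite -(inj_eq val_inj) /=; case: ltngtP.
    have -> : w ^+ i = w * (w ^+ (i - l.+1) * w ^+ l).
      by rewrite -exprD -exprS; congr (_ ^+ _); lia.
    by ring.
  apply: (unit_nmaxi s0 _ ms).
  have -> : s^-1 = (w / s ^+ (n * j).+1) * W' * v^-1 * (u^-1) ^+ j.
    have : w * W' = (s ^+ n * u) ^+ j * v by rewrite -eW ea up.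
    have u0 : u != 0 by apply: contraNneq p00 => z; rewrite up z mulr0.
    have uj : u ^+ j != 0 by rewrite expf_neq0.
    have snj := sl (n * j)%N.
    rewrite exprMn -exprM => ew; rewrite exprVn exprS.
    have -> : w / (s * s ^+ (n * j)) * W' / v / u ^+ j = (w * W') / (s * s ^+ (n * j)) / v / u ^+ j by ring.
    by rewrite ew; field; rewrite s0 snj v0 uj.
  case: Vu' => Vu Vu'; apply: subringM => //; last exact: subringX.
  by apply: subringM => //; apply: subringM.
have exQ : exists j, ~~ Q j by exists j; apply/asboolPn.
have [j0 /asboolPn nj0 minj] := ex_minnP exQ.
case: j0 nj0 minj => [|j0] nj0 minj; first by case: nj0; rewrite expr0 divr1.
have Vj : V (w / s ^+ j0).
  by apply: contrapT => /asboolPn /minj; rewrite ltnn.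
exists j0; split=> //; rewrite -invf_div; apply: (nmaxi_unit Vj) => m.
apply: nj0; rewrite exprSr invfM mulrA; apply: gen => //.
by apply: WM => //; apply: WV; apply: WX.
Qed.

End Discreteness.

(** * Generic points and centers *)

Section ProjectiveGeneric.
Variables (k : closedFieldType) (n : nat).
Implicit Types (X E : set 'rV[k]_n.+1) (P Q : mp n.+1 k).

Definition van X P := forall v, X v -> ev P v = 0.

Lemma van_eq_on X P : eq_on X P 0 <-> van X P.
Proof. by split=> h v /h; rewrite /ev meval0. Qed.

Lemma eq_on_van X P Q : eq_on X P Q <-> van X (P - Q).
Proof.
split=> h v /h; rewrite /ev mevalB; first by move=> ->; rewrite subrr.
by move/eqP; rewrite subr_eq0 => /eqP.
Qed.

Lemma nonzero_onP X P : nonzero_on X P <-> ~ van X P.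
Proof.
split; first by case=> v Xv /eqP ne h; apply: ne; apply: h.
by move=> /existsNP[v /not_implyP[Xv /eqP ne]]; exists v.
Qed.

Lemma vanM X P Q : van X P -> van X (Q * P).
Proof. by move=> h v /h; rewrite /ev rmorphM /= => ->; rewrite mulr0. Qed.

Lemma vanD X P Q : van X P -> van X Q -> van X (P + Q).
Proof. by move=> h h' v Xv; rewrite /ev mevalD; rewrite [X in X + _]h // [X in _ + X]h' // addr0. Qed.

Lemma van_sub X E P : E `<=` X -> van X P -> van E P.
Proof. by move=> EX h v /EX /h. Qed.

Lemma ev_scale d P (c : k) (v : 'rV[k]_n.+1) : hom d P -> ev P (c *: v) = c ^+ d * ev P v.
Proof.
move=> hP; rewrite /ev -(dhomog_scale _ _ _ hP); apply: mmap_ext => i.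
by rewrite mxE.
Qed.

Lemma zclosed_scale X (c : k) v : zclosed X -> c != 0 -> X v -> X (c *: v).
Proof.
move=> [S [hS ->]] c0 [v0 hv]; split; first by rewrite scaler_eq0 negb_or c0.
by move=> p Sp; have [d hd] := hS p Sp; rewrite (ev_scale _ _ hd) hv // mulr0.
Qed.

(** On the scalar multiples of [v], [P] is a polynomial in the scalar whose coefficients are the
    components of [P] at [v]; it has infinitely many zeros. *)
Lemma van_hc X P d : (forall (c : k) v, c != 0 -> X v -> X (c *: v)) -> van X P -> van X (hc d P).
Proof.
move=> sX hP v Xv; apply/eqP; apply: contrapT => /negP ne.
pose s := mmeasure mdeg P.
pose p := \poly_(i < s) ev (hc i P) v.
have ds : (d < s)%N by rewrite ltnNge; apply: contra ne => /hc_big ->; rewrite /ev meval0.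
have p0 : p != 0.
  by apply: contraNneq ne => /polyP/(_ d); rewrite coef_poly ds coef0 => ->.
have [|c hc] := @closed_nonroot k (p * 'X); first by rewrite mulf_neq0 // polyX_eq0.
move: hc; rewrite hornerM hornerX mulf_eq0 negb_or => /andP[pc c0].
case/eqP: pc; rewrite -[RHS](hP _ (sX _ _ c0 Xv)) /ev.
rewrite [X in _ = meval _ X](hom_decomp P) raddf_sum horner_poly.
apply: eq_bigr => i _ /=; rewrite -/(ev (hc i P) (c *: v)) (ev_scale _ _ (hc_hom i P)) mulrC.
by [].
Qed.

Lemma zclosed_form P : ishom P -> zclosed [set v : 'rV[k]_n.+1 | v != 0 /\ ev P v = 0].
Proof.
move=> hP; exists [set P]; split; first by move=> p ->.
by apply/seteqP; split=> v [v0 h]; split=> //; [move=> p ->|exact: h].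
Qed.

Lemma zclosed_neq0 X v : zclosed X -> X v -> v != 0.
Proof. by move=> [S [_ ->]] []. Qed.

Lemma van1N X : projective X -> ~ van X 1.
Proof. by move=> [_ [[v Xv] _]] /(_ v Xv); rewrite /ev meval1 => /eqP; rewrite oner_eq0. Qed.

Lemma zirr_prime X P Q : (forall v, X v -> v != 0) -> zirreducible X -> ishom P -> ishom Q ->
  van X (P * Q) -> van X P \/ van X Q.
Proof.
move=> X0 [[w Xw] irr] hP hQ hPQ.
have [|h|h] := irr _ _ (zclosed_form hP) (zclosed_form hQ).
- move=> v Xv; have := hPQ v Xv; rewrite /ev rmorphM /= => /eqP.
  by rewrite mulf_eq0 => /orP[/eqP h|/eqP h]; [left|right]; split=> //; exact: X0.
- by left=> v /h[].
- by right=> v /h[].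
Qed.

Lemma proj_prime X P Q : projective X -> ishom P -> ishom Q ->
  van X (P * Q) -> van X P \/ van X Q.
Proof. by move=> [cX iX]; apply: zirr_prime => // v; exact: zclosed_neq0. Qed.

Lemma zclosed_sub X E : zclosed X -> (forall v, E v -> v != 0) ->
  (forall P, ishom P -> van X P -> van E P) -> E `<=` X.
Proof.
move=> [S [hS eX]] E0 h v Ev; rewrite eX; split; first exact: E0.
by move=> p Sp; apply: (h p (hS p Sp)) => // w; rewrite eX => -[_]; apply.
Qed.

Definition locus (Om : fieldType) (io : {rmorphism k -> Om}) (x : 'I_n.+1 -> Om) : set 'rV[k]_n.+1 :=
  [set v | v != 0 /\ forall P, mmap io x P = 0 -> ev P v = 0].

Lemma locus_projective (Om : fieldType) (io : {rmorphism k -> Om}) (x : 'I_n.+1 -> Om) :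
  graded io x -> (exists i, x i != 0) ->
  projective (locus io x) /\ forall d P, hom d P -> van (locus io x) P -> mmap io x P = 0.
Proof.
move=> gx [i0 xi0].
have nul d P : hom d P -> van (locus io x) P -> mmap io x P = 0.
  move=> hP hv; apply/eqP; apply: contrapT => /negP P0.
  (* The extra factor [mpX k i0] forces the point found to be a nonzero vector, hence a point of the
     projective locus. *)
  have [|v [hv1 zv]] := @nullstellensatz k Om io _ x (P * mpX k i0) gx.
    by rewrite rmorphM /= mmap_var mulf_neq0.
  move: hv1; rewrite rmorphM /= mevalXU mulf_eq0 negb_or => /andP[Pv vi].
  have rv : (\row_i v i) ord0 =1 v by move=> i; rewrite mxE.
  case/eqP: Pv; have := mmap_ext (idfun : {rmorphism k -> k}) rv P; rewrite {1}/meval => <-.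
  apply: (hv (\row_i v i)); split.
    by apply/eqP => /rowP/(_ i0); rewrite !mxE => h; rewrite h eqxx in vi.
  by move=> Q /zv hQ; rewrite /ev /meval (mmap_ext (idfun : {rmorphism k -> k}) rv).
split=> //; split.
  exists [set P | ishom P /\ mmap io x P = 0]; split; first by move=> p [].
  apply/seteqP; split=> v [v0 h]; split=> //; first by move=> p [_ /h].
  move=> P rP; rewrite (hom_decomp P) /ev raddf_sum big1 //= => d _.
  by apply: h; split; [exists d; exact: hc_hom|exact: gx].
split.
  apply: contrapT => /set0P/negP; rewrite negbK => /eqP e.
  have /eqP : mmap io x 1 = 0.
    by apply: (nul 0%N); [exact: dhomog1|rewrite e].
  by rewrite rmorph1 oner_eq0.
move=> Z1 Z2 [S1 [hS1 ->]] [S2 [hS2 ->]] hZ.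
apply: contrapT => /not_orP[n1 n2].
have pick (S : set (hpoly k n)) : ~ locus io x `<=` [set v | v != 0 /\ forall p, S p -> ev p v = 0] ->
    exists p, S p /\ ~ van (locus io x) p.
  move=> nS; apply: contrapT => h; apply: nS => v lv; split; first by case: lv.
  move=> p Sp; apply: contrapT => np; apply: h; exists p; split=> // hv.
  by apply: np; apply: hv.
have [p1 [Sp1 np1]] := pick _ n1; have [p2 [Sp2 np2]] := pick _ n2.
have [d1 hp1] := hS1 _ Sp1; have [d2 hp2] := hS2 _ Sp2.
have : mmap io x (p1 * p2) = 0.
  apply: (nul (d1 + d2)%N); first exact: dhomogM.
  move=> v lv; rewrite /ev rmorphM /=; have [[_ /(_ _ Sp1) h]|[_ /(_ _ Sp2) h]] := hZ v lv.
    by move: h; rewrite /ev => ->; rewrite mul0r.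
  by move: h; rewrite /ev => ->; rewrite mulr0.
rewrite rmorphM /= => /eqP; rewrite mulf_eq0 => /orP[/eqP h|/eqP h].
  by apply: np1 => v [_]; apply.
by apply: np2 => v [_]; apply.
Qed.

Lemma projective_generic X : projective X ->
  exists (Om : fieldType) (io : {rmorphism k -> Om}) (x : 'I_n.+1 -> Om),
    [/\ graded io x, exists i, x i != 0 & forall P, mmap io x P = 0 <-> van X P].
Proof.
move=> pX; have [cX [[w Xw] iX]] := pX.
have sc (c : k) v : c != 0 -> X v -> X (c *: v) by move=> c0 Xv; exact: zclosed_scale.
have [||||||Om [io [x [gx hx]]]] := @hprime_generic k n.+1 (van X).
- exact: van1N.
- exact: vanD.
- by move=> a b; exact: vanM.
- by move=> v _; rewrite /ev meval0.
- by move=> P d; exact: van_hc.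
- by move=> a b d e ha hb; apply: proj_prime => //; [exists d|exists e].
exists Om, io, x; split=> //.
have /rV0Pn[i wi] := zclosed_neq0 cX Xw; exists i; apply: contraNneq wi => xi0.
by have /hx/(_ w Xw) : mmap io x (mpX k i) = 0; rewrite ?mmap_var // /ev mevalXU => ->.
Qed.

Lemma projective_locus X (Om : fieldType) (io : {rmorphism k -> Om}) (x : 'I_n.+1 -> Om) :
  zclosed X -> (forall d P, hom d P -> mmap io x P = 0 <-> van X P) ->
  graded io x -> X = locus io x.
Proof.
move=> cX hx gx; have [S [hS eX]] := cX; apply/seteqP; split=> v.
  move=> Xv; split; first exact: zclosed_neq0 Xv.
  move=> P rP; rewrite (hom_decomp P) /ev raddf_sum big1 //= => d _.
  by apply: (proj1 (hx d _ (hc_hom d P))) => //; exact: gx.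
move=> [v0 h]; rewrite eX; split=> // p Sp; apply: h; have [d hd] := hS p Sp.
by apply/(hx d _ hd) => w; rewrite eX => -[_]; apply.
Qed.

End ProjectiveGeneric.

(** * Centers of valuation rings on projective varieties *)

Section Centers.
Variables (k : closedFieldType) (Om : fieldType) (io : {rmorphism k -> Om}) (n : nat).
Variables (V : set Om) (vV : valring V) (kV : overk io V).
Let sV : subring V. Proof. by case: vV. Qed.
Variables (z : 'I_n.+1 -> Om) (i0 : 'I_n.+1).
Hypotheses (Vz : forall i, V (z i)) (z1 : z i0 = 1).
Notation evz := (mmap io z).

Lemma V_evz P : V (evz P).
Proof. exact: (V_mmap vV kV). Qed.

Definition is_center (E : set 'rV[k]_n.+1) := projective E /\
  forall d P, hom d P -> van E P <-> maxi V (evz P).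

(** The polynomials all of whose components are nonunits at [z] form a homogeneous prime, and [E] is
    the locus of its generic point. The second clause is kept in order to recognize points of the
    center later. *)
Lemma exists_place_center : exists E, is_center E /\
  forall v, v != 0 -> (forall d P, hom d P -> maxi V (evz P) -> ev P v = 0) -> E v.
Proof.
pose I := [set P : mp n.+1 k | forall d, maxi V (evz (hc d P))].
have If d P : hom d P -> I P <-> maxi V (evz P).
  move=> hP; split; first by move=> /(_ d); rewrite (hom_hc _ hP) eqxx.
  by move=> m e; rewrite (hom_hc _ hP); case: ifP => // _; rewrite rmorph0; left.
have [||||||Om' [io' [x [gx hx]]]] := @hprime_generic k n.+1 I.
- have h1 : hom 0%N (1 : mp n.+1 k) by exact: dhomog1.
  by move/(If _ _ h1); rewrite rmorph1 => /(maxi1 vV).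
- by move=> a b ha hb d; rewrite raddfD rmorphD /=; apply: (maxiD vV).
- move=> a b ha d; rewrite hcM_gen rmorph_sum; apply: (maxi_sum vV) => i _ /=.
  by case: ifP => _; [rewrite rmorphM; apply: (maxiM vV); [exact: V_evz|exact: ha]|rewrite rmorph0; left].
- by move=> d; rewrite raddf0 rmorph0; left.
- by move=> P d /= IP e; rewrite (hom_hc _ (hc_hom d P)); case: ifP => _; [exact: IP|rewrite rmorph0; left].
- move=> a b d e ha hb /(If _ _ (dhomogM ha hb)); rewrite rmorphM /=.
  by move=> /(maxi_prime vV (V_evz a) (V_evz b))[/(If _ _ ha)|/(If _ _ hb)]; [left|right].
have hXi (i : 'I_n.+1) : hom 1%N (mpX k i) by rewrite dhomogX; apply/eqP; exact: mdeg1.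
have [|pE hE] := locus_projective gx.
  exists i0; apply/eqP => e; apply: (maxi1 vV); rewrite -z1 -(mmap_var io z).
  by apply: (proj1 (If _ _ (hXi i0))); apply: (proj1 (hx _)); rewrite mmap_var.
exists (locus io' x); split.
  split=> // d P hP; split=> [h|/(If _ _ hP)/hx h]; last by move=> v [_]; apply.
  by have IP := proj1 (hx P) (hE d P hP h); exact: (proj1 (If _ _ hP) IP).
move=> v v0 h; split=> // P /hx IP.
rewrite (hom_decomp P) /ev raddf_sum big1 //= => d _.
by apply: (h d); [exact: hc_hom|exact: IP].
Qed.

(** Homogenization at a point with [z i0 = 1]. *)
Definition hz D (a : mp n.+1 k) : mp n.+1 k :=
  \sum_(d < D.+1) hc d a * mpX k i0 ^+ (D - d).

Lemma hX1 (i : 'I_n.+1) : hom 1%N (mpX k i).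
Proof. by rewrite dhomogX; apply/eqP; exact: mdeg1. Qed.

Lemma hz_hom D a : hom D (hz D a).
Proof.
rewrite /hz rpred_sum // => d _; have dD : (d <= D)%N by rewrite -ltnS.
rewrite -[X in hom X _](subnKC dD); apply: dhomogM; first exact: hc_hom.
by apply: hom1X; exact: hX1.
Qed.

Lemma hz_ev D a : (mmeasure mdeg a <= D.+1)%N -> evz (hz D a) = evz a.
Proof.
move=> le; rewrite {2}(hom_decomp a) (big_ord_widen _ (fun d => hc d a) le) !rmorph_sum [RHS]big_mkcond /=.
apply: eq_bigr => d _; rewrite rmorphM rmorphXn /= mmap_var z1 expr1n mulr1.
by case: ltnP => // h; rewrite hc_big // rmorph0.
Qed.

Definition kfun w := exists d (N M : mp n.+1 k), [/\ hom d N, hom d M, evz M != 0 & w = evz N / evz M].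

(** The local ring at the center: a form does not vanish identically on the center exactly when it
    is a unit at [z]. *)
Definition OE w := exists d (N M : mp n.+1 k),
  [/\ hom d N, hom d M, ~ maxi V (evz M) & w = evz N / evz M].

Lemma OE_kfun w : OE w -> kfun w.
Proof. by case=> d [N [M [hN hM nM ->]]]; exists d, N, M; split=> //; exact: nmaxi_neq0 nM. Qed.

Lemma OE_ev a : OE (evz a).
Proof.
set D := mmeasure mdeg a.
exists D, (hz D a), (mpX k i0 ^+ D); split; first exact: hz_hom.
- by apply: hom1X; exact: hX1.
- by rewrite rmorphXn /= mmap_var z1 expr1n; exact: maxi1.
- by rewrite rmorphXn /= mmap_var z1 expr1n divr1 hz_ev.
Qed.

Lemma nmaxiM x y : V x -> V y -> ~ maxi V x -> ~ maxi V y -> ~ maxi V (x * y).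
Proof. by move=> Vx Vy nx ny /(maxi_prime vV Vx Vy)[]. Qed.

Lemma OEB w w' : OE w -> OE w' -> OE (w - w').
Proof.
case=> d [N [M [hN hM nM ->]]] [d' [N' [M' [hN' hM' nM' ->]]]].
exists (d + d')%N, (N * M' - N' * M), (M * M'); split.
- by rewrite rpredB //; [|rewrite addnC]; apply: dhomogM.
- exact: dhomogM.
- by rewrite rmorphM; apply: nmaxiM => //; exact: V_evz.
- have := nmaxi_neq0 nM; have := nmaxi_neq0 nM'.
  by rewrite rmorphB !rmorphM /= => h h'; field; rewrite h h'.
Qed.

Lemma OEM w w' : OE w -> OE w' -> OE (w * w').
Proof.
case=> d [N [M [hN hM nM ->]]] [d' [N' [M' [hN' hM' nM' ->]]]].
exists (d + d')%N, (N * N'), (M * M'); split; try exact: dhomogM.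
- by rewrite rmorphM; apply: nmaxiM => //; exact: V_evz.
- by rewrite !rmorphM /= mulf_div.
Qed.

Lemma OEV w : OE w -> ~ maxi V w -> OE w^-1.
Proof.
case=> d [N [M [hN hM nM e]]] nw; exists d, M, N; split=> //; last by rewrite e invf_div.
move=> mN; apply: nw; rewrite e; apply: (maxiMl vV) => //.
exact: (nmaxi_unit (V_evz M)).
Qed.

Lemma kfunD w w' : kfun w -> kfun w' -> kfun (w + w').
Proof.
case=> d [N [M [hN hM nM ->]]] [d' [N' [M' [hN' hM' nM' ->]]]].
exists (d + d')%N, (N * M' + N' * M), (M * M'); split.
- by rewrite rpredD //; [|rewrite addnC]; apply: dhomogM.
- exact: dhomogM.
- by rewrite rmorphM mulf_neq0.
- by rewrite rmorphD !rmorphM /=; field; rewrite nM nM'.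
Qed.

Lemma kfunM w w' : kfun w -> kfun w' -> kfun (w * w').
Proof.
case=> d [N [M [hN hM nM ->]]] [d' [N' [M' [hN' hM' nM' ->]]]].
exists (d + d')%N, (N * N'), (M * M'); split; try exact: dhomogM.
- by rewrite rmorphM mulf_neq0.
- by rewrite !rmorphM /= mulf_div.
Qed.

Lemma kfunX w e : kfun w -> kfun (w ^+ e).
Proof.
move=> kw; elim: e => [|e IH]; last by rewrite exprS; exact: kfunM.
by rewrite expr0 -(rmorph1 evz); apply: OE_kfun; exact: OE_ev.
Qed.

Lemma kfun_ev a : kfun (evz a).
Proof. by apply: OE_kfun; exact: OE_ev. Qed.

Lemma kfunV w : kfun w -> kfun w^-1.
Proof.
have [->|w0] := eqVneq w 0; first by rewrite invr0 -(rmorph0 evz) => _; exact: kfun_ev.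
case=> d [N [M [hN hM nM e]]]; exists d, M, N; split=> //; last by rewrite e invf_div.
by apply: contraNneq w0 => z'; rewrite e z' mul0r.
Qed.

Section Normal.
Variables (Y E : set 'rV[k]_n.+1).
Hypotheses (nY : normal Y) (hY : forall d P, hom d P -> evz P = 0 <-> van Y P)
  (EY : E `<=` Y) (cE : is_center E).

(** Homogenizing all coefficients to one degree and clearing the denominator of [w] turns the
    equation into the one in [normal], read at a point of the center where the leading coefficient
    is nonzero. *)
Lemma normal_center w (F : {poly mp n.+1 k}) : kfun w -> ~ maxi V (evz (lead_coef F)) ->
  (map_poly evz F).[w] = 0 -> OE w.
Proof.
case=> d [P [Q [hP hQ Q0 ew]]] nl rF; pose r := (size F).-1.
have F0 : F != 0.
  by apply/eqP => F0; apply: nl; rewrite F0 lead_coef0 rmorph0; left.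
have sF : size F = r.+1 by rewrite /r prednK // size_poly_gt0.
pose D := \max_(i < r.+1) mmeasure mdeg F`_i.
have hD i : (i < r.+1)%N -> (mmeasure mdeg F`_i <= D.+1)%N.
  move=> ir; apply: leqW.
  exact: (leq_bigmax (F := fun i : 'I_r.+1 => mmeasure mdeg F`_i) (Ordinal ir)).
have [pE hE] := cE.
have [x Ex Sx] : exists2 x, E x & ev (hz D (lead_coef F)) x != 0.
  apply/nonzero_onP => /(hE D _ (hz_hom D _)); rewrite hz_ev // lead_coefE sF /= hD //.
have nQ : nonzero_on Y Q by apply/nonzero_onP => /(hY hQ)/eqP; rewrite (negbTE Q0).
have [] := nY (EY Ex) hP hQ nQ.
  exists r, D, (hz D (lead_coef F)), (fun i => hz D F`_i); split=> //.
  - exact: hz_hom.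
  - by move=> i; exact: hz_hom.
  apply/van_eq_on; rewrite lead_coefE sF /=.
  have hT : hom (D + d * r) (hz D F`_r * P ^+ r + \sum_(i < r) hz D F`_i * P ^+ i * Q ^+ (r - i)).
    rewrite rpredD //.
      by apply: dhomogM; [exact: hz_hom|apply: dhomogMn].
    rewrite rpred_sum // => i _; rewrite -mulrA; apply: dhomogM; first exact: hz_hom.
    rewrite -[X in (d * X)%N](subnKC (ltnW (ltn_ord i))) mulnDr.
    by apply: dhomogM; apply: dhomogMn.
  apply/(hY hT).
  have Qr : evz Q ^+ r != 0 by rewrite expf_neq0.
  transitivity (evz F`_r * evz P ^+ r + \sum_(i < r) evz F`_i * evz P ^+ i * evz Q ^+ (r - i)).
    rewrite rmorphD; congr (_ + _).
      by rewrite rmorphM rmorphXn; congr (_ * _); apply: hz_ev; exact: hD.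
    rewrite rmorph_sum; apply: eq_bigr => i _; rewrite !rmorphM !rmorphXn /=; congr (_ * _ * _).
    by apply: hz_ev; apply: hD; rewrite ltnS ltnW.
  transitivity (evz Q ^+ r * (map_poly evz F).[w]); last by rewrite rF mulr0.
  rewrite (horner_map_wide _ _ (n := r.+1)) ?sF // big_ord_recr /= mulrDr addrC ew exprMn exprVn /=; congr (_ + _); last first.
    by field.
  rewrite mulr_sumr; apply: eq_bigr => i _.
  rewrite exprMn exprVn.
  have -> : evz Q ^+ r = evz Q ^+ (r - i) * evz Q ^+ i by rewrite -exprD subnK // ltnW.
  have Qi : evz Q ^+ i != 0 by rewrite expf_neq0.
  by field.
move=> e [P' [Q' [hP' hQ' Q'x eqY]]]; exists e, P', Q'; split=> //.
  by move/(hE e _ hQ')/(_ x Ex)/eqP; rewrite (negbTE Q'x).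
have nQ'0 : evz Q' != 0.
  apply/eqP => h; move: Q'x; rewrite (proj2 (hE e _ hQ') _ x Ex) ?eqxx //.
  by rewrite h; left.
have := proj1 (eq_on_van Y (P * Q') (P' * Q)) eqY.
move=> /(hY (d := (d + e)%N)); rewrite rmorphB !rmorphM /= => h.
have {}h : evz P * evz Q' = evz P' * evz Q.
  apply/eqP; rewrite -subr_eq0; apply/eqP; apply: h.
  by rewrite rpredB //; [|rewrite addnC]; apply: dhomogM.
by rewrite ew; apply/eqP; rewrite eqr_div // h.
Qed.

(** If [sum a_i w^i = 0], the elements [sum_(m >= l) a_m w^(m-l)] are integral over
    the ring of the [a_i]; this exhibits [w] as a quotient of elements of the
    normal local ring. *)
Lemma normal_center_primitive w (F : {poly mp n.+1 k}) : kfun w -> V w ->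
  (map_poly evz F).[w] = 0 -> (exists i, ~ maxi V (evz F`_i)) -> OE w.
Proof.
move=> kw Vw rF [im nim].
have [->|w0] := eqVneq w 0; first by rewrite -(rmorph0 evz); exact: OE_ev.
pose s := size F.
pose B l := \sum_(m < s) (if (l <= m)%N then evz F`_m * w ^+ (m - l) else 0).
have B0 : B 0%N = 0.
  by rewrite -rF (horner_map_wide _ _ (leqnn s)); apply: eq_bigr => m _; rewrite /= subn0.
have Bs l : B l = evz F`_l + w * B l.+1.
  have [ls|sl] := ltnP l s; last first.
    rewrite /B !big1 ?nth_default // ?rmorph0 ?mulr0 ?addr0 // => m _.
      by rewrite leqNgt (leq_trans (ltn_ord m)) // ltnW.
    by rewrite leqNgt (leq_trans (ltn_ord m)) // ltnW.
  rewrite /B (bigD1 (Ordinal ls)) //= leqnn subnn expr0 mulr1; congr (_ + _).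
  rewrite mulr_sumr [RHS](bigD1 (Ordinal ls)) //= ltnn mulr0 add0r; apply: eq_bigr => m ml.
  have ml' : (m : nat) <> l by move=> h; case/eqP: ml; exact: val_inj.
  case: (ltngtP l m) => [lm|h|h]; [|by rewrite mulr0|by case: ml'].
  by rewrite mulrCA -exprS -subSn // subSS.
have kB l : kfun (B l).
  apply: (big_ind kfun); first by rewrite -(rmorph0 evz); exact: kfun_ev.
    exact: kfunD.
  move=> m _; case: ifP => _; last by rewrite -(rmorph0 evz); exact: kfun_ev.
  by apply: kfunM; [exact: kfun_ev|exact: kfunX].
have OB l : OE (B l).
  pose Pm := [set a : mp n.+1 k | maxi V (evz a)].
  have [||||||G [nG rG]] := @integral_local Om _ evz Pm _ _ _ _ _ (B l).
  - by rewrite /Pm /= rmorph1; exact: maxi1.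
  - by move=> a b ha hb; rewrite /Pm /= rmorphD; apply: (maxiD vV).
  - by move=> a b ha; rewrite /Pm /= rmorphM; apply: (maxiM vV) => //; exact: V_evz.
  - by move=> a b; rewrite /Pm /= rmorphM => /(maxi_prime vV (V_evz a) (V_evz b)).
  - by move=> a ha; rewrite /Pm /= ha; left.
  - move=> V' vV' hV' _; have sV' : subring V' by case: vV'.
    have [V'w|V'w] : V' w \/ V' w^-1 by case: vV'.
      apply: (subring_sum sV') => m _; case: ifP => _; last exact: subring0.
      by apply: (subringM sV'); [exact: hV'|apply: (subringX sV')].
    have -> : B l = - \sum_(m < s | (m < l)%N) evz F`_m * w^-1 ^+ (l - m).
      have wl : w ^+ l != 0 by rewrite expf_neq0.
      apply: (mulIf wl); rewrite mulNr; apply/eqP; rewrite -addr_eq0; apply/eqP.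
      rewrite -[RHS]B0 /B !mulr_suml [in X in _ + X = _]big_mkcond -big_split /=.
      apply: eq_bigr => m _; rewrite subn0; case: (leqP l m) => lm.
        by rewrite addr0 -mulrA -exprD subnK.
      rewrite mul0r add0r -mulrA exprVn; congr (_ * _).
      have -> : w ^+ l = w ^+ (l - m) * w ^+ m by rewrite -exprD subnK // ltnW.
      by rewrite mulKf // expf_neq0.
    apply: (subringN sV'); apply: (subring_sum sV') => m _.
    by apply: (subringM sV'); [exact: hV'|apply: (subringX sV')].
  - exact: (normal_center (kB l) nG rG).
have [l nl] : exists l, ~ maxi V (B l.+1).
  apply: contrapT => /forallNP h; apply: nim.
  have -> : evz F`_im = B im - w * B im.+1 by rewrite (Bs im) addrK.
  apply: (maxiB vV).
    by case: (im) => [|l]; [rewrite B0; left|apply: contrapT; exact: h].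
  by apply: (maxiM vV) => //; apply: contrapT; exact: h.
have -> : w = (B l - evz F`_l) * (B l.+1)^-1.
  by rewrite (Bs l) addrC addKr mulfK // (nmaxi_neq0 nl).
apply: OEM; first by apply: OEB => //; exact: OE_ev.
exact: OEV.
Qed.

End Normal.

(** If [E'] lay strictly between, take [f] vanishing on [E'] but not on [Y] and [g] vanishing on [E]
    but not on [E']. Powers of equal value make [f ^+ b / g ^+ a] a unit of the discrete ring, hence
    a quotient of forms not vanishing on [E]; restricting to [E'], where [f] is zero, is
    contradictory. *)
Lemma center_prime_divisor (Y E : set 'rV[k]_n.+1) s :
  projective Y -> (forall d P, hom d P -> evz P = 0 <-> van Y P) ->
  E `<=` Y -> is_center E -> (exists d P, [/\ hom d P, van E P & ~ van Y P]) ->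
  (forall w, kfun w -> V w -> OE w) ->
  kfun s -> s != 0 ->
  (forall w, kfun w -> V w -> w != 0 -> exists j : nat, V (w / s ^+ j) /\ V (s ^+ j / w)) ->
  prime_divisor Y E.
Proof.
move=> pY hY EY [pE hE] [d0 [P0 [hP0 EP0 YP0]]] hO ks s0 hs; split=> //.
  by split=> // YE; apply: YP0; exact: van_sub EP0.
move=> E' pE' EE' E'Y; apply: contrapT => /not_orP[ne1 ne2].
have ex (A A' : set 'rV[k]_n.+1) : projective A -> A `<=` A' -> projective A' -> A' <> A ->
    exists d P, [/\ hom d P, van A P & ~ van A' P].
  move=> pA AA' pA' ne; apply: contrapT => h; apply: ne; apply/seteqP; split=> //.
  apply: zclosed_sub; first by case: pA.
    by move=> v; apply: zclosed_neq0; case: pA'.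
  by move=> P [d hP] hA; apply: contrapT => nA'; apply: h; exists d, P.
have [df [f [hf E'f Yf]]] : exists d P, [/\ hom d P, van E' P & ~ van Y P].
  by apply: ex => // e; apply: ne2.
have [dg [g [hg Eg E'g]]] := ex _ _ pE EE' pE' ne1.
have mf : maxi V (evz f) by apply/(hE _ _ hf); exact: van_sub E'f.
have mg : maxi V (evz g) by apply/(hE _ _ hg).
have f0 : evz f != 0 by apply/eqP => /(hY _ _ hf).
have g0 : evz g != 0 by apply/eqP => /(hY _ _ hg) h; apply: E'g; exact: van_sub h.
have [a [a1 a2]] := hs _ (kfun_ev f) (V_evz f) f0.
have [b [b1 b2]] := hs _ (kfun_ev g) (V_evz g) g0.
have a0 : (0 < a)%N.
  by case: a a1 a2 => // _; rewrite expr0 div1r => h; case: (unit_nmaxi f0 h mf).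
have sl j : s ^+ j != 0 by rewrite expf_neq0.
pose w := evz f ^+ b / evz g ^+ a.
have fb : evz f ^+ b != 0 by rewrite expf_neq0.
have ga : evz g ^+ a != 0 by rewrite expf_neq0.
have Vw : V w.
  have -> : w = (evz f / s ^+ a) ^+ b * (s ^+ b / evz g) ^+ a.
    rewrite /w !exprMn !exprVn -!exprM [(b * a)%N]mulnC.
    by have := sl (a * b)%N => h; field; rewrite h ga.
  by apply: subringM => //; apply: subringX.
have Vw' : V w^-1.
  have -> : w^-1 = (s ^+ a / evz f) ^+ b * (evz g / s ^+ b) ^+ a.
    rewrite /w invf_div !exprMn !exprVn -!exprM [(b * a)%N]mulnC.
    by have := sl (a * b)%N => h; field; rewrite h fb.
  by apply: subringM => //; apply: subringX.
have kw : kfun w.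
  by apply: kfunM; [|apply: kfunV]; apply: kfunX; exact: kfun_ev.
have w0 : w != 0 by rewrite mulf_neq0 // invr_eq0.
have [e [N [M [hN hM nM ew]]]] := hO _ kw Vw.
have nN : ~ maxi V (evz N).
  move=> mN; apply: (unit_nmaxi w0 Vw'); rewrite ew; apply: (maxiMl vV) => //.
  exact: (nmaxi_unit (V_evz M)).
have M0 := nmaxi_neq0 nM.
pose T1 := f ^+ b * M * mpX k i0 ^+ (dg * a).
pose T2 := g ^+ a * N * mpX k i0 ^+ (df * b).
have hXn m : hom m (mpX k i0 ^+ m).
  by apply: hom1X; exact: hX1.
have hT1 : hom (df * b + e + dg * a) T1.
  by apply: dhomogM => //; apply: dhomogM => //; exact: dhomogMn.
have hT2 : hom (df * b + e + dg * a) T2.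
  have -> : (df * b + e + dg * a = dg * a + e + df * b)%N by rewrite -addnA [(e + _)%N]addnC [RHS]addnC.
  by apply: dhomogM => //; apply: dhomogM => //; exact: dhomogMn.
have hT : hom (df * b + e + dg * a) (T1 - T2) by rewrite rpredB.
have vT : van Y (T1 - T2).
  apply/(hY _ _ hT); rewrite rmorphB !rmorphM !rmorphXn /= mmap_var z1 !expr1n !mulr1.
  apply/eqP; rewrite subr_eq0; apply/eqP.
  have : evz f ^+ b / evz g ^+ a = evz N / evz M by rewrite -ew.
  by move/eqP; rewrite eqr_div // => /eqP ->; rewrite mulrC.
have vT2 : van E' T2.
  move=> v E'v; have := vT v (E'Y _ E'v); rewrite /ev mevalB.
  have -> : meval (v ord0) T1 = 0.
    rewrite !rmorphM !rmorphXn /=; have := E'f v E'v; rewrite /ev => ->.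
    have [b' eb] : exists b', b = b'.+1.
      case: (b) b1 b2 => [|b' _ _]; last by exists b'.
      by rewrite expr0 div1r => _ h; case: (unit_nmaxi g0 h mg).
    by rewrite eb expr0n /= !mul0r.
  by rewrite sub0r => /eqP; rewrite oppr_eq0 => /eqP.
have prim P Q : ishom P -> ishom Q -> van E' (P * Q) -> van E' P \/ van E' Q by exact: proj_prime.
have primX P m : ishom P -> van E' (P ^+ m) -> van E' P.
  move=> hP; elim: m => [|m IH].
    by rewrite expr0 => /(van1N pE').
  rewrite exprS => /prim[] //; case: hP => d hP; exists (d * m)%N; exact: dhomogMn.
have nE P d : hom d P -> ~ maxi V (evz P) -> ~ van E' P.
  by move=> hP nP h; apply: nP; apply/(hE _ _ hP); exact: van_sub h.
have [] := prim _ _ _ _ vT2.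
- exists (dg * a + e)%N; apply: dhomogM => //; exact: dhomogMn.
- by eexists; exact: hXn.
- move=> /prim[].
  + by exists (dg * a)%N; exact: dhomogMn.
  + by exists e.
  + by move/primX => /(_ (ex_intro _ dg hg)).
  + exact: (nE _ _ hN).
- move=> /primX => /(_ (ex_intro _ 1%N (hX1 i0))).
  by apply: (nE _ _ (hX1 i0)); rewrite mmap_var z1; exact: maxi1.
Qed.

End Centers.

(** * Hilbert functions *)

Notation mnm n := (multinom n).
Notation mX k m := (mpolyX k m).

Section Monomials.
Variable n : nat.
Implicit Types (m g : mnm n.+1) (gs : seq (mnm n.+1)).

(** Induction on the number of compared coordinates. If the next exponent is at least the maximum
    [A] over the basis found so far, that basis suffices; each of the finitely many smaller values
    is a slice of its own. *)
Lemma dickson (S : set (mnm n.+1)) l : (l <= n.+1)%N -> exists s : seq (mnm n.+1),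
  (forall g, g \in s -> S g) /\
  forall m, S m -> exists2 g, g \in s & forall i : 'I_n.+1, (i < l)%N -> (g i <= m i)%N.
Proof.
elim: l S => [|l IH] S ln.
  have [[w Sw]|nS] := pselect (S !=set0).
    exists [:: w]; split; first by move=> g; rewrite inE => /eqP ->.
    by move=> m _; exists w; [exact: mem_head|].
  by exists [::]; split=> // m Sm; case: nS; exists m.
have [s0 [s0S hs0]] := IH S (ltnW ln).
pose i := Ordinal ln; pose A := \max_(g <- s0) g i.
have [F hF] := choice (fun a => IH [set m | S m /\ m i = a] (ltnW ln)).
exists (s0 ++ flatten [seq F a | a <- iota 0 A]); split.
  move=> g; rewrite mem_cat => /orP[/s0S //|/flatten_mapP[a _ ga]].
  by have [/(_ _ ga)[]] := hF a.
move=> m Sm; have [Am|mA] := leqP A (m i).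
  have [g gs hg] := hs0 m Sm; exists g; first by rewrite mem_cat gs.
  move=> j; rewrite ltnS leq_eqVlt => /orP[/eqP e|/hg //].
  have -> : j = i by exact: val_inj.
  by apply: leq_trans Am; rewrite /A (big_rem g) //= leq_maxl.
have [_ /(_ m (conj Sm erefl))[g gF hg]] := hF (m i).
exists g; first by rewrite mem_cat; apply/orP; right; apply/flatten_mapP; exists (m i); rewrite ?mem_iota.
move=> j; rewrite ltnS leq_eqVlt => /orP[/eqP e|/hg //].
have -> : j = i by exact: val_inj.
by have [/(_ _ gF)[_ ->]] := hF (m i).
Qed.

Definition mons e : seq (mnm n.+1) :=
  [seq Multinom [tuple (tnth t i : nat) | i < n.+1] |
   t : n.+1.-tuple 'I_e.+1 <- enum [set t : n.+1.-tuple 'I_e.+1 | (\sum_(i <- t) i == e)%N]%SET].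

Lemma mons_size e : size (mons e) = 'C(n + e, n).
Proof. by rewrite size_map -cardE card_ord_partitions. Qed.

Lemma mons_uniq e : uniq (mons e).
Proof.
rewrite map_inj_in_uniq ?enum_uniq // => t t' _ _ /mnmP h.
by apply: eq_from_tnth => i; apply: val_inj; have := h i; rewrite !multinomE !tnth_mktuple.
Qed.

Lemma mem_mons e m : (m \in mons e) = (mdeg m == e).
Proof.
apply/mapP/eqP => [[t]|hm].
  rewrite mem_enum inE => /eqP h ->; rewrite mdegE -[RHS]h big_tuple.
  by apply: eq_bigr => i _; rewrite multinomE tnth_mktuple.
have le i : (m i < e.+1)%N.
  by rewrite ltnS -hm mdegE (bigD1 i) //= leq_addr.
exists [tuple (Ordinal (le i)) | i < n.+1].
  rewrite mem_enum inE big_tuple -[X in _ == X]hm mdegE; apply/eqP.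
  by apply: eq_bigr => i _; rewrite tnth_mktuple.
by apply/mnmP => i; rewrite multinomE !tnth_mktuple.
Qed.

Definition undiv gs m := ~~ has (fun g => mpoly.lem g m) gs.

Definition cnt gs e := count (undiv gs) (mons e).

Lemma count_split (T : Type) (p q : pred T) (s : seq T) :
  count p s = (count (predI p q) s + count (predI p (predC q)) s)%N.
Proof. by elim: s => //= x s ->; case: (p x); case: (q x); rewrite /= ?addnS ?addSn ?addnA. Qed.

Lemma undiv_cons g gs m : undiv (g :: gs) m = ~~ mpoly.lem g m && undiv gs m.
Proof. by rewrite /undiv /= negb_or. Qed.

(** Multiples of [g] avoiding [gs] correspond, after removing [g], to monomials avoiding the
    truncated differences; the truncation accounts for common factors. *)
Lemma cnt_cons g gs e : (mdeg g <= e)%N ->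
  (cnt (g :: gs) e + cnt [seq mnm_sub g' g | g' <- gs] (e - mdeg g) = cnt gs e)%N.
Proof.
move=> ge; rewrite /cnt [RHS](count_split _ (mpoly.lem g)) addnC; congr (_ + _)%N; last first.
  by apply: eq_count => m; rewrite undiv_cons /= andbC.
rewrite -!size_filter -(size_map (fun m => mnm_add m g)); apply: perm_size.
apply: uniq_perm.
- rewrite map_inj_uniq ?filter_uniq ?mons_uniq // => m m' /mnmP h.
  by apply/mnmP => i; have := h i; rewrite !mnmDE => /addIn.
- by rewrite filter_uniq ?mons_uniq.
have hs m : undiv [seq mnm_sub g' g | g' <- gs] m = undiv gs (mnm_add m g).
  rewrite /undiv has_map; congr (~~ _); apply: eq_has => g' /=.
  apply/mnm_lepP/mnm_lepP => h i; have := h i.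
    by rewrite mnmBE mnmDE leq_subLR addnC.
  by rewrite mnmBE mnmDE leq_subLR addnC.
move=> m; rewrite mem_filter mem_mons /=; apply/mapP/andP.
  case=> m'; rewrite mem_filter mem_mons hs => /andP[u /eqP d] ->; split.
    by rewrite u lem_addl.
  by rewrite mdegD d subnK.
case=> /andP[u gm] /eqP d; exists (mnm_sub m g); last by rewrite submK.
rewrite mem_filter mem_mons hs submK // u -d /=.
by rewrite -{2}(submK gm) mdegD addnK.
Qed.

Lemma cnt_nil e : cnt [::] e = 'C(n + e, n).
Proof. by rewrite /cnt -mons_size; apply/eqP; rewrite -all_count; apply/allP. Qed.

Definition evpoly (f : nat -> nat) := exists (p : {poly rat}) (e0 : nat),
  forall e, (e0 <= e)%N -> p.[e%:R] = (f e)%:R.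

End Monomials.

Definition binp n : {poly rat} := n`!%:R^-1 *: \prod_(i < n) ('X + i.+1%:R%:P).

Lemma fact_neq0 (F : numDomainType) n : n`!%:R != 0 :> F.
Proof. by rewrite pnatr_eq0 -lt0n fact_gt0. Qed.

Lemma binp_eval n e : (binp n).[e%:R] = 'C(n + e, n)%:R.
Proof.
rewrite /binp hornerZ horner_prod; apply: (mulfI (fact_neq0 rat n)).
rewrite mulVKf ?fact_neq0 // -natrM mulnC bin_ffact ffact_prod natr_prod.
rewrite (reindex_inj rev_ord_inj) /=; apply: eq_bigr => i _.
rewrite !hornerE -natrD; congr (_%:R).
by have := ltn_ord i; move: (nat_of_ord i) => j; lia.
Qed.

Lemma size_binp_prod n : size (\prod_(i < n) ('X + i.+1%:R%:P : {poly rat})) = n.+1.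
Proof.
rewrite size_prod; last by move=> i _; rewrite -size_poly_eq0 size_XaddC.
rewrite (eq_bigr (fun _ => 2%N)) => [|i _]; last by rewrite size_XaddC.
by rewrite sum_nat_const card_ord; lia.
Qed.

Lemma size_binp n : size (binp n) = n.+1.
Proof. by rewrite size_scale ?invr_eq0 ?fact_neq0 // size_binp_prod. Qed.

Lemma lead_binp n : lead_coef (binp n) = n`!%:R^-1.
Proof.
rewrite lead_coefZ lead_coef_prod big1 ?mulr1 // => i _.
by rewrite lead_coefXaddC.
Qed.

Lemma evpoly_cnt n (gs : seq (mnm n.+1)) : evpoly (cnt gs).
Proof.
move: {2}(size gs) (leqnn (size gs)) => s; elim: s gs => [|s IH] [|g gs] //= hs.
- by exists (binp n), 0%N => e _; rewrite binp_eval cnt_nil.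
- by exists (binp n), 0%N => e _; rewrite binp_eval cnt_nil.
have [p [e0 hp]] := IH gs hs.
have [|q [e1 hq]] := IH [seq mnm_sub g' g | g' <- gs]; first by rewrite size_map.
exists (p - (q \Po ('X - (mdeg g)%:R%:P))), (e0 + (e1 + mdeg g))%N => e he.
have [h1 h2 h3] : [/\ (e0 <= e)%N, (mdeg g <= e)%N & (e1 <= e - mdeg g)%N].
  by move: (mdeg g) he => d he; split; lia.
rewrite hornerD hornerN horner_comp !hornerE -natrB // hp // hq // -(cnt_cons gs h2) natrD.
by rewrite addrK.
Qed.

(** Finite differences: [p(X + 1) - p] is again integer-valued, of degree one less, and its leading
    coefficient is multiplied by the degree. *)
Lemma int_valued_lead d (p : {poly rat}) e0 : (size p <= d.+1)%N ->
  (forall e : nat, (e0 <= e)%N -> p.[e%:R] \is a Num.int) -> d`!%:R * p`_d \is a Num.int.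
Proof.
elim: d p => [|d IH] p sp hp.
  have := hp _ (leqnn e0); rewrite mul1r (size1_polyC sp) hornerC.
  by rewrite coefC.
pose q := (p \Po ('X + 1%:P)) - p.
have cq j : (p \Po ('X + 1%:P))`_j = \sum_(i < d.+2) p`_i * 'C(i, j)%:R.
  rewrite coef_comp_poly (big_ord_widen _ (fun i => p`_i * (('X + 1%:P) ^+ i)`_j) sp) big_mkcond /=.
  apply: eq_bigr => i _; case: ltnP => ip; last by rewrite nth_default ?mul0r.
  congr (_ * _); rewrite polyC1 exprD1n coef_sum.
  have [ji|ij] := leqP j i.
    rewrite (bigD1 (inord j)) //= inordK // coefMn coefXn eqxx big1 ?addr0 // => l.
    by rewrite -val_eqE /= inordK // coefMn coefXn eq_sym => /negbTE ->; rewrite mul0rn.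
  rewrite bin_small // big1 // => l _; rewrite coefMn coefXn.
  by rewrite gtn_eqF ?mul0rn // (leq_trans (ltn_ord l)).
have q0 j : (d < j)%N -> q`_j = 0.
  move=> dj; rewrite coefB cq; have [e|dj'] := eqVneq j d.+1.
    rewrite e (bigD1 ord_max) //= binn mulr1 big1 ?addr0 ?subrr // => i ne.
    rewrite bin_small ?mulr0 // ltn_neqAle -ltnS ltn_ord andbT.
    by apply: contra ne => /eqP h; apply/eqP; exact: val_inj.
  have dj2 : (d.+1 < j)%N by rewrite ltn_neqAle eq_sym dj'.
  rewrite big1 => [|i _]; first by rewrite nth_default ?subr0 // (leq_trans sp).
  by rewrite bin_small ?mulr0 // (leq_trans (ltn_ord i)).
have qd : q`_d = d.+1%:R * p`_d.+1.
  rewrite coefB cq (bigD1 ord_max) //= (bigD1 (inord d)) /=; last by rewrite -val_eqE /= inordK // ltn_eqF.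
  rewrite inordK // binn mulr1 big1 => [|i /andP[n1 n2]].
    by rewrite addr0 addrK binSn mulrC.
  rewrite bin_small ?mulr0 //; move: n1 n2; rewrite -!val_eqE /= inordK //.
  by have := ltn_ord i; move: (nat_of_ord i) => u; lia.
have -> : (d.+1)`!%:R * p`_d.+1 = d`!%:R * q`_d by rewrite qd factS natrM mulrA [_ * d.+1%:R]mulrC.
apply: IH.
  by apply/leq_sizeP => j /q0.
move=> e he; rewrite hornerD hornerN horner_comp !hornerE -(natrD _ e 1) rpredB // hp //.
by rewrite addn1 leqW.
Qed.

Lemma poly_eventually_lead (p : {poly rat}) : 0 < lead_coef p ->
  exists e0 : nat, forall e : nat, (e0 <= e)%N -> lead_coef p <= p.[e%:R].
Proof.
elim/poly_ind: p => [|p c IH]; first by rewrite lead_coef0 ltxx.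
have [->|p0] := eqVneq p 0.
  by rewrite mul0r add0r lead_coefC => _; exists 0%N => e _; rewrite hornerC.
have -> : lead_coef (p * 'X + c%:P) = lead_coef p.
  by rewrite lead_coefDl ?lead_coefMX // size_mulX // (leq_ltn_trans (size_polyC_leq1 c)) // ltnS size_poly_gt0.
move=> l0; have [e0 he0] := IH l0.
pose b := Num.Def.archi_bound ((lead_coef p - c) / lead_coef p).
exists (e0 + b)%N => e he.
have h1 : (e0 <= e)%N by exact: leq_trans (leq_addr _ _) he.
have h2 : (lead_coef p - c) / lead_coef p <= e%:R.
  apply: (le_trans (ler_norm _)); apply: (le_trans (ltW (archi_boundP (normr_ge0 _)))).
  have -> : Num.Def.archi_bound `|(lead_coef p - c) / lead_coef p| = b.
    by rewrite /b /Num.Def.archi_bound normr_id.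
  by rewrite ler_nat (leq_trans (leq_addl _ _) he).
rewrite !hornerE; move: h2; rewrite ler_pdivrMr // => h2.
have h3 := he0 _ h1.
have : e%:R * lead_coef p <= p.[e%:R] * e%:R by rewrite mulrC ler_wpM2r.
by move: h2; rewrite -/(lead_coef p); lra.
Qed.

Lemma poly_eventually_ge0 (p : {poly rat}) e0 : (forall e : nat, (e0 <= e)%N -> 0 <= p.[e%:R]) ->
  0 <= lead_coef p.
Proof.
move=> h; rewrite leNgt; apply/negP => l0.
have [|e1 h1] := @poly_eventually_lead (- p); first by rewrite lead_coefN oppr_gt0.
have := h1 _ (leq_addl e0 e1); have := h _ (leq_addr e1 e0).
by rewrite hornerN lead_coefN => a b; move: l0; rewrite -oppr_gt0 => c; have := lt_le_trans c b; rewrite oppr_gt0 ltNge a.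
Qed.

(** [C(e + r, r) - C(e - d + r, r)] as a sum of binomials, by Pascal's rule. *)
Definition hyp_poly r d : {poly rat} := \sum_(i < d) (binp r \Po ('X - i%:R%:P)).

Lemma coef_hyp_poly r d : (hyp_poly r d)`_r = d%:R / r`!%:R.
Proof.
rewrite /hyp_poly coef_sum (eq_bigr (fun _ => r`!%:R^-1)) => [|i _].
  by rewrite big_const_ord iter_addr_0 mulr_natl.
rewrite -lead_binp -[RHS]mulr1 -[X in _ * X](expr1n _ (size (binp r)).-1).
rewrite -[X in X ^+ _](lead_coefXsubC (i%:R : rat)) -lead_coef_comp ?size_XsubC //.
by rewrite lead_coefE size_comp_poly2 ?size_XsubC // size_binp.
Qed.

Lemma size_hyp_poly r d : (0 < d)%N -> size (hyp_poly r d) = r.+1.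
Proof.
move=> d0; apply/eqP; rewrite eqn_leq; apply/andP; split.
  apply: (leq_trans (size_sum _ _ _)); apply/bigmax_leqP => i _.
  by rewrite size_comp_poly2 ?size_XsubC // size_binp.
rewrite ltnNge; apply/negP => /leq_sizeP/(_ r (leqnn r))/eqP.
by rewrite coef_hyp_poly mulf_eq0 invr_eq0 (negbTE (fact_neq0 _ _)) orbF pnatr_eq0 eqn0Ngt d0.
Qed.

Lemma hyp_poly_eval r d e : (d <= e)%N ->
  (hyp_poly r d).[e%:R] = 'C(r.+1 + e, r.+1)%:R - 'C(r.+1 + (e - d), r.+1)%:R.
Proof.
elim: d => [|d IH] de; first by rewrite /hyp_poly big_ord0 horner0 subn0 subrr.
rewrite /hyp_poly big_ord_recr /= hornerD -/(hyp_poly r d) IH 1?ltnW // horner_comp hornerXsubC.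
have -> : e%:R - d%:R = (e - d)%:R :> rat by rewrite natrB // ltnW.
rewrite binp_eval.
have -> : (e - d = (e - d.+1).+1)%N by lia.
rewrite [in X in _ - X + _]addnS binS addSn natrD addnS.
by rewrite -[in RHS]addSn opprD addrA subrK.
Qed.

(** Both inequalities together force the degrees to agree; the lower one then compares leading
    coefficients, and that of [hyp_poly r d] is [d / r!]. *)
Lemma hilbert_compare r d (p : {poly rat}) (c e0 : nat) (C : nat) : (0 < d)%N ->
  (forall e : nat, (e0 <= e)%N -> (hyp_poly r d).[e%:R] <= p.[e%:R] <= C%:R * (hyp_poly r d).[e%:R]) ->
  d%:R <= (size p).-1`!%:R * lead_coef p.
Proof.
move=> d0 h; set q := hyp_poly r d in h.
have sq : size q = r.+1 by rewrite size_hyp_poly.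
have lq : lead_coef q = d%:R / r`!%:R by rewrite lead_coefE sq coef_hyp_poly.
have lq0 : 0 < lead_coef q by rewrite lq divr_gt0 // ltr0n // fact_gt0.
have h1 : 0 <= lead_coef (p - q).
  by apply: (@poly_eventually_ge0 _ e0) => e /h/andP[a _]; rewrite hornerD hornerN subr_ge0.
have h2 : 0 <= lead_coef (C%:R *: q - p).
  by apply: (@poly_eventually_ge0 _ e0) => e /h/andP[_ a]; rewrite hornerD hornerN hornerZ subr_ge0.
have h3 : 0 <= lead_coef p.
  have [e1 he1] := poly_eventually_lead lq0.
  apply: (@poly_eventually_ge0 _ (e0 + e1)) => e he.
  have /h/andP[a _] : (e0 <= e)%N by exact: leq_trans (leq_addr _ _) he.
  apply: le_trans a; apply: le_trans (he1 e _); first exact: ltW.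
  exact: leq_trans (leq_addl _ _) he.
have spq : size p = size q.
  apply/eqP; rewrite eqn_leq; apply/andP; split; rewrite leqNgt; apply/negP => lt.
    move: h2; rewrite lead_coefDr ?size_polyN ?(leq_ltn_trans (size_scale_leq _ _)) // lead_coefN oppr_ge0.
    by rewrite le_eqVlt ltNge h3 orbF lead_coef_eq0 => /eqP p0; move: lt; rewrite p0 size_poly0.
  by move: h1; rewrite lead_coefDr ?size_polyN // lead_coefN oppr_ge0 leNgt lq0.
rewrite spq sq /= -ler_pdivrMl ?ltr0n ?fact_gt0 // mulrC -lq.
rewrite leNgt; apply/negP => lt.
have l2 : lead_coef (p - q) = lead_coef p - lead_coef q.
  rewrite !lead_coefE spq -coefB; congr (_`_ _.-1); apply/eqP; rewrite eqn_leq; apply/andP; split.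
    by apply: (leq_trans (size_polyD _ _)); rewrite size_polyN spq maxnn.
  rewrite sq ltnNge; apply/negP => /leq_sizeP/(_ r (leqnn r)).
  rewrite coefB; move: lt; rewrite !lead_coefE spq sq /= => lt e.
  by move: lt; rewrite -subr_lt0 e ltxx.
by move: h1; rewrite l2 subr_ge0 leNgt lt.
Qed.

(** * Normal forms modulo a homogeneous ideal *)

Section LeadingMonomials.
Variables (k : fieldType) (n : nat) (J : set (mp n.+1 k)).
Hypotheses (JD : forall a b, J a -> J b -> J (a + b)) (JM : forall a b, J a -> J (b * a)) (J0 : J 0).

Definition leadm (m : mnm n.+1) := exists P, [/\ J P, P != 0, hom (mdeg m) P & mlead P = m].

Definition nlead e := [seq m <- mons n e | ~~ `[< leadm m >]].

Lemma JZ (c : k) a : J a -> J (c *: a).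
Proof. by move=> Ja; rewrite -mul_mpolyC; exact: JM. Qed.

Lemma hom_mX (m : mnm n.+1) : hom (mdeg m) (mX k m).
Proof. by rewrite dhomogX. Qed.

Lemma mlead_mdeg e (P : mp n.+1 k) : P != 0 -> hom e P -> mdeg (mlead P) = e.
Proof. by move=> /mlead_supp h /dhomog_mf/(_ _ h). Qed.

Lemma nlead_comb_hom e (c : mnm n.+1 -> k) : hom e (\sum_(m <- nlead e) c m *: mX k m).
Proof.
rewrite big_seq rpred_sum // => m; rewrite mem_filter mem_mons => /andP[_ /eqP <-].
by rewrite rpredZ // hom_mX.
Qed.

Lemma nlead_coef e (c : mnm n.+1 -> k) m :
  mcoeff m (\sum_(m <- nlead e) c m *: mX k m) = if m \in nlead e then c m else 0.
Proof.
rewrite raddf_sum /= (eq_bigr (fun m' => if m' == m then c m else 0)) => [|m' _].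
  rewrite -big_mkcond /= -big_filter; have u : uniq (nlead e) by rewrite filter_uniq ?mons_uniq.
  case: ifP => hm; first by rewrite filter_pred1_uniq // big_seq1.
  rewrite big1_seq // => i /andP[_]; rewrite mem_filter => /andP[/eqP -> /=].
  by rewrite hm.
by rewrite mcoeffZ mcoeffX; case: eqP => [->|]; rewrite ?mulr1 ?mulr0.
Qed.

Lemma nlead_indep e (c : mnm n.+1 -> k) : J (\sum_(m <- nlead e) c m *: mX k m) ->
  forall m, m \in nlead e -> c m = 0.
Proof.
set P := \sum_(m <- _) _ => JP m hm.
have cP := nlead_coef e c.
have [P0|P0] := eqVneq P 0.
  by have := cP m; rewrite hm -/P P0 mcoeff0.
have := mlead_supp P0; rewrite mcoeff_msupp cP; case: ifP => [|_]; last by rewrite eqxx.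
rewrite mem_filter => /andP[/asboolP nl _] _; case: nl; exists P; split=> //.
by rewrite (mlead_mdeg P0 (nlead_comb_hom e c)); exact: nlead_comb_hom.
Qed.

(** Reduction to normal form: the leading term is removed by an element of the ideal when its
    monomial is a leading one, and otherwise recorded in the combination; the monomial order is well
    founded. *)
Lemma nlead_span e (P : mp n.+1 k) : hom e P ->
  exists c, J (P - \sum_(m <- nlead e) c m *: mX k m).
Proof.
move: {2}(mlead P) (lexx (mlead P)) => m; elim/(@ltmwf n.+1): m P => m IH P Pm hP.
have small Q : hom e Q -> (mlead Q <= m)%O -> mcoeff (mlead P) Q = 0 ->
    (mlead Q <= mlead P)%O -> exists c, J (Q - \sum_(m <- nlead e) c m *: mX k m).
  move=> hQ Qm Q0 QP; have [->|nQ] := eqVneq Q 0.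
    by exists (fun _ => 0); rewrite big1 ?subr0 // => i _; rewrite scale0r.
  have lt : (mlead Q < m)%O.
    rewrite lt_neqAle Qm andbT; apply/eqP => e1.
    have e2 : mlead P = mlead Q by apply/le_anti; rewrite QP e1 Pm.
    have := mlead_supp nQ; rewrite mcoeff_msupp -e2 Q0 eqxx //.
  exact: (IH _ lt Q (lexx _) hQ).
have [->|P0] := eqVneq P 0.
  by exists (fun _ => 0); rewrite big1 ?subr0 // => i _; rewrite scale0r.
have dl := mlead_mdeg P0 hP.
have step T : hom e T -> mlead T = mlead P -> T != 0 -> exists a : k,
    exists c, J (P - a *: T - \sum_(m <- nlead e) c m *: mX k m).
  move=> hT lT T0; have cT : mcoeff (mlead P) T != 0.
    by rewrite -lT -mcoeff_msupp mlead_supp.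
  exists (mcoeff (mlead P) P / mcoeff (mlead P) T).
  set a := _ / _; have le : (mlead (P - a *: T) <= mlead P)%O.
    apply: (le_trans (mleadB_le _ _)); rewrite leUx lexx /=.
    by rewrite (le_trans (mleadZ_le _ _)) // lT.
  apply: small => //; first by rewrite rpredB ?rpredZ.
    exact: le_trans le Pm.
  by rewrite mcoeffB mcoeffZ /a mulfVK // subrr.
have [[T [JT T0 hT lT]]|nl] := pselect (leadm (mlead P)).
  rewrite dl in hT; have [a [c hc]] := step T hT lT T0.
  exists c; have -> : P - \sum_(m <- nlead e) c m *: mX k m =
     P - a *: T - \sum_(m <- nlead e) c m *: mX k m + a *: T by rewrite addrAC subrK.
  by apply: JD => //; exact: JZ.
have [|||a [c hc]] := step (mX k (mlead P)).
- by rewrite -dl; exact: hom_mX.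
- exact: mleadXm.
- by rewrite -msupp_eq0 msuppX.
exists (fun m => c m + (if m == mlead P then a else 0)).
have -> : \sum_(m <- nlead e) (c m + (if m == mlead P then a else 0)) *: mX k m =
   a *: mX k (mlead P) + \sum_(m <- nlead e) c m *: mX k m.
  have ml : mlead P \in nlead e by rewrite mem_filter mem_mons dl eqxx andbT; apply/asboolP.
  have u : uniq (nlead e) by rewrite filter_uniq ?mons_uniq.
  rewrite (bigD1_seq _ ml u) [in RHS](bigD1_seq _ ml u) /= eqxx scalerDl [in RHS]addrA [X in _ = X + _]addrC.
  by congr (_ + _); apply: eq_bigr => i /negbTE ->; rewrite addr0.
by rewrite opprD addrA.
Qed.

Lemma leadm_gens : exists gs : seq (mnm n.+1), (forall g, g \in gs -> leadm g) /\
  forall m, `[< leadm m >] = ~~ undiv gs m.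
Proof.
have [gs [h1 h2]] := @dickson n leadm n.+1 (leqnn _).
exists gs; split=> // m; rewrite /undiv negbK; apply/asboolP/hasP.
  by move=> /h2[g gg hg]; exists g => //; apply/mnm_lepP => i; apply: hg.
case=> g /h1[P [JP P0 hP lP]] gm; exists (mX k (mnm_sub m g) * P).
have X0 : mX k (mnm_sub m g) != 0 by rewrite -msupp_eq0 msuppX.
split; first exact: JM.
- by rewrite mulf_neq0.
- have -> : mdeg m = (mdeg (mnm_sub m g) + mdeg g)%N by rewrite -mdegD submK.
  by apply: dhomogM => //; exact: hom_mX.
- by rewrite mleadM // mleadXm lP submK.
Qed.

Lemma size_nlead gs : (forall m, `[< leadm m >] = ~~ undiv gs m) ->
  forall e, size (nlead e) = cnt gs e.
Proof. by move=> h e; rewrite size_filter; apply: eq_count => m; rewrite h negbK. Qed.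

Lemma nlead_evpoly : evpoly (fun e => size (nlead e)).
Proof.
have [gs [_ h]] := leadm_gens; have [p [e0 hp]] := evpoly_cnt gs.
by exists p, e0 => e /hp ->; rewrite (size_nlead h).
Qed.

Lemma ideal_indep_le e r (P : 'I_r -> mp n.+1 k) : (forall i, hom e (P i)) ->
  (forall c : 'I_r -> k, J (\sum_i c i *: P i) -> forall i, c i = 0) -> (r <= size (nlead e))%N.
Proof.
move=> hP ind; rewrite leqNgt; apply/negP => lt.
have [C hC] := choice (fun i => nlead_span (hP i)).
have [a [[i ai] ha]] := linear_dependence (fun i j => C i (nth mnm0 (nlead e) j)) lt.
case/eqP: ai; apply: ind.
have -> : \sum_i a i *: P i = \sum_i a i *: (P i - \sum_(m <- nlead e) C i m *: mX k m).
  apply/eqP; rewrite -subr_eq0 -sumrB; apply/eqP.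
  rewrite (eq_bigr (fun i => \sum_(m <- nlead e) (a i * C i m) *: mX k m)) => [|l _]; last first.
    rewrite scalerBr subKr scaler_sumr; apply: eq_bigr => m _; exact: scalerA.
  rewrite exchange_big /= (big_nth mnm0) big_mkord big1 // => j _.
  by rewrite -scaler_suml ha scale0r.
by apply: (big_ind J) => // l _; exact: JZ.
Qed.

End LeadingMonomials.

Section HilbertFunction.
Variables (k : closedFieldType) (n : nat) (D : set 'rV[k]_n.+1).

Lemma indep_forms_van e r : indep_forms D e r <-> exists P : 'I_r -> mp n.+1 k, (forall i, hom e (P i)) /\
  forall c : 'I_r -> k, van D (\sum_i c i *: P i) -> forall i, c i = 0.
Proof.
have E (P : 'I_r -> mp n.+1 k) (c : 'I_r -> k) v : ev (\sum_i c i *: P i) v = \sum_(i < r) c i * ev (P i) v.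
  by rewrite /ev raddf_sum /=; apply: eq_bigr => i _; rewrite mevalZ.
split=> -[P [hP hi]]; exists P; split=> // c hc; apply: hi => v Dv; have := hc v Dv.
  by rewrite E.
by rewrite -E.
Qed.

Let JD a b : van D a -> van D b -> van D (a + b). Proof. exact: vanD. Qed.
Let JM a b : van D a -> van D (b * a). Proof. exact: vanM. Qed.
Let J0 : van D 0. Proof. by move=> v _; rewrite /ev meval0. Qed.

Lemma indep_nlead e : indep_forms D e (size (nlead (van D) e)).
Proof.
apply/indep_forms_van; exists (fun i => mX k (nth mnm0 (nlead (van D) e) i)); split.
  move=> i; have := mem_nth mnm0 (ltn_ord i); rewrite mem_filter mem_mons => /andP[_ /eqP h].
  by rewrite -[X in hom X _]h; exact: hom_mX.
move=> c hc i; set s := nlead (van D) e in c hc i *.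
have u : uniq s by rewrite filter_uniq ?mons_uniq.
pose c' m := if insub (index m s) is Some j then c j else 0.
have c'E (j : 'I_(size s)) : c' (nth mnm0 s j) = c j.
  rewrite /c' index_uniq // insubT //= => h; congr (c _); exact: val_inj.
rewrite -c'E; apply: (@nlead_indep k n (van D) e c'); last exact: mem_nth.
rewrite -/s (big_nth mnm0) big_mkord; move: hc; congr (van D _).
by apply: eq_bigr => j _; rewrite c'E.
Qed.

Lemma hilbert_functionE e : hilbert_function D e = size (nlead (van D) e).
Proof.
have le s : indep_forms D e s -> (s <= size (nlead (van D) e))%N.
  by move=> /indep_forms_van[P [hP]]; exact: ideal_indep_le.
apply: xget_unique; first by split; [exact: indep_nlead|exact: le].
move=> y [/le h /(_ _ (indep_nlead e)) h']; apply/eqP; by rewrite eqn_leq h h'.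
Qed.

(** It shows that the default value in [proj_degree] is never taken: integrality and nonnegativity
    of the normalized leading coefficient make it a natural number. *)
Lemma proj_degreeP : exists (p : {poly rat}) (e0 : nat),
  (forall e, (e0 <= e)%N -> p.[e%:R] = (hilbert_function D e)%:R) /\
  (proj_degree D)%:R = (size p).-1`!%:R * lead_coef p.
Proof.
have [p [e0 hp]] := @nlead_evpoly k n (van D) JM.
have hp' e : (e0 <= e)%N -> p.[e%:R] = (hilbert_function D e)%:R.
  by move=> /hp ->; rewrite hilbert_functionE.
pose S := [set d : nat | exists p : {poly rat}, (exists e0 : nat, forall e : nat, (e0 <= e)%N ->
  p.[e%:R] = (hilbert_function D e)%:R) /\ d%:R = ((size p).-1)`!%:R * lead_coef p].
have [q [[e1 hq] eq]] : S (proj_degree D).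
  apply: xgetPex.
  have : (size p).-1`!%:R * p`_(size p).-1 \is a Num.int.
    apply: (@int_valued_lead _ _ e0); first exact: leqSpred.
    by move=> e /hp' ->; rewrite Num.Theory.natr_int.
  have : 0 <= (size p).-1`!%:R * p`_(size p).-1.
    rewrite mulr_ge0 ?ler0n //; apply: (@poly_eventually_ge0 p e0) => e /hp' ->; exact: ler0n.
  move=> h1 h2; have : (size p).-1`!%:R * p`_(size p).-1 \is a Num.nat by rewrite Num.Theory.natrEint h2.
  by move/Num.Theory.natrP => [d hd]; exists d, p; split=> //; exists e0.
by exists q, e1; split.
Qed.

End HilbertFunction.

(** * Noetherian property and irreducible components *)

Section Noetherian.
Variables (k : closedFieldType) (n : nat).
Implicit Types (Z : set 'rV[k]_n.+1).

Lemma leadm_sub (J J' : set (mp n.+1 k)) m : J `<=` J' -> leadm J m -> leadm J' m.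
Proof. by move=> JJ' [P [/JJ' ? ? ? ?]]; exists P. Qed.

Lemma leadm_eq (J J' : set (mp n.+1 k)) e P :
  (forall a b, J a -> J b -> J (a + b)) -> (forall a b, J a -> J (b * a)) -> J 0 ->
  (forall a b, J' a -> J' b -> J' (a + b)) -> (forall a b, J' a -> J' (b * a)) -> J' 0 ->
  J `<=` J' -> (forall m, leadm J' m -> leadm J m) -> hom e P -> J' P -> J P.
Proof.
move=> JD JM J0 JD' JM' J0' JJ' h hP JP.
have [c hc] := nlead_span JD JM J0 hP.
have enl : nlead J e = nlead J' e.
  apply: eq_filter => m; congr (~~ _); apply/asboolP/asboolP => [|/h //]; exact: leadm_sub.
suff c0 : forall m, m \in nlead J' e -> c m = 0.
  move: hc; rewrite big_seq big1 ?subr0 // => m; rewrite enl => /c0 ->; exact: scale0r.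
apply: nlead_indep; rewrite -enl.
rewrite -[X in J' X](subKr P); apply: JD' => //.
by rewrite -mulN1r; apply: JM'; exact: JJ'.
Qed.

(** The leading monomials of the union of the vanishing ideals are generated by finitely many, all
    present at some stage [N]; nested ideals with the same leading monomials agree on forms. *)
Lemma zclosed_chain (Z : nat -> set 'rV[k]_n.+1) : (forall i, zclosed (Z i)) ->
  (forall i, Z i.+1 `<=` Z i) -> exists i, Z i `<=` Z i.+1.
Proof.
move=> cZ dZ; have mono i j : (i <= j)%N -> Z j `<=` Z i.
  move=> /subnK <-; elim: (j - i)%N => [|d IH] //.
  by rewrite addSn; apply: subset_trans IH; exact: dZ.
pose J := [set P : mp n.+1 k | exists i, van (Z i) P].
have up i j P : (i <= j)%N -> van (Z i) P -> van (Z j) P by move=> /mono ij; exact: van_sub.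
have JD a b : J a -> J b -> J (a + b).
  case=> i hi [j hj]; exists (maxn i j); apply: vanD; apply: up; [exact: leq_maxl| |exact: leq_maxr|]; assumption.
have JM a b : J a -> J (b * a) by case=> i hi; exists i; exact: vanM.
have v0 i : van (Z i) 0 by move=> v _; rewrite /ev meval0.
have J0 : J 0 by exists 0%N.
have [gs [h1 h2]] := leadm_gens JM.
have [N hN] : exists N, forall g, g \in gs -> leadm (van (Z N)) g.
  elim: gs h1 {h2} => [|g gs IH] h1; first by exists 0%N.
  have [|N hN] := IH; first by move=> g' h; apply: h1; rewrite inE h orbT.
  have [P [[i hi] P0 hP lP]] := h1 g (mem_head _ _).
  exists (maxn i N) => g'; rewrite inE => /orP[/eqP ->|/hN].
    by exists P; split=> //; apply: (up i); first exact: leq_maxl.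
  by apply: leadm_sub => Q; apply: up; exact: leq_maxr.
exists N; apply: zclosed_sub => //; first by move=> v; apply: zclosed_neq0.
move=> P [d hP] h; have JP : J P by exists N.+1.
have := @leadm_eq (van (Z N)) J d P; apply=> //; try exact: vanD.
- by move=> a b; exact: vanM.
- by move=> Q hQ; exists N.
move=> m lm; have : ~~ undiv gs m by rewrite -h2; exact/asboolP.
rewrite /undiv negbK => /hasP[g /hN [Q [vQ Q0 hQ lQ]] gm].
exists (mX k (mnm_sub m g) * Q).
have X0 : mX k (mnm_sub m g) != 0 by rewrite -msupp_eq0 msuppX.
split; first exact: vanM.
- by rewrite mulf_neq0.
- have -> : mdeg m = (mdeg (mnm_sub m g) + mdeg g)%N by rewrite -mdegD submK.
  by apply: dhomogM => //; exact: hom_mX.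
- by rewrite mleadM // mleadXm lQ submK.
Qed.

Lemma zclosedI Z Z' : zclosed Z -> zclosed Z' -> zclosed (Z `&` Z').
Proof.
move=> [S [hS ->]] [S' [hS' ->]]; exists (S `|` S'); split; first by move=> p [/hS|/hS'].
apply/seteqP; split=> v.
  by move=> [[v0 h] [_ h']]; split=> // p [/h|/h'].
by move=> [v0 h]; split; split=> // p Sp; apply: h; [left|right].
Qed.

(** A closed set without a finite decomposition is reducible, and one of its two pieces is a
    strictly smaller such set; iterating a choice contradicts the chain condition. *)
Lemma zclosed_components Z : zclosed Z -> exists A : set (set 'rV[k]_n.+1),
  [/\ finite_set A, forall C, A C -> projective C & Z = \bigcup_(C in A) C].
Proof.
pose fin Z := exists A : set (set 'rV[k]_n.+1),
  [/\ finite_set A, forall C, A C -> projective C & Z = \bigcup_(C in A) C].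
pose bad Z := zclosed Z /\ ~ fin Z.
have step Z0 : bad Z0 -> exists Z', [/\ bad Z', Z' `<=` Z0 & ~ Z0 `<=` Z'].
  move=> [cZ nf]; have [iZ|] := pselect (zirreducible Z0).
    case: nf; exists [set Z0]; split; first exact: finite_set1.
      by move=> C ->.
    by rewrite bigcup_set1.
  move=> /not_andP[/set0P/negP|].
    rewrite negbK => /eqP e; case: nf; exists set0; split; [exact: finite_set0|by []|by rewrite bigcup_set0].
  move=> /existsNP[Z1 /existsNP[Z2 /not_implyP[c1 /not_implyP[c2 /not_implyP[h /not_orP[n1 n2]]]]]].
  have [f1|nf1] := pselect (fin (Z0 `&` Z1)); last first.
    exists (Z0 `&` Z1); split; first by split=> //; exact: zclosedI.
      by move=> v [].
    by move=> s; apply: n1 => v /s[].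
  exists (Z0 `&` Z2); split; last 2 first.
  - by move=> v [].
  - by move=> s; apply: n2 => v /s[].
  split; first exact: zclosedI.
  case: f1 => A [fA pA eA] [A' [fA' pA' eA']]; apply: nf; exists (A `|` A'); split.
  - by rewrite finite_setU.
  - by move=> C [/pA|/pA'].
  rewrite bigcup_setU -eA -eA' -setIUr; apply/seteqP; split=> v; last by case.
  by move=> Zv; split=> //; exact: h.
move=> cZ; apply: contrapT => nf.
pose T := {Z | bad Z}.
have [next hnext] := choice (fun Zb : T => step _ (projT2 Zb)).
pose nx (Zb : T) : T := exist bad (next Zb) (let: And3 h _ _ := hnext Zb in h).
pose ch i := iter i nx (exist bad Z (conj cZ nf)).
have [||i] := @zclosed_chain (fun i => projT1 (ch i)).
- by move=> i; case: (projT2 (ch i)).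
- by move=> i; have [_ h _] := hnext (ch i).
- by have [_ _ h] := hnext (ch i).
Qed.

Lemma zirreducible_cover (E : set 'rV[k]_n.+1) (A : set (set 'rV[k]_n.+1)) : zirreducible E -> finite_set A ->
  (forall C, A C -> zclosed C) -> E `<=` \bigcup_(C in A) C -> exists2 C, A C & E `<=` C.
Proof.
move=> [[w Ew] iE] /finite_seqP[s ->]; elim: s => [|C s IH] hA h.
  by have [C] := h w Ew.
have [|||hC|hs] := iE C (\bigcup_(D in [set` s]) D).
- by apply: hA; rewrite /= mem_head.
- have {}hA D : D \in s -> zclosed D by move=> h'; apply: hA; rewrite /= inE h' orbT.
  elim: s hA {IH h} => [|D s IH] hA.
    rewrite set_nil bigcup_set0; exists [set 1]; split; first by move=> p ->; exists 0%N; exact: dhomog1.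
    apply/seteqP; split=> // v [_ /(_ 1 erefl)]; rewrite /ev meval1 => /eqP.
    by rewrite oner_eq0.
  have -> : \bigcup_(D0 in [set` D :: s]) D0 = D `|` \bigcup_(D0 in [set` s]) D0.
    apply/seteqP; split=> v.
      by move=> [D0]; rewrite /= inE => /orP[/eqP -> ?|? ?]; [left|right; exists D0].
    move=> [Dv|[D0 h Dv]]; first by exists D; rewrite //= mem_head.
    by exists D0; rewrite //= inE; apply/orP; right.
  have [|S [hS eS]] := IH; first by move=> D' h; apply: hA; rewrite inE h orbT.
  have [S' [hS' eS']] := hA D (mem_head _ _).
  exists [set p | exists a b, [/\ S a, S' b & p = a * b]]; split.
    move=> p [a [b [/hS [d ha] /hS' [d' hb] ->]]]; exists (d + d')%N; exact: dhomogM.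
  rewrite eS eS'; apply/seteqP; split=> v.
    by move=> [[v0 hv]|[v0 hv]]; split=> // p [a [b [Sa Sb ->]]]; rewrite /ev rmorphM /=;
      [have := hv _ Sb|have := hv _ Sa]; rewrite /ev => ->; rewrite ?mulr0 ?mul0r.
  move=> [v0 hv]; apply: contrapT => /not_orP[/not_andP[//|/existsNP[b /not_implyP[Sb /eqP nb]]]].
  move=> /not_andP[//|/existsNP[a /not_implyP[Sa /eqP na]]].
  have : ev (a * b) v = 0 by apply: hv; exists a, b.
  by rewrite /ev rmorphM /= => /eqP; rewrite mulf_eq0 (negbTE na) (negbTE nb).
- move=> v /h[D]; rewrite /= inE => /orP[/eqP -> Cv|Ds Dv]; [by left|right].
  by exists D.
- by exists C; rewrite //= mem_head.
have [|D Ds ED] := IH _ hs; first by move=> D Ds; apply: hA; rewrite /= inE; apply/orP; right.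
by exists D => //=; rewrite inE; apply/orP; right.
Qed.

(** By maximality such a divisor is one of the irreducible components of the zeros of [Q] on [Z]. *)
Lemma finite_prime_divisors Z (Q : mp n.+1 k) : projective Z -> ishom Q -> ~ van Z Q ->
  finite_set [set E | prime_divisor Z E /\ van E Q].
Proof.
move=> pZ hQ nQ; have cZ : zclosed Z by case: pZ.
have [A [fA pA eA]] := zclosed_components (zclosedI cZ (zclosed_form hQ)).
apply: (sub_finite_set _ fA) => E [[pE [EZ nEZ] mE] vE].
have [||C AC EC] := zirreducible_cover (A := A) (proj2 pE) fA.
- by move=> C /pA[].
- rewrite -eA => v Ev; split; first exact: EZ.
  by split; [apply: zclosed_neq0 Ev; case: pE|exact: vE].
have CZ : C `<=` Z `&` [set v | v != 0 /\ ev Q v = 0] by rewrite eA; exact: bigcup_sup.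
have [|<- //|e] := mE C (pA C AC) EC; first by move=> v /CZ[].
by case: nQ => v; rewrite -e => /CZ[_ []].
Qed.

End Noetherian.

(** * Divisors over a projection *)

Section Proportional.
Variables (k : fieldType) (Om : fieldType) (io : {rmorphism k -> Om}).

(** Proportionality by vanishing minors: it is polynomial, so it passes between generic points and
    equations on a variety, and it tolerates zero vectors. *)
Definition prop n (x y : 'I_n -> Om) := forall i j, x i * y j = x j * y i.

Lemma prop_sym n (x y : 'I_n -> Om) : prop x y -> prop y x.
Proof. by move=> h i j; rewrite mulrC -h mulrC. Qed.

Lemma prop_scale n (x y : 'I_n -> Om) j : y j != 0 -> prop x y -> x =1 (fun i => x j / y j * y i).
Proof. by move=> y0 h i; rewrite mulrAC -h mulfK. Qed.

Definition tval n m (F : tuplemap k n m) (x : 'I_n.+1 -> Om) (i : 'I_m.+1) := mmap io x (F i).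

Lemma mmap_tcomp n m (F : tuplemap k n m) (x : 'I_n.+1 -> Om) P :
  mmap io x (tcomp F P) = mmap io (tval F x) P.
Proof. by rewrite mmap_comp; apply: mmap_ext => i; rewrite tnth_mktuple. Qed.

End Proportional.

Lemma tcomp_hom (k : closedFieldType) n m (F : tuplemap k n m) e d P : (forall i, hom e (F i)) -> hom d P ->
  hom (e * d) (tcomp F P).
Proof. by move=> hF hP; apply: comp_hom => // j; rewrite tnth_mktuple. Qed.

Lemma tcomp_hom1 (k : closedFieldType) n m (F : tuplemap k n m) e P : (forall i, hom e (F i)) -> hom 1%N P ->
  hom e (tcomp F P).
Proof. by rewrite -[X in hom X (comp_mpoly _ _)]muln1; exact: tcomp_hom. Qed.

Lemma mlead_hom (k : fieldType) n d (P : mp n k) : P != 0 -> hom d P -> mdeg (mlead P) = d.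
Proof. by move=> /mlead_supp h /dhomog_mf/(_ _ h). Qed.

Lemma hom0_unit (k : fieldType) n (P : mp n k) : P != 0 -> hom 0%N P -> P \is a GRing.unit.
Proof.
move=> P0 hP.
have e : P = mpolyC n (mcoeff mnm0 P).
  apply/mpolyP => m; rewrite mcoeffC; have [<-|ne] := eqVneq; first by rewrite mulr1.
  rewrite mulr0; apply/eqP; rewrite -[_ == 0]negbK -mcoeff_msupp; apply/negP => /(dhomog_mf hP)/eqP.
  by rewrite mdeg_eq0 => /eqP e; move: ne; rewrite e eqxx.
have c0 : mcoeff mnm0 P != 0 by apply: contraNneq P0 => c0; rewrite e c0 mpolyC0.
apply/unitrPr; exists (mpolyC n (mcoeff mnm0 P)^-1).
by rewrite [X in X * _]e -mpolyCM divff // mpolyC1.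
Qed.

Section PrimePower.
Variables (k : fieldType) (n : nat) (pi : mp n k) (dl : nat).
Hypotheses (ppi : primel pi) (hpi : hom dl pi).

Lemma prime_hom_gt0 : (0 < dl)%N.
Proof.
case: ppi => p0 /negP nu _; rewrite lt0n; apply/eqP => d0; apply: nu; apply: hom0_unit => //.
by rewrite -[X in hom X _]d0.
Qed.

Lemma prime_multiplicity a : a != 0 -> exists (j : nat) b, a = pi ^+ j * b /\ ~ dvd pi b.
Proof.
have pi0 : pi != 0 by case: ppi.
have deg_lt b : b * pi != 0 -> b != 0 /\ (mdeg (mlead b) < mdeg (mlead (b * pi)))%N.
  move=> bp; have b0 : b != 0 by apply: contraNneq bp => ->; rewrite mul0r.
  split=> //; rewrite mleadM // mdegD (mlead_hom pi0 hpi).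
  by rewrite -[X in (X < _)%N]addn0 ltn_add2l; exact: prime_hom_gt0.
move: {2}(mdeg (mlead a)).+1 (ltnSn (mdeg (mlead a))) => N.
elim: N a => // N IH a le a0.
have [[b eb]|nd] := pselect (dvd pi a); last by exists 0%N, a; rewrite expr0 mul1r.
rewrite eb in le a0; have [b0 lt] := deg_lt b a0.
have [|j [c [ec nc]]] := IH b _ b0; first exact: leq_trans lt _.
by exists j.+1, c; split=> //; rewrite eb ec exprS mulrC mulrA.
Qed.

End PrimePower.

(** There are at least two variables, and a prime dividing all of them would be proportional to two
    different ones. So every prime has a coordinate that is a unit above it. *)
Lemma prime_not_all_variables (k : fieldType) r (pi : mp r.+2 k) : primel pi ->
  exists l, ~ dvd pi (mpX k l).
Proof.
move=> ppi; apply: contrapT => /forallNP h; have {}h l : dvd pi (mpX k l) by apply: contrapT; exact: h.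
have [p0 nu _] := ppi.
have X0 l : mpX k l != 0 :> mp r.+2 k by rewrite -msupp_eq0 msuppX.
have hX l : hom 1%N (mpX k l : mp r.+2 k) by rewrite dhomogX; apply/eqP; exact: mdeg1.
have co l : exists c : k, c != 0 /\ mpX k l = c *: pi.
  have [w ew] := h l; have := X0 l; rewrite ew => wp0.
  have w0 : w != 0 by apply: contraNneq wp0 => ->; rewrite mul0r.
  have hwp : hom 1%N (w * pi) by rewrite -ew.
  have [d [e [de hw hp]]] := hom_factor wp0 hwp.
  have e1 : (0 < e)%N by exact: prime_hom_gt0 hp.
  have d0 : d = 0%N by lia.
  subst d; have [c ec] : exists c : k, w = mpolyC _ c.
    exists (mcoeff mnm0 w); apply/mpolyP => m; rewrite mcoeffC.
    have [<-|ne] := eqVneq; first by rewrite mulr1.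
    rewrite mulr0; apply/eqP; rewrite -[_ == 0]negbK -mcoeff_msupp; apply/negP => /(dhomog_mf hw)/eqP.
    by rewrite mdeg_eq0 => /eqP e'; move: ne; rewrite e' eqxx.
  exists c; split; first by apply: contraNneq w0 => c0; rewrite ec c0 mpolyC0.
  by rewrite ec mul_mpolyC.
have [c [c0 ec]] := co ord0; have [c' [c0' ec']] := co ord_max.
have e : c' *: mpX k (ord0 : 'I_r.+2) = c *: mpX k ord_max :> mp r.+2 k.
  by rewrite ec ec' !scalerA mulrC.
have := f_equal (mcoeff (mnm1 (ord0 : 'I_r.+2))) e.
rewrite !mcoeffZ !mcoeffX eqxx mulr1 /=.
case: eqP => [/mnmP/(_ ord0)|_]; first by rewrite !mnm1E eqxx.
by rewrite mulr0 => /eqP; rewrite (negbTE c0').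
Qed.

Section PlacesOverPrimes.
Variables (k : closedFieldType) (Om : fieldType) (io : {rmorphism k -> Om}) (n r : nat).
Variables (eta : 'I_n.+1 -> Om) (M : 'I_n.+1 -> 'I_r.+2 -> k) (I : finType) (dg : I -> nat)
  (g : I -> mp n.+1 k).
Hypotheses (geta : graded io eta) (fM : finlin io eta M dg g) (ai : algindep io (lin io M eta)).
Notation eve := (mmap io eta).
Notation t := (lin io M eta).
Notation evt := (mmap io t).

Let evt_inj : injective evt.
Proof.
move=> p q e; apply/eqP; rewrite -subr_eq0; apply/eqP; apply: ai.
by rewrite rmorphB /= e subrr.
Qed.

(** The norm [b = Q * W] of the denominator gives [b * (P / Q) = P * W], and the powers of [P * W]
    up to [#|I|] are dependent; hence the degree bound. *)
Lemma frac_minpoly P Q : eve Q != 0 -> exists mu : {poly mp r.+2 k},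
  [/\ mu != 0, (map_poly evt mu).[eve P / eve Q] = 0, (1 < size mu)%N, (size mu <= #|I|.+1)%N
    & divides_relations evt (eve P / eve Q) mu].
Proof.
move=> Q0; have [b [W [b0 hb]]] := finlin_norm fM ai Q0.
have [a [[l al] ha]] := finlin_dependent fM (fun l : 'I_#|I|.+1 => (P * W) ^+ l) (ltnSn _).
pose F : {poly mp r.+2 k} := \poly_(l < #|I|.+1) (a (inord l) * b ^+ l).
have F0 : F != 0.
  apply: contraNneq al => /polyP/(_ l); rewrite coef_poly ltn_ord coef0 inord_val => /eqP.
  by rewrite mulf_eq0 expf_eq0 (negbTE b0) andbF orbF.
have eb0 : evt b != 0 by rewrite -(rmorph0 evt) (inj_eq evt_inj).
have W0 : eve W != 0 by apply: contraNneq eb0 => w0; rewrite hb w0 mulr0.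
have rF : (map_poly evt F).[eve P / eve Q] = 0.
  rewrite (horner_map_wide _ _ (size_poly _ _)).
  rewrite -[RHS]ha; apply: eq_bigr => i _; rewrite coef_poly ltn_ord inord_val /=.
  rewrite rmorphM !rmorphXn !rmorphM /= hb -mulrA -!exprMn; congr (_ * _ ^+ _).
  by rewrite mulrACA mulrC mulrA; field.
have [|mu [mu0 rmu smu dmu]] := primitive_minpoly (@factorial_mpoly k r.+2) evt_inj (x := eve P / eve Q).
  by exists F.
exists mu; split=> //; have [G eG] := dmu _ rF.
have G0 : G != 0 by apply: contraNneq F0 => G0; rewrite eG G0 mul0r.
have sFle : (size F <= #|I|.+1)%N by exact: size_poly.
have g0 : (0 < size G)%N by rewrite size_poly_gt0.
apply: leq_trans sFle; rewrite eG size_mul //.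
by clear -g0; move: (size G) (size mu) g0 => a b; lia.
Qed.

Lemma kfun_minpoly w : kfun io eta w -> exists (mu : {poly mp r.+2 k}) e,
  [/\ mu != 0, (map_poly evt mu).[w] = 0, (1 < size mu <= #|I|.+1)%N,
    divides_relations evt w mu
    & forall j, hom e mu`_j].
Proof.
case=> d [P [Q [hP hQ Q0 ->]]]; have [mu [mu0 rmu smu smu' dmu]] := frac_minpoly P Q0.
have [e he] : exists e, forall j, homm e (0 * j) mu`_j.
  apply: (weighted_minpoly mu0 rmu dmu) => F rF e.
  by apply: (fraction_weighted geta hP hQ _ Q0 rF); rewrite addn0.
exists mu, e; split=> //; first by rewrite smu smu'.
by move=> j; have := he j; rewrite /homm mul0n leq0n subn0.
Qed.

(** If [pi^m] divides the leading coefficient of the minimal polynomial of [w] and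
    [a #|I| < m], then [pi^a w] is not integral over the local ring at [pi]. *)
Lemma place_of_prime P Q (mu : {poly mp r.+2 k}) (pi : mp r.+2 k) m : eve Q != 0 ->
  (map_poly evt mu).[eve P / eve Q] = 0 -> (1 < size mu <= #|I|.+1)%N ->
  divides_relations evt (eve P / eve Q) mu ->
  primel pi -> (0 < m)%N -> dvd (pi ^+ m) (lead_coef mu) ->
  exists V, [/\ valring V, forall a, V (evt a), forall a, dvd pi a <-> maxi V (evt a)
    & ~ V (evt pi ^+ (m.-1 %/ #|I|) * (eve P / eve Q))].
Proof.
move=> Q0 rmu smu dmu ppi m0 dm; set a := (m.-1 %/ #|I|)%N.
have [p0 nu pp] := ppi.
have I0 : (0 < #|I|)%N by move: smu => /andP[s1 s2]; have := leq_trans s1 s2; rewrite ltnS.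
apply: contrapT => nV.
set w := eve P / eve Q.
have ew : evt pi ^+ a * w = eve (lincomp M pi ^+ a * P) / eve Q.
  by rewrite rmorphM rmorphXn /= mmap_lincomp mulrA.
have [||||||F [nF rF]] := @integral_local Om _ evt (dvd pi) _ _ _ _ _ (evt pi ^+ a * w).
- by case=> c e; case/negP: nu; apply/unitrPr; exists c; rewrite mulrC.
- by move=> x y [c ->] [c' ->]; exists (c + c'); rewrite mulrDl.
- by move=> x y; exact: dvd_mulr.
- exact: pp.
- by move=> x x0; exists 0; rewrite mul0r; apply: ai.
- move=> V vV hV hV'; apply: contrapT => nw; apply: nV; exists V; split=> //.
have [nu' [n0 rn sn sn' dn]] := frac_minpoly (lincomp M pi ^+ a * P) Q0.
rewrite -ew in rn dn.
have nln : ~ dvd pi (lead_coef nu').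
  have [G eG] := dn _ rF; move=> h; apply: nF; rewrite eG lead_coefM; exact: dvd_mulr.
pose s := (size nu').-1.
have es : size nu' = s.+1 by rewrite /s prednK // (leq_trans _ sn).
(* [F'] is the equation of [pi^a w] rewritten for [w], so [mu] divides it and [pi ^+ m] divides its
   leading coefficient. As [a * s < m], [pi] would divide the leading coefficient of the equation of
   [pi^a w]. *)
pose F' : {poly mp r.+2 k} := \poly_(l < s.+1) (nu'`_l * pi ^+ (a * l)).
have lF : F'`_s = lead_coef nu' * pi ^+ (a * s) by rewrite coef_poly ltnSn lead_coefE.
have lF0 : F'`_s != 0 by rewrite lF mulf_neq0 ?lead_coef_eq0 ?expf_neq0.
have sF : size F' = s.+1.
  by apply: size_poly_eq; move: lF0; rewrite coef_poly ltnSn.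
have rF' : (map_poly evt F').[w] = 0.
  rewrite -[RHS]rn !(horner_map_wide _ _ (n := s.+1)) ?sF ?es //.
  apply: eq_bigr => l _; rewrite coef_poly ltn_ord rmorphM rmorphXn /=.
  by rewrite [in RHS]exprMn -[in RHS]exprM mulrA.
have [G eG] := dmu _ rF'.
have eL : lead_coef nu' * pi ^+ (a * s) = lead_coef G * lead_coef mu.
  by rewrite -lF -lead_coefM -eG lead_coefE sF.
have [c ec] := dm.
have sI : (s <= #|I|)%N by rewrite -ltnS -es.
have am : (a * s < m)%N.
  apply: (leq_ltn_trans (leq_mul (leqnn a) sI)); rewrite /a; apply: (leq_ltn_trans (leq_divM _ _)).
  by rewrite prednK.
apply: nln; exists (lead_coef G * c * pi ^+ (m - a * s).-1).
have p0' : pi ^+ (a * s) != 0 by rewrite expf_neq0.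
apply: (mulIf p0'); rewrite eL ec -!mulrA; congr (_ * (_ * _)).
by rewrite mulrA -exprSr prednK ?subn_gt0 // -exprD subnK // ltnW.
Qed.

Section Place.
Variables (V : set Om) (vV : valring V) (Vt : forall a, V (evt a)) (pi : mp r.+2 k) (dl : nat).
Hypotheses (ppi : primel pi) (hpi : hom dl pi) (hV : forall a, dvd pi a <-> maxi V (evt a)).
Let sV : subring V. Proof. by case: vV. Qed.

Lemma place_overk : overk io V.
Proof. by move=> c; have := Vt (mpolyC _ c); rewrite mmapC. Qed.

Lemma place_eta i : V (eta i).
Proof.
apply: (finlin_val fM vV place_overk) => j.
by rewrite -[X in V X](mmap_var io t); exact: Vt.
Qed.

Lemma place_t j : V (t j).
Proof. by rewrite -[X in V X](mmap_var io t); exact: Vt. Qed.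

Lemma place_unit_t : exists l, ~ maxi V (t l).
Proof.
have [l hl] := prime_not_all_variables ppi; exists l => ml; apply: hl; apply/hV.
by rewrite mmap_var.
Qed.

Lemma place_unit_eta : exists i, ~ maxi V (eta i).
Proof.
have [l hl] := place_unit_t; apply: contrapT => /forallNP h; apply: hl.
apply: (maxi_sum vV) => i _; apply: (maxiM vV); first exact: place_overk.
by apply: contrapT; exact: h.
Qed.

(** [uniformizer] applies with the function field as [W] and the coordinate ring of the target as
    [C]: there a prime power splits off every element. Dividing [pi] by a power of a unit coordinate
    makes it a rational function. *)
Lemma place_uniformizer : exists s, [/\ kfun io eta s, maxi V s, s != 0
  & forall w, kfun io eta w -> V w -> w != 0 -> exists j : nat, V (w / s ^+ j) /\ V (s ^+ j / w)].
Proof.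
have [l nl] := place_unit_t; have tl0 := nmaxi_neq0 nl.
pose p0 := evt pi / t l ^+ dl.
have pi0 : evt pi != 0 by rewrite -(rmorph0 evt) (inj_eq evt_inj); case: ppi.
have tlX j : V (t l ^+ j)^-1.
  by rewrite -exprVn; apply: (subringX sV); apply: (nmaxi_unit (place_t l)).
have ke (P : mp n.+1 k) d : hom d P -> eve P / t l ^+ d \in [set w | kfun io eta w].
  move=> hP; rewrite inE; exists d, P, (linf M l ^+ d); split=> //.
  - by apply: hom1X; exact: linf_hom.
  - by rewrite rmorphXn /= mmap_linf expf_neq0.
  - by rewrite rmorphXn /= mmap_linf.
have kp0 : kfun io eta p0.
  by have := ke (lincomp M pi) dl (lincomp_hom M hpi); rewrite inE mmap_lincomp.
apply: (@uniformizer Om V (kfun io eta) [set evt a | a in [set: mp r.+2 k]] p0 #|I|) => //.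
- apply: (maxiMl vV); first by apply/hV; exists 1; rewrite mul1r.
  exact: tlX.
- by rewrite mulf_neq0 // invr_eq0 expf_neq0.
- move=> _ [a _ <-] a0; have a0' : a != 0 by apply: contraNneq a0 => ->; rewrite rmorph0.
  have [j [b [eb nb]]] := prime_multiplicity ppi hpi a0'.
  have nmb : ~ maxi V (evt b) by move/hV.
  exists j, (t l ^+ dl ^+ j * evt b); split.
  + rewrite eb rmorphM rmorphXn /= /p0 mulrA; congr (_ * _); rewrite -exprMn; congr (_ ^+ _).
    by rewrite mulfVK // expf_neq0.
  + by apply: (subringM sV) => //; do 2 apply: (subringX sV); exact: place_t.
  + by rewrite invfM -exprM; apply: (subringM sV) => //; apply: (nmaxi_unit (Vt b)).
- exists 0%N, 1, 1; rewrite rmorph1 divr1 oner_neq0.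
  by split=> //; exact: dhomog1.
- exact: kfunM.
- move=> w kw; have [->|w0] := eqVneq w 0; first by rewrite invr0; exists 0%N, 0, 1; split;
    [exact: rpred0|exact: dhomog1|by rewrite rmorph1 oner_neq0|by rewrite rmorph0 mul0r].
  case: kw => d [P [Q [hP hQ Q0 e]]]; exists d, Q, P; split=> //; last by rewrite e invf_div.
  by apply: contraNneq w0 => z'; rewrite e z' mul0r.
move=> y hy; have [A hA] : exists A : 'I_#|I|.+1 -> mp n.+1 k * mp n.+1 k, forall l,
    eve (A l).2 != 0 /\ y l = eve (A l).1 / eve (A l).2.
  have /choice[A hA] : forall l, exists A : mp n.+1 k * mp n.+1 k, eve A.2 != 0 /\ y l = eve A.1 / eve A.2.
    by move=> l'; have [d [P [Q [_ _ Q0 e]]]] := hy l'; exists (P, Q).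
  by exists A.
have [a [[l' al] ha]] := finlin_dependent fM
  (fun l => (A l).1 * \prod_(l' < #|I|.+1 | l' != l) (A l').2) (ltnSn _).
exists (fun l => evt (a l)); split.
- by move=> i; exists (a i).
- by exists l'; rewrite -(rmorph0 evt) (inj_eq evt_inj).
have D0 : \prod_(l < #|I|.+1) eve (A l).2 != 0 by apply/prodf_neq0 => i _; case: (hA i).
apply: (mulIf D0); rewrite mul0r mulr_suml -[RHS]ha; apply: eq_bigr => i _.
have [Ai0 ->] := hA i; rewrite (bigD1 i) //= rmorphM rmorph_prod /= -!mulrA; congr (_ * (_ * _)).
by rewrite mulKf.
Qed.

(** The finite projection makes every coefficient of a minimal equation over [k[t]]
    a form in the coordinates of the center, whence integrality over its local ring. *)
Lemma place_normal m (z : 'I_m.+1 -> Om) i0 (Y E : set 'rV[k]_m.+1) (L : 'I_r.+2 -> mp m.+1 k) u :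
  (forall i, V (z i)) -> z i0 = 1 -> normal Y ->
  (forall d P, hom d P -> mmap io z P = 0 <-> van Y P) -> E `<=` Y -> is_center io V z E ->
  (forall j, mmap io z (L j) = u * t j) -> u != 0 -> V u -> V u^-1 ->
  forall w, kfun io z w -> kfun io eta w -> V w -> OE io V z w.
Proof.
move=> Vz z1 nY hY EY cE hL u0 Vu Vu' w kz ke Vw.
have [mu [e [mu0 rmu _ dmu hmu]]] := kfun_minpoly ke.
pose F : {poly mp m.+1 k} := \poly_(j < size mu) tcomp L mu`_j.
have eF j : mmap io z F`_j = u ^+ e * evt mu`_j.
  rewrite coef_poly; case: ltnP => h; last by rewrite nth_default // !rmorph0 mulr0.
  rewrite mmap_comp -(dhomog_scale _ _ _ (hmu j)); apply: mmap_ext => i.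
  by rewrite tnth_mktuple.
apply: (normal_center_primitive vV place_overk Vz z1 nY hY EY cE kz Vw (F := F)).
  rewrite (horner_map_wide _ _ (size_poly _ _)).
  transitivity (u ^+ e * (map_poly evt mu).[w]); last by rewrite rmu mulr0.
  by rewrite (horner_map_wide _ _ (leqnn _)) mulr_sumr; apply: eq_bigr => j _; rewrite mulrA -eF.
apply: contrapT => /forallNP h.
have [G eG] : dvd pi%:P mu.
  apply: dvd_polyC => j; apply/hV; have mj := contrapT (h j); rewrite eF in mj.
  exact/(maxi_scaleX vV e _ u0).
have [H eH] : dvd mu G.
  apply: dmu; have := rmu; rewrite eG rmorphM hornerM /= map_polyC hornerC => /eqP.
  rewrite mulf_eq0 => /orP[/eqP //|]; rewrite -(rmorph0 evt) (inj_eq evt_inj).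
  by case: ppi => /negbTE ->.
have e1 : H * pi%:P = 1.
  by apply: (mulIf mu0); rewrite mul1r [RHS]eG eH mulrAC.
case: ppi => _ /negP + _; apply; apply/unitrPr; exists H`_0; rewrite mulrC.
by have := f_equal (fun q : {poly _} => q`_0) e1; rewrite /= coefMC coef1 eqxx.
Qed.

End Place.
End PlacesOverPrimes.
Lemma hilbert_max (k : closedFieldType) n (D : set 'rV[k]_n.+1) e s :
  indep_forms D e s -> (s <= hilbert_function D e)%N.
Proof.
rewrite hilbert_functionE => /indep_forms_van[P [hP]]; apply: ideal_indep_le => //.
- exact: vanD.
- by move=> a b; exact: vanM.
- by move=> v _; rewrite /ev meval0.
Qed.

(** * The degree of a divisor lying over a prime form *)

Section DegreeOfPrime.
Variables (k : closedFieldType) (Om : fieldType) (io : {rmorphism k -> Om}) (n r : nat).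
Variables (eta : 'I_n.+1 -> Om) (M : 'I_n.+1 -> 'I_r.+2 -> k) (I : finType) (dg : I -> nat)
  (g : I -> mp n.+1 k).
Hypotheses (fM : finlin io eta M dg g).
Notation eve := (mmap io eta).
Notation evt := (mmap io (lin io M eta)).
Variables (pi : mp r.+2 k) (dl : nat) (ppi : primel pi) (hpi : hom dl pi).
Let J := [set a : mp r.+2 k | dvd pi a].
Let pi0 : pi != 0. Proof. by case: ppi. Qed.

Let JD a b : J a -> J b -> J (a + b).
Proof. by move=> [c ->] [d ->]; exists (c + d); rewrite mulrDl. Qed.
Let JM a b : J a -> J (b * a). Proof. exact: dvd_mulr. Qed.
Let J0 : J 0. Proof. by exists 0; rewrite mul0r. Qed.

Lemma leadm_prime m : `[< leadm J m >] = ~~ undiv [:: mlead pi] m.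
Proof.
rewrite /undiv /= orbF negbK; apply/asboolP/idP.
  move=> [P [[c eP] P0 hP <-]]; rewrite eP mleadM //; first exact: lem_addl.
  by apply: contraNneq P0 => c0; rewrite eP c0 mul0r.
move=> le; have X0 : mX k (mnm_sub m (mlead pi)) != 0 by rewrite -msupp_eq0 msuppX.
exists (mX k (mnm_sub m (mlead pi)) * pi); split.
- by exists (mX k (mnm_sub m (mlead pi))).
- by rewrite mulf_neq0.
- rewrite -{2}(submK le) mdegD (mlead_hom pi0 hpi).
  by apply: dhomogM => //; exact: hom_mX.
- by rewrite mleadM // mleadXm submK.
Qed.

Let hf e := size (nlead J e).
(** It agrees with [hf] from degree [dl] on. Truncated subtraction keeps it an upper bound in lower
    degrees and makes it monotone, which absorbs the shifts by [dg i]. *)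
Let f e := (\sum_(i < dl) 'C(r + (e - i), r))%N.

Lemma hf_cnt e : hf e = cnt [:: mlead pi] e.
Proof. exact: (size_nlead leadm_prime). Qed.

Lemma hf_add e : (dl <= e)%N -> (hf e + 'C(r.+1 + (e - dl), r.+1) = 'C(r.+1 + e, r.+1))%N.
Proof.
move=> le; have := @cnt_cons r.+1 (mlead pi) [::] e.
by rewrite (mlead_hom pi0 hpi) => /(_ le); rewrite /= !cnt_nil -hf_cnt.
Qed.

Let pascal d e : ('C(r.+1 + e, r.+1) <=
  \sum_(i < d) 'C(r + (e - i), r) + (if (d <= e)%N then 'C(r.+1 + (e - d), r.+1) else 0))%N.
Proof.
elim: d => [|d IH]; first by rewrite big_ord0 leq0n subn0.
apply: (leq_trans IH); rewrite big_ord_recr /= -addnA leq_add2l.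
case: (ltngtP d e) => [lt|lt|eq].
- have -> : (e - d = (e - d.+1).+1)%N by lia.
  by rewrite addnS binS addnC leq_add2r addSn addnS.
- by rewrite leq0n.
- by rewrite -eq subnn !addn0 !binn.
Qed.

Lemma hf_le e : (hf e <= f e)%N.
Proof.
have := pascal dl e; have [le|lt] := leqP dl e => h.
  by move: h; rewrite -(hf_add le) leq_add2r.
rewrite addn0 in h; apply: leq_trans h; rewrite hf_cnt -(cnt_nil r.+1) /cnt; apply: sub_count => m _ //.
Qed.

Lemma f_mono e e' : (e <= e')%N -> (f e <= f e')%N.
Proof.
move=> le; apply: leq_sum => i _; apply: leq_bin2l; rewrite leq_add2l; exact: leq_sub2r.
Qed.

Lemma f_hyp e : (dl <= e)%N -> (hyp_poly r dl).[e%:R] = (f e)%:R.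
Proof.
move=> le; rewrite /hyp_poly horner_sum /f natr_sum; apply: eq_bigr => i _.
rewrite horner_comp hornerXsubC -natrB ?binp_eval //.
by apply: ltnW; apply: leq_trans le.
Qed.

Lemma hf_hyp e : (dl <= e)%N -> (hyp_poly r dl).[e%:R] = (hf e)%:R.
Proof. by move=> le; rewrite hyp_poly_eval // -(hf_add le) natrD addrK. Qed.

Variables (X D : set 'rV[k]_n.+1).
Hypotheses (hX : forall P, eve P = 0 -> van X P) (DX : D `<=` X)
  (hD : forall d a, hom d a -> van D (lincomp M a) <-> dvd pi a).

Lemma lincompZ (c : k) a : lincomp M (c *: a) = c *: lincomp M a.
Proof. by rewrite /lincomp linearZ. Qed.

(** By [hD], forms independent modulo [pi] stay independent when pulled back to [D]. *)
Lemma indep_over_prime e : indep_forms D e (hf e).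
Proof.
apply/indep_forms_van; exists (fun i => lincomp M (mX k (nth mnm0 (nlead J e) i))); split.
  move=> i; have := mem_nth mnm0 (ltn_ord i); rewrite mem_filter mem_mons => /andP[_ /eqP h].
  by apply: lincomp_hom; rewrite -[X in hom X _]h; exact: hom_mX.
move=> c hc i; set s := nlead J e in c hc i *.
have u : uniq s by rewrite filter_uniq ?mons_uniq.
pose c' m := if insub (index m s) is Some j then c j else 0.
have c'E (j : 'I_(size s)) : c' (nth mnm0 s j) = c j.
  rewrite /c' index_uniq // insubT //= => h; congr (c _); exact: val_inj.
rewrite -c'E; apply: (@nlead_indep k r.+1 J e c'); last exact: mem_nth.
have hh := nlead_comb_hom J e c'.
apply/(hD hh); move: hc; congr (van D _); rewrite /lincomp raddf_sum /=.
rewrite (big_nth mnm0) big_mkord; apply: eq_bigr => j _.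
by rewrite -!/(lincomp M _) lincompZ c'E.
Qed.

(** The [g i] generate the coordinate ring of [D] over that of the hypersurface [pi = 0], so its
    Hilbert function is at most [#|I|] times a value of [f]. *)
Lemma indep_le_prime e s : indep_forms D e s -> (s <= #|I| * f e)%N.
Proof.
move=> /indep_forms_van[P [hP iP]].
have [a ha] := choice (fun l => finlin_span fM (hP l)).
pose T := {i : I & 'I_(hf (e - dg i))}.
have [C hC] : exists C : 'I_s -> I -> mnm r.+2 -> k, forall l i,
    J (a l i - \sum_(m <- nlead J (e - dg i)) C l i m *: mX k m).
  have /choice[C hC] : forall li : 'I_s * I, exists c : mnm r.+2 -> k,
      J (a li.1 li.2 - \sum_(m <- nlead J (e - dg li.2)) c m *: mX k m).
    move=> [l i] /=; have [+ _] := ha l => /(_ i); rewrite /homm; case: ifP => _; last first.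
      by move=> ->; exists (fun _ => 0); rewrite big1 ?subr0 // => m _; rewrite scale0r.
    by move=> h; have := nlead_span JD JM J0 h.
  by exists (fun l i => C (l, i)) => l i; exact: (hC (l, i)).
have cT : (#|{: T}| <= #|I| * f e)%N.
  rewrite card_tagged sumnE big_map big_enum /= -sum_nat_const; apply: leq_sum => i _.
  by rewrite card_ord; apply: leq_trans (hf_le _) _; apply: f_mono; exact: leq_subr.
apply: leq_trans cT; rewrite leqNgt; apply/negP => lt.
have [d [[l dl0] hd]] := linear_dependence (fun (l : 'I_s) (j : 'I_#|{: T}|) =>
  C l (tag (enum_val j)) (nth mnm0 (nlead J (e - dg (tag (enum_val j)))) (tagged (enum_val j)))) lt.
have hd' i m : m \in nlead J (e - dg i) -> \sum_l d l * C l i m = 0.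
  move=> hm; have ix : (index m (nlead J (e - dg i)) < hf (e - dg i))%N by rewrite index_mem.
  have := hd (enum_rank (Tagged (fun i => 'I_(hf (e - dg i))) (Ordinal ix) : T)).
  by rewrite enum_rankK /= nth_index.
case/eqP: dl0; apply: iP.
have /choice[b hb] : forall i, exists b : mp r.+2 k, \sum_l d l *: a l i = b * pi.
  move=> i.
  have -> : \sum_l d l *: a l i = \sum_l d l *: (a l i - \sum_(m <- nlead J (e - dg i)) C l i m *: mX k m).
    apply/eqP; rewrite -subr_eq0 -sumrB; apply/eqP.
    rewrite (eq_bigr (fun l => \sum_(m <- nlead J (e - dg i)) (d l * C l i m) *: mX k m)) => [|l' _]; last first.
      rewrite scalerBr subKr scaler_sumr; apply: eq_bigr => m _; exact: scalerA.
    rewrite exchange_big /= big_seq big1 // => m hm.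
    by rewrite -scaler_suml hd' // scale0r.
  have [c ec] : J (\sum_l d l *: (a l i - \sum_(m <- nlead J (e - dg i)) C l i m *: mX k m)).
    apply: (big_ind J) => // l' _; rewrite -mul_mpolyC; apply: JM; exact: hC.
  by exists c.
have vP : van X (\sum_l d l *: P l - \sum_i lincomp M (b i * pi) * g i).
  apply: hX; rewrite rmorphB !rmorph_sum /=; apply/eqP; rewrite subr_eq0; apply/eqP.
  rewrite (eq_bigr (fun l => \sum_i io (d l) * evt (a l i) * eve (g i))) => [|l' _]; last first.
    have [_ hs] := ha l'; rewrite -mul_mpolyC rmorphM /= mmapC hs mulr_sumr.
    by apply: eq_bigr => i _; rewrite mulrA.
  rewrite exchange_big /=; apply: eq_bigr => i _.
  rewrite rmorphM /= mmap_lincomp -hb rmorph_sum mulr_suml /=; apply: eq_bigr => l' _.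
  by rewrite -mul_mpolyC rmorphM /= mmapC.
have vpi : van D (lincomp M pi) by apply/(hD hpi); exists 1; rewrite mul1r.
have -> : \sum_l d l *: P l = (\sum_l d l *: P l - \sum_i lincomp M (b i * pi) * g i) + \sum_i lincomp M (b i * pi) * g i.
  by rewrite subrK.
apply: vanD; first exact: van_sub vP.
apply: (big_ind (van D)); first by move=> v _; rewrite /ev meval0.
  exact: vanD.
move=> i _; rewrite mulrC; apply: vanM; rewrite /lincomp rmorphM /=; exact: vanM.
Qed.

(** The Hilbert function of [D] lies between that of a hypersurface of degree [dl] and a multiple of
    it, so only leading coefficients need to be compared; no projection formula is required. *)
Lemma proj_degree_ge : (dl <= proj_degree D)%N.
Proof.
have [p [e0 [hp eD]]] := proj_degreeP D.
have d0 : (0 < dl)%N by exact: prime_hom_gt0 hpi.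
rewrite -(ler_nat rat) eD; apply: (@hilbert_compare r dl p 0 (e0 + dl) #|I|) => // e he.
have [le1 le2] : (e0 <= e)%N /\ (dl <= e)%N by split; apply: leq_trans he; rewrite ?leq_addr ?leq_addl.
rewrite hp // {1}hf_hyp // f_hyp // -natrM !ler_nat; apply/andP; split.
  have := @hilbert_max k n D e; apply; exact: indep_over_prime.
by apply: indep_le_prime; rewrite hilbert_functionE; exact: indep_nlead.
Qed.

End DegreeOfPrime.

Section Representatives.
Variables (k : closedFieldType) (Om : fieldType) (io : {rmorphism k -> Om}) (m n : nat).
Variables (Gam : set 'rV[k]_m.+1) (xi : 'I_m.+1 -> Om).
Hypothesis hxi : forall P, mmap io xi P = 0 <-> van Gam P.

Lemma tm_nonzero_van (E : set 'rV[k]_m.+1) (F : tuplemap k m n) :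
  tm_nonzero_on E F <-> exists i, ~ van E (F i).
Proof.
split=> [[v Ev /rV0Pn[i]]|[i /nonzero_onP[v Ev h]]].
  by rewrite mxE => h; exists i; apply/nonzero_onP; exists v.
by exists v => //; apply: contraNneq h => /rowP/(_ i); rewrite !mxE => ->.
Qed.

Lemma tm_eqv_generic (F G : tuplemap k m n) : tm_eqv Gam F G ->
  [/\ prop (tval io F xi) (tval io G xi), exists i, tval io F xi i != 0 & exists i, tval io G xi i != 0].
Proof.
have nz (H : tuplemap k m n) : tm_nonzero_on Gam H -> exists i, tval io H xi i != 0.
  by move=> /tm_nonzero_van[i hi]; exists i; apply/eqP => /hxi.
case=> hF hG h; split; [|exact: nz|exact: nz] => i j.
have /eq_on_van/hxi := h i j; rewrite rmorphB !rmorphM /= => /eqP.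
by rewrite subr_eq0 => /eqP.
Qed.

Lemma generic_prop_eq_on (F G : tuplemap k m n) : prop (tval io F xi) (tval io G xi) ->
  forall i j, van Gam (F i * G j - F j * G i).
Proof. by move=> h i j; apply/hxi; rewrite rmorphB !rmorphM /= h subrr. Qed.

Lemma prop_trans (x y z : 'I_n.+1 -> Om) : (exists i, x i != 0) -> prop x y -> prop x z -> prop y z.
Proof.
move=> [l xl] xy xz i j; apply: (mulfI (mulf_neq0 xl xl)).
have -> : x l * x l * (y i * z j) = (x l * y i) * (x l * z j) by ring.
have -> : x l * x l * (y j * z i) = (x l * y j) * (x l * z i) by ring.
by rewrite (xy l i) (xz l j) (xy l j) (xz l i); ring.
Qed.

Lemma tm_eqv_both (p F G : tuplemap k m n) : tm_eqv Gam p F -> tm_eqv Gam p G ->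
  forall i j, van Gam (F i * G j - F j * G i).
Proof.
move=> /tm_eqv_generic[h1 p0 _] /tm_eqv_generic[h2 _ _]; apply: generic_prop_eq_on.
exact: prop_trans p0 h1 h2.
Qed.

Lemma exists_max_coord (V : set Om) (x : 'I_m.+1 -> Om) : valring V -> (exists i, x i != 0) ->
  exists i0, x i0 != 0 /\ forall i, V (x i / x i0).
Proof.
move=> vV [l xl]; have sV : subring V by case: vV.
have [i0 [x0 hi0]] : exists i0, x i0 != 0 /\ forall i, i \in enum 'I_m.+1 -> V (x i / x i0).
  elim: (enum 'I_m.+1) => [|j s [i0 [x0 h]]]; first by exists l.
  have [xj0|xj0] := eqVneq (x j) 0.
    exists i0; split=> // i; rewrite inE => /orP[/eqP ->|/h //].
    by rewrite xj0 mul0r; exact: subring0.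
  have [_ /(_ (x j / x i0))[hj|hj]] := vV.
    by exists i0; split=> // i; rewrite inE => /orP[/eqP ->|/h].
  exists j; split=> // i; rewrite inE => /orP[/eqP ->|/h hi].
    by rewrite divff //; exact: subring1.
  have -> : x i / x j = (x i / x i0) * (x j / x i0)^-1 by field; rewrite x0 xj0.
  exact: (subringM sV).
by exists i0; split=> // i; apply: hi0; rewrite mem_enum.
Qed.

End Representatives.

(** A point [y] of [D] is the image of a point of [E]: extend the specialization at
    [y] of the function field of [D] to a place of the function field of [E]. *)
Lemma morphism_surjective (k : closedFieldType) m n (Gam E : set 'rV[k]_m.+1) (X D : set 'rV[k]_n.+1)
    (p G : tuplemap k m n) :
  projective Gam -> projective E -> E `<=` Gam -> projective D -> D `<=` X ->
  (forall x, Gam x -> defined_at Gam X p x) -> tm_hom G -> tm_eqv Gam p G ->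
  (forall d P, hom d P -> van D P <-> van E (tcomp G P)) ->
  forall y, D y -> exists2 x, E x & evaluates Gam X p x y.
Proof.
move=> pGam pE EG pD DX dp [e hG] pG hD y Dy.
have [OmG [ioG [xiG [_ _ hxiG]]]] := projective_generic pGam.
have [Om [io [x [gx x0 hx]]]] := projective_generic pE.
have /rV0Pn[i2 yi2] := zclosed_neq0 (proj1 pD) Dy.
pose yE := tval io G x.
have hyE d P : hom d P -> mmap io yE P = 0 <-> van D P.
  by move=> hP; rewrite (hD _ _ hP) -hx mmap_tcomp.
have yE0 : yE i2 != 0.
  apply/eqP => h; have := proj1 (hyE _ _ (hX1 k i2)); rewrite mmap_var => /(_ h)/(_ y Dy).
  by rewrite /ev mevalXU => /eqP; rewrite (negbTE yi2).
pose z' i := (yE i2)^-1 * yE i.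
have z'1 : z' i2 = 1 by rewrite /z' mulVf.
pose y' i := (y ord0 i2)^-1 * y ord0 i.
have y'1 : y' i2 = 1 by rewrite /y' mulVf.
have spec Q : mmap io z' Q = 0 -> meval y' Q = 0.
  set dQ := mmeasure mdeg Q => zQ.
  have hh := hz_hom i2 dQ Q.
  have e1 := hz_ev (idfun : {rmorphism k -> k}) y'1 (leqnSn dQ : (mmeasure mdeg Q <= dQ.+1)%N).
  apply: etrans (esym e1) _; rewrite (dhomog_scale _ _ _ hh).
  have vD : van D (hz i2 dQ Q).
    apply/(hyE _ _ hh); have := hz_ev io z'1 (leqnSn dQ : (mmeasure mdeg Q <= dQ.+1)%N).
    rewrite zQ (dhomog_scale _ _ _ hh) => /eqP; rewrite mulf_eq0 expf_eq0 invr_eq0 (negbTE yE0) andbF /=.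
    by move/eqP.
  by have := vD y Dy; rewrite /ev /meval => ->; rewrite mulr0.
have [||||V [vV Vz JV]] := @valring_specialization _ _ (mmap io z') [set P | meval y' P = 0].
- by rewrite /= meval1 => /eqP; rewrite oner_eq0.
- by move=> a b /= ha hb; rewrite mevalD ha hb addr0.
- by move=> a b /= ha; rewrite mevalM ha mulr0.
- exact: spec.
have sV : subring V by case: vV.
have kV : overk io V by move=> c; have := Vz (mpolyC _ c); rewrite /= mmapC.
have Vz' i : V (z' i) by have := Vz (mpX k i); rewrite /= mmap_var.
have [i3 [xi3 hi3]] := exists_max_coord vV x0.
pose x' i := (x i3)^-1 * x i.
have Vx' i : V (x' i) by rewrite /x' mulrC.
have x'1 : x' i3 = 1 by rewrite /x' mulVf.
have [E' [[pE' hE'] _]] := exists_place_center vV kV Vx' x'1.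
have E'E : E' `<=` E.
  apply: zclosed_sub; first by case: pE.
    by move=> v; apply: zclosed_neq0; case: pE'.
  move=> P [d hP] /hx zP; apply/(hE' _ _ hP); rewrite (dhomog_scale _ _ _ hP) zP mulr0; by left.
have [x1 E'x1] : E' !=set0 by case: pE' => _ [].
have [y1 [Gx1 Xy1 [G' [[e' hG'] pG' G'0 ey1]]]] := dp x1 (EG _ (E'E _ E'x1)).
have [j1 G'j1] : exists j, ev (G' j) x1 != 0 by case/rV0Pn: G'0 => j; rewrite mxE; exists j.
have both := tm_eqv_both hxiG pG' pG.
pose mu := tval io G' x' i2.
have hmu i : tval io G' x' i = mu * z' i.
  have : mmap io x (G' i * G i2 - G' i2 * G i) = 0 by apply/hx; exact: van_sub (both i i2).
  rewrite rmorphB !rmorphM /= -/(tval io G x i2) -/(tval io G x i) -/yE => /eqP.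
  rewrite subr_eq0 => /eqP h.
  rewrite /mu /tval !(dhomog_scale _ _ _ (hG' _)) /z' -mulrA; congr (_ * _).
  by apply: (mulIf yE0); rewrite h; move: yE0; clear; move: (yE i2) (yE i) (mmap _ _ _) => a b c a0; field.
have Vmu : V mu by exact: V_evz.
have nmu : ~ maxi V mu.
  move=> m'; case/eqP: G'j1; apply: (proj2 (hE' _ _ (hG' j1))) => //.
  by rewrite -/(tval io G' x' j1) hmu; apply: (maxiMl vV).
have prp i j : y ord0 j * ev (G' i) x1 = y ord0 i * ev (G' j) x1.
  pose Q : mp n.+1 k := y ord0 j *: mpX k i - y ord0 i *: mpX k j.
  have mQ : maxi V (mmap io z' Q).
    by apply: JV; rewrite /= /Q mevalB !mevalZ !mevalXU /y'; ring.
  have hQ : hom e' (y ord0 j *: G' i - y ord0 i *: G' j) by apply: rpredB; apply: rpredZ; exact: hG'.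
  have : van E' (y ord0 j *: G' i - y ord0 i *: G' j).
    apply/(hE' _ _ hQ); rewrite rmorphB -!mul_mpolyC !rmorphM /= !mmapC.
    rewrite -!/(tval io G' x' _) !hmu.
    have -> : io (y ord0 j) * (mu * z' i) - io (y ord0 i) * (mu * z' j) = mu * mmap io z' Q.
      by rewrite /Q rmorphB -!mul_mpolyC !rmorphM /= !mmapC !mmap_var; ring.
    exact: (maxiM vV).
  move=> /(_ x1 E'x1); rewrite /ev mevalB !mevalZ => /eqP.
  by rewrite subr_eq0 => /eqP.
pose c := y ord0 i2 / ev (G' i2) x1.
have g2 : ev (G' i2) x1 != 0.
  apply: contraNneq G'j1 => h; have := prp i2 j1; rewrite h mulr0 => /esym/eqP.
  by rewrite mulf_eq0 (negbTE yi2).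
have c0 : c != 0 by rewrite mulf_neq0 // invr_eq0.
exists x1; first exact: E'E.
split=> //; first exact: DX.
exists (fun i => c *: G' i); split.
- by exists e' => i; apply: rpredZ; exact: hG'.
- case: pG' => n1 /tm_nonzero_van[i hi] h; split=> //.
    apply/tm_nonzero_van; exists i => hc; apply: hi => v Gv; have := hc v Gv.
    by rewrite /ev mevalZ => /eqP; rewrite mulf_eq0 (negbTE c0) => /eqP.
  move=> i' j v Gv; have := h i' j v Gv; rewrite /ev !rmorphM /= !mevalZ => h'.
  by rewrite mulrCA h' mulrCA.
- apply/eqP => /rowP/(_ i2); rewrite !mxE /ev mevalZ => /eqP.
  by rewrite mulf_eq0 (negbTE c0) /= => /eqP h; case/eqP: g2.
apply/rowP => i; rewrite mxE /ev mevalZ -/(ev (G' i) x1) /c mulrAC prp mulfK //.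
Qed.

Lemma kfun_comp (k : closedFieldType) (Om : fieldType) (io : {rmorphism k -> Om}) m n
    (x : 'I_n.+1 -> Om) (y : 'I_m.+1 -> Om) (G : tuplemap k m n) e a w :
  (forall i, hom e (G i)) -> x =1 (fun i => a * tval io G y i) -> kfun io x w -> kfun io y w.
Proof.
move=> hG ex [d [N [M [hN hM M0 ->]]]].
have E P : hom d P -> mmap io x P = a ^+ d * mmap io y (tcomp G P).
  by move=> hP; rewrite (mmap_ext io ex) (dhomog_scale _ _ _ hP) mmap_tcomp.
move: M0; rewrite !E // mulf_eq0 negb_or => /andP[ad M0].
exists (e * d)%N, (tcomp G N), (tcomp G M).
split=> //; try exact: tcomp_hom.
by rewrite invfM mulrACA divff // mul1r.
Qed.

Lemma kfun_scale (k : closedFieldType) (Om : fieldType) (io : {rmorphism k -> Om}) n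
    (x y : 'I_n.+1 -> Om) a w : x =1 (fun i => a * y i) -> kfun io x w -> kfun io y w.
Proof.
move=> ex; apply: (@kfun_comp _ _ _ _ _ _ _ (@tm_id k n) 1%N a); first exact: hX1.
by move=> i; rewrite ex /tval mmap_var.
Qed.
Lemma lin_scale (k : closedFieldType) (Om : fieldType) (io : {rmorphism k -> Om}) n c
    (M : 'I_n -> 'I_c -> k) (x y : 'I_n -> Om) a j :
  x =1 (fun i => a * y i) -> lin io M x j = a * lin io M y j.
Proof. by move=> e; rewrite /lin mulr_sumr; apply: eq_bigr => i _; rewrite e mulrCA. Qed.

(** * The divisors at which a given prime factor is centered *)

Section Divisor.
Variables (k : closedFieldType) (Om : fieldType) (io : {rmorphism k -> Om}) (n r : nat).
Variables (eta : 'I_n.+1 -> Om) (M : 'I_n.+1 -> 'I_r.+2 -> k) (I : finType) (dg : I -> nat)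
  (g : I -> mp n.+1 k).
Hypotheses (geta : graded io eta) (fM : finlin io eta M dg g) (ai : algindep io (lin io M eta)).
Notation eve := (mmap io eta).
Notation t := (lin io M eta).
Notation evt := (mmap io t).
Variable X : set 'rV[k]_n.+1.
Hypotheses (pX : projective X) (nX : normal X) (heta : forall P, eve P = 0 <-> van X P).
Variables (m : nat) (Gam : set 'rV[k]_m.+1) (xi : 'I_m.+1 -> Om).
Hypotheses (pG : projective Gam) (nG : normal Gam)
  (hxi : forall P, mmap io xi P = 0 <-> van Gam P).
Variables (p1 p2 : tuplemap k m n).
Hypotheses (mp1 : is_morphism Gam X p1) (mp2 : is_morphism Gam X p2)
  (pr1 : prop (tval io p1 xi) eta)
  (hk : forall w, kfun io xi w <-> kfun io eta w).
Variables (V : set Om) (vV : valring V) (Vt : forall a, V (evt a)) (pi : mp r.+2 k) (dl : nat).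
Hypotheses (ppi : primel pi) (hpi : hom dl pi) (hV : forall a, dvd pi a <-> maxi V (evt a)).
Let sV : subring V. Proof. by case: vV. Qed.
Let kV : overk io V. Proof. exact: place_overk Vt. Qed.
Let Ve : forall i, V (eta i). Proof. exact: (place_eta fM vV Vt). Qed.

Variables (i0 : 'I_m.+1) (i1 : 'I_n.+1).
Hypotheses (xi0 : xi i0 != 0) (hi0 : forall i, V (xi i / xi i0)) (ne1 : ~ maxi V (eta i1)).
Let e10 : eta i1 != 0. Proof. exact: nmaxi_neq0 ne1. Qed.
Let z i := (xi i0)^-1 * xi i.
Let z2 i := (eta i1)^-1 * eta i.
Let Vz i : V (z i). Proof. by rewrite /z mulrC. Qed.
Let z1 : z i0 = 1. Proof. by rewrite /z mulVf. Qed.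
Let Ve1 : V (eta i1)^-1. Proof. exact: (nmaxi_unit (Ve i1)). Qed.
Let Vz2 i : V (z2 i). Proof. exact: (subringM sV). Qed.
Let z21 : z2 i1 = 1. Proof. by rewrite /z2 mulVf. Qed.

Let Vzz P : V (mmap io z P). Proof. exact: (V_evz vV kV Vz). Qed.

Let scale0 n' (x : 'I_n' -> Om) a d P : a != 0 -> hom d P ->
  mmap io (fun i => a * x i) P = 0 <-> mmap io x P = 0.
Proof.
move=> a0 hP; rewrite (dhomog_scale _ _ _ hP); split=> [/eqP|->]; last by rewrite mulr0.
by rewrite mulf_eq0 expf_eq0 (negbTE a0) andbF => /eqP.
Qed.

Let hzG d P : hom d P -> mmap io z P = 0 <-> van Gam P.
Proof. by move=> hP; rewrite -hxi; apply: (scale0 _ _ hP); rewrite invr_eq0. Qed.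

Let hzX d P : hom d P -> mmap io z2 P = 0 <-> van X P.
Proof. by move=> hP; rewrite -heta; apply: (scale0 _ _ hP); rewrite invr_eq0. Qed.

Let kz w : kfun io z w <-> kfun io eta w.
Proof.
rewrite -hk; split; first exact: kfun_scale.
by apply: (kfun_scale (a := xi i0)) => i; rewrite /z mulVKf.
Qed.

Let kz2 w : kfun io z2 w <-> kfun io eta w.
Proof.
split; first exact: kfun_scale.
by apply: (kfun_scale (a := eta i1)) => i; rewrite /z2 mulVKf.
Qed.

Variables (E : set 'rV[k]_m.+1) (D : set 'rV[k]_n.+1).
Hypotheses (cE : is_center io V z E) (cD : is_center io V z2 D)
  (memD : forall v, v != 0 -> (forall d P, hom d P -> maxi V (mmap io z2 P) -> ev P v = 0) -> D v).
Let pE : projective E. Proof. by case: cE. Qed.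
Let pD : projective D. Proof. by case: cD. Qed.
Let hE d P : hom d P -> van E P <-> maxi V (mmap io z P). Proof. by case: cE => _; apply. Qed.
Let hD d P : hom d P -> van D P <-> maxi V (mmap io z2 P). Proof. by case: cD => _; apply. Qed.

Let EG : E `<=` Gam.
Proof.
apply: zclosed_sub; [by case: pG|by move=> v; apply: zclosed_neq0; case: pE|].
by move=> P [d hP] /(hzG hP) e; apply/(hE hP); rewrite e; left.
Qed.

Let DX : D `<=` X.
Proof.
apply: zclosed_sub; [by case: pX|by move=> v; apply: zclosed_neq0; case: pD|].
by move=> P [d hP] /(hzX hP) e; apply/(hD hP); rewrite e; left.
Qed.

(** A representative of [p1] at the normalized generic point is [eta] times some [l] in [V]. If [l]
    were a nonunit, all its components would be nonunits, that is, vanish on [E]. *)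
Let rep1 (G : tuplemap k m n) e : (forall i, hom e (G i)) -> tm_eqv Gam p1 G ->
  exists l, [/\ V l, tval io G z =1 (fun i => l * eta i) & (exists i, ~ van E (G i)) -> ~ maxi V l].
Proof.
move=> hG /(tm_eqv_generic hxi)[pG' p0 _].
have pe : prop (tval io G xi) eta by exact: prop_trans p0 pG' pr1.
have ez i : tval io G z i = (xi i0)^-1 ^+ e * tval io G xi i by rewrite /tval (dhomog_scale _ _ _ (hG i)).
exists (tval io G z i1 / eta i1).
have Vl : V (tval io G z i1 / eta i1) by apply: (subringM sV) => //; exact: Vzz.
have el : tval io G z =1 (fun i => tval io G z i1 / eta i1 * eta i).
  apply: prop_scale e10 _ => i j; rewrite !ez -!mulrA; congr (_ * _); exact: pe.
split=> // -[i ni] ml; apply: ni; apply/(hE (hG i)); rewrite -/(tval io G z i) el.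
by apply: (maxiMl vV).
Qed.

Let ex_rep (p : tuplemap k m n) : is_morphism Gam X p ->
  exists G e, [/\ forall i, hom e (G i), tm_eqv Gam p G & exists i, ~ van E (G i)].
Proof.
move=> [_ mp]; have [x Ex] : E !=set0 by case: pE => _ [].
have [y [_ _ [G [[e hG] pG' G0 _]]]] := mp x (EG Ex).
case/rV0Pn: G0 => i; rewrite mxE => Gi.
by exists G, e; split=> //; exists i; apply/nonzero_onP; exists x.
Qed.

Let unitE l : V l -> ~ maxi V l -> l != 0 /\ V l^-1.
Proof. by move=> Vl nl; split; [exact: nmaxi_neq0 nl|exact: (nmaxi_unit Vl)]. Qed.

(** The local ring at [E] is the trace of [V] on the function field. The target coordinates become
    forms on [Gam] by composing with a representative of [p1], up to the unit [l], as [place_normal]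
    requires. *)
Let OEE w : kfun io z w -> V w -> OE io V z w.
Proof.
have [G [e [hG eG nG']]] := ex_rep mp1; have [l [Vl el /(_ nG') nl]] := rep1 hG eG.
have [l0 Vl'] := unitE Vl nl.
move=> kw Vw; apply: (@place_normal _ _ _ _ _ _ _ _ _ _ geta fM ai _ vV Vt _ ppi hV _ z i0 Gam E
  (fun j => tcomp G (linf M j)) l) => //.
- by move=> j; rewrite mmap_tcomp mmap_linf; exact: lin_scale.
- exact/kz.
Qed.

Let OED w : kfun io z2 w -> V w -> OE io V z2 w.
Proof.
move=> kw Vw; apply: (@place_normal _ _ _ _ _ _ _ _ _ _ geta fM ai _ vV Vt _ ppi hV _ z2 i1 X D
  (fun j => linf M j) (eta i1)^-1) => //.
- by move=> j; rewrite mmap_linf; exact: lin_scale.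
- by rewrite invr_eq0.
- by rewrite invrK.
- exact/kz2.
Qed.

Lemma center_lincomp d b : hom d b -> van D (lincomp M b) <-> dvd pi b.
Proof.
move=> hb; rewrite (hD (lincomp_hom M hb)) hV mmap_lincomp.
have -> : mmap io (lin io M z2) b = (eta i1)^-1 ^+ d * evt b.
  rewrite -(dhomog_scale _ _ _ hb); apply: mmap_ext => j; exact: lin_scale.
by apply: (maxi_scaleX vV); rewrite ?invr_eq0 ?invrK.
Qed.

(** [pi], viewed as a form on [Gam] through a representative [G] of [p1]. *)
Let piG (G : tuplemap k m n) := tcomp G (lincomp M pi).

Let piG_ev G l : tval io G z =1 (fun i => l * eta i) -> mmap io z (piG G) = l ^+ dl * evt pi.
Proof.
move=> el; rewrite mmap_tcomp mmap_lincomp -(dhomog_scale _ _ _ hpi); apply: mmap_ext => j.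
exact: lin_scale.
Qed.

Let mpi : maxi V (evt pi). Proof. by apply/hV; exists 1; rewrite mul1r. Qed.
Let pi_neq0 : evt pi != 0.
Proof. by apply/eqP => /ai; case: ppi => /eqP. Qed.

Lemma center_prime_E : prime_divisor Gam E.
Proof.
have [s [ks ms s0 hs]] := place_uniformizer fM ai vV Vt ppi hpi hV.
have [G [e [hG eG nG']]] := ex_rep mp1; have [l [Vl el /(_ nG') nl]] := rep1 hG eG.
apply: (center_prime_divisor vV kV Vz z1 pG hzG EG cE _ OEE (s := s)) => //; last 2 first.
- exact/kz.
- by move=> w /kz; exact: hs.
have hpiG : hom (e * dl) (piG G) by apply: tcomp_hom => //; exact: lincomp_hom.
exists (e * dl)%N, (piG G); split=> //.
  by apply/(hE hpiG); rewrite (piG_ev el); apply: (maxiM vV) => //; exact: (subringX sV).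
by move/(hzG hpiG)/eqP; rewrite (piG_ev el) mulf_eq0 expf_eq0 (negbTE pi_neq0) (negbTE (nmaxi_neq0 nl)) andbF.
Qed.

Lemma center_prime_D : prime_divisor X D.
Proof.
have [s [ks ms s0 hs]] := place_uniformizer fM ai vV Vt ppi hpi hV.
apply: (center_prime_divisor vV kV Vz2 z21 pX hzX DX cD _ OED (s := s)) => //; last 2 first.
- exact/kz2.
- by move=> w /kz2; exact: hs.
have hp : hom dl (lincomp M pi) by exact: lincomp_hom.
exists dl, (lincomp M pi); split=> //.
  by apply/(center_lincomp hpi); exists 1; rewrite mul1r.
by move/heta/eqP; rewrite mmap_lincomp (negbTE pi_neq0).
Qed.

Let vanDE G e d P : (forall i, hom e (G i)) -> tm_eqv Gam p1 G -> (exists i, ~ van E (G i)) -> hom d P ->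
  van D P <-> van E (tcomp G P).
Proof.
move=> hG eG nG' hP; have [l [Vl el /(_ nG') nl]] := rep1 hG eG; have [l0 Vl'] := unitE Vl nl.
rewrite (hD hP) (hE (tcomp_hom hG hP)) mmap_tcomp.
have e2 : tval io G z =1 (fun i => (l * eta i1) * z2 i) by move=> i; rewrite el /z2 mulrA mulfK.
rewrite (mmap_ext io e2) [mmap io (fun i => _ * z2 i) P](dhomog_scale _ _ _ hP).
have u0 : l * eta i1 != 0 by rewrite mulf_neq0.
by apply: iff_sym; apply: (maxi_scaleX vV) => //; rewrite ?invfM; exact: (subringM sV).
Qed.

(** Points of the image satisfy all forms that are nonunits at the center, which is what [memD]
    tests; the converse is [morphism_surjective]. *)
Lemma center_image : rm_image Gam X p1 E = D.
Proof.
have [G [e [hG eG nG']]] := ex_rep mp1.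
apply/seteqP; split=> y; last first.
  move=> Dy; have [] := @morphism_surjective k m n Gam E X D p1 G pG pE EG pD DX (proj2 mp1) _ eG _ y Dy.
  - by exists e.
  - by move=> d P; exact: vanDE.
  - by move=> x Ex h; exists x.
move=> [x Ex [_ _ [G' [[e' hG'] eG' G'0 ->]]]]; apply: memD => // d P hP mP.
have [l [Vl el _]] := rep1 hG' eG'.
have : van E (tcomp G' P).
  apply/(hE (tcomp_hom hG' hP)); rewrite mmap_tcomp.
  have e2 : tval io G' z =1 (fun i => (l * eta i1) * z2 i) by move=> i; rewrite el /z2 mulrA mulfK.
  rewrite (mmap_ext io e2) (dhomog_scale _ _ _ hP).
  by apply: (maxiM vV) => //; apply: (subringX sV); exact: (subringM sV).
move=> /(_ x Ex) h; rewrite -[RHS]h /ev /meval mmap_tcomp; apply: mmap_ext => i.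
by rewrite mxE.
Qed.

(** The local rings at [E] and [D] are both the trace of [V], so the residue extension is trivial:
    one element is independent and two never are. The maximum in [field_degree] therefore exists and
    is positive. *)
Lemma center_field_degree : (0 < field_degree Gam p1 E D)%N.
Proof.
have one G e : (forall i, hom e (G i)) -> tm_eqv Gam p1 G -> tm_nonzero_on E G -> indep_over E D G 1.
  move=> hG eG /tm_nonzero_van nG'; exists (fun _ => 1); split; first by exists 0%N => i; exact: dhomog1.
  move=> A [d hA] h i; apply/van_eq_on; apply/(vanDE hG eG nG' (hA i)).
  by move: h => /van_eq_on; rewrite big_ord1 mulr1 (ord1 i).
have [G [e [hG eG nG']]] := ex_rep mp1.
pose S := [set r | exists G : tuplemap k m n,
    [/\ tm_hom G, tm_eqv Gam p1 G, tm_nonzero_on E G, indep_over E D G r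
      & forall s, indep_over E D G s -> (s <= r)%N]].
have [G' [[e' hG'] eG' nG'' _ h]] : S (field_degree Gam p1 E D); last first.
  by apply: h; exact: one hG' eG' nG''.
apply: xgetPex; exists 1%N; exists G; have nG'' : tm_nonzero_on E G by exact/tm_nonzero_van.
split=> //; [by exists e|exact: one hG eG nG''|].
move=> [|[|s]] // [P [[d hP] ind]].
have [l [Vl el /(_ nG') nl]] := rep1 hG eG; have [l0 Vl'] := unitE Vl nl.
pose j0 : 'I_s.+2 := ord0; pose j1 : 'I_s.+2 := lift ord0 ord0.
have sum2 (B : 'I_s.+2 -> mp m.+1 k) : (forall j, j != j0 -> j != j1 -> B j = 0) -> \sum_j B j = B j0 + B j1.
  move=> hB; rewrite (bigD1 j0) //= (bigD1 j1) //= big1 ?addr0 // => j /andP[a b]; exact: hB.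
have comp0 (A : mp n.+1 k) : A = 0 -> tcomp G A = 0.
  by move=> ->; exact: rmorph0.
have nD1 := van1N pD.
exfalso; have [P0|nP0] := pselect (van E (P j0)).
  apply: nD1; apply/van_eq_on.
  have := ind (fun j => if j == j0 then 1 else 0) _ _ j0; rewrite eqxx; apply.
    by exists 0%N => j; case: ifP => _; [exact: dhomog1|exact: rpred0].
  apply/van_eq_on; rewrite sum2 => [|j /negbTE -> _]; last by rewrite comp0 // mul0r.
  rewrite eqxx /= [X in _ + X * _]comp0 // mul0r addr0; exact: vanM.
have nmP0 : ~ maxi V (mmap io z (P j0)) by move/(hE (hP j0)).
have [P00 VP0] := unitE (Vzz _) nmP0.
pose w := mmap io z (P j1) / mmap io z (P j0).
have kw : kfun io z2 w by apply: (proj2 (kz2 w)); apply: (proj1 (kz w)); exists d, (P j1), (P j0); split=> //; exact: hP.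
have Vw : V w by apply: (subringM sV) => //; exact: Vzz.
have [d' [N [M' [hN hM' nM' ew]]]] := OED kw Vw.
apply: (nM'); apply/(hD hM'); apply/van_eq_on.
have := ind (fun j => if j == j0 then - N else if j == j1 then M' else 0) _ _ j1.
rewrite eqxx; apply.
  exists d' => j; case: ifP => _; first by rewrite /homog rpredN.
  by case: ifP => _ //; exact: rpred0.
apply/van_eq_on; rewrite sum2 => [|j /negbTE -> /negbTE ->]; last by rewrite comp0 // mul0r.
rewrite !eqxx /=.
have hS : hom (e * d' + d) (tcomp G (- N) * P j0 +
    tcomp G M' * P j1).
  apply: rpredD; (apply: dhomogM; [apply: tcomp_hom; first exact: hG|exact: hP]).
    by rewrite rpredN.
  exact: hM'.
apply/(hE hS); left; rewrite rmorphD !rmorphM /= !mmap_tcomp.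
have e2 : tval io G z =1 (fun i => (l * eta i1) * z2 i) by move=> i; rewrite el /z2 mulrA mulfK.
rewrite !(mmap_ext io e2) rmorphN /=.
rewrite [mmap io (fun i => _ * z2 i) N](dhomog_scale _ _ _ hN).
rewrite [mmap io (fun i => _ * z2 i) M'](dhomog_scale _ _ _ hM').
have M0 := nmaxi_neq0 nM'.
have : mmap io z (P j1) = mmap io z2 N / mmap io z2 M' * mmap io z (P j0).
  by rewrite -ew /w mulfVK.
by move=> ->; field.
Qed.

(** Dividing [P] by the power of the uniformizer of equal value leaves a unit of the local ring,
    that is, a quotient of forms not vanishing on [E]. It supplies both the local equation and the
    existence of an order. *)
Let order_form s (N N0 : mp m.+1 k) d0 d P : kfun io eta s -> maxi V s -> s != 0 ->
  (forall w, kfun io eta w -> V w -> w != 0 -> exists j : nat, V (w / s ^+ j) /\ V (s ^+ j / w)) ->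
  hom d0 N -> hom d0 N0 -> ~ maxi V (mmap io z N0) -> s = mmap io z N / mmap io z N0 ->
  hom d P -> mmap io z P != 0 -> exists (j : nat) (A C : mp m.+1 k),
  [/\ ishom A, ishom C, ~ van E A, ~ van E C & eq_on Gam (P * C) (A * N ^+ j) /\
    (maxi V (mmap io z P) -> (0 < j)%N)].
Proof.
move=> ks ms s0 hs hN hN0 nN0 es hP P0.
have kP : kfun io z (mmap io z P) by exact: (kfun_ev io vV z1).
have [j [j1 j2]] := hs _ (proj1 (kz _) kP) (Vzz P) P0.
have sj : s ^+ j != 0 by rewrite expf_neq0.
have kw : kfun io z (mmap io z P / s ^+ j).
  by apply: kfunM => //; apply: (kfunV vV z1); apply: (kfunX vV z1); exact/kz.
have [d' [N' [M' [hN' hM' nM' ew]]]] := OEE kw j1.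
have M0 := nmaxi_neq0 nM'; have N00 := nmaxi_neq0 nN0.
have w0 : mmap io z P / s ^+ j != 0 by rewrite mulf_neq0 // invr_eq0.
have nN' : ~ maxi V (mmap io z N').
  have h : ~ maxi V (mmap io z P / s ^+ j) by apply: (unit_nmaxi w0); rewrite invf_div.
  move=> mN'; apply: h; rewrite ew; apply: (maxiMl vV) => //; exact: (nmaxi_unit (Vzz M')).
exists j, (N' * mpX k i0 ^+ d), (M' * N0 ^+ j).
have hXd : hom d (mpX k i0 ^+ d) by apply: hom1X; exact: hX1.
have hA : hom (d' + d) (N' * mpX k i0 ^+ d) by exact: dhomogM.
have hC : hom (d' + d0 * j) (M' * N0 ^+ j) by apply: dhomogM => //; exact: dhomogMn.
split; [by eexists; exact: hA|by eexists; exact: hC|..].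
- move/(hE hA); rewrite rmorphM rmorphXn /= mmap_var z1 expr1n mulr1; exact: nN'.
- move/(hE hC); rewrite rmorphM rmorphXn /= => /(maxi_prime vV (Vzz M')) [].
  + by apply: (subringX sV); exact: Vzz.
  + exact: nM'.
  + by move/(maxiXn vV (Vzz N0)).
split; last first.
  by case: (j) j2 => // ; rewrite expr0 div1r => h mP; case: (unit_nmaxi P0 h mP).
have hT : hom (d + (d' + d0 * j)) (P * (M' * N0 ^+ j) - N' * mpX k i0 ^+ d * N ^+ j).
  rewrite rpredB //; first exact: dhomogM.
  have -> : (d + (d' + d0 * j) = d' + d + d0 * j)%N by rewrite addnA [(d + d')%N]addnC.
  by apply: dhomogM => //; exact: dhomogMn.
apply/eq_on_van/(hzG hT); rewrite rmorphB !rmorphM !rmorphXn /= mmap_var z1 expr1n mulr1.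
have Nj : mmap io z N0 ^+ j != 0 by rewrite expf_neq0.
have -> : mmap io z P = mmap io z N' / mmap io z M' * (mmap io z N ^+ j / mmap io z N0 ^+ j).
  by rewrite -ew -expr_div_n -es mulfVK.
by field; rewrite Nj M0.
Qed.

(** With [T] a local equation, [pi] is a multiple of [T] in [V], and [T] to the multiplicity clears
    the pole of the coordinate of [p2] divided by [h]. A multiplicity of at most [a] would let
    [pi ^+ a] clear it too. *)
Lemma center_pullback_mult h a i : hom 1%N h -> mmap io (tval io p2 xi) h != 0 ->
  ~ V (evt pi ^+ a * (tval io p2 xi i / mmap io (tval io p2 xi) h)) ->
  (a < pullback_mult Gam p2 h E)%N.
Proof.
move=> hh h0 nV.
set zt := tval io p2 xi in h0 nV; set ph := zt i / _ in nV.
have repz G e : (forall i, hom e (G i)) -> tm_eqv Gam p2 G ->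
    mmap io (tval io G z) h * ph = tval io G z i /\ mmap io (tval io G z) h != 0.
  move=> hG /(tm_eqv_generic hxi)[pG' [j zj] [j' gj']].
  have ez i' : tval io G z i' = (xi i0)^-1 ^+ e * tval io G xi i' by rewrite /tval (dhomog_scale _ _ _ (hG i')).
  pose c := tval io G z j / zt j.
  have ec : tval io G z =1 (fun i => c * zt i).
    by apply: prop_scale zj _ => a' b; rewrite !ez -!mulrA; congr (_ * _); exact: prop_sym.
  have c0 : c != 0.
    apply: contraNneq gj' => c0; have := ec j'; rewrite c0 mul0r ez => /eqP.
    by rewrite mulf_eq0 expf_eq0 invr_eq0 (negbTE xi0) andbF.
  have eh : mmap io (tval io G z) h = c * mmap io zt h.
    by rewrite (mmap_ext io ec) (dhomog_scale _ _ _ hh) expr1.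
  by rewrite eh ec /ph; split; [field|rewrite mulf_neq0].
have [s [ks ms s0 hs]] := place_uniformizer fM ai vV Vt ppi hpi hV.
have [d0 [N [N0 [hN hN0 nN0 es]]]] := OEE (proj2 (kz s) ks) (maxi_sub vV ms).
have N00 := nmaxi_neq0 nN0.
have mN : maxi V (mmap io z N).
  have -> : mmap io z N = s * mmap io z N0 by rewrite es mulfVK.
  by apply: (maxiMl vV) => //; exact: Vzz.
have lN : local_equation Gam E N.
  split; first by exists d0.
    by apply/van_eq_on; apply/(hE hN).
  move=> P [d hP] /van_eq_on/(hE hP) mP; have [P0|P0] := eqVneq (mmap io z P) 0.
    exists 0, 1; split; [by exists 0%N; exact: rpred0|by exists 0%N; exact: dhomog1|..].
      exact/nonzero_onP/van1N.
    by apply/eq_on_van; rewrite mul0r subr0 mulr1; apply/(hzG hP).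
  have [j [A [C [hA hC nA nC [eqG /(_ mP) j0]]]]] := order_form ks ms s0 hs hN hN0 nN0 es hP P0.
  exists (A * N ^+ j.-1), C; split=> //.
  - by case: hA => a' ha; exists (a' + d0 * j.-1)%N; apply: dhomogM => //; exact: dhomogMn.
  - exact/nonzero_onP.
  - by move: eqG; rewrite -{1}(prednK j0) exprSr mulrA.
pose S := [set r | exists G : tuplemap k m n,
    [/\ tm_hom G, tm_eqv Gam p2 G, tm_nonzero_on E G
      & is_order_along Gam E (tcomp G h) r]].
have [G [[e hG] eG nG' [T [A [C [[hT vT gT] [[dA hA] [dC hC]] [nA nC] eqG]]]]]] : S (pullback_mult Gam p2 h E).
  apply: xgetPex; have [G [e [hG eG nG']]] := ex_rep mp2.
  have hhG : hom e (tcomp G h) by exact: tcomp_hom1.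
  have [|j [A [C [hA hC nA nC [eqG _]]]]] := order_form ks ms s0 hs hN hN0 nN0 es hhG.
    by rewrite mmap_tcomp; case: (repz G e hG eG).
  exists j, G; split=> //; [by exists e|exact/tm_nonzero_van|].
  by exists N, A, C; split=> //; split; exact/nonzero_onP.
set r' := pullback_mult Gam p2 h E in eqG *; rewrite ltnNge; apply/negP => ra; apply: nV.
have [eh _] := repz G e hG eG.
have unitf d P : hom d P -> nonzero_on E P -> mmap io z P != 0 /\ V (mmap io z P)^-1.
  by move=> hP /nonzero_onP nP; apply: unitE; [exact: Vzz|move/(hE hP)].
have [A0 VA] := unitf _ _ hA nA; have [C0 VC] := unitf _ _ hC nC.
have hhG : hom e (tcomp G h) by exact: tcomp_hom1.
have z_of P Q : van Gam (P - Q) -> mmap io z P = mmap io z Q.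
  have gr R : van Gam R -> mmap io z R = 0.
    move=> vR; rewrite (hom_decomp R) rmorph_sum big1 //= => d _; apply/(hzG (hc_hom d R)).
    apply: van_hc vR => c v c0 Gv; apply: zclosed_scale => //; by case: pG.
  by move/gr; rewrite rmorphB /= => /eqP; rewrite subr_eq0 => /eqP.
have eq1 := z_of _ _ (proj1 (eq_on_van _ _ _) eqG).
rewrite !rmorphM rmorphXn /= mmap_tcomp in eq1.
have [G1 [e1 [hG1 eG1 nG1]]] := ex_rep mp1; have [l [Vl el /(_ nG1) nl]] := rep1 hG1 eG1.
have [l0 Vl'] := unitE Vl nl.
have hpiG : hom (e1 * dl) (piG G1) by apply: tcomp_hom => //; exact: lincomp_hom.
have [|A' [C' [[dA' hA'] [dC' hC'] nC' eqT]]] := gT (piG G1) (ex_intro (fun d => homog d (piG G1)) _ hpiG).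
  by apply/van_eq_on; apply/(hE hpiG); rewrite (piG_ev el); apply: (maxiM vV) => //; exact: (subringX sV).
have [C0' VC'] := unitf _ _ hC' nC'.
have eq2 := z_of _ _ (proj1 (eq_on_van _ _ _) eqT).
rewrite !rmorphM /= (piG_ev el) in eq2.
have ll : l ^+ dl != 0 by rewrite expf_neq0.
pose v := mmap io z A' * l^-1 ^+ dl * (mmap io z C')^-1.
have epi : evt pi = v * mmap io z T.
  rewrite /v; apply: (mulIf C0'); apply: (mulfI ll); rewrite mulrA eq2 exprVn.
  by field; rewrite C0' ll.
have Vv : V v.
  apply: (subringM sV) => //; apply: (subringM sV); first exact: Vzz.
  exact: (subringX sV).
have eTr : mmap io z T ^+ r' * ph = mmap io z C / mmap io z A * tval io G z i.
  have hT0 : mmap io z T ^+ r' = mmap io (tval io G z) h * mmap io z C / mmap io z A.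
    by rewrite eq1 mulrAC divff // mul1r.
  by rewrite hT0 -eh; field.
rewrite epi exprMn -mulrA -(subnK ra) [in X in _ * (X * _)]exprD -mulrA eTr.
apply: (subringM sV); first exact: (subringX sV).
apply: (subringM sV); first by apply: (subringX sV); exact: Vzz.
apply: (subringM sV); last exact: Vzz.
by apply: (subringM sV) => //; exact: Vzz.
Qed.

Lemma center_contribution h a i : hom 1%N h -> mmap io (tval io p2 xi) h != 0 ->
  ~ V (evt pi ^+ a * (tval io p2 xi i / mmap io (tval io p2 xi) h)) ->
  (a.+1 * dl <= pullback_mult Gam p2 h E * pushforward_degree Gam X p1 E)%N.
Proof.
move=> hh h0 nV; apply: leq_mul; first exact: (center_pullback_mult hh h0 nV).
rewrite /pushforward_degree center_image asboolT; last exact: center_prime_D.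
rewrite -[dl]mul1n; apply: leq_mul; first exact: center_field_degree.
apply: (@proj_degree_ge k Om io n r eta M I dg g fM pi dl ppi hpi X D _ DX) => //.
- by move=> P /heta.
- by move=> d b; exact: center_lincomp.
Qed.

End Divisor.

Lemma sum_subseq_fsbig (T : choiceType) (A : set T) (f : T -> nat) (U : seq T) : uniq U ->
  (forall x, x \in U -> A x) -> finite_set (A `&` [set x | f x != 0%N]) ->
  (\sum_(x <- U) f x <= \sum_(x \in A) f x)%N.
Proof.
move=> uU UA fA; set S := finite_support _ _ _.
have uS : uniq S by exact: finite_support_uniq.
have inS x : x \in U -> f x != 0%N -> x \in S.
  move=> /UA Ax fx; rewrite in_finite_support; last first.
    by apply: sub_finite_set fA => y [Ay /= /eqP fy].
  by rewrite inE; split=> //=; apply/eqP.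
rewrite (bigID (fun x => f x != 0%N)) /= [X in (_ + X)%N]big1 ?addn0 => [|x]; last by rewrite negbK => /eqP.
rewrite -big_filter; set U' := [seq x <- U | _].
rewrite [X in (_ <= X)%N](bigID (mem U')) /= -[X in (_ <= X + _)%N]big_filter.
apply: leq_trans (leq_addr _ _); rewrite (perm_big [seq x <- S | x \in U']) //.
apply: uniq_perm; rewrite ?filter_uniq // => x; rewrite !mem_filter.
by case: (boolP (f x != 0%N)) => //= fx; case: (boolP (x \in U)) => //= xU; rewrite inS.
Qed.

(** * Pullback degrees *)

Section GenericImages.
Variables (k : closedFieldType) (Om : fieldType) (io : {rmorphism k -> Om}).

Definition generic n (X : set 'rV[k]_n.+1) (x : 'I_n.+1 -> Om) :=
  forall P, mmap io x P = 0 <-> van X P.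

Lemma generic_graded n (X : set 'rV[k]_n.+1) x :
  (forall (c : k) v, c != 0 -> X v -> X (c *: v)) ->
  (forall d P, hom d P -> mmap io x P = 0 <-> van X P) -> graded io x -> generic X x.
Proof.
move=> sX hx gx P; split=> [rP v Xv|vP].
  rewrite (hom_decomp P) /ev raddf_sum big1 //= => d _.
  by apply: (proj1 (hx d _ (hc_hom d P))) => //; exact: gx.
rewrite (hom_decomp P) rmorph_sum big1 //= => d _.
by apply/(hx d _ (hc_hom d P)); exact: van_hc.
Qed.

Lemma generic_neq0 n (X : set 'rV[k]_n.+1) x : X !=set0 -> (forall v, X v -> v != 0) -> generic X x ->
  exists i, x i != 0.
Proof.
move=> [v Xv] X0 gx; have /rV0Pn[i vi] := X0 v Xv; exists i; apply: contraNneq vi => xi0.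
by have /gx/(_ v Xv) : mmap io x (mpX k i) = 0; rewrite ?mmap_var // /ev mevalXU => ->.
Qed.

(** Only forms are tested, so the notion is invariant under scaling; images under rational maps are
    only known up to a scalar. *)
Definition hgeneric n (X : set 'rV[k]_n.+1) (x : 'I_n.+1 -> Om) :=
  forall d P, hom d P -> mmap io x P = 0 <-> van X P.

Lemma hgeneric_eqv n m (X : set 'rV[k]_n.+1) x (F G : tuplemap k n m) :
  hgeneric X x -> tm_hom F -> tm_hom G -> tm_eqv X F G ->
  [/\ prop (tval io F x) (tval io G x), exists i, tval io F x i != 0 & exists i, tval io G x i != 0].
Proof.
have nz (H : tuplemap k n m) : hgeneric X x -> tm_hom H -> tm_nonzero_on X H -> exists i, tval io H x i != 0.
  by move=> hx [e hH] /tm_nonzero_van[i hi]; exists i; apply/eqP => /(hx _ _ (hH i)).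
move=> hx hF hG [nF nG h]; split; [|exact: nz hF nF|exact: nz hG nG] => i j.
have [[a hF'] [b hG']] := (hF, hG).
have hd : hom (a + b) (F i * G j - F j * G i) by apply: rpredB; apply: dhomogM; [exact: hF'|exact: hG'|exact: hF'|exact: hG'].
have /eq_on_van/(hx _ _ hd) := h i j; rewrite rmorphB !rmorphM /= => /eqP.
by rewrite subr_eq0 => /eqP.
Qed.

(** Density of the image gives one direction. For the other, a form vanishing on [Y] pulls back to
    zero on a nonempty open set; multiplying by a form [s] that vanishes off that set and cancelling
    it gives zero. *)
Lemma generic_image n m (X : set 'rV[k]_n.+1) (Y : set 'rV[k]_m.+1) (F : tuplemap k n m) x :
  hgeneric X x -> (forall v, X v -> v != 0) -> (forall v, Y v -> v != 0) -> dominant X Y F ->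
  hgeneric Y (tval io F x).
Proof.
move=> gx X0 Y0 [[[e hF] [U [[Z cZ ->] [u0 [Xu0 nZ]] hU]]] [sub dense]] d P hP.
rewrite -mmap_tcomp; have hFP := tcomp_hom hF hP; split=> [/(gx _ _ hFP) vP|vP].
  have sY : Y `<=` [set v | v != 0 /\ ev P v = 0].
    apply: dense; first by apply: zclosed_form; exists d.
    move=> y [w Xw [_ _ [G [[e' hG] eG G0 ->]]]]; split; first exact: G0.
    have [pG' [i0 Fi0] [j0 Gj0]] := hgeneric_eqv gx (ex_intro _ e hF) (ex_intro _ e' hG) eG.
    have : mmap io x (tcomp G P) = 0.
      rewrite mmap_tcomp (mmap_ext io (prop_scale Fi0 (prop_sym pG'))).
      by rewrite (dhomog_scale _ _ _ hP) -mmap_tcomp (proj2 (gx _ _ hFP) vP) mulr0.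
    move=> /(gx _ _ (tcomp_hom hG hP))/(_ w Xw) h; rewrite -[RHS]h /ev /meval mmap_tcomp; apply: mmap_ext => i.
    by rewrite mxE.
  by move=> v /sY[].
have [S [hS eZ]] := cZ.
have [s [Ss nsu]] : exists s, S s /\ ev s u0 != 0.
  apply: contrapT => /forallNP h; apply: nZ; rewrite eZ; split; first exact: X0.
  by move=> p Sp; apply/eqP; apply: contrapT => /negP ne; apply: (h p).
have [d' hs] := hS _ Ss.
have : mmap io x (tcomp F P * s) = 0.
  apply/(gx _ _ (dhomogM hFP hs)) => v Xv; rewrite /ev rmorphM /=; have [Zv|nZv] := pselect (Z v).
    by move: Zv; rewrite eZ => -[_ /(_ s Ss)]; rewrite /ev => ->; rewrite mulr0.
  have [_ Yv] := hU v (conj Xv nZv).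
  suff -> : meval (v ord0) (tcomp F P) = 0 by rewrite mul0r.
  rewrite -[RHS](vP _ Yv) /ev /meval mmap_tcomp; apply: mmap_ext => i.
  by rewrite mxE.
rewrite rmorphM /= => /eqP; rewrite mulf_eq0 => /orP[/eqP //|/eqP /(gx _ _ hs) h].
by move: nsu; rewrite h ?eqxx.
Qed.

Lemma generic_point n (X : set 'rV[k]_n.+1) x (c : 'I_n.+1 -> k) a : projective X ->
  (forall d P, hom d P -> mmap io x P = 0 -> van X P) -> x =1 (fun i => a * io (c i)) -> is_point X.
Proof.
move=> [cX [[x0 Xx0] _]] hx ex.
have pr v : X v -> forall i j, c j * v ord0 i = c i * v ord0 j.
  move=> Xv i j; have hP : hom 1%N (c j *: mpX k i - c i *: mpX k j) by rewrite rpredB // rpredZ // hX1.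
  have : mmap io x (c j *: mpX k i - c i *: mpX k j) = 0.
    by rewrite rmorphB -!mul_mpolyC !rmorphM /= !mmapC !mmap_var !ex; ring.
  move=> /(hx _ _ hP)/(_ v Xv); rewrite /ev mevalB !mevalZ !mevalXU => /eqP.
  by rewrite subr_eq0 => /eqP.
have [i0 ci0] : exists i, c i != 0.
  have /rV0Pn[i xi0] := zclosed_neq0 cX Xx0; exists i; apply: contraNneq xi0 => ci0.
  have : mmap io x (mpX k i) = 0 by rewrite mmap_var ex ci0 rmorph0 mulr0.
  by move=> /(hx _ _ (hX1 k i))/(_ x0 Xx0); rewrite /ev mevalXU => ->.
have sc v : X v -> exists2 a : k, a != 0 & v = a *: (\row_i c i).
  move=> Xv; exists (v ord0 i0 / c i0).
    apply/eqP => e; have /eqP := zclosed_neq0 cX Xv; apply; apply/rowP => i; rewrite mxE.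
    have v0 : v ord0 i0 = 0 by move/eqP: e; rewrite mulf_eq0 invr_eq0 (negbTE ci0) orbF => /eqP.
    by have := pr v Xv i i0; rewrite v0 mulr0 => /eqP; rewrite mulf_eq0 (negbTE ci0) => /eqP.
  apply/rowP => i; rewrite !mxE mulrAC [_ * c i]mulrC -(pr v Xv i i0) mulrC mulKf //.
exists (\row_i c i); first by apply/eqP => /rowP/(_ i0); rewrite !mxE => /eqP; rewrite (negbTE ci0).
apply/seteqP; split=> v; first by move=> /sc[b b0 ->]; exists b.
move=> [b b0 ->]; have [b' b0' e] := sc _ Xx0.
have -> : b *: (\row_i c i) = (b / b') *: x0 by rewrite e scalerA mulfVK.
by apply: zclosed_scale => //; rewrite mulf_neq0 // invr_eq0.
Qed.

Lemma algebraic_constant (q : {poly k}) w : q != 0 -> (map_poly io q).[w] = 0 -> exists c, w = io c.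
Proof.
move=> q0; have [s es] := closed_field_poly_normal q.
rewrite es map_polyZ rmorph_prod hornerZ horner_prod => /eqP.
rewrite mulf_eq0 fmorph_eq0 lead_coef_eq0 (negbTE q0) /=.
elim: s {es} => [|a s IH]; first by rewrite big_nil oner_eq0.
rewrite big_cons mulf_eq0 => /orP[|/IH //].
rewrite rmorphB /= map_polyX map_polyC hornerXsubC subr_eq0 => /eqP ->; by exists a.
Qed.

Lemma hom_novar d (a : mp 0 k) : hom d a -> (0 < d)%N -> a = 0.
Proof.
move=> ha d0; apply/mpolyP => m; rewrite mcoeff0; apply/eqP; rewrite -[_ == 0]negbK -mcoeff_msupp.
apply/negP => hm; have e : mdeg m = d := dhomog_mf ha hm.
by move: d0; rewrite -e mdegE big_ord0.
Qed.

Section Dimension.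
Variables (n c : nat) (X : set 'rV[k]_n.+1) (x : 'I_n.+1 -> Om) (M : 'I_n.+1 -> 'I_c -> k)
  (I : finType) (dg : I -> nat) (g : I -> mp n.+1 k).
Hypotheses (pX : projective X) (gx : generic X x) (fM : finlin io x M dg g).

Let x0 : exists i, x i != 0.
Proof.
case: pX => cX [ne _]; apply: (generic_neq0 ne _ gx) => v; exact: zclosed_neq0.
Qed.

Lemma noether_dim_gt0 : (0 < c)%N.
Proof.
rewrite lt0n; apply/eqP => c0; subst c; have [i xi] := x0.
pose D := (\max_(j : I) dg j).+1.
have hP : hom D (mpX k i ^+ D) by apply: hom1X; exact: hX1.
have [a [ha e]] := finlin_span fM hP.
move/eqP: xi; apply; apply/eqP; have : mmap io x (mpX k i ^+ D) = 0.
  rewrite e big1 // => j _; have le : (dg j < D)%N by rewrite ltnS; exact: leq_bigmax.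
  have := ha j; rewrite /homm (ltnW le) => /hom_novar ->; first by rewrite rmorph0 mul0r.
  by rewrite subn_gt0.
by rewrite rmorphXn /= mmap_var => /eqP; rewrite expf_eq0 => /andP[].
Qed.

End Dimension.

(** With a single target coordinate [t], the ratios of degree [d] forms to [t ^+ d] lie in one
    finite-dimensional [k]-space, so each [x i / t] is algebraic over [k], hence constant, and [X]
    is a point. *)
Lemma noether_dim n c (X : set 'rV[k]_n.+1) (x : 'I_n.+1 -> Om) (M : 'I_n.+1 -> 'I_c -> k)
    (I : finType) (dg : I -> nat) (g : I -> mp n.+1 k) :
  projective X -> generic X x -> finlin io x M dg g -> algindep io (lin io M x) ->
  ~ is_point X -> (1 < c)%N.
Proof.
move=> pX gx fM ai np; have c0 := noether_dim_gt0 pX gx fM.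
rewrite ltn_neqAle eq_sym c0 andbT; apply/eqP => c1; subst c; apply: np.
set t := lin io M x ord0; have t0 : t != 0.
  apply/eqP => e; have h : mmap io (lin io M x) (mpX k ord0) = 0 by rewrite mmap_var.
  by have /eqP := ai _ h; rewrite -msupp_eq0 msuppX.
have homt d (a : mp 1 k) : hom d a -> exists b : k, mmap io (lin io M x) a = io b * t ^+ d.
  move=> ha; exists (meval (fun _ => 1) a).
  have e : lin io M x =1 (fun i => t * (io \o (fun _ => 1)) i) by move=> i; rewrite (ord1 i) /= rmorph1 mulr1.
  rewrite (mmap_ext io e) (dhomog_scale _ _ _ ha) mulrC; congr (_ * _).
  by rewrite /meval [RHS](mmap_rmorph (idfun : {rmorphism k -> k}) io).
have key (P : mp n.+1 k) d : hom d P -> exists b : I -> k,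
    mmap io x P / t ^+ d = \sum_i io (b i) * (mmap io x (g i) / t ^+ dg i).
  move=> hP; have [a [ha e]] := finlin_span fM hP.
  have /choice[b hb] : forall i, exists b : k, mmap io (lin io M x) (a i) * t ^+ dg i = io b * t ^+ d.
    move=> i; have := ha i; rewrite /homm; case: leqP => le.
      by move=> /homt[b ->]; exists b; rewrite -mulrA -exprD subnK.
    by move=> ->; exists 0; rewrite !rmorph0 !mul0r.
  exists b; rewrite e mulr_suml; apply: eq_bigr => i _.
  have td : t ^+ d != 0 by rewrite expf_neq0.
  have tg : t ^+ dg i != 0 by rewrite expf_neq0.
  have -> : mmap io (lin io M x) (a i) = io (b i) * t ^+ d / t ^+ dg i by rewrite -hb mulfK.
  by field; rewrite td tg.
have alg i : exists c, x i / t = io c.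
  have hP l : hom l (mpX k i ^+ l) by apply: hom1X; exact: hX1.
  have [B hB] := choice (fun l : 'I_#|I|.+1 => key _ _ (hP l)).
  have [a [[l al] ha]] := linear_dependence (fun (l : 'I_#|I|.+1) (j : 'I_#|I|) => B l (enum_val j)) (ltnSn _).
  apply: (@algebraic_constant (\poly_(l < #|I|.+1) a (inord l))).
    by apply: contraNneq al => /polyP/(_ l); rewrite coef_poly ltn_ord coef0 inord_val => ->.
  rewrite (horner_map_wide _ _ (size_poly _ _)).
  rewrite (eq_bigr (fun l => \sum_i io (a l * B l i) * (mmap io x (g i) / t ^+ dg i))) => [|l' _]; last first.
    rewrite coef_poly ltn_ord inord_val expr_div_n; have := hB l'.
    rewrite rmorphXn /= mmap_var => ->; rewrite mulr_sumr; apply: eq_bigr => i' _.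
    by rewrite rmorphM mulrA.
  rewrite exchange_big big1 //= => i' _; rewrite -mulr_suml -rmorph_sum /=.
  have := ha (enum_rank i'); rewrite enum_rankK => ->.
  by rewrite rmorph0 mul0r.
have [b hb] := choice alg.
apply: (@generic_point n X x b t pX); first by move=> d P _ /gx.
by move=> i; rewrite -hb mulrC mulfVK.
Qed.

End GenericImages.

Lemma unit_mlead (k : fieldType) n (u : mp n k) : u \is a GRing.unit -> mdeg (mlead u) = 0%N.
Proof.
move=> uu; have u0 : u != 0 by apply: contraTneq uu => ->; rewrite unitr0.
have := f_equal (fun q => mdeg (mlead q)) (mulrV uu).
rewrite mlead1 mdeg0 mleadM //; last by apply: contraTneq uu => e; rewrite -unitrV e unitr0.
by rewrite mdegD => /eqP; rewrite addn_eq0 => /andP[/eqP].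
Qed.

Lemma hom_prod_factors (k : fieldType) n D (u : mp n k) (s : seq (mp n k)) : u \is a GRing.unit ->
  (forall p, p \in s -> p != 0) -> hom D (u * \prod_(p <- s) p) ->
  (forall p, p \in s -> hom (mdeg (mlead p)) p) /\
  D = (\sum_(p <- s) mdeg (mlead p))%N.
Proof.
move=> uu s0 hD.
have u0 : u != 0 by apply: contraTneq uu => ->; rewrite unitr0.
have p0 : \prod_(p <- s) p != 0.
  by rewrite prodf_seq_neq0; apply/allP => p ps; rewrite implyTb s0.
have up0 : u * \prod_(p <- s) p != 0 by rewrite mulf_neq0.
split=> [p ps|].
  have e : u * \prod_(p <- s) p = p * (u * \prod_(q <- rem p s) q) by rewrite (big_rem p) //= mulrCA.
  rewrite e in hD up0; have [d [d' [_ hp _]]] := hom_factor up0 hD.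
  by rewrite (mlead_hom (s0 _ ps) hp).
rewrite -(mlead_hom up0 hD) mleadM // mdegD unit_mlead // add0n.
elim: s s0 {hD p0 up0} => [|p s IH] s0; first by rewrite !big_nil mlead1 mdeg0.
have hs q : q \in s -> q != 0 by move=> qs; apply: s0; rewrite inE qs orbT.
rewrite !big_cons mleadM ?mdegD ?IH //; first by apply: s0; exact: mem_head.
by rewrite prodf_seq_neq0; apply/allP => q qs; rewrite implyTb hs.
Qed.

Lemma dvd_count (R : idomainType) (p : R) (s : seq R) :
  dvd (p ^+ count (fun q => `[< dvd p q >]) s) (\prod_(q <- s) q).
Proof.
elim: s => [|q s [c IH]]; first by rewrite big_nil; exists 1; rewrite mul1r.
rewrite big_cons /=; case: asboolP => [[b ->]|_]; last by rewrite add0n; exists (q * c); rewrite IH mulrA.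
by rewrite add1n exprS IH; exists (b * c); rewrite mulrACA.
Qed.

Lemma sum_by_key (T : eqType) (I : eqType) (E : T -> I) (d : T -> nat) (s : seq T) :
  (\sum_(p <- s) d p = \sum_(i <- undup (map E s)) \sum_(p <- s | E p == i) d p)%N.
Proof.
transitivity (\sum_(i <- undup (map E s)) \sum_(p <- s) (if E p == i then d p else 0))%N; last first.
  by apply: eq_bigr => i _; rewrite [RHS]big_mkcond.
rewrite exchange_big /=; apply: eq_big_seq => p ps.
rewrite -big_mkcond /= -big_filter.
have -> : [seq i <- undup (map E s) | E p == i] = [seq i <- undup (map E s) | pred1 (E p) i].
  by apply: eq_filter => i /=; rewrite eq_sym.
by rewrite filter_pred1_uniq ?undup_uniq ?mem_undup ?map_f // big_seq1.
Qed.

(** It confines nonzero multiplicities to the finitely many divisors in the zero set of one form;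
    otherwise the sum over all prime divisors would collapse to its default. *)
Lemma pullback_mult_support (k : closedFieldType) (Om : fieldType) (io : {rmorphism k -> Om}) m n
    (Gam E : set 'rV[k]_m.+1) (xi : 'I_m.+1 -> Om) (p : tuplemap k m n) h e :
  generic io Gam xi -> projective E -> E `<=` Gam -> (forall i, hom e (p i)) -> hom 1%N h ->
  pullback_mult Gam p h E != 0%N -> van E (tcomp p h).
Proof.
move=> gxi pE EG hp hh; rewrite /pullback_mult; case: xgetP => [r _|_]; last by rewrite eqxx.
move=> [G [[e' hG] eG nG [T [A [C [[hT vT _] [hA hC] [nA nC] eqG]]]]]] r0.
have hhG : ishom (tcomp G h) by exists e'; exact: tcomp_hom1.
have vhG : van E (tcomp G h).
  have : van E (tcomp G h * C).
    move=> v Ev; rewrite [LHS](eqG v (EG v Ev)) -(prednK (_ : (0 < r)%N)); last by rewrite lt0n.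
    have := proj1 (van_eq_on _ _) vT v Ev; rewrite /ev exprS !rmorphM /= => ->.
    by rewrite mul0r mulr0.
  case/(proj_prime pE hhG hC) => // h'; by move/nonzero_onP: nC.
have [pG' [i0 Fi0] _] := tm_eqv_generic gxi eG.
have [j0 nj0] := proj1 (tm_nonzero_van _ _) nG.
have hhp : ishom (tcomp p h) by exists e; exact: tcomp_hom1.
have : van E (tcomp p h * G j0).
  have eqv : van Gam (tcomp p h * G j0 -
     p j0 * tcomp G h).
    apply/gxi; rewrite rmorphB !rmorphM /= !mmap_tcomp -!/(tval io _ xi _).
    have ec := prop_scale Fi0 (prop_sym pG').
    by rewrite !(mmap_ext io ec) (dhomog_scale _ _ _ hh) ec expr1; ring.
  have -> : tcomp p h * G j0 =
     (tcomp p h * G j0 - p j0 * tcomp G h)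
     + p j0 * tcomp G h by rewrite subrK.
  by apply: vanD; [exact: van_sub eqv|exact: vanM].
have hGj : ishom (G j0) by exists e'; exact: hG.
by move=> hv; case: (proj_prime pE hhp hGj hv) => [h1|h1]; [exact: h1|case: (nj0 h1)].
Qed.

(** * The degree of the leading coefficients *)

Section PullbackDegree.
Variables (k : closedFieldType) (Om : fieldType) (io : {rmorphism k -> Om}) (n r : nat).
Variables (eta : 'I_n.+1 -> Om) (M : 'I_n.+1 -> 'I_r.+2 -> k) (I : finType) (dg : I -> nat)
  (g : I -> mp n.+1 k).
Hypotheses (geta : graded io eta) (fM : finlin io eta M dg g) (ai : algindep io (lin io M eta)).
Notation eve := (mmap io eta).
Notation t := (lin io M eta).
Notation evt := (mmap io t).
Variable X : set 'rV[k]_n.+1.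
Hypotheses (pX : projective X) (nX : normal X) (heta : generic io X eta).
Variables (f : tuplemap k n n) (u : nat).
Hypotheses (npX : ~ is_point X) (hu : is_pullback_degree X f u)
  (hom_f : tm_hom f)
  (domf : forall d P, hom d P -> mmap io (tval io f eta) P = 0 -> van X P).
Let zt := tval io f eta.

(** A generic point of the resolution is placed in the field of [eta], so that one valuation ring
    has centers on [Gam] and on [X] at the same time. *)
Lemma birational_generic m (Gam : set 'rV[k]_m.+1) (p1 p2 : tuplemap k m n) (q1 : tuplemap k n m) :
  projective Gam -> is_morphism Gam X p2 -> birational_inverse Gam X p1 q1 ->
  tm_eqv X f (tm_comp p2 q1) -> exists xi,
  [/\ generic io Gam xi, exists j, xi j != 0, prop (tval io p1 xi) eta,
    forall w, kfun io xi w <-> kfun io eta w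
    & exists2 c, c != 0 & tval io p2 xi =1 (fun j => c * zt j)].
Proof.
move=> pG mp2 [dp1 dq1 _ eX] ef.
have X0 v : X v -> v != 0 by case: pX => cX _; exact: zclosed_neq0.
have G0 v : Gam v -> v != 0 by case: pG => cG _; exact: zclosed_neq0.
have [l el] : exists l, eta l != 0 by apply: (generic_neq0 _ X0 heta); case: pX => _ [].
have [[[eq hq] _] _] := dq1.
(* The factor [mpX k l] makes the degree positive, as [graded_comp] requires; [q1] may consist of
   constants. *)
pose Q j := mpX k l * q1 j.
have hQ j : hom (1 + eq) (Q j) by apply: dhomogM; [exact: hX1|exact: hq].
pose xi := tval io Q eta.
have exi j : xi j = eta l * tval io q1 eta j by rewrite /xi /tval rmorphM /= mmap_var.
have gxi : graded io xi.
  have := @graded_comp k Om io _ _ (1 + eq)%N [tuple Q j | j < m.+1] eta isT _ geta.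
  move=> /(_ _) h'; apply: (graded_ext _ (h' _)).
    by move=> j; rewrite tnth_mktuple.
  by move=> j; rewrite tnth_mktuple.
have hxi : generic io Gam xi.
  apply: generic_graded => // [c v c0 Gv|d P hP].
    by apply: zclosed_scale => //; case: pG.
  rewrite (mmap_ext io exi) (dhomog_scale _ _ _ hP) -(generic_image (fun d P _ => heta P) X0 G0 dq1 hP).
  split=> [/eqP|->]; last by rewrite mulr0.
  by rewrite mulf_eq0 expf_eq0 (negbTE el) andbF => /eqP.
have xi0 : exists j, xi j != 0 by apply: (generic_neq0 _ G0 hxi); case: pG => _ [].
have ez e (p : tuplemap k m n) j : hom e (p j) -> tval io p xi j = eta l ^+ e * tval io (tm_comp p q1) eta j.
  by move=> hp; rewrite /tval /tm_comp mmap_tcomp -(dhomog_scale _ _ _ hp); exact: mmap_ext.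
clearbody xi.
have [[[e1 hp1] _] _] := dp1; have [[[e2 hp2] _] _] := mp2.
have [pr1' [j1 nz1] _] := tm_eqv_generic heta eX.
have id1 j : tval io (@tm_id k n) eta j = eta j by rewrite /tval mmap_var.
have ez1 j := ez e1 p1 j (hp1 j); have ez2 j := ez e2 p2 j (hp2 j).
have pr1 : prop (tval io p1 xi) eta.
  move=> a b; rewrite (ez1 a) (ez1 b); have := pr1' a b; rewrite (id1 a) (id1 b) => e.
  by rewrite -[LHS]mulrA -[RHS]mulrA e.
have p1nz : tval io p1 xi j1 != 0 by rewrite (ez1 j1) mulf_neq0 ?expf_neq0.
exists xi; split=> //.
  move=> w; split; first by apply: (kfun_comp (a := 1) hQ) => j; rewrite mul1r /tval rmorphM /= mmap_var exi.
  apply: (kfun_comp hp1 (a := eta j1 / tval io p1 xi j1)).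
  exact: prop_scale p1nz (prop_sym pr1).
have [pr2 [j2 nz2] [j3 nz3]] := tm_eqv_generic heta ef.
have pr3 : prop (tval io p2 xi) zt.
  move=> a b; rewrite (ez2 a) (ez2 b) -[LHS]mulrA -[RHS]mulrA; congr (_ * _).
  exact: prop_sym.
exists (tval io p2 xi j2 / zt j2); last by apply: prop_scale nz2 pr3.
have w0 : tval io p2 xi j3 != 0 by rewrite (ez2 j3) mulf_neq0 // expf_neq0.
rewrite mulf_eq0 invr_eq0 negb_or nz2 andbT.
apply/eqP => e0; have := pr3 j2 j3; rewrite e0 mul0r => /esym/eqP.
by rewrite mulf_eq0 (negbTE w0) (negbTE nz2).
Qed.

(** Each prime factor of the leading coefficient is charged to a prime divisor [E] of [Gam]. Only
    associate primes share an [E], because the image of [E] lies over one hypersurface; so the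
    degree is at most [#|I|] times the sum of distinct terms of [u]. *)
Lemma lead_degree_bound : exists h, [/\ hom 1%N h, mmap io zt h != 0 &
  forall i (mu : {poly mp r.+2 k}) e, mu != 0 -> (map_poly evt mu).[zt i / mmap io zt h] = 0 ->
    (1 < size mu <= #|I|.+1)%N ->
    divides_relations evt (zt i / mmap io zt h) mu ->
    (forall j, hom e mu`_j) -> (e <= #|I| * u)%N].
Proof.
case: hu => [[] //|[_ [m [Gam [p1 [p2 [q1 [h [[pG nG] [mp1 bir] [mp2 ef] [hh nh] eu]]]]]]]]].
have gh0 : mmap io zt h != 0 by apply/eqP => /(domf hh) h'; move/nonzero_onP: nh.
exists h; split=> // i mu e mu0 rmu smu dmu hmu.
have [xi [hxi xi0 pr1 hk [c c0 ec]]] := birational_generic pG mp2 bir ef.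
have eh : mmap io (tval io p2 xi) h = c * mmap io zt h.
  by rewrite (mmap_ext io ec) (dhomog_scale _ _ _ hh) expr1.
have h20 : mmap io (tval io p2 xi) h != 0 by rewrite eh mulf_neq0.
have ephi : zt i / mmap io zt h = tval io p2 xi i / mmap io (tval io p2 xi) h.
  by rewrite (ec i) eh invfM mulrACA divff // mul1r.
pose term E := (pullback_mult Gam p2 h E * pushforward_degree Gam X p1 E)%N.
have N0 : (0 < #|I|)%N by move: smu => /andP[s1 s2]; have := leq_trans s1 s2; rewrite ltnS.
have a0 : lead_coef mu != 0 by rewrite lead_coef_eq0.
have [s [v [uv ps es]]] := factorial_mpoly a0.
have ha0 : hom e (lead_coef mu) by rewrite lead_coefE.
have s0 p : p \in s -> p != 0 by move=> /ps[].
have [hs eD] : (forall p, p \in s -> hom (mdeg (mlead p)) p) /\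
    e = (\sum_(p <- s) mdeg (mlead p))%N.
  by apply: (hom_prod_factors uv s0); rewrite -es.
pose dl (p : mp r.+2 k) := mdeg (mlead p).
pose mlt p := count (fun q => `[< dvd p q >]) s.
have key p : p \in s -> exists E, [/\ prime_divisor Gam E,
    forall d b, hom d b -> van (rm_image Gam X p1 E) (lincomp M b) <-> dvd p b
    & (mlt p * dl p <= #|I| * term E)%N].
  move=> p_s; have pp := ps p p_s; have hp := hs p p_s.
  have m0 : (0 < mlt p)%N.
    by rewrite -has_count; apply/hasP; exists p => //; apply/asboolP; exists 1; rewrite mul1r.
  have dm : dvd (p ^+ mlt p) (lead_coef mu).
    by rewrite es; apply: dvd_mulr; exact: dvd_count.
  have e_phi : zt i / mmap io zt h = eve (f i) / eve (tcomp f h).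
    by rewrite mmap_tcomp.
  have f0 : eve (tcomp f h) != 0 by rewrite mmap_tcomp.
  rewrite e_phi in rmu dmu.
  have [V [vV Vt hV nV]] := place_of_prime fM ai f0 rmu smu dmu pp m0 dm.
  rewrite -e_phi ephi in nV.
  have kV : overk io V by exact: place_overk Vt.
  have Ve := place_eta fM vV Vt.
  have [i0 [xi00 hi0]] := exists_max_coord vV xi0.
  have [i1 ne1] := place_unit_eta vV Vt pp hV.
  have Vz j : V ((xi i0)^-1 * xi j) by rewrite mulrC.
  have z1 : (xi i0)^-1 * xi i0 = 1 by rewrite mulVf.
  have e10 := nmaxi_neq0 ne1.
  have Vz2 j : V ((eta i1)^-1 * eta j).
    by apply: subringM => //; [case: vV|exact: (nmaxi_unit (Ve i1))].
  have z21 : (eta i1)^-1 * eta i1 = 1 by rewrite mulVf.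
  have [E [cE _]] := exists_place_center vV kV Vz z1.
  have [D [cD memD]] := exists_place_center vV kV Vz2 z21.
  exists E; split.
  - exact: (center_prime_E geta fM ai pG nG hxi mp1 pr1 hk vV Vt pp hp hV xi00 hi0 ne1 cE).
  - rewrite (center_image fM pX heta pG hxi mp1 pr1 vV Vt xi00 hi0 ne1 cE cD memD) => d b hb.
    exact: (center_lincomp fM vV Vt hV ne1 cD hb).
  have le := center_contribution geta fM ai pX nX heta pG nG hxi mp1 mp2 pr1 hk vV Vt pp hp hV xi00 hi0 ne1
    cE cD memD hh h20 nV.
  apply: leq_trans (leq_mul (leqnn #|I|) le); rewrite mulnA leq_mul2r; apply/orP; right.
  (* A prime of multiplicity [m] yields a pole of order above [a = (m - 1) / #|I|], and
     [m <= #|I| * (a + 1)]; this is where the factor [#|I|] arises. *)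
  have gen (a b : nat) : (0 < b)%N -> (a < b + b * (a %/ b))%N.
    by move=> b0; rewrite {1}(divn_eq a b) mulnC addnC ltn_add2r ltn_mod.
  by rewrite mulnS -{1}(prednK m0); exact: gen.
(* The value [set0] outside [s] is never looked at; it only makes the choice function total. *)
have /choice[E hE] : forall p, exists E, p \in s -> [/\ prime_divisor Gam E,
    forall d b, hom d b -> van (rm_image Gam X p1 E) (lincomp M b) <-> dvd p b
    & (mlt p * dl p <= #|I| * term E)%N].
  by move=> p; have [/key[E hE]|h'] := boolP (p \in s); [exists E|exists set0].
rewrite eD (sum_by_key E) eu.
have fin : finite_set ([set E | prime_divisor Gam E] `&` [set E | term E != 0%N]).
  have [[[e2 hp2] _] _] := mp2.
  apply: (sub_finite_set _ (finite_prime_divisors (Q := tcomp p2 h) pG _ _)).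
  - move=> E' [pE' /= t0]; split=> //; have [pE'' [E'G _] _] := pE'.
    apply: (pullback_mult_support hxi pE'' E'G hp2 hh).
    by move: t0; rewrite /term muln_eq0 negb_or => /andP[].
  - by exists e2; exact: tcomp_hom1.
  - by move/hxi/eqP; rewrite mmap_tcomp (negbTE h20).
apply: leq_trans (leq_mul (leqnn #|I|) (sum_subseq_fsbig (undup_uniq (map E s)) _ fin)); last first.
  by move=> E'; rewrite mem_undup => /mapP[p p_s ->]; case: (hE p p_s).
rewrite big_distrr /=; rewrite !big_seq; apply: leq_sum => E'; rewrite mem_undup => /mapP[p p_s eE'].
have [_ hp le] := hE p p_s; rewrite eE'.
apply: leq_trans le; rewrite /mlt -sum1_count big_distrl /= [X in (_ <= X)%N]big_mkcond [X in (X <= _)%N]big_mkcond.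
rewrite !big_seq; apply: leq_sum => q q_s; case: eqP => // eEq; rewrite mul1n.
have [_ hq _] := hE q q_s; rewrite eEq in hq.
(* The same divisor means the same forms vanishing on its image, so [p] and [q] divide each other
   and [q] is already counted in the multiplicity of [p]. *)
have pq : dvd p q by apply/(hp _ _ (hs q q_s))/(hq _ _ (hs q q_s)); exists 1; rewrite mul1r.
have [b eb] : dvd q p by apply/(hq _ _ (hs p p_s))/(hp _ _ (hs p p_s)); exists 1; rewrite mul1r.
rewrite asboolT // /dl eb mleadM ?mdegD ?leq_addl //; last exact: s0.
by apply: contraNneq (s0 p p_s) => b0; rewrite eb b0 mul0r.
Qed.

(** If [w] is not in [V] its inverse is, and dividing the equation by a power of [w] expresses the
    product through nonnegative powers of the inverse. *)
Lemma lead_mul_integral (mu : {poly mp r.+2 k}) w V : valring V -> (forall a, V (evt a)) ->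
  mu != 0 -> (map_poly evt mu).[w] = 0 -> V (evt (lead_coef mu) * w).
Proof.
move=> vV Vt mu0 rmu; have sV : subring V by case: vV.
have [_ /(_ w)[Vw|Vw]] := vV; first exact: (subringM sV).
have [->|w0] := eqVneq w 0; first by rewrite mulr0; exact: subring0.
pose s := (size mu).-1; have es : size mu = s.+1 by rewrite /s prednK // size_poly_gt0.
have e1 : \sum_(j < s.+1) evt mu`_j * w ^+ j = 0.
  by rewrite -[RHS]rmu (horner_map_wide _ _ (n := s.+1)) ?es.
have [s0|s0] := posnP s.
  move: e1; rewrite s0 big_ord1 expr0 mulr1 lead_coefE -/s s0 => ->.
  by rewrite mul0r; exact: subring0.
have ws : w ^+ s != 0 by rewrite expf_neq0.
have -> : evt (lead_coef mu) * w = - \sum_(j < s) evt mu`_j * w^-1 ^+ (s.-1 - j).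
  move: e1; rewrite big_ord_recr /= lead_coefE -/s => /eqP; rewrite addrC addr_eq0 => /eqP e1.
  have ws1 : w ^+ s.-1 != 0 by rewrite expf_neq0.
  apply: (mulIf ws1); rewrite -mulrA -exprS prednK // e1 mulNr mulr_suml; congr (- _).
  apply: eq_bigr => j _; rewrite -mulrA; congr (_ * _).
  have js : (j <= s.-1)%N by rewrite -ltnS prednK.
  by rewrite -{2}(subnK js) exprD exprVn mulKf // expf_neq0.
apply: (subringN sV); apply: (subring_sum sV) => j _; apply: (subringM sV) => //.
exact: (subringX sV).
Qed.

(** The leading coefficients of the minimal equations of the coordinates of [f]
    have degree at most [#|I| u]; their product clears all denominators. *)
Lemma pullback_degree_bound : (0 < u)%N /\ exists h, [/\ hom 1%N h, mmap io zt h != 0 &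
  exists D H, [/\ hom D H, H != 0, (D <= n.+1 * (#|I| * u))%N
    & forall V, valring V -> (forall a, V (evt a)) -> forall i, V (evt H * (zt i / mmap io zt h))]].
Proof.
have [h [hh h0 hb]] := lead_degree_bound.
have [ef hf] := hom_f.
have kf i : kfun io eta (zt i / mmap io zt h).
  by exists ef, (f i), (tcomp f h); split; rewrite ?mmap_tcomp //; [exact: hf|exact: tcomp_hom1].
have /choice[mu hmu] : forall i, exists mu : {poly mp r.+2 k}, exists e, [/\ mu != 0,
    (map_poly evt mu).[zt i / mmap io zt h] = 0, forall j, hom e mu`_j & (e <= #|I| * u)%N].
  move=> i; have [mu [e [mu0 rmu smu dmu hmu]]] := kfun_minpoly geta fM ai (kf i).
  by exists mu, e; split=> //; exact: (hb i mu).
have /choice[e he] := hmu.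
split.
  (* If [u] were 0, all coefficients of the minimal equations would have degree 0; every ratio of
     coordinates would then be algebraic over [k], hence constant, and the image of the map would be
     a point. *)
  rewrite lt0n; apply/eqP => u0; apply: npX.
  have /choice[c hc] : forall i, exists c, zt i / mmap io zt h = io c.
    move=> i; have [mu0 rmu hmu' ] := he i; rewrite u0 muln0 leqn0 => /eqP e0.
    pose q := map_poly (meval (fun _ => 0)) (mu i).
    have emu j : evt (mu i)`_j = io (meval (fun _ => 0) (mu i)`_j).
      have h' : hom 0%N (mu i)`_j by have := hmu' j; rewrite e0.
      rewrite -[evt _]mul1r -(expr0 0) -(dhomog_scale _ _ _ h').
      rewrite /meval (mmap_rmorph (idfun : {rmorphism k -> k}) io); apply: mmap_ext => l.
      by rewrite mul0r /= rmorph0.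
    apply: (@algebraic_constant _ _ io q).
      have : lead_coef (mu i) != 0 by rewrite lead_coef_eq0.
      apply: contraNneq => q0; have := emu (size (mu i)).-1.
      rewrite -lead_coefE => h'; apply/eqP; apply: ai; rewrite h'.
      have := f_equal (fun p : {poly k} => p`_(size (mu i)).-1) q0; rewrite coef_map coef0 /= -lead_coefE => ->.
      exact: rmorph0.
    rewrite -[RHS]rmu; congr (_.[_]); apply/polyP => j; rewrite coef_map [RHS]coef_map /= /q.
    rewrite emu; congr (io _); exact: (coef_map (meval (fun _ => 0))).
  apply: (@generic_point _ _ io n X zt c (mmap io zt h) pX); first exact: domf.
  by move=> i; rewrite -hc mulrC mulfVK.
exists h; split=> //; exists (\sum_i e i)%N, (\prod_i lead_coef (mu i)); split.
- apply: (big_ind2 (fun d (P : mp r.+2 k) => hom d P)); first exact: dhomog1.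
    by move=> d P d' P'; exact: dhomogM.
  by move=> i _; case: (he i) => _ _ + _; rewrite lead_coefE; apply.
- by apply/prodf_neq0 => i _; rewrite lead_coef_eq0; case: (he i).
- rewrite -[X in (X * _)%N]card_ord -sum_nat_const; apply: leq_sum => i _; by case: (he i).
move=> V vV Vt i; have sV : subring V by case: vV.
rewrite (bigD1 i) //= rmorphM /= mulrAC mulrC; apply: (subringM sV) => //.
by have [mu0 rmu _ _] := he i; exact: lead_mul_integral.
Qed.

End PullbackDegree.

(** The left side grows like the [c]-th power of [e] and the right side like the next one; [e] is
    chosen explicitly. *)
Lemma bin_growth N c b : exists e, (N * 'C(c + b * e, c) < 'C(c.+1 + e, c.+1))%N.
Proof.
pose e := (N * (c.+1)`! * (c + b) ^ c)%N; exists e.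
have f0 : (0 < (c.+1)`!)%N by exact: fact_gt0.
rewrite -(ltn_pmul2r f0) bin_ffact.
have low : (e.+1 ^ c.+1 <= (c.+1 + e) ^_ c.+1)%N.
  rewrite ffact_prod -[X in (_ ^ X <= _)%N]card_ord -prod_nat_const; apply: leq_prod => i _.
  have := ltn_ord i; move: (nat_of_ord i) => j; lia.
have up : ('C(c + b * e, c) <= ((c + b) * e.+1) ^ c)%N.
  apply: (@leq_trans ((c + b * e) ^_ c)).
    by rewrite -bin_ffact leq_pmulr // fact_gt0.
  rewrite ffact_prod -[X in (_ <= _ ^ X)%N]card_ord -prod_nat_const; apply: leq_prod => i _.
  apply: leq_trans (leq_subr _ _) _; rewrite mulnDl leq_add //; first by rewrite leq_pmulr.
  by rewrite leq_mul2l leqnSn orbT.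
apply: leq_trans low; rewrite expnS.
have le1 : (N * 'C(c + b * e, c) * (c.+1)`! <= e * e.+1 ^ c)%N.
  rewrite mulnAC {2}/e -[X in (_ <= X)%N]mulnA -expnMn; exact: leq_mul.
by apply: leq_ltn_trans le1 _; rewrite ltn_pmul2r ?expn_gt0.
Qed.

(** * Iterates *)

Section Dependence.
Variables (k : closedFieldType) (Om : fieldType) (io : {rmorphism k -> Om}) (n : nat).
Variable x : 'I_n -> Om.
Notation ev := (mmap io x).

Lemma hom_mons_eq0 c d (a : mp c.+1 k) : hom d a ->
  (forall m, m \in mons c d -> mcoeff m a = 0) -> a = 0.
Proof.
move=> ha h; apply/mpolyP => m; rewrite mcoeff0; apply/eqP; rewrite -[_ == 0]negbK -mcoeff_msupp.
apply/negP => hm; have := h m; rewrite mem_mons => /(_ _)/eqP.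
have e : mdeg m = d := dhomog_mf ha hm.
by rewrite e eqxx => /(_ isT); rewrite mcoeff_eq0 hm.
Qed.

(** Monomials of degree [e] in more than [c.+1] forms outnumber the coefficients needed to expand
    them on the generators. The degree [e] depends on [b] but not on the forms; all later uniformity
    rests on this. *)
Lemma forms_dependent c (M : 'I_n -> 'I_c.+1 -> k) (I : finType) dg g (b : nat) :
  @finlin k Om io n x c.+1 M I dg g -> exists e, forall c' (P : 'I_c'.+1 -> mp n k), (c < c')%N ->
  (forall j, hom b (P j)) -> exists R : mp c'.+1 k, [/\ R != 0, hom e R
    & mmap io (fun j => ev (P j)) R = 0].
Proof.
move=> fM; have [e he] := bin_growth #|I| c b; exists e => c' P cc hP.
pose s := mons c' e.
have hcomp (m : mnm c'.+1) : mdeg m = e -> hom (b * e) (tcomp P (mX k m)).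
  by move=> <-; apply: comp_hom => [j|]; [rewrite tnth_mktuple|exact: hom_mX].
have sdeg (l : 'I_(size s)) : mdeg (nth mnm0 s l) = e.
  by apply/eqP; rewrite -mem_mons; exact: mem_nth.
have [A hA] := choice (fun l : 'I_(size s) => finlin_span fM (hcomp _ (sdeg l))).
pose sz i := size (mons c (b * e - dg i)).
pose T := {i : I & 'I_(sz i)}.
have lt : (#|{: T}| < size s)%N.
  have cT : (#|{: T}| <= #|I| * 'C(c + b * e, c))%N.
    rewrite card_tagged sumnE big_map big_enum /= -sum_nat_const; apply: leq_sum => i _.
    by rewrite card_ord /sz mons_size leq_bin2l // leq_add2l leq_subr.
  apply: (leq_ltn_trans cT); apply: (leq_trans he).
  have b1 (u : nat) : 'C(u + e, u) = 'C(u + e, e) by rewrite -(bin_sub (leq_addl u e)) addnK.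
  rewrite /s mons_size (b1 c.+1) (b1 c').
  by apply: leq_bin2l; rewrite leq_add2r.
have [d [[l dl0] hd]] := linear_dependence (fun (l : 'I_(size s)) (j : 'I_#|{: T}|) =>
  mcoeff (nth mnm0 (mons c (b * e - dg (tag (enum_val j)))) (tagged (enum_val j)))
    (A l (tag (enum_val j)))) lt.
have Ad i : \sum_l d l *: A l i = 0.
  case: (leqP (dg i) (b * e)) => le; last first.
    by apply: big1 => l' _; case: (hA l') => /(_ i) + _; rewrite /homm leqNgt le => ->; rewrite scaler0.
  apply: (@hom_mons_eq0 _ (b * e - dg i)).
    apply: rpred_sum => l' _; apply: rpredZ.
    by case: (hA l') => /(_ i) + _; rewrite /homm le.
  move=> m hm; have ix : (index m (mons c (b * e - dg i)) < sz i)%N by rewrite index_mem.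
  have := hd (enum_rank (Tagged (fun i => 'I_(sz i)) (Ordinal ix) : T)).
  rewrite enum_rankK /= nth_index // => h; rewrite -[RHS]h raddf_sum /=.
  by apply: eq_bigr => l' _; rewrite mcoeffZ.
exists (\sum_l d l *: mX k (nth mnm0 s l)); split.
- apply: contraNneq dl0 => R0; have := f_equal (mcoeff (nth mnm0 s l)) R0.
  rewrite mcoeff0 raddf_sum (bigD1 l) //= big1 ?addr0 => [|l' ne].
    by rewrite mcoeffZ mcoeffX eqxx mulr1 => /eqP.
  rewrite mcoeffZ mcoeffX nth_uniq ?mons_uniq //.
  by rewrite (inj_eq val_inj) (negbTE ne) mulr0.
- by apply: rpred_sum => l' _; apply: rpredZ; rewrite -[X in hom X _](sdeg l'); exact: hom_mX.
rewrite rmorph_sum /=.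
transitivity (\sum_l \sum_i io (d l) * mmap io (lin io M x) (A l i) * ev (g i)).
  apply: eq_bigr => l' _; have [_] := hA l'; rewrite mmap_comp -mul_mpolyC rmorphM /= mmapC.
  rewrite (mmap_ext io (y := fun j => ev (P j))) => [->|j]; last by rewrite tnth_mktuple.
  by rewrite mulr_sumr; apply: eq_bigr => i _; rewrite mulrA.
rewrite exchange_big big1 //= => i _; rewrite -mulr_suml.
have -> : \sum_l io (d l) * mmap io (lin io M x) (A l i) = mmap io (lin io M x) (\sum_l d l *: A l i).
  by rewrite rmorph_sum; apply: eq_bigr => l' _; rewrite -mul_mpolyC rmorphM /= mmapC.
by rewrite Ad rmorph0 mul0r.
Qed.

End Dependence.

Section Avoidance.
Variables (k : closedFieldType) (Om : fieldType) (io : {rmorphism k -> Om}) (n r : nat).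
Variables (x : 'I_n.+1 -> Om) (M0 : 'I_n.+1 -> 'I_r.+2 -> k) (I0 : finType) (dg0 : I0 -> nat)
  (g0 : I0 -> mp n.+1 k).
Hypotheses (f0 : finlin io x M0 dg0 g0) (ai0 : algindep io (lin io M0 x)).
Notation ev := (mmap io x).

(** A form [R0] vanishing on the image of [b = 0] under the [c] forms [w] of degree
    one, when [c] exceeds the dimension of the projective set [b = 0]. *)
Lemma image_equation b be c (W : 'I_c.+1 -> mp n.+1 k) : hom be b -> ev b != 0 -> (r < c)%N ->
  (forall j, hom 1%N (W j)) ->
  exists d (R0 : mp c.+1 k), [/\ hom d R0, R0 != 0
    & forall z, zeros io x z -> meval z b = 0 -> meval (fun j => meval z (W j) ^+ be) R0 = 0].
Proof.
move=> hb b0 rc hW; have [e he] := forms_dependent be f0.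
pose P (j : 'I_c.+2) := if unlift ord_max j is Some j' then W j' ^+ be else b.
have [|j|R [R0 hR zR]] := he c.+1 P; first exact: rc.
  rewrite /P; case: unliftP => [j' _|_] //.
  by apply: hom1X.
(* A relation of minimal degree is not divisible by the variable standing for [b], which is nonzero
   at [x]; so setting that variable to 0 leaves a nonzero form [R0]. The powers [be] give all
   entries one degree. *)
pose ok d := `[< exists R : mp c.+2 k, [/\ R != 0, hom d R & mmap io (fun j => ev (P j)) R = 0] >].
have ex : exists d, ok d by exists e; apply/asboolP; exists R.
have [d /asboolP[S [S0 hS zS]] mind] := ex_minnP ex.
exists d, (muni S)`_0.
have cS : comp_mpoly [tuple if unlift ord_max j is Some j' then mpX k j' else 0 | j < c.+2] S = (muni S)`_0.
  rewrite /comp_mpoly mmap_muni tnth_mktuple unlift_none horner_coef0 coef_map /=.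
  rewrite -[RHS]comp_mpoly_id /comp_mpoly; apply: mmap_ext => i.
  by rewrite [in LHS]/comp !tnth_mktuple -(ord_lift_max i) liftK.
split.
- rewrite -cS -[X in hom X _]mul1n; apply: comp_hom => // j; rewrite tnth_mktuple.
  by case: unliftP => [j' _|_]; [exact: hX1|exact: rpred0].
- apply/eqP => S00; have [Q eQ] : exists Q, muni S = Q * ('X - 0%:P).
    by apply/factor_theorem; rewrite /root horner_coef0 S00.
  rewrite subr0 in eQ; pose S' := (map_poly (@mwiden c.+1 k) Q).[mpX k ord_max].
  have eS : S = S' * mpX k ord_max.
    have := muniK S; rewrite /= eQ /horner_eval rmorphM hornerM /= map_polyX hornerX => <-.
    by [].
  have S'0 : S' * mpX k ord_max != 0 by rewrite -eS.
  have hS' : hom d (S' * mpX k ord_max) by rewrite -eS.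
  have [d1 [d2 [ed h1 h2]]] := hom_factor S'0 hS'.
  have X0 : mpX k (ord_max : 'I_c.+2) != 0 by rewrite -msupp_eq0 msuppX.
  have d21 := hom_unique X0 h2 (hX1 k ord_max).
  have : ok d1.
    apply/asboolP; exists S'; split=> //; first by apply: contraNneq S'0 => ->; rewrite mul0r.
    move: zS; rewrite eS rmorphM /= mmap_var /P unlift_none => /eqP.
    by rewrite mulf_eq0 (negbTE b0) orbF => /eqP.
  by move/mind; rewrite -ed d21 addn1 ltnn.
move=> z hz zb; rewrite -cS.
have := hz (tcomp P S).
rewrite mmap_comp (mmap_ext io (y := fun j => ev (P j))) => [/(_ zS)|j]; last by rewrite tnth_mktuple.
rewrite /meval mmap_comp => e1; rewrite mmap_comp -[RHS]e1; apply: mmap_ext => j.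
rewrite !tnth_mktuple /P; case: unliftP => [j' _|_]; first by rewrite mmap_var rmorphXn.
by rewrite rmorph0; move: zb; rewrite /meval => ->.
Qed.

Lemma zeros_scale (c : k) z : graded io x -> zeros io x z -> zeros io x (fun i => c * z i).
Proof.
move=> gx hz P rP; rewrite (hom_decomp P) raddf_sum big1 //= => d _.
rewrite /meval (dhomog_scale _ _ _ (hc_hom d P)).
by have := hz _ (gx _ rP d); rewrite /meval => ->; rewrite mulr0.
Qed.

Lemma closed_root_exists (k' : closedFieldType) (v : k') m : (0 < m)%N -> exists u, u ^+ m = v.
Proof.
move=> m0; have /closed_rootP[u] : size ('X^m - v%:P) != 1%N.
  by rewrite size_XnsubC //; case: (m) m0.
by rewrite rootE !hornerE subr_eq0 => /eqP; exists u.
Qed.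

(** Project successively from general centers; keeping the fibre through [y] away
    from [b = 0] is possible by [image_equation]. *)
Lemma projection_avoiding : graded io x -> exists N, forall b be y, hom be b -> (0 < be)%N ->
  zeros io x y -> meval y b != 0 ->
  exists (M : 'I_n.+1 -> 'I_r.+2 -> k) (I : finType) dg g,
  [/\ @finlin k Om io _ x _ M I dg g, (#|I| <= N)%N, algindep io (lin io M x)
    & forall z, zeros io x z -> lin idfun M z =1 lin idfun M y -> meval z b != 0].
Proof.
move=> gx; have [e he] := forms_dependent 1 f0.
have rn : (r.+2 <= n.+1)%N.
  rewrite leqNgt; apply/negP => lt.
  have [e' he'] := forms_dependent 1 (finlin_id io x).
  have [|j|R [R0 _ zR]] := he' r.+1 (linf M0); first by rewrite -ltnS.
    exact: linf_hom.
  case/eqP: R0; apply: ai0; rewrite -[RHS]zR; apply: mmap_ext => j.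
  by rewrite mmap_linf.
(* Every projection uses a relation of degree [e] among linear forms, whatever the center, so each
   of the [n.+1 - r.+2] steps multiplies the number of generators by [e]. *)
exists (e ^ (n.+1 - r.+2))%N => b be y hb be0 hy yb.
have evb : ev b != 0 by apply: contraNneq yb => /hy ->.
have step i c : (c + i = n.+1)%N -> (r.+2 <= c)%N ->
  exists (M : 'I_n.+1 -> 'I_c -> k) (I : finType) dg g,
  [/\ @finlin k Om io _ x _ M I dg g, (#|I| <= e ^ i)%N
    & forall z, zeros io x z -> lin idfun M z =1 lin idfun M y -> meval z b != 0].
  elim: i c => [|i IH] c ci rc.
    rewrite addn0 in ci; subst c; exists (@idM k n.+1), 'I_1, (fun=> 0%N), (fun=> 1).
    split; [exact: finlin_id|by rewrite card_ord|].
    move=> z _ h; rewrite (_ : meval z b = meval y b) //; apply: mmap_ext => l.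
    by have := h l; rewrite !lin_idM.
  case: c ci rc => // c ci rc.
  have [||M [I [dg [g [fM cI av]]]]] := IH c.+2; [by rewrite addSnnS|exact: leqW|].
  have [|F [F0 hF zF]] := he c.+1 (linf M) rc; first by move=> j; exact: linf_hom.
  rewrite (mmap_ext io (y := lin io M x)) in zF; last by move=> j; rewrite mmap_linf.
  pose yM := lin idfun M y.
  (* Otherwise the zero vector would lie in the fibre through [y], and [b] vanishes there because
     its degree is positive. *)
  have [j0 yj0] : exists j, yM j != 0.
    apply: contrapT => /forallNP h.
    have : meval (fun i => 0 * y i) b != 0.
      apply: av; first exact: zeros_scale.
      move=> j; have -> : lin idfun M y j = 0 by apply/eqP; apply: contrapT => /negP; exact: h.
      by rewrite /lin big1 // => l _; rewrite mul0r mulr0.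
    by rewrite /meval (dhomog_scale _ _ _ hb) expr0n eqn0Ngt be0 mul0r eqxx.
  (* The forms [W] project from [yM]: at a point whose image is [yM + tau * o] they are [tau] times
     their values at [o]. Where [b] vanishes, [R0] kills their [be]-th powers, so a center [o] with
     [f] nonzero at [o] forces [tau = 0]. *)
  pose rt j := yM (lift j0 j) / yM j0.
  pose W (j : 'I_c.+1) := linf M (lift j0 j) - rt j *: linf M j0.
  have hW j : hom 1%N (W j) by apply: rpredB; [|apply: rpredZ]; exact: linf_hom.
  have [d [R0 [hR R00 vR]]] := @image_equation b be c W hb evb rc hW.
  pose L (j : 'I_c.+1) : mp c.+2 k := mpX k (lift j0 j) - rt j *: mpX k j0.
  have hL j : hom 1%N (L j) by apply: rpredB; [|apply: rpredZ]; exact: hX1.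
  pose f := comp_mpoly [tuple L j ^+ be | j < c.+1] R0.
  have evf o : meval o f = meval (fun j => (o (lift j0 j) - rt j * o j0) ^+ be) R0.
    rewrite /meval mmap_comp; apply: mmap_ext => j; rewrite tnth_mktuple rmorphXn /=.
    by rewrite rmorphB -mul_mpolyC rmorphM /= mmapC !mmap_var.
  have hf : hom (be * d) f.
    apply: comp_hom => // j; rewrite tnth_mktuple -[X in hom X _]mul1n.
    exact: dhomogMn.
  have f0' : f != 0.
    (* A point where [R0] is nonzero is reached by extracting [be]-th roots in the algebraically
       closed [k]. *)
    have [v vR0] := mpoly_nonroot R00.
    have [u hu] := choice (fun j => closed_root_exists (v j) be0).
    apply: contraNneq vR0 => f0'.
    pose o j := if unlift j0 j is Some j' then u j' else 0.
    have := evf o; rewrite f0' meval0 => /esym <-; apply/eqP; apply: mmap_ext => j.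
    by rewrite /o liftK unlift_none mulr0 subr0 hu.
  have Xm0 : mpX k (ord_max : 'I_c.+2) != 0 by rewrite -msupp_eq0 msuppX.
  have [ c1 ho1] := mpoly_nonroot (mulf_neq0 (mulf_neq0 F0 f0') Xm0).
  move: ho1; rewrite !rmorphM /= mevalXU !mulf_eq0 !negb_or => /andP[/andP[F1 f1] om].
  pose o i := (c1 ord_max)^-1 * c1 i.
  have o_max : o ord_max = 1 by rewrite /o mulVf.
  have Fo : meval o F != 0.
    by rewrite /meval (dhomog_scale _ _ _ hF) mulf_neq0 // expf_neq0 // invr_eq0.
  have fo : meval o f != 0.
    by rewrite /meval (dhomog_scale _ _ _ hf) mulf_neq0 // expf_neq0 // invr_eq0.
  have fM' : finlin io x (projM M o) (fun il : I * 'I_e => (dg il.1 + il.2)%N)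
      (fun il : I * 'I_e => g il.1 * linf M ord_max ^+ il.2).
    apply: (@finlin_step _ _ _ _ _ _ _ _ _ _ e ((meval o F)^-1 *: F) o fM) => //.
    - exact: rpredZ.
    - by rewrite -mul_mpolyC rmorphM /= zF mulr0.
    - by rewrite mevalZ mulVf.
  exists (projM M o), (I * 'I_e)%type, (fun il : I * 'I_e => (dg il.1 + il.2)%N), (fun il : I * 'I_e => g il.1 * linf M ord_max ^+ il.2).
  split=> //; first by rewrite card_prod card_ord expnSr leq_mul.
  move=> z hz hzy; apply/eqP => zb.
  pose tau := lin idfun M z ord_max - yM ord_max.
  have zM j : lin idfun M z j = yM j + tau * o j.
    case: (unliftP ord_max j) => [j' ->|->]; last by rewrite o_max mulr1 addrC subrK.
    rewrite ord_lift_max; have := hzy j'; rewrite !lin_projM /= -/yM => e1.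
    have -> : lin idfun M z (wid j') = yM (wid j') - o (wid j') * yM ord_max + o (wid j') * lin idfun M z ord_max.
      by rewrite /yM -e1 subrK.
    by rewrite /tau; ring.
  have Wz j : meval z (W j) = tau * (o (lift j0 j) - rt j * o j0).
    have lf i' : meval z (linf M i') = lin idfun M z i' by exact: mmap_linf.
    rewrite /W mevalB mevalZ !lf !zM /rt.
    have e1 : yM (lift j0 j) / yM j0 * yM j0 = yM (lift j0 j) by rewrite mulfVK.
    by rewrite mulrDr e1; ring.
  have : meval (fun j => meval z (W j) ^+ be) R0 = (tau ^+ be) ^+ d * meval o f.
    rewrite evf /meval -(dhomog_scale _ _ _ hR); apply: mmap_ext => j.
    by rewrite -[mmap _ _ (W j)]/(meval z (W j)) Wz exprMn.
  rewrite (vR z hz zb) => /esym/eqP; rewrite mulf_eq0 (negbTE fo) orbF !expf_eq0 => /andP[_ /andP[_ /eqP t0]].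
  have : meval z b != 0 by apply: (av z hz) => j; rewrite zM t0 mul0r addr0.
  by rewrite zb eqxx.
have [M [I [dg [g [fM cI av]]]]] := step (n.+1 - r.+2)%N r.+2 (subnKC rn) (leqnn _).
(* A relation between the final coordinates would permit one more projection, and then the [r.+2]
   independent forms of [M0] would be dependent by [forms_dependent]. *)
exists M, I, dg, g; split=> // R zR; apply/eqP; apply: contrapT => /negP R0.
have [d Rd] := hc_neq0 R0.
have zRd := graded_lin gx zR d.
have [a [c [cmax cF]]] := exists_center (hc_hom d R) Rd.
have fM' := @finlin_step _ _ _ _ _ _ _ _ _ _ d (a *: hc d R) c fM (rpredZ a (hc_hom d R)) _ cmax cF.
have [|e2 he2] := forms_dependent 1 (fM' _); first by rewrite -mul_mpolyC rmorphM /= zRd mulr0.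
have [||R' [R'0 _ zR']] := he2 r.+1 (linf M0); [by []|by move=> j; exact: linf_hom|].
case/eqP: R'0; apply: ai0; rewrite -[RHS]zR'; apply: mmap_ext => j.
by rewrite mmap_linf.
Qed.

End Avoidance.

(** * Integral fractions and their equations *)

Section IntegralFractions.
Variables (k : closedFieldType) (Om : fieldType) (io : {rmorphism k -> Om}) (n r : nat).
Variables (x : 'I_n.+1 -> Om) (M : 'I_n.+1 -> 'I_r.+2 -> k) (I : finType) (dg : I -> nat)
  (g : I -> mp n.+1 k).
Hypotheses (gx : graded io x) (fM : finlin io x M dg g) (ai : algindep io (lin io M x)).
Notation ev := (mmap io x).
Notation t := (lin io M x).
Notation evt := (mmap io t).

Definition tintegral w := forall V, valring V -> (forall a, V (evt a)) -> V w.

(** A prime factor of the leading coefficient would, by [place_of_prime] with exponent 1, give a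
    valuation ring excluding the fraction. So the leading coefficient is a unit, and this fixes the
    total weight as [dl * s]. *)
Lemma integral_weighted P Q a b dl : hom a P -> hom b Q -> (a = b + dl)%N -> ev Q != 0 ->
  tintegral (ev P / ev Q) -> exists (mu : {poly mp r.+2 k}) s,
  [/\ (map_poly evt mu).[ev P / ev Q] = 0, size mu = s.+1, (0 < s <= #|I|)%N, mu`_s \is a GRing.unit
    & (forall j, homm (dl * s) (dl * j) mu`_j) /\
      divides_relations evt (ev P / ev Q) mu].
Proof.
move=> hP hQ ab Q0 iw; have [mu [mu0 rmu smu smu' dmu]] := frac_minpoly fM ai P Q0.
pose s := (size mu).-1; have es : size mu = s.+1 by rewrite /s prednK // (leq_trans _ smu).
have ul : mu`_s \is a GRing.unit.
  have l0 : lead_coef mu != 0 by rewrite lead_coef_eq0.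
  have [q [u [uu pq e]]] := factorial_mpoly l0.
  rewrite -lead_coefE in e *; case: q pq e => [|p q] pq e; first by rewrite e big_nil mulr1.
  have pp : primel p by apply: pq; exact: mem_head.
  have dp : dvd (p ^+ 1) (lead_coef mu).
    by rewrite e big_cons expr1; exists (u * \prod_(j <- q) j); rewrite mulrAC mulrA.
  have smu2 : (1 < size mu <= #|I|.+1)%N by rewrite smu smu'.
  have [V [vV Vt _ nV]] := place_of_prime fM ai Q0 rmu smu2 dmu pp (ltn0Sn 0) dp.
  by case: nV; rewrite div0n expr0 mul1r; exact: iw.
have [e he] : exists e, forall j, homm e (dl * j) mu`_j.
  by apply: (weighted_minpoly mu0 rmu dmu) => F rF e; exact: (fraction_weighted gx hP hQ ab Q0 rF).
have l0 : mu`_s != 0 by rewrite -[s]/((size mu).-1) -lead_coefE lead_coef_eq0.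
have ee : e = (dl * s)%N.
  have := he s; rewrite /homm; case: leqP => [le h|_ h]; last by rewrite h eqxx in l0.
  by have := mlead_hom l0 h; rewrite unit_mlead // => /esym/eqP; rewrite subn_eq0 => le'; apply/eqP; rewrite eqn_leq le' le.
by exists mu, s; split=> //; [move: smu smu'; rewrite es !ltnS => -> ->|rewrite -ee].
Qed.

(** The norm [b] of [L = l(G)] clears the denominator of [G_i / L]; all degrees are
    controlled by the degree of [G] and the degree of the projection. *)
Lemma lead_degree_integral (G : 'I_n.+1 -> Om) (P : 'I_n.+1 -> mp n.+1 k) Qd bd dl
    (Q : tuplemap k n n) eQ l i (mu : {poly mp r.+2 k}) e :
  (forall i, hom (bd + dl) (P i)) -> hom bd Qd -> ev Qd != 0 -> (forall i, G i = ev (P i) / ev Qd) ->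
  (forall i, tintegral (G i)) -> (forall i, hom eQ (Q i)) -> hom 1%N l ->
  (exists2 c, c != 0 & tval io Q x =1 (fun j => c * G j)) ->
  mmap io (tval io Q x) l != 0 -> mu != 0 ->
  divides_relations evt (tval io Q x i / mmap io (tval io Q x) l) mu ->
  hom e (lead_coef mu) -> (e <= #|I| ^ 2 * dl)%N.
Proof.
move=> hP hQd Qd0 eG iG hQ hl [c c0 ec] l0 mu0 dmu hmu.
have elG : mmap io (tval io Q x) l = c * mmap io G l.
  by rewrite (mmap_ext io ec) (dhomog_scale _ _ _ hl) expr1.
have lG0 : mmap io G l != 0 by apply: contraNneq l0 => e0; rewrite elG e0 mulr0.
pose L := mmap io G l.
pose PL := tcomp P l.
have hPL : hom (bd + dl) PL by exact: tcomp_hom1.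
have eL : L = ev PL / ev Qd.
  have eG' : G =1 (fun j => (ev Qd)^-1 * ev (P j)) by move=> j; rewrite eG mulrC.
  by rewrite /L (mmap_ext io eG') (dhomog_scale _ _ _ hl) expr1 mmap_tcomp mulrC.
have iL : tintegral L.
  move=> V vV Vt; apply: (V_mmap vV) => [|j]; first exact: place_overk Vt.
  exact: iG.
rewrite eL in iL; have [nu [s [rnu snu s0 us [hnu dnu]]]] := integral_weighted hPL hQd erefl Qd0 iL.
rewrite -eL in rnu dnu.
have nu0 : nu`_0 != 0.
  apply/eqP => z0; have [N eN] : exists N, nu = N * ('X - 0%:P).
    by apply/factor_theorem; rewrite /root horner_coef0 z0.
  have rN : (map_poly evt N).[L] = 0.
    move: rnu; rewrite eN subr0 rmorphM hornerM /= map_polyX hornerX => /eqP.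
    by rewrite mulf_eq0 (negbTE lG0) orbF => /eqP.
  have [N' eN'] := dnu _ rN; have N0 : N != 0.
    by apply/eqP => N0; move: snu; rewrite eN N0 mul0r size_poly0.
  have N'0 : N' != 0 by apply: contraNneq N0 => h; rewrite eN' h mul0r.
  have := f_equal (fun p : {poly mp r.+2 k} => size p) eN'.
  have nun0 : nu != 0 by rewrite -size_poly_eq0 snu.
  have sN : size nu = (size N).+1 by rewrite eN subr0 size_mulX.
  rewrite size_mul // sN; have : (0 < size N')%N by rewrite size_poly_gt0.
  by move: (size N) (size N') => a b; clear; rewrite /=; lia.
set b := nu`_0 in nu0.
have hb : hom (dl * s) b by have := hnu 0%N; rewrite /homm muln0 leq0n subn0.
(* The constant term [b] of the equation of [L] equals [- Ls * L], so [b] times [G i / L] is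
   [- Ls * G i], which is integral. *)
pose Ls := \sum_(j < s) evt nu`_j.+1 * L ^+ j.
have eLs : evt b = - (Ls * L).
  apply/eqP; rewrite -addr_eq0; apply/eqP.
  move: rnu; rewrite (horner_map_wide _ _ (n := s.+1)) ?snu // big_ord_recl expr0 mulr1 => <-.
  by congr (_ + _); rewrite mulr_suml; apply: eq_bigr => j _; rewrite -mulrA -exprSr.
pose ph := tval io Q x i / mmap io (tval io Q x) l.
have eph : ph = G i / L by rewrite /ph elG ec /L; field; rewrite lG0 c0.
pose PE := lincomp M b * Q i; pose QE := tcomp Q l.
have hPE : hom (dl * s + eQ) PE by apply: dhomogM => //; exact: lincomp_hom.
have hQE : hom eQ QE by exact: tcomp_hom1.
have QE0 : ev QE != 0 by rewrite mmap_tcomp.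
have eE : ev PE / ev QE = evt b * ph by rewrite rmorphM /= mmap_lincomp mmap_tcomp -mulrA.
have iE : tintegral (ev PE / ev QE).
  move=> V vV Vt; have sV : subring V by case: vV.
  rewrite eE eLs eph; have -> : - (Ls * L) * (G i / L) = - (Ls * G i) by field.
  apply: (subringN sV); apply: (subringM sV); last exact: iG.
  apply: (subring_sum sV) => j _; apply: (subringM sV) => //; apply: (subringX sV).
  by rewrite eL; exact: iL.
have [ka [s' [rka ska s0' us' [hka _]]]] := integral_weighted hPE hQE (addnC _ _) QE0 iE.
(* The equation of [b * ph] rewritten for [ph]: the minimal one divides it, so its leading
   coefficient divides a unit times [b ^+ s'], a form of degree [dl * s * s']. *)
pose F0 : {poly mp r.+2 k} := \poly_(j < s'.+1) (ka`_j * b ^+ j).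
have lF : F0`_s' = ka`_s' * b ^+ s' by rewrite coef_poly ltnSn.
have ka0 : ka`_s' != 0 by apply: contraTneq us' => ->; rewrite unitr0.
have lF0 : F0`_s' != 0 by rewrite lF mulf_neq0 // expf_neq0.
have sF : size F0 = s'.+1.
  by apply: size_poly_eq; move: lF0; rewrite coef_poly ltnSn.
have rF : (map_poly evt F0).[ph] = 0.
  rewrite -[RHS]rka eE !(horner_map_wide _ _ (n := s'.+1)) ?sF ?ska //.
  apply: eq_bigr => j _; rewrite coef_poly ltn_ord rmorphM rmorphXn /=.
  by rewrite [in RHS]exprMn mulrA.
have [H eH] := dmu _ rF.
have eLd : F0`_s' = lead_coef H * lead_coef mu by rewrite -lead_coefM -eH lead_coefE sF.
have hL : hom (dl * s * s') (lead_coef H * lead_coef mu).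
  rewrite -eLd lF -[X in hom X _]add0n; apply: dhomogM; last exact: dhomogMn.
  have := hka s'; rewrite /homm leqnn subnn; exact.
have L0 : lead_coef H * lead_coef mu != 0 by rewrite -eLd.
have [d1 [d2 [ed _ hd2]]] := hom_factor L0 hL.
have lmu0 : lead_coef mu != 0 by rewrite lead_coef_eq0.
rewrite (hom_unique lmu0 hmu hd2); apply: (@leq_trans (dl * s * s')); first by rewrite -ed leq_addl.
move/andP: s0 => [_ le1]; move/andP: s0' => [_ le2].
by rewrite expnS expn1 -mulnA mulnC; apply: leq_mul => //; exact: leq_mul.
Qed.

(** If the fibre of the projection through [y] avoids the zeros of [Q] and of [l(Q)],
    then [Q_i / l(Q)] is integral over the local ring at the image of [y]. *)
Lemma lead_nonzero_at P Q y (mu : {poly mp r.+2 k}) : zeros io x y -> ev Q != 0 ->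
  (forall z, zeros io x z -> lin idfun M z =1 lin idfun M y -> meval z Q != 0) ->
  divides_relations evt (ev P / ev Q) mu ->
  meval y (lincomp M (lead_coef mu)) != 0.
Proof.
move=> hy Q0 hz dmu.
have ey a : meval y (lincomp M a) = meval (lin idfun M y) a by exact: mmap_lincomp.
rewrite ey; set w := lin idfun M y in hz *.
have [||||||F [nF rF]] := @integral_local Om _ evt [set a | meval w a = 0] _ _ _ _ _ (ev P / ev Q).
- by rewrite /= meval1; apply/eqP; exact: oner_neq0.
- by move=> a b /= ha hb; rewrite mevalD ha hb addr0.
- by move=> a b /= ha; rewrite mevalM ha mulr0.
- by move=> a b /=; rewrite mevalM => /eqP; rewrite mulf_eq0 => /orP[/eqP|/eqP]; [left|right].
- by move=> a /ai ->; rewrite /= meval0.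
- move=> V vV Vt hV; have kV := place_overk Vt; have sV : subring V by case: vV.
  have tw j : maxi V (t j - io (w j)).
    have -> : t j - io (w j) = evt (mpX k j - mpolyC _ (w j)).
      by rewrite rmorphB /= mmap_var mmapC.
    by apply/hV; rewrite /= mevalB mevalXU mevalC subrr.
  have [z [hzx zz zw]] := finlin_point fM vV kV tw.
  have Vx i : V (x i) by apply: (finlin_val fM vV kV) => j; rewrite -[X in V X](mmap_var io t); exact: Vt.
  apply: (subringM sV); first exact: (V_mmap vV kV).
  apply: (nmaxi_unit (V_mmap vV kV _ Vx)) => mQ.
  have := maxiB vV mQ (mmap_maxi vV kV Q hzx); rewrite subKr => /(maxi_const kV)/eqP.
  by apply/negP; exact: hz.
have [H eH] := dmu _ rF.
apply/eqP => l0; apply: nF; rewrite /= eH lead_coefM mevalM l0 mulr0 //.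
Qed.

End IntegralFractions.

Section RegularRelations.
Variables (k : closedFieldType) (Om : fieldType) (io : {rmorphism k -> Om}) (n r : nat).
Variables (x : 'I_n.+1 -> Om) (M0 : 'I_n.+1 -> 'I_r.+2 -> k) (I0 : finType) (dg0 : I0 -> nat)
  (g0 : I0 -> mp n.+1 k).
Hypotheses (gx : graded io x) (f0 : finlin io x M0 dg0 g0) (ai0 : algindep io (lin io M0 x)).
Notation ev := (mmap io x).

(** A point off the product of the dual hyperplanes gives the coefficients; zero vectors contribute
    the factor 1. *)
Lemma separating_form (s : seq ('I_n.+1 -> k)) : exists l : mp n.+1 k, hom 1%N l /\
  forall z, List.In z s -> (exists j, z j != 0) -> meval z l != 0.
Proof.
pose Lz z : mp n.+1 k := \sum_i z i *: mpX k i.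
have cL z i : mcoeff (mnm1 i) (Lz z) = z i.
  rewrite raddf_sum (bigD1 i) //= big1 ?addr0 => [|j ne]; first by rewrite mcoeffZ mcoeffX eqxx mulr1.
  rewrite mcoeffZ mcoeffX; case: eqP => [/mnmP/(_ j)|_]; last by rewrite mulr0.
  by rewrite !mnm1E eqxx eq_sym (negbTE ne).
pose F z := if Lz z == 0 then 1 else Lz z.
have F0 : \prod_(z <- s) F z != 0.
  elim: s => [|z s IH]; first by rewrite big_nil oner_neq0.
  rewrite big_cons mulf_neq0 // /F; case: ifPn => // _; exact: oner_neq0.
have [v hv] := mpoly_nonroot F0.
exists (Lz v); split; first by apply: rpred_sum => i _; apply: rpredZ; exact: hX1.
have sw z : meval z (Lz v) = meval v (Lz z).
  rewrite !raddf_sum /=; apply: eq_bigr => i _; by rewrite !mevalZ !mevalXU mulrC.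
move=> z zs [j zj]; rewrite sw.
have Lz0 : Lz z != 0 by apply: contraNneq zj => e; rewrite -cL e mcoeff0.
elim: s zs hv {F0} => //= z' s IH zs; rewrite big_cons rmorphM /= mulf_eq0 negb_or => /andP[h1 h2].
case: zs => [e|/IH]; last exact.
by move: h1; rewrite e /F (negbTE Lz0).
Qed.

Lemma regular_relations : exists N, forall dl bd (G : 'I_n.+1 -> Om) (P : 'I_n.+1 -> mp n.+1 k) Qd
    (Q : tuplemap k n n) eQ y,
  (forall i, hom (bd + dl) (P i)) -> hom bd Qd -> ev Qd != 0 -> (forall i, G i = ev (P i) / ev Qd) ->
  (forall V, valring V -> overk io V -> (forall i, V (x i)) -> forall i, V (G i)) ->
  (forall i, hom eQ (Q i)) -> (exists2 c, c != 0 & tval io Q x =1 (fun j => c * G j)) ->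
  zeros io x y -> (exists j, y j != 0) -> (exists j, meval y (Q j) != 0) ->
  exists l : mp n.+1 k, [/\ hom 1%N l, meval (fun i => meval y (Q i)) l != 0 &
    forall i, exists s (B : nat -> mp n.+1 k) e, [/\ (e <= N * dl)%N, (0 < s)%N, forall j, hom e (B j),
      meval y (B s) != 0
    & \sum_(j < s.+1) ev (B j) * tval io Q x i ^+ j * mmap io (tval io Q x) l ^+ (s - j) = 0]].
Proof.
have [N hN] := projection_avoiding f0 ai0 gx; exists (N ^ 2)%N.
move=> dl bd G P Qd Q eQ y hP hQd Qd0 eG iG hQ pQ hy [l0 yl0] [j0 Qj0].
(* The factor [mpX k l0] ensures the positive degree that [projection_avoiding] requires. *)
have hb : hom (eQ + 1) (Q j0 * mpX k l0) by apply: dhomogM => //; exact: hX1.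
have yb : meval y (Q j0 * mpX k l0) != 0 by rewrite rmorphM /= mevalXU mulf_neq0.
have [|M [I [dg [g [fM cI ai av]]]]] := hN _ _ _ hb _ hy yb; first by rewrite addn1.
have [s hs] := finlin_fib fM (lin idfun M y).
have [l [hl lz]] := separating_form (map (fun z i => meval z (Q i)) s).
have lQ z : zeros io x z -> lin idfun M z =1 lin idfun M y ->
    meval z (tcomp Q l) != 0.
  move=> zz zw; have [z' z's ez] := hs z zz zw.
  have ezz A : meval z A = meval z' A by exact: mmap_ext.
  rewrite ezz /meval mmap_tcomp; apply: lz.
    by apply/List.in_map_iff; exists z'.
  exists j0; have := av z zz zw; rewrite rmorphM /= mulf_eq0 negb_or => /andP[+ _].
  by rewrite ezz.
have evlQ : ev (tcomp Q l) != 0.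
  by apply: contraTneq (lQ y hy (fun _ => erefl)) => /hy ->; rewrite eqxx.
have ti : forall i, tintegral io x M (G i).
  move=> i V vV Vt; apply: iG => //; first exact: place_overk Vt.
  by move=> i'; exact: (place_eta fM vV Vt).
exists l; split=> // [|i].
  have := lQ y hy (fun _ => erefl); rewrite /meval mmap_tcomp; exact.
have kf : kfun io x (ev (Q i) / ev (tcomp Q l)).
  by exists eQ, (Q i), (tcomp Q l); split=> //; exact: tcomp_hom1.
have [mu [e [mu0 rmu smu dmu hmu]]] := kfun_minpoly gx fM ai kf.
pose s' := (size mu).-1; have es : size mu = s'.+1.
  by rewrite /s' prednK //; move/andP: smu => [h _]; exact: leq_trans h.
exists s', (fun j => lincomp M mu`_j), e; split.
- have hle : (e <= #|I| ^ 2 * dl)%N.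
    apply: (lead_degree_integral gx fM ai (i := i) hP hQd Qd0 eG ti hQ hl pQ _ mu0) => //.
    + by rewrite -mmap_tcomp.
    + by rewrite -mmap_tcomp.
    + by rewrite lead_coefE.
  by apply: leq_trans hle _; rewrite leq_mul2r leq_exp2r // cI orbT.
- by move/andP: smu => [h _]; move: h; rewrite es.
- by move=> j; exact: lincomp_hom.
- have := lead_nonzero_at fM ai hy evlQ lQ dmu; rewrite lead_coefE; exact.
have lq : mmap io (tval io Q x) l != 0 by rewrite -mmap_tcomp.
transitivity ((map_poly (mmap io (lin io M x)) mu).[ev (Q i) / ev (tcomp Q l)] *
   mmap io (tval io Q x) l ^+ s'); last by rewrite rmu mul0r.
rewrite (horner_map_wide _ _ (n := s'.+1)) ?es // mulr_suml.
apply: eq_bigr => j _; rewrite mmap_lincomp mmap_tcomp expr_div_n.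
have jj : (j <= s')%N by rewrite -ltnS.
have lj : mmap io (tval io Q x) l ^+ j != 0 by rewrite expf_neq0.
rewrite -[X in _ = _ * _ ^+ X](subnK jj) exprD -/(tval io Q x i).
by field.
Qed.

End RegularRelations.

Section ProjectivePoints.
Variables (k : closedFieldType) (Om : fieldType) (io : {rmorphism k -> Om}).

Definition peq n (x y : 'I_n -> Om) := exists2 c : Om, c != 0 & x =1 (fun i => c * y i).

Lemma peq_refl n (x : 'I_n -> Om) : peq x x.
Proof. by exists 1; [exact: oner_neq0|move=> i; rewrite mul1r]. Qed.

Lemma peq_sym n (x y : 'I_n -> Om) : peq x y -> peq y x.
Proof. by case=> c c0 h; exists c^-1; [rewrite invr_eq0|move=> i; rewrite h mulKf]. Qed.

Lemma peq_trans n (x y z : 'I_n -> Om) : peq x y -> peq y z -> peq x z.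
Proof. by case=> c c0 h [d d0 h']; exists (c * d); [rewrite mulf_neq0|move=> i; rewrite h h' mulrA]. Qed.

Lemma peq_prop n (x y : 'I_n -> Om) : peq x y -> prop x y.
Proof. by case=> c c0 h i j; rewrite !h; ring. Qed.

Lemma prop_peq n (x y : 'I_n -> Om) : prop x y -> (exists i, x i != 0) -> (exists i, y i != 0) -> peq x y.
Proof.
move=> h [i xi] [j yj]; have e := prop_scale yj h; exists (x j / y j); last exact: e.
by apply: contraNneq xi => z; rewrite e z mul0r.
Qed.

Lemma peq_tval n m (F : tuplemap k n m) (x y : 'I_n.+1 -> Om) : tm_hom F -> peq x y ->
  peq (tval io F x) (tval io F y).
Proof.
case=> e hF [c c0 h]; exists (c ^+ e); first by rewrite expf_neq0.
by move=> i; rewrite /tval (mmap_ext io h) (dhomog_scale _ _ _ (hF i)).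
Qed.

Lemma peq_eqfun n (x y : 'I_n -> Om) : x =1 y -> peq x y.
Proof. by move=> h; exists 1; [exact: oner_neq0|move=> i; rewrite h mul1r]. Qed.

Lemma tval_comp n m l (G : tuplemap k m l) (F : tuplemap k n m) x :
  tval io (tm_comp G F) x =1 tval io G (tval io F x).
Proof. by move=> i; exact: mmap_tcomp. Qed.

Lemma tval_id n (x : 'I_n.+1 -> Om) : tval io (@tm_id k n) x =1 x.
Proof. by move=> i; exact: mmap_var. Qed.

Lemma peq_comp n m l (G : tuplemap k m l) (F : tuplemap k n m) x :
  peq (tval io (tm_comp G F) x) (tval io G (tval io F x)).
Proof. exact: peq_eqfun (tval_comp _ _ _). Qed.

Lemma peq_id n (x : 'I_n.+1 -> Om) : peq (tval io (@tm_id k n) x) x.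
Proof. exact: peq_eqfun (tval_id _). Qed.

Lemma tm_comp_hom n m l (G : tuplemap k m l) (F : tuplemap k n m) :
  tm_hom G -> tm_hom F -> tm_hom (tm_comp G F).
Proof. by case=> a hG [b hF]; exists (b * a)%N => i; exact: (tcomp_hom hF (hG i)). Qed.

Lemma tm_id_hom n : tm_hom (@tm_id k n).
Proof. by exists 1%N => i; exact: hX1. Qed.

Lemma tm_iter_hom n (f : tuplemap k n n) r : tm_hom f -> tm_hom (tm_iter f r).
Proof. by move=> hf; elim: r => [|r IH]; [exact: tm_id_hom|exact: tm_comp_hom]. Qed.

Lemma hgeneric_peq n (X : set 'rV[k]_n.+1) x y : peq x y -> hgeneric io X x -> hgeneric io X y.
Proof.
case=> c c0 h gx d P hP; rewrite -(gx _ _ hP) (mmap_ext io h) (dhomog_scale _ _ _ hP).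
by split=> [->|/eqP]; [rewrite mulr0|rewrite mulf_eq0 expf_eq0 (negbTE c0) andbF => /eqP].
Qed.

Lemma hgeneric_peq_eqv n m (X : set 'rV[k]_n.+1) x (F G : tuplemap k n m) :
  hgeneric io X x -> tm_hom F -> tm_hom G -> tm_eqv X F G -> peq (tval io F x) (tval io G x).
Proof. by move=> gx hF hG h; have [p1 p2 p3] := hgeneric_eqv gx hF hG h; exact: prop_peq. Qed.

End ProjectivePoints.

Lemma dominant_hom (k : fieldType) n m (X : set 'rV[k]_n.+1) (Y : set 'rV[k]_m.+1) F :
  dominant X Y F -> tm_hom F.
Proof. by case=> [[]]. Qed.

(** * Iterates on two conjugate models *)

Lemma peq_point (k : closedFieldType) (Om : fieldType) (io : {rmorphism k -> Om}) n m
    (X : set 'rV[k]_n.+1) (Y : set 'rV[k]_m.+1) (F : tuplemap k m n) x y : projective X ->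
  is_point Y -> generic io Y y -> hgeneric io X x -> tm_hom F -> peq (tval io F y) x -> is_point X.
Proof.
move=> pX [v v0 eY] gy gx [e hF] [c c0 h].
have [l vl] : exists l, v ord0 l != 0.
  by apply/rV0Pn.
have ey : y =1 (fun i => y l / io (v ord0 l) * io (v ord0 i)).
  move=> i; have : mmap io y (v ord0 l *: mpX k i - v ord0 i *: mpX k l) = 0.
    apply/gy => w; rewrite eY => -[a a0 ->].
    by rewrite /ev mevalB !mevalZ !mevalXU !mxE; ring.
  rewrite rmorphB -!mul_mpolyC !rmorphM /= !mmapC !mmap_var => /eqP.
  rewrite subr_eq0 => /eqP e1; have vl' : io (v ord0 l) != 0 by rewrite fmorph_eq0.
  by apply: (mulfI vl'); rewrite e1; field.
apply: (generic_point (c := fun i => meval (v ord0) (F i)) (a := c^-1 * (y l / io (v ord0 l)) ^+ e) pX).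
  by move=> d P hP /(gx _ _ hP).
move=> i; apply: (mulfI c0); rewrite -h /tval (mmap_ext io ey) (dhomog_scale _ _ _ (hF i)).
by rewrite /meval mmap_rmorph /= -mulrA mulVKf //.
Qed.

Section Conjugacy.
Variables (k : closedFieldType) (Om : fieldType) (io : {rmorphism k -> Om}) (n n1 n' : nat).
Variables (X : set 'rV[k]_n.+1) (X1 : set 'rV[k]_n1.+1) (X' : set 'rV[k]_n'.+1).
Variables (f : tuplemap k n n) (f1 : tuplemap k n1 n1) (f' : tuplemap k n' n').
Variables (pT : tuplemap k n n1) (qT : tuplemap k n1 n) (p : tuplemap k n n') (q : tuplemap k n' n).
Hypotheses (X0 : forall v, X v -> v != 0) (pX1 : projective X1) (pX' : projective X')
  (domf : dominant X X f) (hf1 : tm_hom f1) (hf' : tm_hom f')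
  (bT : birational_inverse X X1 pT qT) (b' : birational_inverse X X' p q)
  (cT : tm_eqv X (tm_comp pT f) (tm_comp f1 pT)) (c' : tm_eqv X (tm_comp p f) (tm_comp f' p)).
Variable xi : 'I_n1.+1 -> Om.
Hypothesis hxi : generic io X1 xi.

Let X10 v (X1v : X1 v) : v != 0 := zclosed_neq0 (proj1 pX1) X1v.
Let X'0 v (X'v : X' v) : v != 0 := zclosed_neq0 (proj1 pX') X'v.
Let th m := tval io (tm_iter f m) (tval io qT xi).

Lemma orbit_generic m : hgeneric io X (th m).
Proof.
case: bT => _ dq _ _; have g0 : hgeneric io X (tval io qT xi).
  by apply: (generic_image (fun d P _ => hxi P) X10 X0 dq).
elim: m => [|m IH].
  by apply: (hgeneric_peq (peq_sym (peq_id io _)) g0).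
apply: (hgeneric_peq _ (generic_image IH X0 X0 domf)).
by apply: peq_sym; exact: peq_comp.
Qed.

Lemma conj_iter l (Y : set 'rV[k]_l.+1) (g : tuplemap k l l) (s : tuplemap k n l) y m : tm_hom g ->
  tm_hom s -> tm_eqv X (tm_comp s f) (tm_comp g s) -> peq (tval io s (th 0)) y ->
  peq (tval io s (th m)) (tval io (tm_iter g m) y).
Proof.
move=> hg hs cs h0; have hf := dominant_hom domf; elim: m => [|m IH].
  by apply: peq_trans h0 _; apply: peq_sym; exact: peq_id.
have h1 : peq (tval io (tm_comp s f) (th m)) (tval io (tm_comp g s) (th m)).
  by apply: (hgeneric_peq_eqv (orbit_generic m) _ _ cs); apply: tm_comp_hom.
have e1 : peq (tval io s (th m.+1)) (tval io (tm_comp s f) (th m)).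
  apply: peq_trans (peq_sym (peq_comp io s f _)); apply: peq_tval => //.
  by apply: peq_eqfun; exact: tval_comp.
apply: peq_trans e1 (peq_trans h1 _).
apply: peq_trans (peq_comp io g s _) _.
apply: peq_trans (peq_tval io hg IH) _.
by apply: peq_sym; exact: (peq_comp io g (tm_iter g m)).
Qed.

(** The map [pp] goes from the model carrying the orbit to the normal one, with a linear factor for
    positive degree; the composite of [pT] and [q] goes back. Iterates correspond up to scalars
    because both squares commute generically. *)
Lemma conjugate_generic : graded io xi -> exists (pp : tuplemap k n1 n') e,
  [/\ (0 < e)%N, forall i, hom e (pp i), generic io X' (tval io pp xi), graded io (tval io pp xi)
    & forall m, hgeneric io X' (tval io (tm_iter f' m) (tval io pp xi)) /\
       peq (tval io (tm_comp pT q) (tval io (tm_iter f' m) (tval io pp xi))) (tval io (tm_iter f1 m) xi)].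
Proof.
move=> gxi; have [dpT dqT idT idT'] := bT; have [dp dq idp _] := b'.
have [[[hpT hqT] hp] hq] := (dominant_hom dpT, dominant_hom dqT, dominant_hom dp, dominant_hom dq).
have X1n : X1 !=set0 by case: pX1 => _ [].
have [l xl] := generic_neq0 X1n X10 hxi.
have [e hpq] : tm_hom (tm_comp p qT) by exact: tm_comp_hom.
pose pp : tuplemap k n1 n' := fun i => mpX k l * tm_comp p qT i.
have hpp i : hom e.+1 (pp i) by rewrite -[X in hom X _]add1n; apply: dhomogM; [exact: hX1|exact: hpq].
have th0 : peq (tval io qT xi) (th 0) by apply: peq_sym; exact: peq_id.
have pp0 : peq (tval io p (th 0)) (tval io pp xi).
  apply: peq_trans (peq_tval io hp (peq_sym th0)) _.
  apply: peq_trans (peq_sym (peq_comp io p qT _)) _.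
  by apply: peq_sym; exists (xi l) => // i; rewrite /tval rmorphM /= mmap_var.
have hg0 m : hgeneric io X' (tval io p (th m)) := generic_image (orbit_generic m) X0 X'0 dp.
have gr : graded io (tval io pp xi).
  apply: (graded_ext _ (graded_comp (e := e.+1) (L := [tuple pp j | j < n'.+1]) (ltn0Sn _) _ gxi)).
    by move=> j /=; rewrite tnth_mktuple.
  by move=> j; rewrite tnth_mktuple.
exists pp, e.+1; split=> //.
  apply: generic_graded => //; last exact: (hgeneric_peq pp0 (hg0 0%N)).
  by move=> c v c0; apply: zclosed_scale => //; case: pX'.
move=> m; have pm := conj_iter X' m hf' hp c' pp0.
split; first exact: (hgeneric_peq pm (hg0 m)).
have pTx : peq (tval io pT (th 0)) xi.
  apply: peq_trans (peq_tval io hpT (peq_sym th0)) _.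
  apply: peq_trans (peq_sym (peq_comp io pT qT _)) _.
  apply: peq_trans (peq_id io xi).
  by apply: (hgeneric_peq_eqv (fun d P _ => hxi P) _ _ idT'); [exact: tm_comp_hom|exact: tm_id_hom].
apply: peq_trans (conj_iter X1 m hf1 hpT cT pTx).
apply: peq_trans (peq_comp io pT q _) _; apply: peq_tval => //.
apply: peq_trans (peq_tval io hq (peq_sym pm)) _.
apply: peq_trans (peq_sym (peq_comp io q p _)) _.
apply: peq_trans (peq_id io _).
by apply: (hgeneric_peq_eqv (orbit_generic m) _ _ idp); [exact: tm_comp_hom|exact: tm_id_hom].
Qed.

Hypothesis gxi : graded io xi.
Variable u : nat -> nat.
Hypotheses (nX' : normal X') (hu : forall r, is_pullback_degree X' (tm_iter f' r) (u r)).

Lemma iterate_hom m : tm_hom (tm_iter f' m). Proof. exact: tm_iter_hom. Qed.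

Lemma not_point_conjugate : ~ is_point X1 -> ~ is_point X'.
Proof.
move=> np pt; apply: np.
have [pp [e [_ _ geta _ hm]]] := conjugate_generic gxi.
have [_ h0] := hm 0%N; have [dpT _ _ _] := bT; have [_ dq _ _] := b'.
have hpq : tm_hom (tm_comp pT q) by exact: (tm_comp_hom (dominant_hom dpT) (dominant_hom dq)).
have gx0 : hgeneric io X1 (tval io (tm_iter f1 0) xi).
  by apply: (hgeneric_peq (peq_sym (peq_id io xi))) => d P _; exact: hxi.
apply: (peq_point pX1 pt geta gx0 hpq).
by apply: peq_trans h0; apply: peq_tval => //; apply: peq_sym; exact: peq_id.
Qed.

(** On [X'] the form [H] clears the denominators of the iterate divided by [h]. The way back has
    degree [eq], so scaling its value by the [eq]-th power of [H / h] gives coordinates [G] integral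
    over [xi], of weight linear in [u m]. *)
Lemma iterate_integral r' (M' : 'I_n'.+1 -> 'I_r'.+2 -> k) (I : finType) dg g pp e :
  ~ is_point X' -> (forall i, hom e (pp i)) -> generic io X' (tval io pp xi) -> graded io (tval io pp xi) ->
  (forall m, hgeneric io X' (tval io (tm_iter f' m) (tval io pp xi)) /\
       peq (tval io (tm_comp pT q) (tval io (tm_iter f' m) (tval io pp xi))) (tval io (tm_iter f1 m) xi)) ->
  @finlin k Om io _ (tval io pp xi) _ M' I dg g -> algindep io (lin io M' (tval io pp xi)) ->
  exists C, forall m, exists dl bd (G : 'I_n1.+1 -> Om) (P : 'I_n1.+1 -> mp n1.+1 k) Qd,
  [/\ (dl <= C * u m)%N, (forall i, hom (bd + dl) (P i)) /\ hom bd Qd, mmap io xi Qd != 0,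
     forall i, G i = mmap io xi (P i) / mmap io xi Qd
   & peq G (tval io (tm_iter f1 m) xi) /\
     forall V, valring V -> overk io V -> (forall i, V (xi i)) -> forall i, V (G i)].
Proof.
move=> np hpp geta greta hm fM ai; have [dpT _ _ _] := bT; have [_ dq _ _] := b'.
have [eq hq'] : tm_hom (tm_comp pT q) by exact: (tm_comp_hom (dominant_hom dpT) (dominant_hom dq)).
set q' := tm_comp pT q in hq' hm; set eta := tval io pp xi in geta greta fM ai hm.
(* [n'.+1 * #|I| * u m] bounds the degree of [H], while [e] and [eq] are the degrees of the two maps
   between the models; none of these factors but [u m] depends on [m]. *)
exists (e * (n'.+1 * #|I|) * eq)%N => m; have [gm em] := hm m.
have [dm hdm] := iterate_hom m.
have domfm d P : hom d P -> mmap io (tval io (tm_iter f' m) eta) P = 0 -> van X' P.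
  by move=> hP /(gm _ _ hP).
have [_ [h [hh h0 [D [H [hH H0 leD hV]]]]]] :=
  pullback_degree_bound greta fM ai pX' nX' geta np (hu m) (iterate_hom m) domfm.
set z := tval io (tm_iter f' m) eta in gm em h0 hV.
pose HP : mp n1.+1 k := tcomp pp (lincomp M' H).
have hHP : hom (e * D) HP by apply: (tcomp_hom hpp); exact: lincomp_hom.
have eHP : mmap io xi HP = mmap io (lin io M' eta) H.
  by rewrite /HP mmap_tcomp mmap_lincomp.
pose ZF := tm_comp (tm_iter f' m) pp.
have hZF i : hom (e * dm) (ZF i) := tcomp_hom hpp (hdm i).
have eZF : tval io ZF xi =1 z by exact: tval_comp.
pose hZ : mp n1.+1 k := tcomp ZF h.
have hhZ : hom (e * dm * 1) hZ := tcomp_hom hZF hh.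
have ehZ : mmap io xi hZ = mmap io z h by rewrite /hZ mmap_tcomp; exact: mmap_ext.
pose P i : mp n1.+1 k := HP ^+ eq * tm_comp q' ZF i.
have hP i : hom (e * dm * 1 * eq + e * D * eq) (P i).
  by rewrite addnC muln1; apply: dhomogM; [exact: dhomogMn|exact: (tcomp_hom hZF (hq' i))].
have Hn0 : mmap io (lin io M' eta) H != 0 by apply: contraNneq H0 => /ai ->.
set c := mmap io (lin io M' eta) H / mmap io z h.
have c0 : c != 0 by rewrite mulf_neq0 // invr_eq0.
have eG i : mmap io xi (P i) / mmap io xi (hZ ^+ eq) = c ^+ eq * tval io q' z i.
  rewrite /P rmorphM !rmorphXn /= eHP ehZ mmap_tcomp (mmap_ext io eZF) /c exprMn exprVn.
  by rewrite -/(tval io q' z i); field; rewrite expf_neq0.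
exists (e * D * eq)%N, (e * dm * 1 * eq)%N, (fun i => c ^+ eq * tval io q' z i), P, (hZ ^+ eq); split.
- by rewrite [X in (_ <= X)%N]mulnAC leq_mul2r -mulnA -(mulnA n'.+1) leq_mul2l leD !orbT.
- by split=> //; exact: dhomogMn.
- by rewrite rmorphXn /= expf_neq0 // ehZ.
- by move=> i; rewrite eG.
split.
  by apply: peq_trans em; exists (c ^+ eq); [rewrite expf_neq0|].
move=> V vV kV Vxi i; have sV : subring V by case: vV.
have Veta j : V (eta j) by apply: (V_mmap vV kV).
have Vt a : V (mmap io (lin io M' eta) a).
  by apply: (V_mmap vV kV) => j; rewrite -mmap_linf; exact: (V_mmap vV kV).
rewrite -(dhomog_scale _ _ _ (hq' i)); apply: (V_mmap vV kV) => j.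
by have := hV V vV Vt j; rewrite /c mulrA mulrAC.
Qed.

Lemma iterate_relations : ~ is_point X1 -> exists C, forall m (Q : tuplemap k n1 n1) eQ y,
  (forall i, hom eQ (Q i)) -> peq (tval io Q xi) (tval io (tm_iter f1 m) xi) -> X1 y -> tm_val Q y != 0 ->
  exists l : hpoly k n1, [/\ hom 1%N l, ev l (tm_val Q y) != 0 & forall i, exists s (B : nat -> hpoly k n1) e,
   [/\ (e <= C * u m)%N, (0 < s)%N, forall j, hom e (B j), ev (B s) y != 0
    & forall y', X1 y' ->
      \sum_(j < s.+1) ev (B j) y' * ev (Q i) y' ^+ j * ev l (tm_val Q y') ^+ (s - j) = 0]].
Proof.
move=> np; have np' := not_point_conjugate np.
have [pp [e [e0 hpp geta greta hm]]] := conjugate_generic gxi.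
have [d [M [I [dg [g [fM ai]]]]]] := noether gxi.
have := noether_dim pX1 hxi fM ai np; case: d M fM ai => [|[|r]] // M fM ai _.
have [d' [M' [I' [dg' [g' [fM' ai']]]]]] := noether greta.
have := noether_dim pX' geta fM' ai' np'; case: d' M' fM' ai' => [|[|r']] // M' fM' ai' _.
have [C hC] := iterate_integral np' hpp geta greta hm fM' ai'.
have [N hN] := regular_relations gxi fM ai.
exists (N * C)%N => m Q eQ y hQ pQ X1y Qy0.
have [dl [bd [G [P [Qd [ledl [hP hQd] Qd0 eG [pG iG]]]]]]] := hC m.
have [c c0 ec] : peq (tval io Q xi) G by apply: peq_trans pQ _; exact: peq_sym.
have zy : zeros io xi (y ord0) by move=> A /hxi/(_ y X1y).
have y0 : exists j, y ord0 j != 0 by apply/rV0Pn; exact: (zclosed_neq0 (proj1 pX1)).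
have Qy : exists j, meval (y ord0) (Q j) != 0.
  by move/rV0Pn: Qy0 => [j]; rewrite mxE; exists j.
have [l [hl l0 hr]] := hN dl bd G P Qd Q eQ _ hP hQd Qd0 eG iG hQ (ex_intro2 _ _ c c0 ec) zy y0 Qy.
have elv y' : ev l (tm_val Q y') = meval (fun i => meval (y' ord0) (Q i)) l.
  by apply: mmap_ext => i; rewrite mxE.
exists l; split=> //; first by rewrite elv.
move=> i; have [s [B [e' [le' s0 hB B0 rel]]]] := hr i.
exists s, B, e'; split=> //; first by apply: leq_trans le' _; rewrite -mulnA leq_mul2l ledl orbT.
move=> y' X1y'.
pose R : hpoly k n1 := \sum_(j < s.+1) B j * Q i ^+ j * tcomp Q l ^+ (s - j).
have R0 : mmap io xi R = 0.
  rewrite -[RHS]rel raddf_sum; apply: eq_bigr => j _.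
  by rewrite /= !rmorphM !rmorphXn /= mmap_tcomp.
move/hxi/(_ y' X1y'): R0; rewrite /ev raddf_sum => R0; rewrite -[RHS]R0; apply: eq_bigr => j _.
rewrite /= !rmorphM !rmorphXn /= -/(ev l _) elv; congr (_ * _ ^+ _).
by rewrite /meval mmap_tcomp.
Qed.

Lemma pullback_degree_gt0 m : (0 < u m)%N.
Proof.
have [[_ -> //]|[np _]] := hu m.
have [pp [e [e0 hpp geta greta hm]]] := conjugate_generic gxi.
have [d' [M' [I' [dg' [g' [fM' ai']]]]]] := noether greta.
have := noether_dim pX' geta fM' ai' np; case: d' M' fM' ai' => [|[|r']] // M' fM' ai' _.
have [gm _] := hm m.
by have [] := pullback_degree_bound greta fM' ai' pX' nX' geta np (hu m) (iterate_hom m) (fun d P hP => proj1 (gm d P hP)).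
Qed.

End Conjugacy.

(** * Places of function fields *)

Lemma big_uniq_sub (T : eqType) (V : Type) (idx : V) (op : Monoid.com_law idx) (s s' : seq T) (f : T -> V) :
  uniq s -> uniq s' -> {subset s <= s'} -> (forall x, x \in s' -> x \notin s -> f x = idx) ->
  \big[op/idx]_(x <- s') f x = \big[op/idx]_(x <- s) f x.
Proof.
move=> us us' ss f0.
have hp : perm_eq s [seq x <- s' | x \in s].
  apply: uniq_perm => //; first exact: filter_uniq.
  by move=> x; rewrite mem_filter; case xs: (x \in s) => //=; rewrite ss.
rewrite [RHS](perm_big _ hp) big_filter [LHS]big_seq_cond [RHS]big_seq_cond.
rewrite [LHS](bigID (mem s)) /= [X in op _ X]big1 ?Monoid.mulm1 //; last by move=> x /andP[/andP[xs' _]]; exact: f0.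
by apply: eq_bigl => x; rewrite andbT.
Qed.

Lemma bounded_max (P : nat -> Prop) B n0 : P n0 -> (forall n, P n -> (n <= B)%N) ->
  exists n, P n /\ forall m, P m -> (m <= n)%N.
Proof.
move=> h0 hB; have ex : exists n, `[< P n >] by exists n0; apply/asboolP.
have bd n : `[< P n >] -> (n <= B)%N by move/asboolP; exact: hB.
have [n /asboolP Pn mn] := ex_maxnP ex bd.
by exists n; split=> // m Pm; apply: mn; apply/asboolP.
Qed.

Lemma poly_X_quotient (R : comNzRingType) (p : {poly R}) : exists r, p = r * 'X + p.[0]%:P.
Proof.
have /factor_theorem[r e] : root (p - p.[0]%:P) 0 by rewrite /root !hornerE subrr.
by exists r; rewrite -[p in LHS](subrK p.[0]%:P) e subr0.
Qed.

Section Places.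
Variables (K : closedFieldType) (L : fieldType) (ka : {rmorphism K -> L}).

(** For [ka c = (iota c)%:A] this is [is_place iota]. *)
Definition place (v : L -> int) :=
  [/\ v 0 = 0,
      forall a b, a != 0 -> b != 0 -> v (a * b) = v a + v b,
      forall a b, a != 0 -> b != 0 -> a + b != 0 -> Num.min (v a) (v b) <= v (a + b),
      forall c : K, v (ka c) = 0
    & exists2 a, a != 0 & v a = 1].

Definition peval (a : L) (p : {poly K}) := (map_poly ka p).[a].

(** For nonconstant [a] this is linear independence over [K(a)] with denominators cleared;
    accordingly [rank_le a N] says that [L] has degree at most [N] over [K(a)]. *)
Definition kfree (J : finType) (a : L) (w : J -> L) :=
  forall p : J -> {poly K}, \sum_j peval a (p j) * w j = 0 -> forall j, p j = 0.

Definition rank_le (a : L) N := forall (J : finType) (w : J -> L), kfree a w -> (#|J| <= N)%N.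

Definition nonconst (a : L) := forall c, a <> ka c.

Lemma peval_nonconst a p : nonconst a -> peval a p = 0 -> p = 0.
Proof.
move=> na pa; apply: contrapT => /eqP p0; have [c e] := algebraic_constant p0 pa.
exact: (na c).
Qed.

Lemma pevalE a p : peval a p = (map_poly ka p).[a]. Proof. by []. Qed.

Lemma pevalM a p q : peval a (p * q) = peval a p * peval a q.
Proof. by rewrite /peval rmorphM hornerM. Qed.

Lemma pevalD a p q : peval a (p + q) = peval a p + peval a q.
Proof. by rewrite /peval rmorphD hornerD. Qed.

Lemma pevalC a c : peval a c%:P = ka c.
Proof. by rewrite /peval map_polyC hornerC. Qed.

Lemma peval1 a : peval a 1 = 1.
Proof. by rewrite -polyC1 pevalC rmorph1. Qed.

Lemma peval0 a : peval a 0 = 0.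
Proof. by rewrite -polyC0 pevalC rmorph0. Qed.

Lemma pevalN a p : peval a (- p) = - peval a p.
Proof. by rewrite /peval rmorphN hornerN. Qed.

Lemma pevalX a : peval a 'X = a.
Proof. by rewrite /peval map_polyX hornerX. Qed.

Lemma pevalXn a p n : peval a (p ^+ n) = peval a p ^+ n.
Proof. by elim: n => [|n IH]; rewrite ?expr0 ?peval1 // !exprS pevalM IH. Qed.

Lemma peval_sum a (I : Type) (s : seq I) (P : pred I) (f : I -> {poly K}) :
  peval a (\sum_(i <- s | P i) f i) = \sum_(i <- s | P i) peval a (f i).
Proof. by apply: (big_morph (peval a) (pevalD a)); rewrite /peval rmorph0 horner0. Qed.

Lemma nonconst_neq0 a : nonconst a -> a != 0.
Proof. by move=> na; apply/eqP => e; apply: (na 0); rewrite rmorph0. Qed.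

Lemma nonconstV a : nonconst a -> nonconst a^-1.
Proof. by move=> na c e; apply: (na c^-1); rewrite fmorphV -e invrK. Qed.

Lemma kfree_root0 (J : finType) a (w : J -> L) : a != 0 ->
  (forall p : J -> {poly K}, \sum_j peval a (p j) * w j = 0 -> forall j, (p j).[0] = 0) -> kfree a w.
Proof.
move=> a0 h p; have [n] : exists n, forall j, (size (p j) <= n)%N.
  by exists (\max_j size (p j)) => j; exact: leq_bigmax.
elim: n p => [|n IH] p sp pw j.
  by apply/eqP; rewrite -size_poly_eq0 -leqn0.
have [q eq] : exists q : J -> {poly K}, forall j, p j = q j * 'X.
  have [q eq] := choice (fun j => poly_X_quotient (p j)).
  by exists q => i; rewrite eq h // polyC0 addr0.
have qw : \sum_j peval a (q j) * w j = 0.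
  apply: (mulfI a0); rewrite mulr0 -[RHS]pw mulr_sumr; apply: eq_bigr => i _.
  by rewrite eq pevalM pevalX; ring.
rewrite eq (IH q _ qw) ?mul0r // => i.
have [->|q0] := eqVneq (q i) 0; first by rewrite size_poly0.
by have := sp i; rewrite eq size_mulX.
Qed.

Section OnePlace.
Variables (v : L -> int) (pv : place v).

Definition vge (m : int) a := a = 0 \/ m <= v a.

Lemma placeM a b : a != 0 -> b != 0 -> v (a * b) = v a + v b. Proof. by case: pv => _ + _ _ _; apply. Qed.

Lemma placeC c : v (ka c) = 0. Proof. by case: pv. Qed.

Lemma place1 : v 1 = 0. Proof. by rewrite -(rmorph1 ka) placeC. Qed.

Lemma placeV a : a != 0 -> v a^-1 = - v a.
Proof.
move=> a0; have := placeM a0 (_ : a^-1 != 0); rewrite invr_eq0 => /(_ a0).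
by rewrite mulfV // place1 => /eqP; rewrite eq_sym addrC addr_eq0 => /eqP.
Qed.

Lemma placeX a n : a != 0 -> v (a ^+ n) = v a *+ n.
Proof.
move=> a0; elim: n => [|n IH]; first by rewrite place1.
by rewrite exprS placeM ?expf_neq0 // IH mulrS.
Qed.

Lemma place_uniformizer_exists : exists2 a, a != 0 & v a = 1. Proof. by case: pv. Qed.

Lemma vge0 m : vge m 0. Proof. by left. Qed.

Lemma vge_le m m' a : m' <= m -> vge m a -> vge m' a.
Proof. by move=> le [->|h]; [left|right; exact: le_trans h]. Qed.

Lemma vgeD m a b : vge m a -> vge m b -> vge m (a + b).
Proof.
move=> [->|ha]; first by rewrite add0r.
move=> [->|hb]; first by rewrite addr0; right.
have [->|a0] := eqVneq a 0; first by rewrite add0r; right.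
have [->|b0] := eqVneq b 0; first by rewrite addr0; right.
have [e|ab0] := eqVneq (a + b) 0; [by left|right].
case: pv => _ _ /(_ a b a0 b0 ab0) h _ _; apply: le_trans h.
by rewrite le_min ha hb.
Qed.

Lemma vge_sum m (I : Type) (s : seq I) (P : pred I) (f : I -> L) :
  (forall i, P i -> vge m (f i)) -> vge m (\sum_(i <- s | P i) f i).
Proof. by move=> h; apply: big_ind; [exact: vge0|exact: vgeD|]. Qed.

Lemma vgeM m m' a b : vge m a -> vge m' b -> vge (m + m') (a * b).
Proof.
have [-> _ _|a0] := eqVneq a 0; first by rewrite mul0r; left.
have [-> _ _|b0] := eqVneq b 0; first by rewrite mulr0; left.
move=> [e|ha]; first by rewrite e eqxx in a0.
move=> [e|hb]; first by rewrite e eqxx in b0.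
by right; rewrite placeM // lerD.
Qed.

Lemma vgeC c : vge 0 (ka c). Proof. by right; rewrite placeC. Qed.

Lemma vgeN m a : vge m a -> vge m (- a).
Proof. by move=> h; rewrite -mulN1r -(rmorph1 ka) -rmorphN -[m]add0r; apply: vgeM => //; exact: vgeC. Qed.

Lemma vgeB m a b : vge m a -> vge m b -> vge m (a - b).
Proof. by move=> ha hb; apply: vgeD => //; exact: vgeN. Qed.

Lemma vgeX a n : vge 0 a -> vge 0 (a ^+ n).
Proof.
by move=> h; elim: n => [|n IH]; [right; rewrite place1|rewrite exprS -[0]addr0; exact: vgeM].
Qed.

Lemma vge_peval a p : vge 0 a -> vge 0 (peval a p).
Proof.
move=> h; rewrite /peval horner_coef; apply: vge_sum => i _; rewrite -[0]addr0.
by apply: vgeM; [rewrite coef_map; exact: vgeC|exact: vgeX].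
Qed.

Lemma vgeE m a : a != 0 -> vge m a -> m <= v a.
Proof. by move=> a0 [e|//]; rewrite e eqxx in a0. Qed.

Lemma place_lt_add x y : x != 0 -> y != 0 -> x + y != 0 -> v x < v y -> v (x + y) = v x.
Proof.
move=> x0 y0 xy0 uxy; apply/eqP; rewrite eq_le; apply/andP; split; last first.
  by apply: (vgeE xy0); apply: vgeD; right => //; exact: ltW.
rewrite leNgt; apply/negP => h.
have : vge (v x + 1) (x + y - y) by apply: vgeB; right; [move: h|move: uxy]; clear; lia.
by rewrite addrK => /(vgeE x0); clear; lia.
Qed.

Lemma dominant_sum_neq0 (J : finType) (f : J -> L) j0 : f j0 != 0 ->
  (forall j, j != j0 -> vge (v (f j0) + 1) (f j)) -> \sum_j f j != 0.
Proof.
move=> f0 h; apply/eqP; rewrite (bigD1 j0) //= => /eqP; rewrite addrC addr_eq0 => /eqP e.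
have : vge (v (f j0) + 1) (- f j0) by rewrite -e; exact: vge_sum.
by move/vgeN; rewrite opprK => /(vgeE f0); lia.
Qed.

(** Otherwise [a] has a transcendental residue, every nonzero polynomial in [a] is a unit, and the
    powers of a uniformizer are independent over [K(a)], against the finite rank. *)
Lemma place_residue a : (forall a, nonconst a -> exists N, rank_le a N) -> vge 0 a -> exists c, vge 1 (a - ka c).
Proof.
move=> fr Va; apply: contrapT => /forallNP nc.
have na : nonconst a by move=> c e; apply: (nc c); rewrite e subrr; left.
have v0 c : a - ka c != 0 /\ v (a - ka c) = 0.
  have a0 : a - ka c != 0 by apply/eqP => e; apply: (nc c); rewrite e; left.
  split=> //; have h := vgeE a0 (vgeB Va (vgeC c)).
  apply/eqP; rewrite eq_le h andbT; have [//|lt] := lerP (v (a - ka c)) 0.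
  by case: (nc c); right.
have vp p : p != 0 -> peval a p != 0 /\ v (peval a p) = 0.
  move=> p0; have [s es] := closed_field_poly_normal p.
  have lp : lead_coef p != 0 by rewrite lead_coef_eq0.
  rewrite es -mul_polyC pevalM pevalC.
  have [h1 h2] : peval a (\prod_(z <- s) ('X - z%:P)) != 0 /\ v (peval a (\prod_(z <- s) ('X - z%:P))) = 0.
    elim: s {es} => [|z s [IH1 IH2]]; first by rewrite big_nil -[1]/(1%:P) pevalC rmorph1 place1 oner_neq0.
    have ez : peval a ('X - z%:P) = a - ka z by rewrite /peval rmorphB /= map_polyX map_polyC !hornerE.
    have [z0 vz] := v0 z.
    by rewrite big_cons pevalM ez mulf_neq0 // placeM // IH2 vz.
  have kl : ka (lead_coef p) != 0 by rewrite fmorph_eq0.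
  by rewrite mulf_neq0 // placeM // placeC h2.
have [x x0 vx] := place_uniformizer_exists.
have [N hN] := fr a na.
have := hN 'I_N.+1 (fun i => x ^+ i); rewrite card_ord ltnn => h; apply: notF; apply: h => p pw j.
apply: contrapT => /eqP pj0.
have [j0 pj00 jmin] := @arg_minnP _ j (fun j => p j != 0) (fun j : 'I_N.+1 => nat_of_ord j) pj0.
have xn0 i : x ^+ i != 0 by rewrite expf_neq0.
have vt i : p i != 0 -> peval a (p i) * x ^+ i != 0 /\ v (peval a (p i) * x ^+ i) = i.
  move=> /vp[h1 h2]; rewrite mulf_neq0 //; split=> //.
  by rewrite placeM // h2 add0r placeX // vx natz.
have [t0 vt0] := vt _ pj00.
suff : \sum_(i < N.+1) peval a (p i) * x ^+ i != 0 by rewrite pw eqxx.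
apply: (dominant_sum_neq0 (f := fun i : 'I_N.+1 => peval a (p i) * x ^+ i) t0).
move=> i ij; have [e|pi] := eqVneq (p i) 0.
  by left; rewrite e -[0]/(0%:P) pevalC rmorph0 mul0r.
have [_ e] := vt i pi; right; rewrite e vt0.
have := jmin i pi; rewrite leq_eqVlt => /orP[/eqP e'|]; last by clear; lia.
by case/eqP: ij; apply: val_inj.
Qed.

End OnePlace.

Lemma place_inj v w : place v -> place w -> (forall a, a != 0 -> 0 <= v a -> 0 <= w a) -> w = v.
Proof.
move=> pv pw h.
have unit a : a != 0 -> v a = 0 -> w a = 0.
  move=> a0 va; have a0' : a^-1 != 0 by rewrite invr_eq0.
  have h1 := h a a0; have h2 := h _ a0'; rewrite !placeV // va in h1 h2.
  by have := h1 (lexx _); have := h2 (lexx _); lia.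
have [x x0 vx] := place_uniformizer_exists pv.
have wx : 0 <= w x by apply: h => //; rewrite vx.
have wv n : forall a, a != 0 -> v a = n%:Z -> w a = n%:Z * w x.
  elim: n => [|n IH] a a0 va; first by rewrite mul0r; exact: unit.
  have a0' : a / x != 0 by rewrite mulf_neq0 ?invr_eq0.
  have e : a = (a / x) * x by rewrite divfK.
  have va' : v (a / x) = n%:Z by rewrite placeM ?invr_eq0 // placeV // vx va; lia.
  by rewrite e placeM // (IH _ a0' va'); lia.
have wv' a : a != 0 -> w a = v a * w x.
  move=> a0; case e : (v a) => [n|n]; first exact: wv.
  have a0' : a^-1 != 0 by rewrite invr_eq0.
  have := wv n.+1 _ a0'; rewrite !placeV // e NegzE opprK => /(_ erefl) h1.
  by rewrite mulNr -h1 opprK.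
have [b b0 wb] := place_uniformizer_exists pw.
have wx1 : w x = 1.
  have := wv' b b0; rewrite wb => e; move: wx e; move: (w x) (v b) => m l wx e.
  have : (m %| 1)%Z by apply/dvdzP; exists l.
  by rewrite dvdz1; lia.
apply: funext => a; have [->|a0] := eqVneq a 0; first by case: pv => -> _ _ _ _; case: pw => -> .
by rewrite wv' // wx1 mulr1.
Qed.

(** Weak approximation, one place at a time, then a product and a power. *)
Lemma place_approx v (ws : seq (L -> int)) : place v -> (forall w, w \in ws -> place w /\ w != v) ->
  forall N : nat, exists2 s, s != 0 & v s = 0 /\ forall w, w \in ws -> N%:Z <= w s.
Proof.
move=> pv hws N.
have step (us : seq (L -> int)) w : place w -> w != v -> (forall u, u \in us -> place u) ->
    exists2 e, e != 0 & [/\ v e = 0, 0 < w e & forall u, u \in us -> 0 <= u e].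
  move=> pw wv pus.
  have [a a0 [va wa]] : exists2 a, a != 0 & 0 <= v a /\ w a < 0.
    apply: contrapT => h; case/eqP: wv; apply: place_inj => // a a0 va; rewrite leNgt; apply/negP => wa.
    by apply: h; exists a.
  have [b b0 [wb vb]] : exists2 b, b != 0 & 0 <= w b /\ v b < 0.
    apply: contrapT => h; case/eqP: wv; apply/esym; apply: place_inj => // b b0 wb; rewrite leNgt; apply/negP => vb.
    by apply: h; exists b.
  (* [c] has a pole at [v] and a zero at [w], so [c / (1 + l c)] is a unit at [v] and vanishes at
     [w]. It has no pole elsewhere provided [l] avoids the residues causing cancellation at places
     where [c] is a unit. *)
  pose c := b / a; have c0 : c != 0 by rewrite mulf_neq0 ?invr_eq0.
  have vc : v c < 0 by rewrite placeM ?invr_eq0 // placeV //; lia.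
  have wc : 0 < w c by rewrite placeM ?invr_eq0 // placeV //; lia.
  have bad u : place u -> u c = 0 -> exists x : K, forall l, l != x -> ~ vge u 1 (1 + ka l * c).
    move=> pu uc; have [[x hx]|h] := pselect (exists x, vge u 1 (1 + ka x * c)); last first.
      by exists 0 => l _ hl; apply: h; exists l.
    exists x => l lx hl; have := vgeB pu hl hx.
    have -> : 1 + ka l * c - (1 + ka x * c) = ka (l - x) * c by rewrite rmorphB; ring.
    have l0 : ka (l - x) != 0 by rewrite fmorph_eq0 subr_eq0.
    by move=> /(vgeE (mulf_neq0 l0 c0)); rewrite placeM // placeC // uc.
  have [l l0 hl] : exists2 l : K, l != 0 & forall u, u \in us -> u c = 0 -> ~ vge u 1 (1 + ka l * c).
    have [xs hxs] : exists xs : seq K, forall l, l \notin xs -> forall u, u \in us -> u c = 0 -> ~ vge u 1 (1 + ka l * c).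
      elim: us pus => [|u us IH] pus; first by exists [::].
      have [|xs hxs] := IH; first by move=> u' h; apply: pus; rewrite inE h orbT.
      have [e|ne] := eqVneq (u c) 0.
        have [x hx] := bad u (pus _ (mem_head _ _)) e.
        exists (x :: xs) => l; rewrite inE negb_or => /andP[lx lxs] u'; rewrite inE => /orP[/eqP ->|h].
          by move=> _; exact: hx.
        exact: hxs.
      exists xs => l lxs u'; rewrite inE => /orP[/eqP ->|h]; last exact: hxs.
      by move=> e; rewrite e eqxx in ne.
    have [l hl] : exists l : K, (\prod_(x <- 0 :: xs) ('X - x%:P)).[l] != 0.
      by apply: closed_nonroot; rewrite monic_neq0 // monic_prod_XsubC.
    have ln x : x \in 0 :: xs -> l != x.
      move=> xin; apply: contraNneq hl => ->; rewrite -[_ == 0]/(root _ _) root_prod_XsubC //.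
    exists l; first by apply: ln; exact: mem_head.
    by apply: hxs; apply/negP => lxs; have := ln l; rewrite inE lxs orbT eqxx => /(_ isT).
  have kl0 : ka l != 0 by rewrite fmorph_eq0.
  have lc0 : ka l * c != 0 by rewrite mulf_neq0.
  have vlc u : place u -> u (ka l * c) = u c by move=> pu; rewrite placeM // placeC // add0r.
  have d0 : 1 + ka l * c != 0.
    apply/eqP => e; have := place1 pw; have -> : 1 = - (ka l * c) by apply/eqP; rewrite -addr_eq0 e.
    by rewrite -mulN1r -(rmorph1 ka) -rmorphN mulrA -rmorphM placeM ?fmorph_eq0 ?mulN1r ?oppr_eq0 // placeC // add0r; lia.
  exists (c / (1 + ka l * c)); first by rewrite mulf_neq0 ?invr_eq0.
  have ve u : place u -> u (c / (1 + ka l * c)) = u c - u (1 + ka l * c).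
    by move=> pu; rewrite placeM ?invr_eq0 // placeV.
  have n10 : (1 : L) != 0 := oner_neq0 _.
  have neg u : place u -> u c < 0 -> u (1 + ka l * c) = u c.
    by move=> pu uc; rewrite addrC place_lt_add ?vlc ?place1 // addrC.
  have pos u : place u -> 0 < u c -> u (1 + ka l * c) = 0.
    by move=> pu uc; rewrite place_lt_add ?vlc ?place1.
  split; first by rewrite ve // neg // subrr.
    by rewrite ve // pos // subr0.
  move=> u uin; have pu := pus _ uin; rewrite ve //.
  have [uc|uc|uc] := ltrgtP (u c) 0; first by rewrite neg // subrr.
    by rewrite pos // subr0; exact: ltW.
  rewrite uc sub0r oppr_ge0 leNgt; apply/negP => h; apply: (hl u uin uc); right; move: h; clear; lia.
have [s s0 [vs hs]] : exists2 s, s != 0 & v s = 0 /\ forall w, w \in ws -> 0 < w s.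
  have [s s0 [vs hs _]] : exists2 s, s != 0 & [/\ v s = 0, forall w, w \in ws -> 0 < w s & forall w, w \in ws -> 0 <= w s].
    have : forall us : seq (L -> int), (forall w, w \in us -> w \in ws) -> exists2 s, s != 0 & [/\ v s = 0, forall w, w \in us -> 0 < w s & forall w, w \in ws -> 0 <= w s].
      elim=> [|u us IH] sub.
        by exists 1; [exact: oner_neq0|split=> // [|w /hws[pw _]]; rewrite place1].
      have [|s s0 [vs h1 h2]] := IH; first by move=> w h; apply: sub; rewrite inE h orbT.
      have [pu uv] := hws _ (sub _ (mem_head _ _)).
      have [e e0 [ve ue he]] := step ws u pu uv (fun w h => proj1 (hws w h)).
      exists (s * e); first by rewrite mulf_neq0.
      split; first by rewrite placeM // vs ve.
        move=> w; rewrite inE => /orP[/eqP ->|h].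
          by rewrite placeM // ltr_wpDl // h2 // sub // mem_head.
        have win : w \in ws by apply: sub; rewrite inE h orbT.
        by have [pw _] := hws w win; rewrite placeM // ltr_wpDr ?he ?h1.
      by move=> w win; have [pw _] := hws w win; rewrite placeM //; apply: addr_ge0; [exact: h2|exact: he].
    exact.
  by exists s.
exists (s ^+ N); first by rewrite expf_neq0.
rewrite placeX // vs mul0rn; split=> // w win; have [pw _] := hws w win.
rewrite placeX //; have := hs w win; rewrite -mulr_natl natz; move: (w s) => x; clear; nia.
Qed.

Lemma valring_place V s : valring V -> overk ka V -> maxi V s -> s != 0 ->
  (forall w, V w -> w != 0 -> exists j : nat, V (w / s ^+ j) /\ V (s ^+ j / w)) ->
  exists v, place v /\ forall x, x != 0 -> V x <-> 0 <= v x.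
Proof.
move=> vV kV ms s0 hs; have sV : subring V by case: vV.
have Vs := maxi_sub vV ms.
pose unit x := V x /\ V x^-1.
have unitM x y : unit x -> unit y -> unit (x * y).
  by move=> [x1 x2] [y1 y2]; split; [exact: (subringM sV)|rewrite invfM; exact: (subringM sV)].
have unitV x : unit x -> unit x^-1 by case=> h1 h2; split=> //; rewrite invrK.
have sn n : ~ V (s ^- n.+1).
  move=> h; apply: (maxi1 vV); have -> : 1 = s ^- n.+1 * (s ^+ n * s) by rewrite -exprSr mulVf // expf_neq0.
  by apply: (maxiM vV) => //; apply: (maxiM vV) => //; exact: (subringX sV).
have Vsi (i : int) : V (s ^ i) -> 0 <= i by case: i => // n; rewrite NegzE => /sn.
have si0 (i : int) : s ^ i != 0 by rewrite expfz_neq0.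
have us (i : int) : unit (s ^ i) -> i = 0.
  by case=> /Vsi h1; rewrite -exprz_inv exprzN invrK // -?exprzN => /Vsi h2 || rewrite invr_expz => /Vsi h2; move: h1 h2; clear; lia.
have ex x : exists i : int, x != 0 -> unit (x * s ^ (- i)).
  have [->|x0] := eqVneq x 0; first by exists 0.
  have x0' : x^-1 != 0 by rewrite invr_eq0.
  have [Vx|Vx] := proj2 vV x.
    have [j [h1 h2]] := hs x Vx x0; exists j => _; rewrite -invr_expz; split=> //.
    by rewrite invf_div.
  have [j [h1 h2]] := hs _ Vx x0'; exists (- j%:Z) => _; rewrite opprK; split; first by rewrite mulrC -[x]invrK.
  by rewrite invfM.
have [v' hv'] := choice ex.
pose v x := if x == 0 then 0 else v' x.
have hv x : x != 0 -> unit (x * s ^ (- v x)) by move=> x0; rewrite /v (negbTE x0); exact: hv'.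
have uniq x i : x != 0 -> unit (x * s ^ (- i)) -> v x = i.
  move=> x0 h; have := unitM _ _ (unitV _ (hv _ x0)) h.
  rewrite invfM invr_expz opprK mulrACA mulVf // mul1r -expfzDr // => /us.
  by clear; lia.
have vM a b : a != 0 -> b != 0 -> v (a * b) = v a + v b.
  move=> a0 b0; apply: uniq; first by rewrite mulf_neq0.
  by rewrite opprD expfzDr // mulrACA; apply: unitM; exact: hv.
have vS (i : int) : v (s ^ i) = i.
  by apply: uniq => //; rewrite -expfzDr // subrr expr0z; split; rewrite ?invr1; exact: (subring1 sV).
have Vv x : x != 0 -> V x <-> 0 <= v x.
  move=> x0; have [h1 h2] := hv x x0; split=> h.
    apply: Vsi; have -> : s ^ v x = x * (x * s ^ (- v x))^-1.
      by rewrite invfM invr_expz opprK mulrA mulfV // mul1r.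
    exact: (subringM sV).
  have -> : x = x * s ^ (- v x) * s ^ v x by rewrite -mulrA -expfzDr // addNr expr0z mulr1.
  apply: (subringM sV) => //; move: h; case: (v x) => // n _; exact: (subringX sV).
exists v; split=> //; split=> //.
- by rewrite /v eqxx.
- move=> a b a0 b0 ab0; set m := Num.min _ _.
  have key x : x != 0 -> m <= v x -> V (x * s ^ (- m)).
    by move=> x0 h; apply/Vv; rewrite ?mulf_neq0 // vM // vS; move: h; clear; lia.
  have : V ((a + b) * s ^ (- m)).
    by rewrite mulrDl; apply: (subringD sV); apply: key => //; rewrite /m ge_min lexx ?orbT.
  by move/Vv; rewrite mulf_neq0 // vM // vS => /(_ isT); clear; lia.
- move=> c; have [->|c0] := eqVneq c 0; first by rewrite rmorph0 /v eqxx.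
  by apply: uniq; rewrite ?fmorph_eq0 // oppr0 expr0z mulr1; split; rewrite -?fmorphV; exact: kV.
- by exists s => //; exact: (vS 1).
Qed.

(** Chevalley's theorem over [K[1/a]] gives a valuation ring with [1/a] a nonunit, and the finite
    rank makes it discrete through [uniformizer]. *)
Lemma place_pole a N : nonconst a -> rank_le a^-1 N -> exists v, place v /\ v a < 0.
Proof.
move=> na hN; have a0 := nonconst_neq0 na; pose b := a^-1.
have b0 : b != 0 by rewrite invr_eq0.
have nb : nonconst b := nonconstV na.
pose R := [set x | exists p, x = peval b p].
have sR : subring R.
  split; first by exists 1; rewrite peval1.
    by move=> _ _ [p ->] [q ->]; exists (p - q); rewrite pevalD pevalN.
  by move=> _ _ [p ->] [q ->]; exists (p * q); rewrite pevalM.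
have [||V [vV RV bV]] := valring_extension sR (I := [set b]).
- by move=> _ ->; exists 'X; rewrite pevalX.
- move=> [n [x [y [hx hy e]]]]; have [q hq] := choice hy.
  have : peval b ('X * (\sum_i q i) - 1) = 0.
    rewrite pevalD pevalN peval1 pevalM pevalX peval_sum e mulr_sumr; apply/eqP.
    by rewrite subr_eq0; apply/eqP; apply: eq_bigr => i _; rewrite -hq hx.
  move=> /(peval_nonconst nb)/(f_equal (fun p : {poly K} => p.[0])).
  by rewrite !hornerE => /eqP; rewrite oppr_eq0 oner_eq0.
have mb : maxi V b by exact: bV.
have sV : subring V by case: vV.
have kV : overk ka V by move=> c; apply: RV; exists c%:P; rewrite pevalC.
have [||||||s [_ ms s0 hs]] := @uniformizer L V setT R b N vV mb b0 _ _ _ _ _ _ => //.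
- move=> _ [p ->] p0; have p0' : p != 0 by apply: contraNneq p0 => ->; rewrite peval0.
  have [j [q q0 ep]] := multiplicity_XsubC p 0; rewrite p0' subr0 /= in q0 ep.
  have eq : peval b p = b ^+ j * peval b q.
    by rewrite ep pevalM pevalXn pevalX mulrC.
  have [r er] := poly_X_quotient q.
  have mq : maxi V (peval b q - ka q.[0]).
    rewrite {1}er pevalD pevalM pevalX pevalC addrK; apply: (maxiM vV) => //.
    by apply: RV; exists r.
  have nq : ~ maxi V (peval b q).
    move=> mq'; have := maxiB vV mq' mq; rewrite subKr => /(maxi_const kV)/eqP.
    by rewrite -[_ == 0]/(root _ _) (negbTE q0).
  exists j, (peval b q); split=> //; first by apply: RV; exists q.
  by apply: (nmaxi_unit _ nq); apply: RV; exists q.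
- move=> y _; have : ~ kfree b y by move=> /hN; rewrite card_ord ltnn.
  move=> /existsNP[p /not_implyP[pw /existsNP[j pj]]].
  exists (fun l => peval b (p l)); split=> //; first by move=> l; exists (p l).
  by exists j; apply/eqP => /(peval_nonconst nb).
have [v [pv hv]] := valring_place vV kV ms s0 (fun w => hs w I).
exists v; split=> //; rewrite ltNge; apply/negP => /(hv a a0) Va.
by case: mb => [e|]; [rewrite e eqxx in b0|rewrite invrK].
Qed.

Lemma place_unit_peval v a p : place v -> 0 < v a -> a != 0 -> p.[0] != 0 ->
  peval a p != 0 /\ v (peval a p) = 0.
Proof.
move=> pv va a0 p0.
have [r er] := poly_X_quotient p.
have ep : peval a p = peval a r * a + ka p.[0] by rewrite {1}er pevalD pevalM pevalX pevalC.
have c0 : ka p.[0] != 0 by rewrite fmorph_eq0.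
have h : vge v 1 (peval a r * a).
  rewrite -[1]add0r; apply: (vgeM pv); last by right; move: va; clear; lia.
  by apply: (vge_peval pv); right; exact: ltW.
have n0 : peval a p != 0.
  apply/eqP => e; move: h; have -> : peval a r * a = - ka p.[0] by apply/eqP; rewrite -addr_eq0 -ep e.
  by move/(vgeN pv); rewrite opprK => /(vgeE c0); rewrite (placeC pv).
split=> //; rewrite ep; have [e|ne] := eqVneq (peval a r * a) 0; first by rewrite e add0r (placeC pv).
rewrite ep addrC in n0; rewrite addrC (place_lt_add pv) ?(placeC pv) //.
by have := vgeE ne h; clear; lia.
Qed.

Lemma place_separate v (ws : seq (L -> int)) a y : place v -> (forall w, w \in ws -> place w /\ w != v) ->
  y != 0 -> exists s, [/\ s != 0, v s = v y & forall w, w \in ws -> w a <= w s].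
Proof.
move=> pv hws y0; have [B hB] : exists B : nat, forall w, w \in ws -> w a - w y <= B%:Z.
  elim: (ws) => [|w us [B hB]]; first by exists 0%N.
  exists (maxn B `|w a - w y|%N) => w'; rewrite inE => /orP[/eqP ->|/hB]; clear; lia.
have [s s0 [vs hs]] := place_approx pv hws B.
exists (y * s); rewrite mulf_neq0 // (placeM pv) // vs addr0; split=> // w win.
have [pw _] := hws w win; rewrite (placeM pw) //; have := hs w win; have := hB w win; clear; lia.
Qed.

(** For each zero of order [d] take [d] functions of values 0, ..., [d - 1] there that vanish to
    high order at the other zeros; comparing values shows that all of them together are free over
    [K(a)]. *)
Lemma place_zero_bound a N (S : seq (L -> int)) : nonconst a -> rank_le a N -> uniq S ->
  (forall v, v \in S -> place v /\ 0 < v a) -> (\sum_(v <- S) `|v a|%N <= N)%N.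
Proof.
move=> na hN uS hS; have a0 := nonconst_neq0 na.
pose v0 : L -> int := fun=> 0; pose Vi (i : 'I_(size S)) := nth v0 S i.
have ViS i : Vi i \in S by apply: mem_nth.
have pV i : place (Vi i) by case: (hS _ (ViS i)).
have vV i : 0 < Vi i a by case: (hS _ (ViS i)).
pose d i := `|Vi i a|%N.
pose J : finType := {i : 'I_(size S) & 'I_(d i)}.
have hw (j : J) : exists w, [/\ w != 0, Vi (tag j) w = tagged j & forall i, i != tag j -> Vi i a <= Vi i w].
  case: j => i l /=; have [pi pi0 vpi] := place_uniformizer_exists (pV i).
  have [|w [w0 e h]] := place_separate a (ws := [seq v <- S | v != Vi i]) (pV i) _ (y := pi ^+ l) (expf_neq0 _ pi0).
    by move=> w; rewrite mem_filter => /andP[ne /hS[]].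
  exists w; split=> //; first by rewrite e (placeX (pV i)) // vpi natz.
  move=> i' ne; apply: h; rewrite mem_filter ViS andbT.
  by apply: contra ne => e'; rewrite -val_eqE /= -(nth_uniq v0 (ltn_ord i') (ltn_ord i) uS).
have [w hw'] := choice hw.
have fw : kfree a w.
  apply: kfree_root0 => // p pw j1; apply: contrapT => /eqP pj1.
  pose i := tag j1.
  pose Pj (j : J) := (tag j == i) && ((p j).[0] != 0).
  have Pj1 : Pj j1 by rewrite /Pj eqxx.
  have [j0 /andP[/eqP t0 p0] jmin] := @arg_minnP _ j1 Pj (fun j : J => nat_of_ord (tagged j)) Pj1.
  have [w0 vw0 _] := hw' j0.
  have [pe0 pv0] := place_unit_peval (pV (tag j0)) (vV (tag j0)) a0 p0.
  have vt : Vi (tag j0) (peval a (p j0) * w j0) = tagged j0 by rewrite (placeM (pV _)) // pv0 vw0 add0r.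
  suff : \sum_j peval a (p j) * w j != 0 by rewrite pw eqxx.
  apply: (dominant_sum_neq0 (pV (tag j0)) (j0 := j0)); first by rewrite mulf_neq0.
  move=> j nj; rewrite vt; have [wj0 vwj hwj] := hw' j.
  have Va : vge (Vi (tag j0)) 0 a by right; apply: ltW; exact: vV.
  have ltd : (tagged j0 < `|Vi (tag j0) a|%N)%N := ltn_ord (tagged j0).
  have [e|ne] := eqVneq (tag j0) (tag j); last first.
    rewrite -[_ + 1]add0r; apply: (vgeM (pV _)); first exact: (vge_peval (pV _)).
    right; have := hwj _ ne; have := vV (tag j0); move: ltd; clear; lia.
  have vwj' : Vi (tag j0) (w j) = tagged j by rewrite -vwj; congr (Vi _ _).
  have [pz|pnz] := eqVneq (p j).[0] 0.
    have [r] := poly_X_quotient (p j); rewrite pz polyC0 addr0 => er.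
    rewrite er pevalM pevalX -mulrA -[_ + 1]add0r; apply: (vgeM (pV _)); first exact: (vge_peval (pV _)).
    right; rewrite (placeM (pV _)) // vwj'; move: ltd (vV (tag j0)); clear; lia.
  have le : (tagged j0 <= tagged j)%N by apply: jmin; apply/andP; split=> //; apply/eqP; rewrite -e.
  rewrite -[_ + 1]add0r; apply: (vgeM (pV _)); first exact: (vge_peval (pV _)).
  right; rewrite vwj'; move: le; rewrite leq_eqVlt => /orP[/eqP eq|]; last by clear; lia.
  case/eqP: nj; case: (j0) (j) e eq => [i0 l0] [i' l'] /= ei; case: _ / ei l' => l' /= el.
  by congr (existT _ _ _); apply: val_inj.
have := hN J w fw; rewrite card_tagged sumnE big_map big_enum /=.
rewrite (eq_bigr d) => [|i _]; last by rewrite card_ord.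
by rewrite (big_nth v0) big_mkord.
Qed.

(** * Zeros and poles of a function are equally many *)

Section DegreeTheorem.
Hypothesis fr : forall a, nonconst a -> exists N, rank_le a N.

Lemma no_pole_const x : (forall v, place v -> vge v 0 x) -> exists c, x = ka c.
Proof.
move=> h; apply: contrapT => /forallNP nx; have nx' : nonconst x by move=> c e; exact: (nx c).
have [N hN] := fr (nonconstV nx'); have [v [pv vx]] := place_pole nx' hN.
by have := vgeE (nonconst_neq0 nx') (h v pv); rewrite leNgt vx.
Qed.

Definition kindep r (x : 'I_r -> L) := forall c : 'I_r -> K, \sum_i ka (c i) * x i = 0 -> forall i, c i = 0.

(** Lowering one pole order by 1 costs at most one dimension, because the residue field is [K]; with
    no poles allowed only constants remain. *)
Lemma divisor_dim (S : seq (L -> int)) (m : (L -> int) -> nat) r (x : 'I_r -> L) :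
  uniq S -> (forall v, v \in S -> place v) -> (forall v, place v -> v \notin S -> m v = 0%N) ->
  (forall v, place v -> forall i, vge v (- (m v)%:Z) (x i)) -> kindep x ->
  (r <= 1 + \sum_(v <- S) m v)%N.
Proof.
move=> uS pS; have [t] := ubnP (\sum_(v <- S) m v)%N; elim: t m r x => // t IH m r x lt m0 hx ix.
have [all0|] := pselect (forall v, v \in S -> m v = 0%N).
  have {}m0 v : place v -> m v = 0%N.
    by move=> pv; case vS : (v \in S); [exact: all0|apply: m0 => //; rewrite vS].
  have hc i : exists c, x i = ka c.
    by apply: no_pole_const => v pv; have := hx v pv i; rewrite m0 // oppr0.
  have [c ec] := choice hc.
  have x0 i : x i != 0.
    apply/eqP => xi; have s0 : \sum_j ka (j == i)%:R * x j = 0.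
      rewrite (bigD1 i) //= xi mulr0 add0r big1 // => j /negbTE ->.
      by rewrite rmorph0 mul0r.
    by have /eqP := ix _ s0 i; rewrite eqxx oner_eq0.
  rewrite big1_seq ?addn0 => [|v /andP[_ /all0]] //; rewrite leqNgt; apply/negP => r1.
  case: r x r1 hx ix c ec x0 {hc} => [|[|r]] // x _ hx ix c ec x0.
  pose i0 : 'I_r.+2 := ord0; pose i1 : 'I_r.+2 := lift ord0 ord0.
  pose b i := if i == i0 then c i1 else if i == i1 then - c i0 else 0.
  have := ix b _ i0; rewrite /b eqxx => h; have := x0 i1; rewrite ec h ?rmorph0 ?eqxx //.
  rewrite (bigD1 i0) // (bigD1 i1) //= big1 => [|i /andP[/negbTE -> /negbTE ->]]; last by rewrite rmorph0 mul0r.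
  by rewrite addr0 !ec rmorphN; ring.
move=> /existsNP[v0 /not_implyP[v0S /eqP mv0]].
have pv0 := pS _ v0S; have [pi pi0 vpi] := place_uniformizer_exists pv0.
pose m' v := if v == v0 then (m v).-1 else m v.
have em : (\sum_(v <- S) m v = 1 + \sum_(v <- S) m' v)%N.
  rewrite (bigD1_seq v0) //= [X in (_ = 1 + X)%N](bigD1_seq v0) //= {1}/m' eqxx addnA add1n prednK ?lt0n //.
  by congr (_ + _)%N; apply: eq_bigr => v /negbTE ne; rewrite /m' ne.
have lt' : (\sum_(v <- S) m' v < t)%N by move: lt; rewrite em add1n ltnS.
have m'0 v : place v -> v \notin S -> m' v = 0%N.
  by move=> pv vS; rewrite /m' m0 //; case: eqP => e //; rewrite e v0S in vS.
pose y i := x i * pi ^+ m v0.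
have hy i : vge v0 0 (y i).
  rewrite -(addNr (m v0)%:Z); apply: (vgeM pv0); first exact: hx.
  by right; rewrite (placeX pv0) // vpi natz.
have [c hc] := choice (fun i => place_residue pv0 fr (hy i)).
have back z : vge v0 1 (z * pi ^+ m v0) -> vge v0 (- (m v0).-1%:Z) z.
  move=> h; have -> : z = z * pi ^+ m v0 * pi ^- m v0 by rewrite mulfK // expf_neq0.
  have -> : - (m v0).-1%:Z = 1 + - (m v0)%:Z by move: mv0; case: (m v0) => // n _; lia.
  apply: (vgeM pv0) => //; right; rewrite (placeV pv0) ?expf_neq0 // (placeX pv0) // vpi natz //.
have out v z : place v -> (v = v0 -> vge v0 1 (z * pi ^+ m v0)) -> vge v (- (m v)%:Z) z -> vge v (- (m' v)%:Z) z.
  move=> pv h1 h2; rewrite /m'; case: eqP => [e|_ //]; rewrite e; apply: back; exact: h1.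
have [c0|] := pselect (forall i, c i = 0).
  have := IH m' r x lt' m'0 _ ix; rewrite em => h; apply: leq_trans (h _) _; last by rewrite leq_add2l leq_addl.
  move=> v pv i; apply: out => // [_|]; last exact: hx.
  by have := hc i; rewrite c0 rmorph0 subr0.
move=> /existsNP[i0 /eqP ci0].
have er : r = r.-1.+1 by rewrite prednK // (leq_ltn_trans (leq0n i0) (ltn_ord i0)).
move: er; move: (r.-1) => r' er; subst r.
pose x' l := x (lift i0 l) - ka (c (lift i0 l) / c i0) * x i0.
have := IH m' r' x' lt' m'0; rewrite em => h; rewrite add1n ltnS; apply: h.
  move=> v pv l; apply: out => // [ev|]; last first.
    apply: (vgeB pv); first exact: hx.
    by rewrite -[- _]add0r; apply: (vgeM pv); [exact: (vgeC pv)|exact: hx].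
  have -> : x' l * pi ^+ m v0 = (y (lift i0 l) - ka (c (lift i0 l))) - ka (c (lift i0 l) / c i0) * (y i0 - ka (c i0)).
    have k0 : ka (c i0) != 0 by rewrite fmorph_eq0.
    by rewrite /x' /y fmorph_div; field.
  apply: (vgeB pv0); first exact: hc.
  by rewrite -[1]add0r; apply: (vgeM pv0); [exact: (vgeC pv0)|exact: hc].
move=> b hb l.
pose b' i := if unlift i0 i is Some l then b l else - \sum_l b l * (c (lift i0 l) / c i0).
have := ix b' _ (lift i0 l); rewrite /b' liftK; apply.
rewrite (bigD1_ord i0) //= unlift_none -[RHS]hb rmorphN rmorph_sum /= mulNr addrC mulr_suml -sumrB.
by apply: eq_bigr => j _; rewrite liftK /x' rmorphM; ring.
Qed.

Lemma kfree_enum (J : finType) a (w : J -> L) : kfree a w -> kfree a (w \o @enum_val J (mem J)).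
Proof.
move=> fw p pw i; have := fw (fun j => p (enum_rank j)) _ (enum_val i); rewrite enum_valK; apply.
rewrite -[RHS]pw (reindex_onto (@enum_val J (mem J)) enum_rank) => [|j _]; last exact: enum_rankK.
by apply: eq_big => [j|j _]; rewrite enum_valK ?eqxx.
Qed.

Lemma kfreeV (J : finType) a (w : J -> L) : a != 0 -> kfree a w -> kfree a^-1 w.
Proof.
move=> a0 fw p pw j; pose D := (\max_j size (p j))%N.
have sp i : (size (p i) <= D.+1)%N by apply: leqW; exact: (leq_bigmax (F := fun i => size (p i))).
pose q i := \poly_(l < D.+1) (p i)`_(D - l).
have eq i : peval a (q i) = a ^+ D * peval a^-1 (p i).
  rewrite !pevalE (horner_coef_wide a (n := D.+1)); last first.
    by rewrite size_map_poly size_poly.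
  rewrite (horner_coef_wide a^-1 (n := D.+1)) ?size_map_poly // mulr_sumr (reindex_inj rev_ord_inj) /=.
  apply: eq_bigr => l _; have lD : (l <= D)%N := ltnSE (ltn_ord l).
  rewrite subSS coef_map [in RHS]coef_map {1}/q coef_poly ltnS leq_subr (subKn lD) mulrCA; congr (_ * _).
  by rewrite exprVn -[X in _ = a ^+ X / _](subnK lD) exprD mulfK // expf_neq0.
have q0 : forall i, q i = 0.
  apply: fw; transitivity (a ^+ D * \sum_j peval a^-1 (p j) * w j); last by rewrite pw mulr0.
  by rewrite mulr_sumr; apply: eq_bigr => i _; rewrite eq mulrA.
apply/polyP => l; rewrite coef0; have [le|lt] := leqP l D.
  by have := f_equal (fun r : {poly K} => r`_(D - l)) (q0 j); rewrite coef_poly coef0 ltnS leq_subr subKn.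
by apply: nth_default; exact: leq_trans (sp j) lt.
Qed.

Lemma finite_zeros a : nonconst a -> exists S, uniq S /\ forall v, v \in S <-> place v /\ 0 < v a.
Proof.
move=> na; have [N hN] := fr na.
pose P n := exists S : seq (L -> int), [/\ uniq S, forall v, v \in S -> place v /\ 0 < v a & size S = n].
have [||n [[S [uS hS sS]] mS]] := @bounded_max P N 0; first by exists [::].
  move=> n [S [uS hS <-]]; apply: leq_trans (place_zero_bound na hN uS hS).
  rewrite -sum1_size big_seq [X in (_ <= X)%N]big_seq; apply: leq_sum => v /hS[_].
  by case: (v a) => // -[].
exists S; split=> // v; split=> [/hS //|hv]; apply: contrapT => /negP vS.
have := mS (size S).+1; rewrite sS ltnn => h; apply: notF; apply: h; exists (v :: S); split=> //=.
- by rewrite vS.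
- by move=> u; rewrite inE => /orP[/eqP ->|/hS].
- by rewrite sS.
Qed.

Lemma finite_poles x : exists S, uniq S /\ forall v, v \in S <-> place v /\ ~ vge v 0 x.
Proof.
have [[c ->]|nx] := pselect (exists c, x = ka c).
  by exists [::]; split=> // v; split=> // -[pv []]; exact: (vgeC pv).
have na : nonconst x by move=> c e; apply: nx; exists c.
have x0 := nonconst_neq0 na; have [S [uS hS]] := finite_zeros (nonconstV na).
exists S; split=> // v; rewrite hS; split=> -[pv h]; split=> //; move: h; rewrite (placeV pv) // oppr_gt0.
  by move=> lt [e|]; [rewrite e eqxx in x0|rewrite leNgt lt].
by move=> h; rewrite ltNge; apply/negP => le; apply: h; right.
Qed.

Definition polar (x : L) (v : L -> int) : nat := if v x < 0 then `|v x|%N else 0%N.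

(** The functions [a ^+ i * w j] with [i <= l] are independent over [K] and have poles bounded by
    [l] times those of [a] plus a fixed divisor, so [divisor_dim] gives the inequality
    asymptotically in [l]. *)
Lemma pole_lower_bound a N (w : 'I_N -> L) (Sp : seq (L -> int)) : nonconst a -> kfree a w ->
  uniq Sp -> (forall v, v \in Sp <-> place v /\ v a < 0) -> (N <= \sum_(v <- Sp) `|v a|%N)%N.
Proof.
move=> na fw uSp hSp; have a0 := nonconst_neq0 na.
have [T hT] := choice (fun j => finite_poles (w j)).
pose S := undup (Sp ++ flatten [seq T j | j <- enum 'I_N]).
pose C v := (\sum_j polar (w j) v)%N.
have uS : uniq S := undup_uniq _.
have pS v : v \in S -> place v.
  rewrite mem_undup mem_cat => /orP[/hSp[]//|/flatten_mapP[j _ vT]].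
  by have [_ /(_ v)[/(_ vT)[]]] := hT j.
have inT v j : place v -> polar (w j) v != 0%N -> v \in S.
  move=> pv; rewrite /polar; case: ifP => // lt _; rewrite mem_undup mem_cat; apply/orP; right.
  apply/flatten_mapP; exists j; first by rewrite mem_enum.
  apply/(proj2 (hT j) v); split=> // -[e|]; last by rewrite leNgt lt.
  by move: lt; rewrite e; case: pv => -> _ _ _ _; rewrite ltxx.
have inSp v : place v -> polar a v != 0%N -> v \in Sp.
  by move=> pv; rewrite /polar; case: ifP => // lt _; apply/hSp.
have eS : (\sum_(v <- S) polar a v = \sum_(v <- Sp) `|v a|%N)%N.
  rewrite (@big_uniq_sub _ _ _ _ Sp S) //.
  - by apply: eq_big_seq => v /hSp[_ lt]; rewrite /polar lt.
  - by move=> v vs; rewrite mem_undup mem_cat vs.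
  by move=> v vS vSp; apply/eqP; apply: contraNT vSp => /inSp; apply; exact: pS.
have bound l : (l.+1 * N <= 1 + (l * \sum_(v <- Sp) `|v a|%N + \sum_(v <- S) C v))%N.
  pose J : finType := ('I_l.+1 * 'I_N)%type; pose m v := (l * polar a v + C v)%N.
  pose x (j : J) := a ^+ j.1 * w j.2.
  suff : (#|J| <= 1 + \sum_(v <- S) m v)%N by rewrite card_prod !card_ord big_split /= -big_distrr /= eS.
  apply: (@divisor_dim S m #|J| (x \o @enum_val J (mem J)) uS pS).
  - move=> v pv vS; apply/eqP; rewrite addn_eq0 muln_eq0; apply/andP; split.
      apply/orP; right; apply: contraNT vS => /(inSp v pv) vSp; rewrite mem_undup mem_cat vSp //.
    by rewrite /C sum_nat_eq0; apply/forallP => j; apply/implyP => _; apply: contraNT vS; exact: inT.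
  - move=> v pv i; rewrite /x /=; case: (enum_val i) => j1 j2 /=.
    have [w0|w0] := eqVneq (w j2) 0; first by left; rewrite w0 mulr0.
    right; rewrite (placeM pv) ?expf_neq0 // (placeX pv) // -mulr_natl natz.
    have h1 : - (polar (w j2) v)%:Z <= v (w j2) by rewrite /polar; case: ltP; clear; lia.
    have h2 : (polar (w j2) v <= C v)%N by rewrite /C (bigD1 j2) //= leq_addr.
    have h3 : - (l * polar a v)%N%:Z <= j1%:Z * v a.
      have := ltn_ord j1; rewrite /polar; case: ltP; clear; move: (v a) (nat_of_ord j1) => z i; nia.
    by rewrite /m; move: h1 h2 h3; clear; lia.
  move=> c hc i.
  pose p j := \poly_(e < l.+1) c (enum_rank (inord e, j) : 'I_#|J|).
  have p0 : forall j, p j = 0.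
    apply: fw; rewrite -[RHS]hc (reindex_onto (@enum_rank J) enum_val) => [|j _]; last exact: enum_valK.
    rewrite [RHS](eq_bigl xpredT) => [|j]; last by rewrite enum_rankK eqxx.
    transitivity (\sum_(e < l.+1) \sum_(j < N) ka (c (enum_rank (e, j))) * (a ^+ e * w j)); last first.
      by rewrite pair_bigA; apply: eq_bigr => -[e j] _; rewrite /x /= enum_rankK.
    rewrite exchange_big /=.
      apply: eq_bigr => j _; rewrite pevalE (horner_coef_wide a (n := l.+1)) ?size_map_poly ?size_poly //.
      rewrite mulr_suml; apply: eq_bigr => e _; rewrite coef_map coef_poly ltn_ord inord_val -mulrA //.
  case e : (enum_val i) => [j1 j2]; have := f_equal (fun q : {poly K} => q`_j1) (p0 j2).
  by rewrite coef_poly coef0 ltn_ord inord_val -e enum_valK.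
(* The value 2 more than the degree of the fixed divisor is already large enough for [l]. *)
rewrite leqNgt; apply/negP => lt; have := bound (\sum_(v <- S) C v + 2)%N.
by move: lt; move: (\sum_(v <- Sp) _)%N (\sum_(v <- S) _)%N => A B; clear; nia.
Qed.

Theorem place_degree a : nonconst a -> exists N (S : seq (L -> int)),
  [/\ rank_le a N, exists w : 'I_N -> L, kfree a w, uniq S /\ (forall v, v \in S -> place v),
      forall v, place v -> v a != 0 -> v \in S
    & \sum_(v <- S) Num.max (- v a) 0 = N%:Z /\ \sum_(v <- S) v a = 0].
Proof.
move=> na; have a0 := nonconst_neq0 na; have nb := nonconstV na; have b0 := nonconst_neq0 nb.
have [B hB] := fr na.
have [||N [[w fw] mN]] := @bounded_max (fun n => exists w : 'I_n -> L, kfree a w) B 0.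
- by exists (fun=> 0) => p _ [].
- by move=> n [w /hB]; rewrite card_ord.
have rN : rank_le a N by move=> J u /kfree_enum fu; apply: mN; exists (u \o @enum_val J (mem J)).
have rN' : rank_le a^-1 N by move=> J u /(kfreeV b0); rewrite invrK; exact: rN.
have [Sz [uz hz]] := finite_zeros na; have [Sp [up hp]] := finite_zeros nb.
have hp' v : v \in Sp <-> place v /\ v a < 0.
  by rewrite hp; split=> -[pv]; rewrite (placeV pv) // oppr_gt0.
have hz' v : v \in Sz <-> place v /\ v a^-1 < 0.
  by rewrite hz; split=> -[pv]; rewrite (placeV pv) // oppr_lt0.
have eNp : (\sum_(v <- Sp) `|v a|%N = N)%N.
  apply/eqP; rewrite eqn_leq (pole_lower_bound na fw up hp') andbT.
  apply: leq_trans (place_zero_bound nb rN' up (fun v => proj1 (hp v))).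
  by rewrite big_seq [X in (_ <= X)%N]big_seq; apply: leq_sum => v /hp[pv _]; rewrite (placeV pv) // abszN.
have eNz : (\sum_(v <- Sz) `|v a|%N = N)%N.
  apply/eqP; rewrite eqn_leq (place_zero_bound na rN uz (fun v => proj1 (hz v))) /=.
  apply: leq_trans (pole_lower_bound nb (kfreeV a0 fw) uz hz') _.
  by rewrite big_seq [X in (_ <= X)%N]big_seq; apply: leq_sum => v /hz[pv _]; rewrite (placeV pv) // abszN.
have sumz : \sum_(v <- Sz) v a = N%:Z.
  rewrite -eNz -natz natr_sum; apply: eq_big_seq => v /hz[_ lt]; rewrite natz; move: lt; clear; lia.
have sump : \sum_(v <- Sp) v a = - N%:Z.
  rewrite -eNp -natz natr_sum -sumrN; apply: eq_big_seq => v /hp'[_ lt]; rewrite natz; move: lt; clear; lia.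
have uS : uniq (Sz ++ Sp).
  rewrite cat_uniq uz up /= andbT; apply/hasPn => v /hp'[_ lt]; apply/negP => /hz[_]; move: lt; clear; lia.
exists N, (Sz ++ Sp); split=> //.
- by exists w.
- by split=> // v; rewrite mem_cat => /orP[/hz[]|/hp[]].
- by move=> v pv; rewrite mem_cat neq_lt => /orP[lt|lt]; apply/orP; [right; apply/hp'|left; apply/hz].
rewrite !big_cat /= sumz sump subrr; split=> //.
rewrite big1_seq ?add0r => [|v /andP[_ /hz[_ lt]]]; last by move: lt; clear; lia.
rewrite -[RHS]opprK -sump -sumrN; apply: eq_big_seq => v /hp'[_ lt]; move: lt; clear; lia.
Qed.

End DegreeTheorem.

Definition kspan (J : finType) a (W : J -> L) x :=
  exists (p : {poly K}) (q : J -> {poly K}), p != 0 /\ peval a p * x = \sum_i peval a (q i) * W i.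

Lemma dependent_of_span (I J : finType) a (W : I -> L) (x : J -> L) :
  (forall j, kspan a W (x j)) -> kfree a x -> (#|J| <= #|I|)%N.
Proof.
move=> hs fx; rewrite leqNgt; apply/negP => lt.
have [p hp] := choice hs; have [q hq] := choice hp.
have [c [[i0 ci0] hc]] := linear_dependence (fun (i : 'I_#|J|) (l : 'I_#|I|) => q (enum_val i) (enum_val l)) lt.
have h : \sum_j peval a (c (enum_rank j) * p j) * x j = 0.
  transitivity (\sum_j \sum_i peval a (c (enum_rank j) * q j i) * W i).
    apply: eq_bigr => j _; rewrite pevalM -mulrA (proj2 (hq j)) mulr_sumr.
    by apply: eq_bigr => i _; rewrite pevalM mulrA.
  rewrite exchange_big /= big1 // => i _; rewrite -mulr_suml -peval_sum.
  have -> : \sum_j c (enum_rank j) * q j i = 0; last by rewrite peval0 mul0r.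
  rewrite -[RHS](hc (enum_rank i)) (reindex_onto (@enum_rank J) enum_val) => [|j _]; last exact: enum_valK.
  rewrite [RHS](eq_bigl xpredT) => [|j]; last by rewrite enum_rankK eqxx.
  by apply: eq_bigr => j _; rewrite !enum_rankK.
have /eqP := fx _ h (enum_val i0); rewrite enum_valK mulf_eq0 (negbTE ci0) /=.
by apply/negP; case: (hq (enum_val i0)).
Qed.

Lemma kfree_cons r a (c : 'I_r -> L) x : kfree a c ->
  ~ kfree a (fun i : 'I_r.+1 => oapp c x (unlift ord0 i)) -> kspan a c x.
Proof.
move=> fc /existsNP[p /not_implyP[pw /existsNP[j pj]]].
move: pw; rewrite big_ord_recl unlift_none /=.
rewrite (eq_bigr (fun i => peval a (p (lift ord0 i)) * c i)) => [|i _]; last by rewrite liftK.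
have [p0|p0] := eqVneq (p ord0) 0.
  rewrite p0 peval0 mul0r add0r => /(fc (fun i => p (lift ord0 i))) h; case: pj.
  by case: (unliftP ord0 j) => [l ->|->].
move=> e; exists (p ord0), (fun i => - p (lift ord0 i)); split=> //.
apply/eqP; rewrite -subr_eq0 -sumrN -[X in _ == X]e; apply/eqP; congr (_ + _).
by apply: eq_bigr => i _; rewrite pevalN mulNr opprK.
Qed.

Lemma max_free_span a N (E : set L) : rank_le a N ->
  exists r (c : 'I_r -> L), [/\ kfree a c, forall i, E (c i) & forall x, E x -> kspan a c x].
Proof.
move=> hN.
have [||r [[c [fc Ec]] mr]] := @bounded_max (fun n => exists w : 'I_n -> L, kfree a w /\ forall i, E (w i)) N 0.
- by exists (fun=> 0); split=> [p _ []|[]].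
- by move=> n [w [/hN + _]]; rewrite card_ord.
exists r, c; split=> // x Ex.
apply: kfree_cons fc _ => fw; have := mr r.+1; rewrite ltnn => h; apply: notF; apply: h.
exists (fun i => oapp c x (unlift ord0 i)); split=> // i; case: unliftP => [l|] _ /=; [exact: Ec|exact: Ex].
Qed.

Lemma kspanD (J : finType) a (W : J -> L) x y : kspan a W x -> kspan a W y -> kspan a W (x + y).
Proof.
move=> [p [q [p0 e]]] [p' [q' [p0' e']]]; exists (p * p'), (fun i => p' * q i + p * q' i).
rewrite mulf_neq0 // pevalM mulrDr; split=> //.
rewrite mulrAC e -mulrA e' mulr_suml mulr_sumr -big_split; apply: eq_bigr => i _ /=.
by rewrite pevalD !pevalM; ring.
Qed.

Lemma kspanZ (J : finType) a (W : J -> L) r x : kspan a W x -> kspan a W (peval a r * x).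
Proof.
move=> [p [q [p0 e]]]; exists p, (fun i => r * q i); split=> //.
by rewrite mulrCA e mulr_sumr; apply: eq_bigr => i _; rewrite pevalM mulrA.
Qed.

Lemma kspan0 (J : finType) a (W : J -> L) : kspan a W 0.
Proof. by exists 1, (fun=> 0); rewrite oner_neq0 mulr0 big1 // => i _; rewrite peval0 mul0r. Qed.

Lemma kspan_sum (J : finType) a (W : J -> L) (T : Type) (s : seq T) (P : pred T) (f : T -> L) :
  (forall i, P i -> kspan a W (f i)) -> kspan a W (\sum_(i <- s | P i) f i).
Proof. by move=> h; apply: big_ind => //; [exact: kspan0|exact: kspanD]. Qed.

Lemma kspan_gen (J : finType) a (W : J -> L) i : kspan a W (W i).
Proof.
exists 1, (fun l => (l == i)%:R); rewrite oner_neq0 peval1 mul1r; split=> //.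
rewrite (bigD1 i) //= eqxx peval1 mul1r big1 ?addr0 // => l /negbTE ->.
by rewrite peval0 mul0r.
Qed.

Lemma kspan_div (J : finType) a (W : J -> L) r x : r != 0 -> kspan a W (peval a r * x) -> kspan a W x.
Proof.
move=> r0 [p [q [p0 e]]]; exists (p * r), q; rewrite mulf_neq0 //; split=> //.
by rewrite pevalM -mulrA.
Qed.

(** A relation over [K(t)] among powers of [a], reordered by powers of [t], makes [t] algebraic over
    [K(a)]; finite degree then passes along the tower. *)
Lemma rank_change t N a : nonconst t -> rank_le t N -> nonconst a -> exists N', rank_le a N'.
Proof.
move=> nt hN na.
have [r [w [_ _ sw]]] := max_free_span setT hN.
have : ~ kfree t (fun i : 'I_N.+1 => a ^+ i) by move=> /hN; rewrite card_ord ltnn.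
move=> /existsNP[p /not_implyP[pw /existsNP[i0 /eqP pi0]]].
pose S := (\max_i size (p i))%N.
have sS i : (size (p i) <= S)%N := leq_bigmax (F := fun i => size (p i)) i.
pose q l := \poly_(i < N.+1) (p (inord i))`_l.
have eq : \sum_(l < S) peval a (q l) * t ^+ l = 0.
  rewrite -[RHS]pw.
  transitivity (\sum_(l < S) \sum_(i < N.+1) ka (p i)`_l * a ^+ i * t ^+ l).
    apply: eq_bigr => l _; rewrite pevalE (horner_coef_wide a (n := N.+1)) ?size_map_poly ?size_poly // mulr_suml.
    by apply: eq_bigr => i _; rewrite coef_map coef_poly ltn_ord inord_val.
  rewrite exchange_big; apply: eq_bigr => i _ /=.
  rewrite pevalE (horner_coef_wide t (n := S)) ?size_map_poly // mulr_suml.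
  by apply: eq_bigr => l _; rewrite coef_map; ring.
have ql0 : exists l, q l != 0.
  exists (size (p i0)).-1; apply/eqP => /(f_equal (fun r : {poly K} => r`_i0)).
  by rewrite coef_poly ltn_ord inord_val coef0 -lead_coefE => /eqP; rewrite lead_coef_eq0 (negbTE pi0).
have qS l : q l != 0 -> (l <= S)%N.
  move=> ql; rewrite leqNgt; apply: contraNN ql => lt; apply/eqP/polyP => i.
  rewrite coef_poly coef0; case: ifP => // _; apply: nth_default; exact: leq_trans (sS _) (ltnW lt).
have [D qD mD] := ex_maxnP ql0 qS.
have DS : (D < S)%N.
  rewrite ltn_neqAle qS // andbT; apply: contraNneq qD => ->; apply/eqP/polyP => i.
  by rewrite coef_poly coef0; case: ifP => // _; apply: nth_default; exact: sS.
have eqD : peval a (q D) * t ^+ D = - \sum_(l < D) peval a (q l) * t ^+ l.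
  apply/eqP; rewrite -addr_eq0 -[X in _ == X]eq -(subnKC DS).
  rewrite big_split_ord /= [X in _ == _ + X]big1 ?addr0 => [|l _].
    by rewrite big_ord_recr /= addrC.
  have [->|ne] := eqVneq (q (D.+1 + l)%N) 0; first by rewrite peval0 mul0r.
  by have := mD _ ne; rewrite addSn ltnNge leq_addr.
pose U (i : 'I_D) := t ^+ i.
have D0 : (0 < D)%N.
  case: (D) eqD qD => // /eqP; rewrite big_ord0 oppr0 expr0 mulr1 => /eqP /(peval_nonconst na) ->.
  by rewrite eqxx.
have st e : kspan a U (t ^+ e).
  elim: e => [|e IH]; first exact: (kspan_gen a U (Ordinal D0)).
  case: IH => p' [s [p0' es]]; apply: (kspan_div (r := p')) => //; rewrite exprSr mulrA es mulr_suml.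
  apply: kspan_sum => i _; rewrite -mulrA; apply: kspanZ; rewrite /U -exprSr.
  have := ltn_ord i; rewrite leq_eqVlt => /orP[/eqP e'|lt]; last exact: (kspan_gen a U (Ordinal lt)).
  rewrite e'; apply: (kspan_div qD); rewrite eqD -sumrN; apply: kspan_sum => l _.
  rewrite -mulNr -pevalN; apply: kspanZ; exact: (kspan_gen a U l).
have sp p' : kspan a U (peval t p').
  rewrite pevalE horner_coef; apply: kspan_sum => l _.
  have -> : (map_poly ka p')`_l = peval a (p'`_l)%:P by rewrite pevalC coef_map.
  exact: kspanZ.
pose W (j : 'I_D * 'I_r) := U j.1 * w j.2.
exists #|{: 'I_D * 'I_r}| => J x fx.
have [pj hpj] := choice (fun j => sw (x j) I); have [qj hqj] := choice hpj.
pose P := peval t (\prod_j pj j).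
have P0 : P != 0.
  apply/eqP => /(peval_nonconst nt)/eqP; apply/negP; rewrite prodf_seq_neq0.
  by apply/allP => j _ /=; case: (hqj j).
apply: (@dependent_of_span _ _ a W (fun j => P * x j)).
  move=> j; rewrite /P (bigD1 j) //= pevalM mulrAC (proj2 (hqj j)) mulr_suml.
  apply: kspan_sum => i _; rewrite mulrAC -pevalM.
  have [p' [s [p0' es]]] := sp (qj j i * \prod_(i0 | i0 != j) pj i0).
  apply: (kspan_div (r := p')) => //; rewrite mulrA es mulr_suml; apply: kspan_sum => l _.
  by rewrite -mulrA; apply: kspanZ; exact: (kspan_gen a W (l, i)).
move=> c cx; apply: fx; apply: (mulfI P0); rewrite mulr0 -[RHS]cx mulr_sumr.
by apply: eq_bigr => j _; rewrite mulrCA.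
Qed.

End Places.

(** With three or more target coordinates the hyperplane section [Z] would consist of finitely many
    points, as proper irreducible closed subsets of the curve are points, and yet be infinite. *)
Lemma curve_noether (K : closedFieldType) (Om : fieldType) (io : {rmorphism K -> Om}) m c
    (B : set 'rV[K]_m.+1) (x : 'I_m.+1 -> Om) (M : 'I_m.+1 -> 'I_c -> K) (I : finType) dg g :
  smooth_projective_curve B -> graded io x -> generic io B x -> @finlin K Om io _ x _ M I dg g ->
  algindep io (lin io M x) -> c = 2%N.
Proof.
move=> [pB [npB mB] _] gx hx fM ai; have := noether_dim pB hx fM ai npB.
case: c M fM ai => [|[|[|c]]] // M fM ai _.
pose Z := B `&` [set v | v != 0 /\ ev (linf M ord0) v = 0].
have cZ : zclosed Z.
  by apply: zclosedI; [case: pB|apply: zclosed_form; exists 1%N; exact: linf_hom].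
have [A [fA pA eA]] := zclosed_components cZ.
have ptA E : A E -> is_point E.
  move=> AE; have EZ : E `<=` Z by rewrite eA; exact: bigcup_sup.
  have [|e|//] := mB E (pA _ AE); first by move=> v /EZ[].
  have vB : van B (linf M ord0) by rewrite -e => v /EZ[_ []].
  have := proj2 (hx _) vB; rewrite mmap_linf -(mmap_var io (lin io M x)) => /ai /eqP.
  rewrite -msupp_eq0 msuppX //.
(* The points [(0, 1, s, ..., s)] all lift to [Z], and a component of [Z], being a single point,
   determines [s] as a ratio of coordinates. *)
pose w (s : K) (j : 'I_c.+3) := if j == ord0 then 0 else if j == lift ord0 ord0 then 1 else s.
have pt (s : K) : exists v : 'rV[K]_m.+1, Z v /\ lin idfun M (v ord0) =1 w s.
  have [V [_ _ _ [z [_ zz zw]]]] := finlin_place fM (w s) ai.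
  pose v : 'rV[K]_m.+1 := \row_i z i.
  have ev_v P : ev P v = meval z P by apply: mmap_ext => i; rewrite mxE.
  have lv : lin idfun M (v ord0) =1 w s by move=> j; rewrite -zw /lin; apply: eq_bigr => i _; rewrite mxE.
  have v0 : v != 0.
    apply/eqP => v0; have := lv (lift ord0 ord0); rewrite /w /= /lin v0 big1 => [/eqP|i _]; last by rewrite mxE mulr0.
    by rewrite eq_sym oner_eq0.
  exists v; split=> //; split; last by split=> //; rewrite ev_v /meval mmap_linf zw.
  rewrite (projective_locus (proj1 pB) (fun d P _ => hx P) gx); split=> // P xP.
  by rewrite ev_v; exact: zz.
have key E s s' v v' : A E -> E v -> E v' ->
    lin idfun M (v ord0) =1 w s -> lin idfun M (v' ord0) =1 w s' -> s = s'.
  move=> /ptA[u u0 ->] [a a0 ->] [b b0 ->] h h'.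
  have lz (d : K) j : lin idfun M ((d *: u) ord0) j = d * lin idfun M (u ord0) j.
    by rewrite /lin mulr_sumr; apply: eq_bigr => i _; rewrite mxE /=; ring.
  have := h (lift ord0 ord0); have := h' (lift ord0 ord0); rewrite !lz /w /= => h1' h1.
  have := h ord_max; have := h' ord_max; rewrite !lz /w /= => h2' h2.
  have ab : a = b.
    have u1 : lin idfun M (u ord0) (lift ord0 ord0) != 0.
      by apply/eqP => e; have /eqP := h1; rewrite e mulr0 eq_sym oner_eq0.
    by apply: (mulIf u1); rewrite h1 h1'.
  by rewrite -h2 -h2' ab.
have [es hes] : exists es : seq (set 'rV[K]_m.+1), forall E, A E -> E \in es.
  have /finite_setP[N] := fA; rewrite card_eq_sym => /card_set_bijP[f [_ _ sf]].
  by exists (map f (iota 0 N)) => E /sf[i iN <-]; apply: map_f; rewrite mem_iota add0n.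
pose bad (E : set 'rV[K]_m.+1) s := exists v, E v /\ lin idfun M (v ord0) =1 w s.
have [sE hsE] : exists sE : set 'rV[K]_m.+1 -> K, forall E s, A E -> bad E s -> s = sE E.
  have h E : exists s0, forall s, A E -> bad E s -> s = s0.
    have [[s0 [v [Ev hv]]]|n] := pselect (exists s, bad E s).
      by exists s0 => s AE [v' [Ev' hv']]; exact: key AE Ev' Ev hv' hv.
    by exists 0 => s AE bs; case: n; exists s.
  by have [sE hsE] := choice h; exists sE => E s; exact: hsE.
have [s hs] : exists s : K, (\prod_(z <- map sE es) ('X - z%:P)).[s] != 0.
  by apply: closed_nonroot; rewrite monic_neq0 // monic_prod_XsubC.
have [v [Zv hv]] := pt s; move: Zv; rewrite eA => -[E AE Ev].
case/negP: hs; rewrite -[_ == 0]/(root _ _) root_prod_XsubC (hsE E s AE); last by exists v.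
by apply: map_f; exact: hes.
Qed.
(** [t] is the ratio of the two coordinates of a Noether normalization, and the generators divided
    by powers of [T ord0] span [F] over [K(t)]. Relations are carried from an auxiliary generic
    point to [xi], which is only tested on forms. *)
Lemma function_field_rank (K : closedFieldType) m (B : set 'rV[K]_m.+1) (F : fieldType)
    (iota : {rmorphism K -> F}) : smooth_projective_curve B -> is_function_field B iota ->
  exists t N, nonconst iota t /\ rank_le iota t N.
Proof.
move=> hB [xi [hxi frac]]; have pB : projective B by case: hB.
have [Om [io [x [gx x0 hx]]]] := projective_generic pB.
have [c [M [I [dg [g [fM ai]]]]]] := noether gx.
have c2 := curve_noether hB gx hx fM ai; subst c.
pose z := xi ord0; pose T := lin iota M z.
have transfer d P : hom d P -> mmap io x P = 0 -> mmap iota z P = 0.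
  by move=> hP /hx vP; apply/hxi; [exists d|exact/van_eq_on].
have injT d a : hom d a -> a != 0 -> mmap iota T a != 0.
  move=> ha a0; rewrite -mmap_lincomp; apply: contraNneq a0 => /hxi e.
  have := e (ex_intro _ d (lincomp_hom M ha)) => /van_eq_on/hx; rewrite mmap_lincomp => /ai ->.
  by [].
have X0 j : (mpX K j : mp 2 K) != 0.
  by apply/eqP => /(f_equal (meval (fun=> 1)))/eqP; rewrite mevalXU meval0 oner_eq0.
have T0 : T ord0 != 0 by have := injT 1%N _ (hX1 K ord0) (X0 _); rewrite mmap_var.
pose i1 : 'I_2 := lift ord0 ord0; pose t := T i1 / T ord0.
have ord2 (j : 'I_2) : j = if j == ord0 then ord0 else i1.
  by case: eqP => // /eqP ne; apply: val_inj; case: j ne => -[|[|]].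
have nt : nonconst iota t.
  move=> s e; have h : hom 1%N ((mpX K i1 : mp 2 K) - s *: mpX K ord0) by rewrite rpredB ?rpredZ ?hX1.
  have ne0 : (mpX K i1 : mp 2 K) - s *: mpX K ord0 != 0.
    apply/eqP => /(f_equal (meval (fun j : 'I_2 => (j != ord0)%:R)))/eqP.
    by rewrite mevalB mevalZ !mevalXU meval0 /= mulr0 subr0 oner_eq0.
  have := injT _ _ h ne0; rewrite rmorphB -mul_mpolyC !rmorphM /= mmapC !mmap_var.
  have eTT : T i1 = iota s * T ord0 by rewrite -(divfK T0 (T i1)) -/t e.
  by rewrite eTT subrr eqxx.
pose deh (a : mp 2 K) : {poly K} := mmap polyC (fun j : 'I_2 => if j == ord0 then 1 else 'X) a.
have eT : T =1 (fun j => T ord0 * (if j == ord0 then 1 else t)).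
  by move=> j; rewrite (ord2 j); case: (j == ord0) => /=; rewrite ?mulr1 // /t mulrCA mulfV ?mulr1.
have deh_ev a : peval iota t (deh a) = mmap iota (fun j => if j == ord0 then 1 else t) a.
  pose f1 : {rmorphism mp 2 K -> F} := horner_eval t \o map_poly iota \o
    mmap polyC (fun j : 'I_2 => if j == ord0 then 1 else 'X).
  pose f2 : {rmorphism mp 2 K -> F} := mmap iota (fun j : 'I_2 => if j == ord0 then 1 else t).
  have := @mp_rmorph_ext 2 K F f1 f2; rewrite /f1 /f2 /= => h; apply: h => [s|j].
    by rewrite !mmapC /= map_polyC /= /horner_eval hornerC.
  rewrite !mmap_var; case: (j == ord0); first by rewrite rmorph1 /horner_eval hornerC.
  by rewrite map_polyX /horner_eval hornerX.
have degT d a : hom d a -> mmap iota T a = T ord0 ^+ d * peval iota t (deh a).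
  by move=> ha; rewrite deh_ev -(dhomog_scale _ _ _ ha); exact: mmap_ext.
exists t, #|I|; split=> // J w fw.
apply: (@dependent_of_span _ _ _ _ _ t (fun i => mmap iota z (g i) / T ord0 ^+ dg i) w _ fw) => j.
have [d [P [Q [hP hQ Q0 ->]]]] := frac (w j).
have Qx : mmap io x Q != 0 by apply: contraNneq Q0 => /(transfer _ _ hQ) ->.
have [b0 [W0 [b00 eW0]]] := finlin_norm fM ai Qx.
have W00 : mmap io x W0 != 0.
  apply: contraNneq b00 => e; apply/eqP/ai; by rewrite eW0 e mulr0.
have [e We] : exists e, mmap io x (hc e W0) != 0.
  apply: contrapT => /forallNP h; case/negP: W00; rewrite (hom_decomp W0) rmorph_sum big1 // => i _.
  by apply: contrapT => /eqP; exact: h.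
pose b := hc (d + e) b0; pose W := hc e W0.
have hW : hom e W := hc_hom _ _; have hb : hom (d + e) b := hc_hom _ _.
have ebx : mmap io x (lincomp M b - Q * W) = 0.
  rewrite /b /W -(hcM _ _ hQ) -hc_lincomp -raddfB /=; apply: gx.
  by rewrite rmorphB rmorphM /= mmap_lincomp eW0 subrr.
have hbW : hom (d + e) (lincomp M b - Q * W) by rewrite rpredB ?dhomogM // lincomp_hom.
have ebz := transfer _ _ hbW ebx.
have bz : mmap iota T b = mmap iota z Q * mmap iota z W.
  by apply/eqP; rewrite -subr_eq0 -mmap_lincomp -rmorphM -rmorphB; apply/eqP.
have b0' : b != 0.
  apply/eqP => b0'; move: ebx; rewrite b0' /lincomp rmorph0 sub0r rmorphN rmorphM /= => /eqP.
  by rewrite oppr_eq0 mulf_eq0 (negbTE Qx) (negbTE We).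
have bz0 := injT _ _ hb b0'.
have Wz0 : mmap iota z W != 0 by apply: contraNneq bz0 => e0; rewrite bz e0 mulr0.
have hPW : hom (d + e) (P * W) by apply: dhomogM.
have [a [ha ea]] := finlin_span fM hPW.
have eaz : mmap iota z P * mmap iota z W = \sum_i mmap iota T (a i) * mmap iota z (g i).
  have hs : hom (d + e) (P * W - \sum_i lincomp M (a i) * g i).
    rewrite rpredB // rpred_sum // => i _; have := ha i; rewrite /homm; case: leqP => [le hai|_ ->].
      by rewrite -(subnK le); apply: dhomogM; [exact: lincomp_hom|exact: (finlin_hom fM)].
    by rewrite /lincomp rmorph0 mul0r rpred0.
  have : mmap io x (P * W - \sum_i lincomp M (a i) * g i) = 0.
    rewrite rmorphB rmorph_sum /= ea; apply/eqP; rewrite subr_eq0; apply/eqP; apply: eq_bigr => i _.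
    by rewrite rmorphM /= mmap_lincomp.
  move=> /(transfer _ _ hs); rewrite rmorphB rmorph_sum rmorphM /= => /eqP; rewrite subr_eq0 => /eqP ->.
  by apply: eq_bigr => i _; rewrite rmorphM /= mmap_lincomp.
exists (deh b), (fun i => deh (a i)); split.
  by apply: contraNneq bz0 => e0; rewrite (degT _ _ hb) e0 peval0 mulr0.
have T0e : T ord0 ^+ (d + e) != 0 by rewrite expf_neq0.
apply: (mulfI T0e); rewrite mulrA -(degT _ _ hb) bz.
have -> : mmap iota z Q * mmap iota z W * (mmap iota z P / mmap iota z Q) =
  mmap iota z P * mmap iota z W by field.
rewrite eaz mulr_sumr; apply: eq_bigr => i _; have := ha i; rewrite /homm; case: leqP => [le hai|_ ->].
  rewrite (degT _ _ hai) -[in RHS](subnK le) exprD.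
  have T0d : T ord0 ^+ dg i != 0 by rewrite expf_neq0.
  by field.
by rewrite /deh !rmorph0 peval0 mul0r mul0r mulr0.
Qed.

Notation dimL L := (\dim (fullv : {vspace L})).

(** * Finite extensions of the function field *)

Section Extensions.
Variables (K : closedFieldType) (F : fieldType) (iota : {rmorphism K -> F}).

Definition kL (L : fieldExtType F) : {rmorphism K -> L} := in_alg L \o iota.

Lemma ext_rank (L : fieldExtType F) t N : nonconst iota t -> rank_le iota t N ->
  forall a, nonconst (kL L) a -> exists N', rank_le (kL L) a N'.
Proof.
move=> nt hN; have [r [c [_ _ sc]]] := max_free_span setT hN.
have pt p : peval (kL L) t%:A p = (peval iota t p)%:A.
  transitivity (in_alg L (peval iota t p)) => //.
  by rewrite /peval -horner_map -map_poly_comp.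
have nt' : nonconst (kL L) t%:A by move=> s /(fmorph_inj (in_alg L)); exact: nt.
pose b := vbasis (fullv : {vspace L}).
pose W (l : 'I_(dimL L) * 'I_r) := b`_l.1 * (c l.2)%:A.
move=> a; apply: (rank_change (N := #|{: 'I_(dimL L) * 'I_r}|) nt') => J x fx.
apply: (dependent_of_span (W := W) _ fx) => j; rewrite (coord_vbasis (memvf (x j))).
apply: kspan_sum => i _; have [p [q [p0 e]]] := sc (coord b i (x j)) I.
apply: (kspan_div p0); rewrite pt mulr_algl scalerA e scaler_suml; apply: kspan_sum => l _.
have -> : (peval iota t (q l) * c l) *: b`_i = peval (kL L) t%:A (q l) * W (i, l).
  by rewrite pt /W /= mulr_algl mulr_algr scalerA.
by apply: kspanZ; exact: kspan_gen.
Qed.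

Variables (k : closedFieldType) (j : {rmorphism F -> k}).

Definition jk : {rmorphism K -> k} := j \o iota.

(** For nonconstant [b], [alg_degree] and [alg_rank] are the degrees of [F(b)] over [F] and over
    [K(b)], phrased inside [k] so that no finite extension has to be named. *)
Definition alg_degree b d := (exists p : {poly F}, size p = d.+1 /\ (map_poly j p).[b] = 0) /\
  forall p : {poly F}, p != 0 -> (map_poly j p).[b] = 0 -> (d < size p)%N.

Definition alg_rank b r :=
  (exists q : 'I_r -> {poly F}, kfree jk b (fun i => (map_poly j (q i)).[b])) /\
  forall r' (q : 'I_r' -> {poly F}), kfree jk b (fun i => (map_poly j (q i)).[b]) -> (r' <= r)%N.

Section Embedded.
Variables (L : fieldExtType F) (e : {rmorphism L -> k}).
Hypothesis eF : forall a : F, e a%:A = j a.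

Lemma e_horner (q : {poly F}) a : e (map_poly (in_alg L) q).[a] = (map_poly j q).[e a].
Proof.
rewrite -horner_map -map_poly_comp; congr (_.[_]); apply: eq_map_poly => c.
exact: eF.
Qed.

Lemma e_peval a p : e (peval (kL L) a p) = peval jk (e a) p.
Proof.
rewrite /peval -horner_map -map_poly_comp; congr (_.[_]); apply: eq_map_poly => c.
exact: eF.
Qed.

Lemma kfree_e (J : finType) a (w : J -> L) : kfree (kL L) a w <-> kfree jk (e a) (e \o w).
Proof.
have h (p : J -> {poly K}) : e (\sum_i peval (kL L) a (p i) * w i) = \sum_i peval jk (e a) (p i) * (e \o w) i.
  by rewrite rmorph_sum; apply: eq_bigr => i _; rewrite rmorphM e_peval.
split=> fw p pw; apply: fw.
  by apply: (fmorph_inj e); rewrite h rmorph0.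
by rewrite -h pw rmorph0.
Qed.

Lemma nonconst_e a : nonconst (kL L) a <-> nonconst jk (e a).
Proof.
split=> h c ec; apply: (h c); last by rewrite ec /= eF.
by apply: (fmorph_inj e); rewrite ec /= eF.
Qed.

Lemma alg_degree_exists a : exists d, alg_degree (e a) d /\ adjoin_degree 1%AS a = d.
Proof.
have /polyOver1P[q eq] := minPolyOver 1%AS a.
have sq : size q = (adjoin_degree 1%AS a).+1.
  by rewrite -(size_minPoly 1%AS a) eq size_map_poly.
exists (adjoin_degree 1%AS a); split=> //; split.
  by exists q; rewrite -e_horner -eq minPolyxx rmorph0.
move=> p p0; rewrite -e_horner => /eqP; rewrite fmorph_eq0 => rp.
have : minPoly 1%AS a %| map_poly (in_alg L) p.
  by apply: minPoly_dvdp => //; apply/polyOver1P; exists p.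
by move=> /dvdp_leq; rewrite map_poly_eq0 size_map_poly size_minPoly; apply.
Qed.

(** With [E = F(a)], [[L : K(a)] = [L : E] r] and [[L : F] = [L : E] d]. So the number of poles of
    [a] divided by [[L : F]] is [r / d], independent of [L]. *)
Lemma height_ratio a N d r : nonconst (kL L) a -> rank_le (kL L) a N ->
  (exists w : 'I_N -> L, kfree (kL L) a w) -> alg_degree (e a) d -> alg_rank (e a) r ->
  (N * d = dimL L * r)%N.
Proof.
move=> na hN [w0 fw0] [[p0 [sp0 rp0]] md] [[q fq] mr].
have [d' [[[p1 [sp1 rp1]] md'] ed]] := alg_degree_exists a.
have p00 : p0 != 0 by rewrite -size_poly_eq0 sp0.
have p10 : p1 != 0 by rewrite -size_poly_eq0 sp1.
have dd : d' = d.
  by apply/eqP; rewrite eqn_leq; have := md' _ p00 rp0; have := md _ p10 rp1; rewrite sp0 sp1 !ltnS => -> ->.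
pose E : {subfield L} := <<1%AS; a>>%AS.
have dE : \dim E = d by rewrite dim_Fadjoin ed dd dimv1 muln1.
have [X [_ nX] [sX dX]] := field_module_semisimple (subvf (E * fullv)).
set m := \dim_E {:L} in X nX sX dX.
have em : (m * d = dimL L)%N.
  by rewrite -dE -dim_field_module // subvf.
have KE p : peval (kL L) a p \in E.
  rewrite pevalE; apply/Fadjoin_polyP; exists (map_poly (kL L) p) => //.
  by apply/polyOver1P; exists (map_poly iota p); rewrite map_poly_comp.
pose c (i : 'I_r) := (map_poly (in_alg L) (q i)).[a].
have cE i : c i \in E by apply/Fadjoin_polyP; exists (map_poly (in_alg L) (q i)) => //; apply/polyOver1P; exists (q i).
have fc : kfree (kL L) a c by apply/kfree_e => p pw; apply: fq; rewrite -[RHS]pw; apply: eq_bigr => i _; rewrite /= e_horner.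
pose W (l : 'I_m * 'I_r) := c l.2 * X`_l.1.
have X0 (i : 'I_m) : X`_i != 0.
  by apply: contraNneq nX => <-; apply: mem_nth; rewrite size_tuple.
have fW : kfree (kL L) a W.
  move=> p pw l; have yE (u : 'I_m) : \sum_(i < r) peval (kL L) a (p (u, i)) * c i \in E.
    by apply: rpred_sum => i _; apply: rpredM.
  have ys : \sum_(u < m) (\sum_(i < r) peval (kL L) a (p (u, i)) * c i) * X`_u = 0.
    transitivity (\sum_(u < m) \sum_(i < r) peval (kL L) a (p (u, i)) * W (u, i)); last first.
      by rewrite pair_bigA -[RHS]pw; apply: eq_bigr => -[u i] _.
    by apply: eq_bigr => u _; rewrite mulr_suml; apply: eq_bigr => i _; rewrite mulrA.
  have /directv_sum_independent dX' := dX.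
  have yz u : \sum_(i < r) peval (kL L) a (p (u, i)) * c i = 0.
    have := dX' (fun u => (\sum_(i < r) peval (kL L) a (p (u, i)) * c i) * X`_u) _ ys u isT.
    move=> h; apply/eqP; have /eqP := h (fun u _ => memv_mul (yE u) (memv_line _)).
    by rewrite mulf_eq0 (negbTE (X0 u)) orbF.
  by case: l => u i; exact: (fc (fun i => p (u, i)) (yz u)).
have sW x : kspan (kL L) a W x.
  have : x \in (\sum_(i < m) E * <[X`_i]>)%VS by rewrite sX memvf.
  move=> /memv_sumP[y hy ->]; apply: kspan_sum => u _.
  have /memv_cosetP[z zE ->] := hy u isT.
  have /Fadjoin_polyP[Z /polyOver1P[z' ez] ezz] := zE.
  have : kspan (kL L) a c z.
    apply: kfree_cons fc _ => /kfree_e fw.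
    have := mr r.+1 (fun i => oapp q z' (unlift ord0 i)); rewrite ltnn => h; apply: notF; apply: h.
    move=> p pw; apply: fw; rewrite -[RHS]pw; apply: eq_bigr => i _; congr (_ * _) => /=.
    by case: unliftP => [l|] _ /=; rewrite -e_horner // -ez -ezz.
  case=> p [s [pz es]]; apply: (kspan_div pz); rewrite mulrA es mulr_suml; apply: kspan_sum => i _.
  by rewrite -mulrA; apply: kspanZ; exact: (kspan_gen (kL L) a W (u, i)).
have eN : N = (m * r)%N.
  apply/eqP; rewrite eqn_leq; apply/andP; split.
    have := dependent_of_span (fun i => sW (w0 i)) fw0.
    by rewrite card_ord card_prod !card_ord.
  by have := hN _ W fW; rewrite card_prod !card_ord.
by rewrite eN -em mulnAC.
Qed.

Lemma alg_rank_exists t N a : nonconst iota t -> rank_le iota t N -> nonconst (kL L) a ->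
  exists r, alg_rank (e a) r.
Proof.
move=> nt hN na; have [N' hN'] := ext_rank nt hN na.
have [||r [hr mr]] := @bounded_max (fun r => exists q : 'I_r -> {poly F},
    kfree jk (e a) (fun i => (map_poly j (q i)).[e a])) N' 0.
- by exists (fun=> 0) => p _ [].
- move=> r [q fq]; have := hN' _ (fun i => (map_poly (in_alg L) (q i)).[a]); rewrite card_ord; apply.
  by apply/kfree_e => p pw; apply: fq; rewrite -[RHS]pw; apply: eq_bigr => i _; rewrite /= e_horner.
by exists r; split=> // r' q fq; apply: mr; exists q.
Qed.

End Embedded.
End Extensions.

(** * Heights *)

Section Orbits.
Variables (k : closedFieldType) (T : admissible_triple k).
Notation X := (at_X T).
Notation f := (at_f T).
Notation y := (rm_orbit (at_X T) (at_f T) (at_x T)).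

Lemma orbit_evaluates r : evaluates X X f (y r) (y r.+1).
Proof.
have [z hz] := at_orbit_defined _ T r.
by rewrite /rm_orbit iterS -/(rm_orbit _ _ _ r) /rm_app; case: xgetP => [w _ //|/(_ z)].
Qed.

Lemma orbit_mem r : X (y r).
Proof. by case: r => [|r]; [exact: at_point|case: (orbit_evaluates r)]. Qed.

Hypothesis pX : projective X.
Variables (Om : fieldType) (io : {rmorphism k -> Om}) (xi : 'I_(at_dim T).+1 -> Om).
Hypothesis hxi : generic io X xi.

Lemma iterate_hgeneric m : hgeneric io X (tval io (tm_iter f m) xi).
Proof.
have X0 v : X v -> v != 0 by apply: zclosed_neq0; case: pX.
elim: m => [|m IH].
  by apply: (hgeneric_peq (peq_sym (peq_id io xi))) => d P _; exact: hxi.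
apply: (hgeneric_peq _ (generic_image IH X0 X0 (at_dominant _ T))).
by apply: peq_sym; exact: peq_comp.
Qed.

Lemma orbit_representative m n : exists Q : tuplemap k (at_dim T) (at_dim T),
  [/\ tm_hom Q, peq (tval io Q xi) (tval io (tm_iter f m) xi) & tm_val Q (y n) = y (n + m)].
Proof.
elim: m => [|m [Q [hQ pQ eQ]]].
  exists (@tm_id k (at_dim T)); split; [exact: tm_id_hom|exact: peq_refl|].
  by apply/rowP => i; rewrite mxE /ev mevalXU addn0.
have [_ _ [G [hG eG G0 eG']]] := orbit_evaluates (n + m).
exists (tm_comp G Q); split; first exact: tm_comp_hom.
  apply: peq_trans (peq_comp io G Q xi) _.
  apply: peq_trans (peq_tval io hG pQ) _.
  apply: peq_trans (peq_sym (peq_comp io f _ xi)).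
  apply: peq_sym; apply: (hgeneric_peq_eqv (iterate_hgeneric m) _ hG eG).
  by case: (at_dominant _ T) => [[]].
rewrite addnS eG' -eQ; apply/rowP => i; rewrite !mxE /ev /meval mmap_tcomp.
by apply: mmap_ext => l; rewrite mxE.
Qed.

Lemma representatives_proportional (Q Q' : tuplemap k (at_dim T) (at_dim T)) m v : X v ->
  peq (tval io Q xi) (tval io (tm_iter f m) xi) -> peq (tval io Q' xi) (tval io (tm_iter f m) xi) ->
  tm_val Q v != 0 -> tm_val Q' v != 0 -> exists2 c, c != 0 & tm_val Q v = c *: tm_val Q' v.
Proof.
move=> Xv h h' /rV0Pn[i Qi] /rV0Pn[i' Q'i].
have pr := generic_prop_eq_on hxi (peq_prop (peq_trans h (peq_sym h'))).
have pv a b : ev (Q a) v * ev (Q' b) v = ev (Q b) v * ev (Q' a) v.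
  by have := pr a b v Xv; rewrite /ev rmorphB !rmorphM /= => /eqP; rewrite subr_eq0 => /eqP.
move: Qi Q'i; rewrite !mxE => Qi Q'i.
have e a : ev (Q a) v = ev (Q i') v / ev (Q' i') v * ev (Q' a) v.
  by apply: (mulIf Q'i); rewrite pv; field.
exists (ev (Q i') v / ev (Q' i') v); last by apply/rowP => a; rewrite !mxE e.
by apply: contraNneq Qi => c0; rewrite e c0 mul0r.
Qed.

End Orbits.

Lemma zclosed_stable (k : closedFieldType) n (P : nat -> hpoly k n) : (forall i, ishom (P i)) ->
  exists N, forall v, v != 0 -> (exists i, ev (P i) v != 0) -> exists2 r, (r <= N)%N & ev (P r) v != 0.
Proof.
move=> hP; pose Z i := [set v : 'rV[k]_n.+1 | v != 0 /\ forall p, (exists2 r, (r <= i)%N & p = P r) -> ev p v = 0].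
have cZ i : zclosed (Z i) by exists [set p | exists2 r, (r <= i)%N & p = P r]; split=> // p [r _ ->].
have mZ i j : (i <= j)%N -> Z j `<=` Z i.
  by move=> ij v [v0 h]; split=> // p [r ri ->]; apply: h; exists r => //; exact: leq_trans ij.
have [N hN] : exists N, forall j, (N <= j)%N -> Z N `<=` Z j.
  apply: contrapT => /forallNP h.
  have h' i : exists j, (i <= j)%N /\ ~ Z i `<=` Z j.
    by have /existsNP[j /not_implyP[ij nZ]] := h i; exists j.
  have [g hg] := choice h'.
  have [i hi] := @zclosed_chain k n (fun i => Z (iter i g 0%N)) (fun i => cZ _) (fun i => mZ _ _ (proj1 (hg _))).
  by case: (hg (iter i g 0%N)).
exists N => v v0 [i Pi]; apply: contrapT => h.
have ZN : Z N v.
  split=> // p [r rN ->]; apply/eqP; apply: contrapT => /negP nz; by apply: h; exists r.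
have [_ e] := mZ _ _ (leq_maxl i N) _ (hN _ (leq_maxr i N) _ ZN).
by move: Pi; rewrite (e (P i)) ?eqxx //; exists i.
Qed.

Section Heights.
Variables (R : realType) (K : closedFieldType) (F : fieldType) (iota : {rmorphism K -> F})
  (k : closedFieldType) (j : {rmorphism F -> k}).
Hypothesis hk : forall z : k, algebraicOver j z.
Variables (t : F) (Nt : nat).
Hypotheses (nt : nonconst iota t) (hNt : rank_le iota t Nt).

Lemma adjoin_embedded (L : fieldExtType F) (e : {rmorphism L -> k}) (b : k) : (forall a : F, e a%:A = j a) ->
  exists (L' : fieldExtType F) (e' : {rmorphism L' -> k}),
    [/\ forall a : F, e' a%:A = j a, forall y, exists y', e' y' = e y & exists y', e' y' = b].
Proof.
move=> eF; have [q q0 rq] := hk b.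
have ex : exists n, `[< exists p : {poly L}, [/\ p != 0, root (map_poly e p) b & size p = n] >].
  exists (size (map_poly (in_alg L) q)); apply/asboolP; exists (map_poly (in_alg L) q); split=> //.
    by rewrite map_poly_eq0.
  by rewrite -map_poly_comp (eq_map_poly eF).
have [n /asboolP[p [p0 rp sp]] mn] := ex_minnP ex.
have irr : irreducible_poly p.
  apply/(subfx_irreducibleP rp p0) => q' rq' q'0; rewrite sp; apply: mn; apply/asboolP; by exists q'.
pose L1 := SubFieldExtType rp irr.
pose e1 : {rmorphism L1 -> k} := @subfx_inj L k e b p.
exists (baseFieldType L1), e1.
have e1A (y : L) : e1 (y%:A : L1) = e y by exact: subfx_inj_base.
split.
- by move=> a; rewrite baseField_scaleE; exact: (etrans (e1A _) (eF a)).
- by move=> y; exists (y%:A : L1).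
by exists (subfx_root e b p : L1); exact: subfx_inj_root.
Qed.

Lemma common_extension (s : seq k) : exists (L : fieldExtType F) (e : {rmorphism L -> k}),
  (forall a : F, e a%:A = j a) /\ forall x, x \in s -> exists y, e y = x.
Proof.
elim: s => [|b s [L [e [eF h]]]].
  by exists (F^o : fieldExtType F), j; split=> // a; rewrite /GRing.scale /= mulr1.
have [L' [e' [eF' h1 h2]]] := adjoin_embedded b eF.
exists L', e'; split=> // x; rewrite inE => /orP[/eqP -> //|/h[y <-]]; exact: h1.
Qed.

Lemma alg_degree_unique b d d' : alg_degree j b d -> alg_degree j b d' -> d = d'.
Proof.
move=> [[p [sp rp]] m] [[p' [sp' rp']] m']; apply/eqP; rewrite eqn_leq.
have p0 : p != 0 by rewrite -size_poly_eq0 sp.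
have p0' : p' != 0 by rewrite -size_poly_eq0 sp'.
by have := m' _ p0 rp; have := m _ p0' rp'; rewrite sp sp' !ltnS => -> ->.
Qed.

Lemma alg_rank_unique b r r' : alg_rank iota j b r -> alg_rank iota j b r' -> r = r'.
Proof. by move=> [[q fq] m] [[q' fq'] m']; apply/eqP; rewrite eqn_leq; rewrite (m' _ _ fq) (m _ _ fq'). Qed.

(** The affine height of [b]: its number of poles over the degree of the field of definition,
    written intrinsically; constants get the default 0. *)
Definition hh (b : k) : R := xget 0 [set h : R | exists d r,
  [/\ nonconst (jk iota j) b, alg_degree j b d, alg_rank iota j b r & h = r%:R / d%:R]].

Lemma hh0 : hh 0 = 0.
Proof. by rewrite /hh xgetPN // => h [d [r [nb _ _ _]]]; apply: (nb 0); rewrite rmorph0. Qed.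

Lemma hh_ge0 b : 0 <= hh b.
Proof. by rewrite /hh; case: xgetP => // h _ [d [r [_ _ _ ->]]]; rewrite divr_ge0 ?ler0n. Qed.

(** A substitute for the Weil height that involves no choice of extension. Ratios with zero
    denominator count 0, since division by 0 gives 0. *)
Definition H n (x : 'rV[k]_n.+1) : R := \sum_i \sum_l hh (x ord0 i / x ord0 l).

Lemma H_scale n (x : 'rV[k]_n.+1) c : c != 0 -> H (c *: x) = H x.
Proof.
move=> c0; apply: eq_bigr => i _; apply: eq_bigr => l _; congr (hh _); rewrite !mxE.
by rewrite invfM mulrACA divff // mul1r.
Qed.

Lemma H_ge0 n (x : 'rV[k]_n.+1) : 0 <= H x.
Proof. by do 2 apply: sumr_ge0 => ? _; exact: hh_ge0. Qed.

Lemma H_le_const n (x : 'rV[k]_n.+1) W : (forall i l, hh (x ord0 i / x ord0 l) <= W) ->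
  H x <= (n.+1 ^ 2)%:R * W.
Proof.
move=> le; apply: (@le_trans _ _ (\sum_(i < n.+1) \sum_(l < n.+1) W)).
  by apply: ler_sum => i _; apply: ler_sum => l _; exact: le.
by rewrite !sumr_const card_ord -mulrnA mulnn mulr_natl.
Qed.

Lemma column_le_H n (x : 'rV[k]_n.+1) l : \sum_i hh (x ord0 i / x ord0 l) <= H x.
Proof.
rewrite /H exchange_big [X in _ <= X](bigD1 l) //= lerDl.
by do 2 apply: sumr_ge0 => ? _; exact: hh_ge0.
Qed.

Section InExtension.
Variables (L : fieldExtType F) (e : {rmorphism L -> k}).
Hypothesis eF : forall a : F, e a%:A = j a.
Notation kap := (kL iota L).
Notation place := (place kap).
Notation pole v a := (Num.max (- v a) 0).

Definition covers (S : seq (L -> int)) (s : seq L) := [/\ uniq S, forall v, v \in S -> place v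
  & forall a v, a \in s -> place v -> v a != 0 -> v \in S].

Lemma place_degree_ext a : nonconst kap a -> exists N (S : seq (L -> int)),
  [/\ rank_le kap a N, exists w : 'I_N -> L, kfree kap a w, uniq S /\ (forall v, v \in S -> place v),
      forall v, place v -> v a != 0 -> v \in S
    & \sum_(v <- S) Num.max (- v a) 0 = N%:Z /\ \sum_(v <- S) v a = 0].
Proof. by apply: place_degree; exact: ext_rank nt hNt. Qed.

Lemma covers_exists (s : seq L) : exists S, covers S s.
Proof.
elim: s => [|a s [S [uS pS hS]]]; first by exists [::].
have [[c ec]|na] := pselect (exists c, a = kap c).
  exists S; split=> // b v; rewrite inE => /orP[/eqP ->|]; last exact: hS.
  by move=> pv; rewrite ec (placeC pv) eqxx.
have [|N [S' [_ _ [uS' pS'] hS' _]]] := @place_degree_ext a; first by move=> c ec; apply: na; exists c.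
exists (undup (S ++ S')); split; first exact: undup_uniq.
  by move=> v; rewrite mem_undup mem_cat => /orP[/pS|/pS'].
move=> b v; rewrite inE mem_undup mem_cat => /orP[/eqP ->|bs] pv vb; first by rewrite hS' ?orbT.
by rewrite (hS b).
Qed.

Lemma covers_sub S s s' : {subset s' <= s} -> covers S s -> covers S s'.
Proof. by move=> ss [uS pS hS]; split=> // a v /ss; exact: hS. Qed.

Lemma sum_covers (S S' : seq (L -> int)) a (f : int -> int) : f 0 = 0 -> covers S [:: a] -> covers S' [:: a] ->
  \sum_(v <- S) f (v a) = \sum_(v <- S') f (v a).
Proof.
move=> f0 [uS pS hS] [uS' pS' hS'].
have h (U : seq (L -> int)) : uniq U -> (forall v, v \in U -> place v) -> (forall v, place v -> v a != 0 -> v \in U) ->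
    \sum_(v <- U) f (v a) = \sum_(v <- [seq v <- U | v a != 0]) f (v a).
  move=> uU _ hU; apply: big_uniq_sub => //; first exact: filter_uniq.
    by move=> v; rewrite mem_filter => /andP[].
  by move=> v vU; rewrite mem_filter vU andbT negbK => /eqP ->.
rewrite (h S uS pS) => [|v pv va]; last by apply: (hS a v); rewrite ?mem_head.
rewrite (h S' uS' pS') => [|v pv va]; last by apply: (hS' a v); rewrite ?mem_head.
apply: perm_big; apply: uniq_perm; rewrite ?filter_uniq // => v; rewrite !mem_filter.
have [//|va /=] := eqVneq (v a) 0; apply/idP/idP => h1.
  by apply: (hS' a v) => //; [exact: mem_head|exact: pS].
by apply: (hS a v) => //; [exact: mem_head|exact: pS'].
Qed.

Lemma product_formula S a : covers S [:: a] -> \sum_(v <- S) v a = 0.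
Proof.
move=> cS; have [[c ec]|na] := pselect (exists c, a = kap c).
  by rewrite big1_seq // => v /andP[_ vS]; rewrite ec placeC //; case: cS => _ + _; apply.
have [|N [S' [_ _ [uS' pS'] hS' [_ s0]]]] := @place_degree_ext a; first by move=> c ec; apply: na; exists c.
rewrite -[RHS]s0; apply: (sum_covers (f := id)) => //; split=> // b v; rewrite inE => /eqP -> pv; exact: hS'.
Qed.

Lemma alg_degree_gt0 b d : nonconst (jk iota j) b -> alg_degree j b d -> (0 < d)%N.
Proof.
move=> nb [[p [sp rp]] _]; rewrite lt0n; apply/eqP => d0.
have /size_poly1P[c c0 ep] : size p == 1%N by rewrite sp d0.
by move: rp; rewrite ep map_polyC hornerC => /eqP; rewrite fmorph_eq0 (negbTE c0).
Qed.

Lemma dimL_gt0 : (0 < dimL L)%N.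
Proof. by rewrite lt0n dimv_eq0 -subv0; apply/negP => /subvP/(_ 1 (memvf _)); rewrite memv0 oner_eq0. Qed.

(** [place_degree] counts the poles as [[L : K(a)]], and [height_ratio] turns this into [r / d]. *)
Lemma hh_places S a : covers S [:: a] ->
  (dimL L)%:R * hh (e a) = (\sum_(v <- S) Num.max (- v a) 0)%:~R.
Proof.
move=> cS; have [[c ec]|na] := pselect (exists c, a = kap c).
  rewrite /hh xgetPN => [|h [d [r [nb _ _ _]]]]; last by apply: (nb c); rewrite ec /= eF.
  rewrite mulr0 big1_seq // => v /andP[_ vS]; rewrite ec placeC ?oppr0 //; by case: cS => _ + _; apply.
have {}na : nonconst kap a by move=> c ec; apply: na; exists c.
have [N [S' [rN fN [uS' pS'] hS' [eN _]]]] := place_degree_ext na.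
have nb : nonconst (jk iota j) (e a) by apply/(nonconst_e iota eF).
have [d [hd _]] := alg_degree_exists eF a.
have [r hr] := alg_rank_exists eF nt hNt na.
have d0 := alg_degree_gt0 nb hd.
have -> : hh (e a) = r%:R / d%:R.
  rewrite /hh; case: xgetP => [h _ [d' [r' [_ hd' hr' ->]]]|/(_ (r%:R / d%:R)) []].
    by rewrite (alg_degree_unique hd' hd) (alg_rank_unique hr' hr).
  by exists d, r.
rewrite (sum_covers (S' := S') (f := fun i => Num.max (- i) 0)) //; last first.
  by split=> // b v; rewrite inE => /eqP -> pv; exact: hS'.
rewrite eN mulrA -natrM -(height_ratio eF na rN fN hd hr) natrM mulfK ?pnatr_eq0 -?lt0n //.
Qed.

Lemma vge_prod v (I : Type) (s : seq I) (P : pred I) (m : I -> int) (f : I -> L) : place v ->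
  (forall i, P i -> vge v (m i) (f i)) -> vge v (\sum_(i <- s | P i) m i) (\prod_(i <- s | P i) f i).
Proof.
move=> pv h; apply: (big_ind2 (fun x m => vge v m x)) => //.
  by right; rewrite (place1 pv).
by move=> x m1 y m2; exact: (vgeM pv).
Qed.

Lemma vgeXn v m f n : place v -> vge v m f -> vge v (m *+ n) (f ^+ n).
Proof.
move=> pv h; elim: n => [|n IH]; first by right; rewrite mulr0n (place1 pv).
by rewrite exprS mulrS; exact: (vgeM pv).
Qed.

Lemma hh_sum (T : eqType) (s : seq T) (a : T -> L) (S : seq (L -> int)) : covers S (map a s) ->
  (dimL L)%:R * \sum_(i <- s) hh (e (a i)) = (\sum_(v <- S) \sum_(i <- s) pole v (a i))%:~R.
Proof.
move=> cS; rewrite mulr_sumr exchange_big rmorph_sum /=; apply: eq_big_seq => i si.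
rewrite (hh_places (S := S)) //; apply: covers_sub cS => b; rewrite inE => /eqP ->.
exact: map_f.
Qed.

Lemma pole_ge0 (v : L -> int) a : 0 <= pole v a. Proof. by rewrite le_max lexx orbT. Qed.

Lemma pole_ratio (I : finType) (z : I -> L) m v i : place v -> m != 0 ->
  vge v (- (\sum_i pole v (z i / m) - v m)) (z i).
Proof.
move=> pv m0; have [->|zi] := eqVneq (z i) 0; [by left|right].
have : pole v (z i / m) <= \sum_i pole v (z i / m).
  by rewrite (bigD1 i) //= lerDl sumr_ge0 // => l _; exact: pole_ge0.
rewrite (placeM pv) ?invr_eq0 // (placeV pv) //; move: (\sum_i _) => s.
clear; move: (v (z i)) (v m) => a b; lia.
Qed.

(** At each place a pole of [z i / z l] is bounded by the poles of the [z i' / m] plus the values of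
    [z l] and [1 / m], which sum to 0 by the product formula. *)
Lemma ratio_bound (I : finType) (z : I -> L) m i l : m != 0 ->
  hh (e (z i / z l)) <= \sum_i' hh (e (z i' / m)).
Proof.
move=> m0; have [zl|zl] := eqVneq (z l) 0.
  by rewrite zl invr0 mulr0 rmorph0 hh0; apply: sumr_ge0 => i' _; exact: hh_ge0.
have [S cS] := covers_exists (m :: z l :: z i / z l :: [seq z i' / m | i' <- index_enum I]).
have d0 : (0 : R) < (dimL L)%:R by rewrite ltr0n dimL_gt0.
rewrite -(ler_pM2l d0) (hh_places (S := S)); last first.
  by apply: covers_sub cS => b; rewrite !inE => ->; rewrite !orbT.
rewrite (hh_sum (S := S)); last by apply: covers_sub cS => b bs; rewrite !inE bs !orbT.
rewrite ler_int.
have e1 : \sum_(v <- S) v m = 0.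
  by apply: product_formula; apply: covers_sub cS => b; rewrite !inE => ->.
have e2 : \sum_(v <- S) v (z l) = 0.
  by apply: product_formula; apply: covers_sub cS => b; rewrite !inE => ->; rewrite orbT.
have -> : \sum_(v <- S) \sum_i' pole v (z i' / m) = \sum_(v <- S) (\sum_i' pole v (z i' / m) - v m + v (z l)).
  by rewrite !big_split /= sumrN e1 e2 oppr0 !addr0.
rewrite big_seq [X in _ <= X]big_seq.
apply: ler_sum => v vS; have pv : place v by case: cS => _ + _; apply.
have h1 := pole_ratio z l pv m0; have h2 := pole_ratio z i pv m0.
have := vgeE zl h1; move: h2; move: (\sum_i' _) => s.
have [-> _|zi h2] := eqVneq (z i) 0.
  by rewrite mul0r; case: pv => -> _ _ _ _; clear; move: (v (z l)) (v m) => a b; lia.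
have := vgeE zi h2; rewrite (placeM pv) ?invr_eq0 // (placeV pv) //.
clear; move: (v (z l)) (v m) (v (z i)) => a b c; lia.
Qed.

Lemma sup_coord n (z : 'rV[L]_n.+1) (v : L -> int) : z != 0 ->
  let A := [set ((- v (z ord0 i))%:~R : R) | i in [set i | z ord0 i != 0]] in
  (forall i, z ord0 i != 0 -> (- v (z ord0 i))%:~R <= sup A) /\
  exists i, z ord0 i != 0 /\ sup A = (- v (z ord0 i))%:~R.
Proof.
move=> /rV0Pn[i0 z0] A.
case: (@arg_maxP _ _ _ i0 (fun i => z ord0 i != 0) (fun i => - v (z ord0 i)) z0) => i zi hi.
have ub : ubound A (- v (z ord0 i))%:~R by move=> _ [l zl <-]; rewrite ler_int; exact: hi.
have hub : has_ubound A by exists (- v (z ord0 i))%:~R.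
split=> [l zl|]; first by apply: ub_le_sup => //; exists l.
exists i; split=> //; apply/eqP; rewrite eq_le; apply/andP; split.
  by apply: ge_sup => //; exists (- v (z ord0 i))%:~R, i.
by apply: ub_le_sup => //; exists i.
Qed.

Definition naive n (z : 'rV[L]_n.+1) (v : L -> int) : R :=
  sup [set ((- v (z ord0 i))%:~R : R) | i in [set i | z ord0 i != 0]].

Lemma naive_sum n (z : 'rV[L]_n.+1) S : z != 0 -> covers S [seq z ord0 i | i <- index_enum 'I_n.+1] ->
  \sum_(v \in [set v | is_place iota v]) naive z v = \sum_(v <- S) naive z v.
Proof.
move=> z0 [uS pS hS]; transitivity (\sum_(v \in [set` S]) naive z v); last by apply/esym; exact: fsbig_seq.
apply/esym; apply: fsbig_widen.
  by move=> v /= /pS.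
move=> v [/= pv /negP nS]; have [_ [i [zi e1]]] := sup_coord v z0.
rewrite /naive e1; have -> : v (z ord0 i) = 0; last by rewrite oppr0.
apply/eqP; apply: contraNT nS => h; apply: (hS (z ord0 i)) => //.
by apply: map_f; rewrite mem_index_enum.
Qed.

Lemma naive_bounds n (z : 'rV[L]_n.+1) l : z ord0 l != 0 ->
  (forall i, hh (e (z ord0 i / z ord0 l)) <= (dimL L)%:R^-1 * \sum_(v \in [set v | is_place iota v]) naive z v) /\
  (dimL L)%:R^-1 * \sum_(v \in [set v | is_place iota v]) naive z v <= \sum_i hh (e (z ord0 i / z ord0 l)).
Proof.
move=> zl; have z0 : z != 0 by apply/rV0Pn; exists l.
have [S cS] := covers_exists ([seq z ord0 i | i <- index_enum 'I_n.+1] ++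
   [seq z ord0 i / z ord0 l | i <- index_enum 'I_n.+1]).
have c1 : covers S [seq z ord0 i | i <- index_enum 'I_n.+1].
  by apply: covers_sub cS => b bs; rewrite mem_cat bs.
have c2 : covers S [seq z ord0 i / z ord0 l | i <- index_enum 'I_n.+1].
  by apply: covers_sub cS => b bs; rewrite mem_cat bs orbT.
have d0 : (0 : R) < (dimL L)%:R by rewrite ltr0n dimL_gt0.
have e2 : \sum_(v <- S) v (z ord0 l) = 0.
  apply: product_formula; apply: covers_sub c1 => b; rewrite !inE => /eqP ->.
  by apply: map_f; rewrite mem_index_enum.
rewrite (naive_sum z0 c1).
have -> : \sum_(v <- S) naive z v = \sum_(v <- S) (naive z v + (v (z ord0 l))%:~R).
  by rewrite big_split /= -rmorph_sum /= e2 addr0.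
have pS v : v \in S -> place v by case: cS => _ + _; apply.
have ratio v i : place v -> z ord0 i != 0 -> (- v (z ord0 i / z ord0 l))%:~R = (- v (z ord0 i))%:~R + (v (z ord0 l))%:~R :> R.
  by move=> pv zi; rewrite (placeM pv) ?invr_eq0 // (placeV pv) // -intrD; congr (_%:~R); lia.
split=> [i|].
  rewrite ler_pdivlMl // (hh_places (S := S)); last first.
    by apply: covers_sub c2 => b; rewrite !inE => /eqP ->; apply: map_f; rewrite mem_index_enum.
  rewrite rmorph_sum /= big_seq [X in _ <= X]big_seq; apply: ler_sum => v vS; have pv := pS v vS.
  have [h1 _] := sup_coord v z0.
  have h0 : 0 <= naive z v + (v (z ord0 l))%:~R.
    by have := h1 l zl; rewrite -subr_ge0 rmorphN opprK.
  have [->|zi] := eqVneq (z ord0 i) 0.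
    by rewrite mul0r; case: (pv) => -> _ _ _ _; rewrite oppr0 maxxx.
  rewrite /Num.max; case: ifP => _ //; rewrite ratio // lerD2r; exact: h1.
rewrite ler_pdivrMl // (hh_sum c2) rmorph_sum /= big_seq [X in _ <= X]big_seq; apply: ler_sum => v vS.
have pv := pS v vS; have [_ [i [zi e1]]] := sup_coord v z0.
rewrite /naive e1 -ratio // ler_int (bigD1 i) ?mem_index_enum //=.
by rewrite -[X in X <= _]addr0 lerD // ?le_max ?lexx // sumr_ge0 // => i' _; exact: pole_ge0.
Qed.

(** For a larger pole of [f] the top term alone would have the smallest value, and the sum could not
    vanish. *)
Lemma newton_bound v (s : nat) (b : 'I_s.+1 -> L) f (D : int) : place v -> b ord_max != 0 ->
  (forall i, vge v (- D) (b i)) -> \sum_i b i * f ^+ i = 0 -> pole v f <= D + v (b ord_max).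
Proof.
move=> pv bs hb rel; have D0 := vgeE bs (hb ord_max).
have [->|f0] := eqVneq f 0; first by case: (pv) => -> _ _ _ _; move: D0; clear; lia.
rewrite leNgt; apply/negP => lt.
have vf : v f < 0 by move: lt D0; clear; move: (v f) (v _) => a c; lia.
have fn0 i : f ^+ i != 0 by rewrite expf_neq0.
suff : \sum_i b i * f ^+ i != 0 by rewrite rel eqxx.
apply: (dominant_sum_neq0 pv (j0 := ord_max)); first by rewrite mulf_neq0.
move=> i ne; rewrite (placeM pv) // (placeX pv) //.
apply: (@vge_le _ v (- D + v f *+ i)).
  have il : (i < s)%N by rewrite ltn_neqAle -ltnS ltn_ord andbT; apply: contra ne => /eqP h; apply/eqP/val_inj.
  have lt' : D + v (b ord_max) < - v f by move: lt vf; clear; lia.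
  have [r er] : exists r, s = (i + r.+1)%N by exists (s - i.+1)%N; rewrite addnS -addSn subnKC.
  have r0 : v f *+ r <= 0 by rewrite mulrn_wle0 // ltW.
  have es : v f *+ s = v f *+ i + (v f + v f *+ r) by rewrite -mulrS -mulrnDr -er.
  rewrite /= es; move: lt' r0; clear.
  by move: (v f *+ r) (v f *+ i) (v f) (v _) => a b' d c; lia.
by apply: (vgeM pv); [exact: hb|right; rewrite (placeX pv)].
Qed.

End InExtension.

Lemma lift_list (s : seq k) : exists (L : fieldExtType F) (e : {rmorphism L -> k}) (g : k -> L),
  (forall a : F, e a%:A = j a) /\ forall x, x \in s -> e (g x) = x.
Proof.
have [L [e [eF h]]] := common_extension s.
have hg x : exists y, x \in s -> e y = x.
  by case xs: (x \in s); [have [y ey] := h x xs; exists y|exists 0].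
by have [g hg'] := choice hg; exists L, e, g.
Qed.

Lemma H_le_ratio n (x : 'rV[k]_n.+1) m : m != 0 -> H x <= (n.+1 ^ 2)%:R * \sum_i hh (x ord0 i / m).
Proof.
move=> m0; have [L [e [g [eF hg]]]] := lift_list (m :: [seq x ord0 i | i <- enum 'I_n.+1]).
have gm : e (g m) = m by apply: hg; rewrite mem_head.
have gx i : e (g (x ord0 i)) = x ord0 i by apply: hg; rewrite inE map_f ?orbT ?mem_enum.
have gm0 : g m != 0 by apply: contraNneq m0 => e0; rewrite -gm e0 rmorph0.
have le i l : hh (x ord0 i / x ord0 l) <= \sum_i hh (x ord0 i / m).
  have := ratio_bound eF (fun i => g (x ord0 i)) i l gm0; rewrite fmorph_div !gx.
  by rewrite (eq_bigr (fun i => hh (x ord0 i / m))) // => i' _; rewrite fmorph_div gx gm.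
exact: H_le_const le.
Qed.

Lemma weil_bounds n (x : 'rV[k]_n.+1) : x != 0 ->
  weil_height R iota j x <= H x /\ H x <= (n.+1 ^ 2)%:R * weil_height R iota j x.
Proof.
move=> x0; have [l xl] : exists l, x ord0 l != 0 by apply/rV0Pn.
rewrite /weil_height; case: xgetP => [h _ [L [e [z [eF ez ->]]]]|hn]; last first.
  have [L [e [g [eF hg]]]] := lift_list [seq x ord0 i | i <- enum 'I_n.+1].
  exfalso; apply: (hn _); exists L, e, (\row_i g (x ord0 i)); split=> //.
  by move=> i; rewrite mxE; apply: hg; apply: map_f; rewrite mem_enum.
have zl : z ord0 l != 0 by apply: contraNneq xl => e0; rewrite -ez e0 rmorph0.
have rat i m : hh (x ord0 i / x ord0 m) = hh (e (z ord0 i / z ord0 m)) by rewrite fmorph_div !ez.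
have [b1 b2] := naive_bounds eF zl.
split.
  apply: le_trans b2 _; rewrite -(eq_bigr _ (fun i _ => rat i l)); exact: column_le_H.
set W := (\dim _)%:R^-1 * _.
have le i m : hh (x ord0 i / x ord0 m) <= W.
  have [e0|xm] := eqVneq (x ord0 m) 0; first by rewrite e0 invr0 mulr0 hh0; apply: le_trans (b1 l); exact: hh_ge0.
  have zm : z ord0 m != 0 by apply: contraNneq xm => e0; rewrite -ez e0 rmorph0.
  by rewrite rat; have [+ _] := naive_bounds eF zm; apply.
exact: H_le_const le.
Qed.

Definition coef_height n (B : hpoly k n) : R := \sum_(m <- msupp B) hh (mcoeff m B).

(** [newton_bound] is summed over all places: the values of the leading coefficient and of the
    chosen coordinate cancel by the product formula. A form of degree [d] at [y] costs [d] times the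
    poles of [y], plus those of its own coefficients, which do not depend on [y]. *)
Lemma relation_height n (y : 'rV[k]_n.+1) s (B : nat -> hpoly k n) d f : y != 0 ->
  (forall i, homog d (B i)) -> ev (B s) y != 0 -> \sum_(i < s.+1) ev (B i) y * f ^+ i = 0 ->
  hh f <= d%:R * H y + \sum_(i < s.+1) coef_height (B i).
Proof.
move=> /rV0Pn[l yl] hB Bs rel.
pose cs := flatten [seq [seq mcoeff m (B i) | m <- msupp (B i)] | i : 'I_s.+1 <- enum 'I_s.+1].
have [L [e [g [eF hg]]]] := lift_list (f :: [seq y ord0 i | i <- enum 'I_n.+1] ++ cs).
have gf : e (g f) = f by apply: hg; rewrite mem_head.
have gy i : e (g (y ord0 i)) = y ord0 i by apply: hg; rewrite inE mem_cat map_f ?orbT ?mem_enum.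
have gc (i : 'I_s.+1) m : m \in msupp (B i) -> e (g (mcoeff m (B i))) = mcoeff m (B i).
  move=> ms; apply: hg; rewrite inE mem_cat; apply/orP; right; apply/orP; right.
  by apply/flatten_mapP; exists i; [rewrite mem_enum|apply/mapP; exists m].
pose z i := g (y ord0 i).
have zl : z l != 0 by apply: contraNneq yl => e0; rewrite -gy -/(z l) e0 rmorph0.
pose b (i : 'I_s.+1) := \sum_(m <- msupp (B i)) g (mcoeff m (B i)) * \prod_l z l ^+ m l.
have eb i : e (b i) = ev (B i) y.
  rewrite /ev mevalE rmorph_sum; apply: eq_big_seq => m ms; rewrite rmorphM gc //= rmorph_prod.
  by congr (_ * _); apply: eq_bigr => i' _; rewrite rmorphXn /= gy.
have bs0 : b ord_max != 0 by apply: contraNneq Bs => e0; rewrite -[s]/(nat_of_ord (@ord_max s)) -eb e0 rmorph0.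
have brel : \sum_i b i * g f ^+ i = 0.
  apply: (fmorph_inj e); rewrite rmorph0 -[RHS]rel rmorph_sum; apply: eq_bigr => i _.
  by rewrite rmorphM rmorphXn /= eb gf.
pose gcs := flatten [seq [seq g (mcoeff m (B i)) | m <- msupp (B i)] | i : 'I_s.+1 <- enum 'I_s.+1].
have [S cS] := covers_exists (g f :: z l :: b ord_max :: [seq z i / z l | i <- index_enum 'I_n.+1] ++ gcs).
have pS v : v \in S -> place (kL iota L) v by case: cS => _ + _; apply.
have d0 : (0 : R) < (dimL L)%:R by rewrite ltr0n dimL_gt0.
have e1 : \sum_(v <- S) v (z l) = 0.
  by apply: product_formula; apply: covers_sub cS => x; rewrite !inE => ->; rewrite ?orbT.
have e2 : \sum_(v <- S) v (b ord_max) = 0.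
  by apply: product_formula; apply: covers_sub cS => x; rewrite !inE => ->; rewrite ?orbT.
pose Y (v : L -> int) := \sum_i Num.max (- v (z i / z l)) 0.
pose C (v : L -> int) := \sum_(i < s.+1) \sum_(m <- msupp (B i)) Num.max (- v (g (mcoeff m (B i)))) 0.
have sY : (dimL L)%:R * \sum_i hh (y ord0 i / y ord0 l) = (\sum_(v <- S) Y v)%:~R.
  rewrite -(hh_sum eF); last by apply: covers_sub cS => x xs; rewrite !inE mem_cat xs ?orbT.
  by congr (_ * _); apply: eq_bigr => i _; rewrite fmorph_div !gy.
have sC : (dimL L)%:R * \sum_(i < s.+1) coef_height (B i) = (\sum_(v <- S) C v)%:~R.
  rewrite exchange_big rmorph_sum mulr_sumr; apply: eq_bigr => i _ /=.
  rewrite -(hh_sum eF).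
    by congr (_ * _); apply: eq_big_seq => m ms; rewrite gc.
  apply: covers_sub cS => x xs; rewrite !inE mem_cat; do 4 (apply/orP; right).
  by apply/flatten_mapP; exists i => //; rewrite mem_enum.
have key v : v \in S -> Num.max (- v (g f)) 0 <= (d%:Z * (Y v - v (z l)) + C v) + v (b ord_max).
  move=> vS; have pv := pS v vS; apply: (newton_bound pv bs0 _ brel) => i.
  rewrite /b big_seq; apply: (vge_sum pv) => m ms.
  have -> : - (d%:Z * (Y v - v (z l)) + C v) = - C v + - (Y v - v (z l)) *+ d.
    by rewrite -mulr_natl natz; ring.
  apply: (vgeM pv).
    set ga := g _; have [->|ga0] := eqVneq ga 0; [by left|right].
    apply: (@le_trans _ _ (- Num.max (- v ga) 0)); last by clear; lia.
    rewrite lerN2 /C (bigD1 i) //= (bigD1_seq m ms (msupp_uniq _)) /=.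
    rewrite -addrA lerDl addr_ge0 //; first by apply: sumr_ge0 => ? _; exact: pole_ge0.
    by do 2 apply: sumr_ge0 => ? _; exact: pole_ge0.
  have <- : mdeg m = d by have /dhomogP := hB i; apply.
  rewrite mdegE -sumrMnr; apply: (vge_prod _ pv) => i' _.
  by apply: (vgeXn _ pv); exact: pole_ratio.
have le1 : \sum_(v <- S) Num.max (- v (g f)) 0 <= d%:Z * (\sum_(v <- S) Y v) + \sum_(v <- S) C v.
  have -> : d%:Z * (\sum_(v <- S) Y v) + \sum_(v <- S) C v =
      \sum_(v <- S) ((d%:Z * (Y v - v (z l)) + C v) + v (b ord_max)).
    by rewrite !big_split /= -mulr_sumr big_split /= sumrN e1 e2 oppr0 !addr0.
  by rewrite big_seq [X in _ <= X]big_seq; apply: ler_sum => v; exact: key.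
have le2 : hh f <= d%:R * \sum_i hh (y ord0 i / y ord0 l) + \sum_(i < s.+1) coef_height (B i).
  rewrite -(ler_pM2l d0) mulrDr sC mulrCA sY -[X in hh X]gf (hh_places eF (S := S)); last first.
    by apply: covers_sub cS => x; rewrite !inE => ->.
  by move: le1; rewrite -(ler_int R) rmorphD rmorphM /=; exact.
apply: le_trans le2 _; rewrite lerD2r ler_wpM2l ?ler0n //; exact: column_le_H.
Qed.

Lemma coef_height_ge0 n (B : hpoly k n) : 0 <= coef_height B.
Proof. by apply: sumr_ge0 => m _; exact: hh_ge0. Qed.

(** Two factors [n.+1] come from comparing [H] with the ratios to [l(Q)], the third from the sum
    over the coordinates. *)
Lemma image_height n (Q : tuplemap k n n) (l : hpoly k n) (s e : 'I_n.+1 -> nat)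
    (B : 'I_n.+1 -> nat -> hpoly k n) (E : nat) (y : 'rV[k]_n.+1) : y != 0 ->
  ev l (tm_val Q y) != 0 -> (forall i a, homog (e i) (B i a)) -> (forall i, (e i <= E)%N) ->
  (forall i, ev (B i (s i)) y != 0) ->
  (forall i, \sum_(a < (s i).+1) ev (B i a) y * ev (Q i) y ^+ a * ev l (tm_val Q y) ^+ (s i - a) = 0) ->
  H (tm_val Q y) <= (n.+1 ^ 3 * E)%:R * H y +
    (n.+1 ^ 2)%:R * \sum_i \sum_(a < (s i).+1) coef_height (B i a).
Proof.
move=> y0 l0 hB eE B0 rel; set la := ev l _ in l0 rel.
apply: (le_trans (H_le_ratio (tm_val Q y) l0)).
have -> : (n.+1 ^ 3 * E)%:R * H y = (n.+1 ^ 2)%:R * \sum_(i < n.+1) E%:R * H y.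
  by rewrite sumr_const card_ord -mulr_natl expnSr !natrM; ring.
rewrite -mulrDr ler_wpM2l ?ler0n // -big_split; apply: ler_sum => i _ /=.
have h := @relation_height n y (s i) (B i) (e i) (tm_val Q y ord0 i / la) y0 (hB i) (B0 i).
apply: le_trans (h _) _.
  have ls : la ^+ s i != 0 by rewrite expf_neq0.
  apply: (mulIf ls); rewrite mul0r -[RHS](rel i) mulr_suml; apply: eq_bigr => a _; rewrite mxE.
  have as_ : (a <= s i)%N by rewrite -ltnS.
  have la0 : la ^+ a != 0 by rewrite expf_neq0.
  have -> : la ^+ s i = la ^+ a * la ^+ (s i - a) by rewrite -exprD subnKC.
  rewrite expr_div_n; by field.
by rewrite lerD2r ler_wpM2r ?H_ge0 // ler_nat.
Qed.

Variables (T T' : admissible_triple k) (n' : nat) (X' : set 'rV[k]_n'.+1)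
  (p : tuplemap k (at_dim T) n') (q : tuplemap k n' (at_dim T)) (f' : tuplemap k n' n') (u : nat -> nat).
Hypotheses (pX1 : projective (at_X T')) (bTT' : birational_triples T T')
  (pX' : projective X') (nX' : normal X') (b' : birational_inverse (at_X T) X' p q)
  (hf' : tm_hom f') (c' : tm_eqv (at_X T) (tm_comp p (at_f T)) (tm_comp f' p))
  (hu : forall r, is_pullback_degree X' (tm_iter f' r) (u r)).
Notation y := (rm_orbit (at_X T') (at_f T') (at_x T')).

Lemma triple_neq0 (S : admissible_triple k) v : at_X S v -> v != 0.
Proof. by case: (at_quasi_projective _ S) => -[Z1 [Z2 [cZ1 _ ->]]] _ [Zv _]; exact: zclosed_neq0 cZ1 Zv. Qed.

(** The representative and the relations are found anew at each [y n]. They can be used at any orbit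
    point where their leading coefficients and [l(Q)] are nonzero; by [zclosed_stable] finitely many
    sets of data suffice, so [c] does not depend on [n]. *)
Lemma orbit_height_growth : (forall r, (0 < u r)%N) /\
  exists A : nat, forall m, exists c : R, 0 <= c /\
    forall n, H (y (n + m)) <= (A * u m)%:R * H (y n) + c.
Proof.
have [pT [qT [V [bT cT _ _ _]]]] := bTT'.
have [Om [io [xi [gxi _ hxi]]]] := projective_generic pX1.
have X0 v (Xv : at_X T v) := triple_neq0 Xv.
have hf1 : tm_hom (at_f T') by case: (at_dominant _ T') => [[]].
have u0 r : (0 < u r)%N.
  exact: (pullback_degree_gt0 X0 pX1 pX' (at_dominant _ T) hf1 hf' bT b' cT c' hxi gxi nX' hu).
split=> //.
have y0 r : y r != 0 := triple_neq0 (orbit_mem T' r).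
(* On a point all orbit vectors are proportional, so [H] is constant along the orbit, and [u m] is
   at least 1. *)
have [[v v0 eX]|np] := pselect (is_point (at_X T')).
  exists 1%N => m; exists 0; split=> // n; rewrite mul1n addr0.
  have := orbit_mem T' (n + m); have := orbit_mem T' n; rewrite eX => -[a a0 ->] [b b0 ->].
  by rewrite !H_scale // ler_peMl ?H_ge0 // ler1n.
have [C hC] := iterate_relations X0 pX1 pX' (at_dominant _ T) hf1 hf' bT b' cT c' hxi gxi nX' hu np.
set N := at_dim T' in C hC *.
exists (N.+1 ^ 3 * C)%N => m.
have hrep n := orbit_representative pX1 hxi m n.
have [Q hQ] := choice hrep.
have Q0 n : tm_val (Q n) (y n) != 0 by have [_ _ ->] := hQ n; exact: y0.
have hdata n : exists (l : hpoly k N) (s : 'I_N.+1 -> nat) (B : 'I_N.+1 -> nat -> hpoly k N) (e : 'I_N.+1 -> nat),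
  [/\ hom 1%N l, ev l (tm_val (Q n) (y n)) != 0, forall i, (e i <= C * u m)%N /\ (forall a, homog (e i) (B i a)),
    forall i, ev (B i (s i)) (y n) != 0
  & forall y', at_X T' y' -> forall i,
      \sum_(a < (s i).+1) ev (B i a) y' * ev (Q n i) y' ^+ a * ev l (tm_val (Q n) y') ^+ (s i - a) = 0].
  have [[eQ heQ] pQ _] := hQ n.
  have [l [hl l0 hr]] := hC m (Q n) eQ (y n) heQ pQ (orbit_mem T' n) (Q0 n).
  have [s hs] := choice hr; have [B hB] := choice hs; have [e he] := choice hB.
  exists l, s, B, e; split=> // [i|i|y' Xy' i]; first by have [h1 _ h2 _ _] := he i.
    by have [_ _ _ h _] := he i.
  by have [_ _ _ _ h] := he i; exact: h.
have [l /choice[s /choice[B /choice[e hD']]]] := choice hdata.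
(* [P n] collects all the nonvanishing conditions of the data of index [n] into one form. *)
pose P n : hpoly k N := tcomp (Q n) (l n) * \prod_i B n i (s n i).
have evP n v : ev (P n) v = ev (l n) (tm_val (Q n) v) * \prod_i ev (B n i (s n i)) v.
  rewrite /ev rmorphM rmorph_prod /= [in LHS]/meval mmap_tcomp; congr (_ * _); apply: mmap_ext => i.
  by rewrite mxE.
have hP n : ishom (P n).
  have [hl _ hB _ _] := hD' n; have [[eQ heQ] _ _] := hQ n.
  exists (eQ + \sum_i e n i)%N; apply: dhomogM; first exact: (tcomp_hom1 heQ hl).
  by apply: (big_ind2 (fun (x : hpoly k N) d => hom d x)) => [|x d1 x' d2|i _];
    [exact: dhomog1|exact: dhomogM|case: (hB i) => _; apply].
have [r0 hr0] := zclosed_stable hP.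
pose c n : R := (N.+1 ^ 2)%:R * \sum_i \sum_(a < (s n i).+1) coef_height (B n i a).
have c0 n : 0 <= c n.
  by rewrite mulr_ge0 ?ler0n //; do 2 apply: sumr_ge0 => ? _; exact: coef_height_ge0.
exists (\sum_(r < r0.+1) c r); split; first by apply: sumr_ge0 => i _; exact: c0.
move=> n; have Xy := orbit_mem T' n.
have [r rr0 Pr] : exists2 r, (r <= r0)%N & ev (P r) (y n) != 0.
  apply: hr0 => //; exists n; rewrite evP; have [_ l0 _ hB _] := hD' n.
  by rewrite mulf_neq0 // prodf_seq_neq0; apply/allP => i _ /=; exact: hB.
have [hl _ hB _ rel] := hD' r; have [heQ pQ _] := hQ r.
move: Pr; rewrite evP mulf_eq0 negb_or prodf_seq_neq0 => /andP[lr0 /allP Br].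
have Qr0 : tm_val (Q r) (y n) != 0.
  apply: contraNneq lr0 => e0; rewrite e0 -(scale0r (0 : 'rV[k]_N.+1)).
  by rewrite (ev_scale _ _ hl) expr1 mul0r.
have [heQn pQn eQn] := hQ n.
have [a a0 ea] := representatives_proportional hxi Xy pQn pQ (Q0 n) Qr0.
rewrite -eQn ea H_scale //.
apply: (le_trans (image_height (s := s r) (y0 n) lr0 (fun i => proj2 (hB i)) (fun i => proj1 (hB i)) _ _)).
- by move=> i; have := Br i; rewrite mem_index_enum; exact.
- by move=> i; exact: rel.
rewrite mulnA lerD2l -/(c r) (bigD1 (Ordinal (rr0 : (r < r0.+1)%N))) //= lerDl.
by apply: sumr_ge0 => i _; exact: c0.
Qed.

End Heights.

(** * From the recursion to the growth rate *)

Section Growth.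
Variable R : realType.

Lemma exp_dominates (M x y : R) : 0 < x -> x < y -> exists N, forall n, (N <= n)%N -> M * x ^+ n <= y ^+ n.
Proof.
move=> x0 xy; have y0 : 0 < y := lt_trans x0 xy.
have : geometric M (x / y) @ \oo --> (0 : R).
  by apply: cvg_geometric; rewrite ger0_norm ?divr_ge0 ?ltW // ltr_pdivrMr ?mul1r.
move=> /cvgr_lt/(_ 1 ltr01)[N _ hN]; exists N => n /hN /=.
by rewrite expr_div_n mulrA ltr_pdivrMr ?exprn_gt0 // mul1r => /ltW.
Qed.

Lemma geometric_bound (b : nat -> R) m al be : (0 < m)%N -> (forall n, 0 <= b n) -> 1 <= be -> 0 <= al -> al <= be ^+ m ->
  (forall n, b (n + m)%N <= al * b n) -> exists2 M, 0 <= M & forall n, b n <= M * be ^+ n.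
Proof.
move=> m0 b0 be1 al0 albe hb; exists (\sum_(r < m) b r); first by apply: sumr_ge0 => r _; exact: b0.
elim/ltn_ind => n IH; have [lt|le] := ltnP n m.
  apply: (@le_trans _ _ (\sum_(r < m) b r)).
    by rewrite (bigD1 (Ordinal lt)) //= lerDl; apply: sumr_ge0 => r _; exact: b0.
  by rewrite ler_peMr ?exprn_ege1 //; apply: sumr_ge0 => r _; exact: b0.
rewrite -(subnK le); apply: le_trans (hb _) _; rewrite exprD mulrA mulrC.
apply: ler_pM => //.
by apply: IH; rewrite -subn_gt0 subKn.
Qed.

Lemma root_le (a x : R) n : (0 < n)%N -> 0 <= a -> 0 <= x -> a <= x ^+ n -> a `^ n%:R^-1 <= x.
Proof.
move=> n0 a0 x0 h; have n0' : n%:R != 0 :> R by rewrite pnatr_eq0 -lt0n.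
have -> : x = (x ^+ n) `^ n%:R^-1 by rewrite -powR_mulrn // -powRrM divff // powRr1.
by rewrite ge0_ler_powR ?invr_ge0 ?ler0n ?nnegrE ?exprn_ge0.
Qed.

Lemma le_of_root (a x : R) n : (0 < n)%N -> 0 <= a -> a `^ n%:R^-1 <= x -> a <= x ^+ n.
Proof.
move=> n0 a0 h; have n0' : n%:R != 0 :> R by rewrite pnatr_eq0 -lt0n.
have -> : a = (a `^ n%:R^-1) ^+ n by rewrite -powR_mulrn ?powR_ge0 // -powRrM mulVf // powRr1.
by rewrite lerXn2r // ?nnegrE ?powR_ge0 // (le_trans _ h) // powR_ge0.
Qed.

(** The recursion multiplies by [A * u m] every [m] steps; the constant [A] is
    absorbed by taking [m] large. *)
Lemma recursive_growth (h : nat -> R) (u : nat -> nat) (A : nat) (l eps : R) :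
  (forall n, 0 <= h n) -> (forall m, (0 < u m)%N) ->
  (forall m, exists c, 0 <= c /\ forall n, h (n + m)%N <= (A * u m)%:R * h n + c) ->
  ((u r)%:R : R) `^ (r%:R^-1) @[r --> \oo] --> l -> 0 < eps ->
  exists N, forall n, (N <= n)%N -> forall a, 0 <= a -> a <= h n + 1 -> a `^ n%:R^-1 <= l + eps.
Proof.
move=> h0 u0 hrec ul e0.
have e3 : 0 < eps / 3 by rewrite divr_gt0.
have u1 m : 1 <= ((u m)%:R : R) `^ (m%:R^-1).
  have : (1 : R) `^ (m%:R^-1) <= ((u m)%:R : R) `^ (m%:R^-1).
    by rewrite ge0_ler_powR ?invr_ge0 ?ler0n ?nnegrE ?ler1n.
  by rewrite powR1.
have l1 : 1 <= l.
  rewrite leNgt; apply/negP => lt.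
  have [N _ hN] := cvgr_lt _ ul _ lt.
  by have := hN N (leqnn N) => /= /lt_geF; rewrite u1.
(* The margin is split in three: up to [x] for the convergence of the roots of [u m], up to [y] for
   the constant factor, and the rest for the constant [M] of the geometric bound. *)
pose x := l + eps / 3; pose y := l + eps / 3 *+ 2.
have lx : l < x by rewrite ltrDl.
have x0 : 0 < x by apply: lt_trans lx; exact: lt_le_trans l1.
have xy : x < y by rewrite /x /y mulr2n addrA ltrDl.
have yz : y < l + eps by rewrite /y ltrD2l; lra.
have y1 : 1 <= y by apply: le_trans l1 _; apply: ltW; exact: lt_trans xy.
have y0 : 0 < y := lt_le_trans ltr01 y1.
have [N1 _ hN1] := cvgr_lt _ ul _ lx.
(* The factor [2 * A + 2] in place of [A] pays for the additive constant, which is absorbed into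
   [b n = h n + c + 1]. *)
have [N2 hN2] := exp_dominates (2 * A + 2)%:R x0 xy.
pose m := (maxn N1 (maxn N2 1)).
have m0 : (0 < m)%N by rewrite !leq_max /= !orbT.
have um : (u m)%:R <= x ^+ m.
  apply: le_of_root => //.
  by apply: ltW; apply: hN1; rewrite /= /m leq_maxl.
have al : ((2 * A + 2) * u m)%:R <= y ^+ m.
  apply: le_trans (hN2 m _); first by rewrite natrM ler_wpM2l ?ler0n.
  by rewrite /m !leq_max leqnn orbT.
have [c [c0 hc]] := hrec m.
pose b n := h n + c + 1.
have b0 n : 0 <= b n by rewrite !addr_ge0.
have brec n : b (n + m)%N <= ((2 * A + 2) * u m)%:R * b n.
  have um1 : 1 <= (u m)%:R :> R by rewrite ler1n.
  have A0 : 0 <= A%:R :> R by rewrite ler0n.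
  have Au : 0 <= A%:R * (u m)%:R :> R by rewrite mulr_ge0 ?ler0n.
  have := hc n; have := h0 n; rewrite /b !(natrM, natrD); move: (h n) (h (n + m)%N) ((u m)%:R : R) um1 A0 Au c0.
  clear; move: (A%:R : R) => B a a' v v1 B0 Bv c1 a0 le.
  have p1 : 0 <= B * v * a by rewrite mulr_ge0.
  have p2 : 0 <= B * v * (c + 1) by rewrite mulr_ge0 // addr_ge0.
  have p3 : 0 <= v * a by rewrite mulr_ge0 // (le_trans ler01).
  have p4 : 0 <= (v - 1) * (c + 1) by rewrite mulr_ge0 ?subr_ge0 // addr_ge0.
  nra.
have [M M0 hM] := geometric_bound m0 b0 y1 (ler0n _ _) al brec.
have [N3 hN3] := exp_dominates M y0 yz.
exists (maxn N3 1) => n nN a a0 ah.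
have n0 : (0 < n)%N by apply: leq_trans nN; rewrite leq_max orbT.
apply: root_le => //; first by apply: ltW; exact: lt_trans yz.
apply: le_trans ah _; apply: le_trans (_ : b n <= _); first by rewrite /b addrAC lerDl.
apply: le_trans (hM n) (hN3 n _); by apply: leq_trans nN; rewrite leq_max leqnn.
Qed.

End Growth.

Unset Implicit Arguments.
Theorem proposition2p10 (R : realType) (K : closedFieldType)
    (m : nat) (B : set 'rV[K]_m.+1) (hB : smooth_projective_curve B)
    (F : fieldType) (iota : {rmorphism K -> F}) (hF : is_function_field B iota)
    (k : closedFieldType) (j : {rmorphism F -> k})
    (hk : forall z : k, algebraicOver j z)
    (T : admissible_triple k)
    (lambda1 : R) (hlambda1 : is_first_dynamical_degree (at_X T) (at_f T) lambda1) :
  (upper_arith_degree R iota j T <= lambda1%:E)%E.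
Proof.
have [t [Nt [nt hNt]]] := function_field_rank hB hF.
have [n' [X' [p [q [f' [u [[pX' nX'] b' [[hf' _] c'] hu ul]]]]]]] := hlambda1.
apply: ge_ereal_sup => a [T' [pX1 bTT' cl]].
have [u0 [A hA]] := orbit_height_growth R hk nt hNt pX1 bTT' pX' nX' b' hf' c' hu.
pose y := rm_orbit (at_X T') (at_f T') (at_x T').
apply/lee_addgt0Pr => eps e0; rewrite -EFinD.
have [N hN] := recursive_growth (fun n => H_ge0 R iota j (y n)) u0 hA ul e0.
rewrite leNgt; apply/negP => lt.
(* If [a] exceeded [lambda1 + eps], the open set above that value would be a neighbourhood of the
   cluster point [a] and would meet the tail, which stays at or below it. *)
have [x [xl xg]] : exists x : \bar R, (x <= (lambda1 + eps)%:E)%E /\ ((lambda1 + eps)%:E < x)%E.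
  apply: (cl [set x | (x <= (lambda1 + eps)%:E)%E] [set x | ((lambda1 + eps)%:E < x)%E]).
    exists N => // n /= Nn; rewrite lee_fin; apply: hN => //; first by rewrite le_max ler01 orbT.
    have [w _] := weil_bounds R hk nt hNt (triple_neq0 (orbit_mem T' n)).
    by rewrite ge_max lerDr H_ge0 andbT (le_trans w) // lerDl ler01.
  by apply: open_nbhs_nbhs; split=> //; exact: open_ereal_gt_ereal.
by have := le_lt_trans xl xg; rewrite ltxx.
Qed.
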